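(* Assume that $\partial_x m(0,t)\neq 0$ and $\partial_x m(1,t)\neq 0$ for all $t\in[0,T]$. Let $\lambda(D)$ be the principal eigenvalue of $$\begin{cases}\partial_t\varphi-D\partial_{xx}\varphi-\partial_x m\,\partial_x\varphi+V\varphi=\lambda(D)\varphi & \text{in }(0,1)\times(0,T),\\ \partial_x\varphi(0,t)=\partial_x\varphi(1,t)=0 & \text{on }[0,T],\\ \varphi(x,0)=\varphi(x,T) & \text{on }(0,1),\end{cases}$$ and consider the ordinary differential equation $$(\ast)\qquad \dot P(t)=-\partial_x m(P(t),t),\qquad P(t)=P(t+T).$$ (i) Suppose $(\ast)$ has at least one but only finitely many $T$-periodic solutions, denoted by $\{P_i(t)\}_{i=1}^N$, satisfying $0<P_1(t)<\cdots<P_N(t)<1$, and that $\partial_{xx}m(P_i(t),t)\neq 0$ for all $1\le i\le N$ and $t\in[0,T]$. Then $$\lim_{D\to 0}\lambda(D)=\min_{0\le i\le N+1}\left\{\frac1T\int_0^T\Big[V(P_i(s),s)+[\partial_{xx}m]_+(P_i(s),s)\Big]\,ds\right\},$$ where $P_0(t)\equiv 0$ and $P_{N+1}(t)\equiv 1$, and where for $i=0$ and $i=N+1$ the expression in braces is understood as $\hat V(0)+[\partial_{xx}\hat m]_+(0)$ and $\hat V(1)+[\partial_{xx}\hat m]_+(1)$ respectively, with the boundary convention for $\partial_{xx}\hat m(0)$ and $\partial_{xx}\hat m(1)$ given in the context. (ii) If $(\ast)$ has no periodic solutions, then $$\lim_{D\to 0}\lambda(D)=\min\Big\{\hat V(0)+[\partial_{xx}\hat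 m]_+(0),\ \hat V(1)+[\partial_{xx}\hat m]_+(1)\Big\}.$$
   Context: $T>0$ and $D>0$. The functions $m\in C^{2,1}([0,1]\times[0,T])$ ($C^2$ in $x$, $C^1$ in $t$) and $V\in C([0,1]\times[0,T])$ are periodic in $t$ with common period $T$ (and are extended periodically to all $t\in\mathbb R$). The principal eigenvalue is the simple real eigenvalue of the stated time-periodic problem that has a positive eigenfunction (it exists by the Krein-Rutman theorem, and every other eigenvalue has larger real part). Solutions of the ordinary differential equation are those taking values in $[0,1]$. For a $T$-periodic function $p(x,t)$: $\hat p(x)=\frac1T\int_0^T p(x,s)\,ds$ and $p_+(x,t)=\max\{p(x,t),0\}$; likewise $[q]_+=\max\{q,0\}$, with $[+\infty]_+=+\infty$ and $[-\infty]_+=0$. Boundary convention: $\partial_{xx}\hat m$ at the endpoints is redefined by $$\partial_{xx}\hat m(0)=\begin{cases}-\infty & \text{if }\partial_x\hat m(0^+)<0,\\ +\infty & \text{if }\partial_x\hat m(0^+)>0,\end{cases}\qquad \partial_{xx}\hat m(1)=\begin{cases}+\infty & \text{if }\partial_x\hat m(1^-)<0,\\ -\infty & \text{if }\partial_x\hat m(1^-)>0.\end{cases}$$ *)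

(* Defs.v *)
From Stdlib Require Import Reals Lra Lia.
From Coquelicot Require Import Coquelicot.
Open Scope R_scope.

(* Space-time functions are written  f x t,  with x in [0,1]; their values for
   x outside [0,1] are never used. *)

Definition cylinder (T : R) (p : R * R) : Prop :=
  0 <= fst p <= 1 /\ 0 <= snd p <= T.

Definition cont_cylinder (T : R) (f : R -> R -> R) : Prop :=
  continuous_on (cylinder T) (fun p : R * R => f (fst p) (snd p)).

Definition periodic_in_t (T : R) (f : R -> R -> R) : Prop :=
  forall x t, 0 <= x <= 1 -> f x (t + T) = f x t.

(* [D_in f f' I x] is the derivative of f at x relative to the interval I,
   hence one-sided at an endpoint of I. *)
Definition deriv_unit (f f' : R -> R) : Prop :=
  forall x, 0 <= x <= 1 -> D_in f f' (fun y => 0 <= y <= 1) x.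

(* m is of class C^{2,1} on [0,1] x [0,T], with m_t = mt, m_x = mx and
   m_xx = mxx. *)
Definition is_C21 (T : R) (m mt mx mxx : R -> R -> R) : Prop :=
  (forall t, deriv_unit (fun x => m x t) (fun x => mx x t)) /\
  (forall t, deriv_unit (fun x => mx x t) (fun x => mxx x t)) /\
  (forall x t, 0 <= x <= 1 -> 0 <= t <= T ->
     D_in (m x) (mt x) (fun s => 0 <= s <= T) t) /\
  cont_cylinder T m /\ cont_cylinder T mt /\
  cont_cylinder T mx /\ cont_cylinder T mxx.

Definition hat (T : R) (p : R -> R -> R) (x : R) : R :=
  / T * RInt (fun s => p x s) 0 T.

(* The equation
     phi_t - D phi_xx - m_x phi_x + V phi = l phi   in (0,1) x (0,T),
   integrated over every rectangle [x1,x2] x [t1,t2] contained in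
   (0,1) x (0,T), with phix = phi_x.  As V is merely continuous, the
   eigenfunction given by the Krein-Rutman theorem is in W^{2,1}_p for all
   finite p (so phi and phi_x are continuous), but phi_t and phi_xx need not
   exist at every point; hence the integrated form.  By
   [pde_integrated_pointwise] below it is the pointwise equation when
   phi_t and phi_xx are continuous. *)
Definition pde_integrated (T D : R) (mx V : R -> R -> R) (l : R)
    (phi phix : R -> R -> R) : Prop :=
  forall x1 x2 t1 t2, 0 < x1 -> x1 < x2 -> x2 < 1 ->
                      0 < t1 -> t1 < t2 -> t2 < T ->
    RInt (fun x => phi x t2 - phi x t1) x1 x2
    - D * RInt (fun t => phix x2 t - phix x1 t) t1 t2
    - RInt (fun t => RInt (fun x => mx x t * phix x t) x1 x2) t1 t2
    + RInt (fun t => RInt (fun x => V x t * phi x t) x1 x2) t1 t2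
    = l * RInt (fun t => RInt (fun x => phi x t) x1 x2) t1 t2.

(* phi is an eigenfunction, positive, for the eigenvalue l.  A real eigenvalue
   with a positive eigenfunction is unique and simple. *)
Definition positive_eigenfunction (T D : R) (mx V : R -> R -> R) (l : R)
    (phi : R -> R -> R) : Prop :=
  (forall x t, 0 <= x <= 1 -> 0 <= t <= T -> 0 < phi x t) /\
  exists phix : R -> R -> R,
    (forall t, 0 <= t <= T -> deriv_unit (fun x => phi x t) (fun x => phix x t)) /\
    cont_cylinder T phi /\ cont_cylinder T phix /\
    pde_integrated T D mx V l phi phix /\
    (forall t, 0 <= t <= T -> phix 0 t = 0 /\ phix 1 t = 0) /\
    (forall x, 0 < x < 1 -> phi x 0 = phi x T).

Definition is_principal_eigenvalue (T D : R) (mx V : R -> R -> R) (l : R) : Prop :=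
  exists phi, positive_eigenfunction T D mx V l phi.

Definition periodic_solution (T : R) (mx : R -> R -> R) (P : R -> R) : Prop :=
  (forall t, 0 <= P t <= 1) /\
  (forall t, is_derive P t (- mx (P t) t)) /\
  (forall t, P t = P (t + T)).

Definition Rbar_pos (q : Rbar) : Rbar :=
  match q with
  | Finite r => Finite (Rmax r 0)
  | p_infty => p_infty
  | m_infty => Finite 0
  end.

(* The second derivative of the time average of m at the endpoints, with its
   boundary convention; d1 and d2 are the first and second (one-sided)
   derivatives there. *)
Definition dxx_at_0 (d1 d2 : R) : Rbar :=
  match total_order_T d1 0 with
  | inleft (left _) => m_infty
  | inleft (right _) => Finite d2
  | inright _ => p_infty
  end.

Definition dxx_at_1 (d1 d2 : R) : Rbar :=
  match total_order_T d1 0 with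
  | inleft (left _) => p_infty
  | inleft (right _) => Finite d2
  | inright _ => m_infty
  end.

Definition value_at_0 (T : R) (V : R -> R -> R) (mhx mhxx : R -> R) : Rbar :=
  Rbar_plus (Finite (hat T V 0)) (Rbar_pos (dxx_at_0 (mhx 0) (mhxx 0))).

Definition value_at_1 (T : R) (V : R -> R -> R) (mhx mhxx : R -> R) : Rbar :=
  Rbar_plus (Finite (hat T V 1)) (Rbar_pos (dxx_at_1 (mhx 1) (mhxx 1))).

Definition value_on_orbit (T : R) (mxx V : R -> R -> R) (P : R -> R) : Rbar :=
  Finite (/ T * RInt (fun s => V (P s) s + Rmax (mxx (P s) s) 0) 0 T).

Definition value (T : R) (mxx V : R -> R -> R) (mhx mhxx : R -> R)
    (N : nat) (P : nat -> R -> R) (i : nat) : Rbar :=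
  if Nat.eqb i 0 then value_at_0 T V mhx mhxx
  else if Nat.eqb i (S N) then value_at_1 T V mhx mhxx
  else value_on_orbit T mxx V (P i).

Fixpoint Rbar_min_upto (e : nat -> Rbar) (n : nat) : Rbar :=
  match n with
  | O => e O
  | S k => Rbar_min (Rbar_min_upto e k) (e (S k))
  end.

Lemma continuous_slice_x (f : R -> R -> R) x t :
  continuity_2d_pt f x t -> continuous (fun y => f y t) x.
Proof.
intros H; apply (filterlim_locally (F := locally x)); intros eps.
destruct (H eps) as [del Hdel]; exists del; intros y Hy.
apply Hdel; [exact Hy | rewrite Rminus_diag, Rabs_R0; apply cond_pos].
Qed.

Lemma ex_RInt_slice (f : R -> R -> R) a b t :
  a < b -> (forall x, a <= x <= b -> continuity_2d_pt f x t) ->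
  ex_RInt (fun x => f x t) a b.
Proof.
intros Hab H; apply (ex_RInt_continuous (V := R_CompleteNormedModule)); intros z Hz.
rewrite Rmin_left, Rmax_right in Hz by lra.
now apply continuous_slice_x, H.
Qed.

Lemma continuous_RInt_slice (f : R -> R -> R) a b c d t :
  a < b -> c < t < d ->
  (forall x s, a <= x <= b -> c < s < d -> continuity_2d_pt f x s) ->
  continuous (fun s => RInt (fun x => f x s) a b) t.
Proof.
intros Hab Ht H.
apply (filterlim_locally (F := locally t)); intros eps.
assert (He : 0 < eps / (2 * (b - a))).
{ apply Rdiv_lt_0_compat; [apply cond_pos | lra]. }
destruct (uniform_continuity_2d_1d f a b t (fun x Hx => H x t Hx Ht) (mkposreal _ He))
  as [del Hdel].
assert (Hm : 0 < Rmin del (Rmin (t - c) (d - t))).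
{ repeat apply Rmin_glb_lt; try lra; apply cond_pos. }
exists (mkposreal _ Hm); intros s Hs.
change (Rabs (s - t) < Rmin del (Rmin (t - c) (d - t))) in Hs.
assert (H1 : Rabs (s - t) < del) by (eapply Rlt_le_trans; [exact Hs | apply Rmin_l]).
assert (H2 : Rabs (s - t) < Rmin (t - c) (d - t))
  by (eapply Rlt_le_trans; [exact Hs | apply Rmin_r]).
assert (H3 : Rabs (s - t) < t - c) by (eapply Rlt_le_trans; [exact H2 | apply Rmin_l]).
assert (H4 : Rabs (s - t) < d - t) by (eapply Rlt_le_trans; [exact H2 | apply Rmin_r]).
apply Rabs_def2 in H1; apply Rabs_def2 in H3; apply Rabs_def2 in H4.
assert (I1 : ex_RInt (fun x => f x s) a b).
{ apply ex_RInt_slice; auto; intros; apply H; lra. }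
assert (I2 : ex_RInt (fun x => f x t) a b).
{ apply ex_RInt_slice; auto. }
change (Rabs (RInt (fun x => f x s) a b - RInt (fun x => f x t) a b) < eps).
rewrite <- (RInt_minus (V := R_CompleteNormedModule)) by assumption.
apply Rle_lt_trans with ((b - a) * (eps / (2 * (b - a)))).
- apply abs_RInt_le_const; [lra | now apply (ex_RInt_minus (V := R_NormedModule)) | ].
  intros x Hx; left.
  assert (L := cond_pos del).
  apply (Hdel x t x s); try lra; rewrite Rminus_diag, Rabs_R0; lra.
- replace ((b - a) * (eps / (2 * (b - a)))) with (eps / 2) by (field; lra).
  assert (L := cond_pos eps); lra.
Qed.

Lemma ex_RInt_RInt_slice (f : R -> R -> R) a b c d t1 t2 :
  a < b -> c < t1 -> t1 < t2 -> t2 < d ->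
  (forall x s, a <= x <= b -> c < s < d -> continuity_2d_pt f x s) ->
  ex_RInt (fun s => RInt (fun x => f x s) a b) t1 t2.
Proof.
intros Hab Hc Ht Hd H; apply (ex_RInt_continuous (V := R_CompleteNormedModule)).
intros z Hz; rewrite Rmin_left, Rmax_right in Hz by lra.
apply continuous_RInt_slice with c d; auto; lra.
Qed.

Lemma RInt_lin (f g : R -> R) a b u v :
  ex_RInt f a b -> ex_RInt g a b ->
  ex_RInt (fun x => u * f x + v * g x) a b /\
  RInt (fun x => u * f x + v * g x) a b = u * RInt f a b + v * RInt g a b.
Proof.
intros Hf Hg.
assert (E : is_RInt (fun x => u * f x + v * g x) a b (u * RInt f a b + v * RInt g a b)).
{ apply (is_RInt_plus (V := R_NormedModule) (fun x => u * f x) (fun x => v * g x));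
    apply (is_RInt_scal (V := R_NormedModule));
    now apply (RInt_correct (V := R_CompleteNormedModule)). }
split; [eexists; exact E | now apply is_RInt_unique].
Qed.

Lemma RInt_RInt_lin (f g : R -> R -> R) x1 x2 c d t1 t2 u v :
  x1 < x2 -> c < t1 -> t1 < t2 -> t2 < d ->
  (forall x s, x1 <= x <= x2 -> c < s < d -> continuity_2d_pt f x s) ->
  (forall x s, x1 <= x <= x2 -> c < s < d -> continuity_2d_pt g x s) ->
  RInt (fun t => RInt (fun x => u * f x t + v * g x t) x1 x2) t1 t2 =
  u * RInt (fun t => RInt (fun x => f x t) x1 x2) t1 t2 +
  v * RInt (fun t => RInt (fun x => g x t) x1 x2) t1 t2.
Proof.
intros Hx Hc Ht Hd Hf Hg.
rewrite <- (proj2 (RInt_lin (fun t => RInt (fun x => f x t) x1 x2)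
                     (fun t => RInt (fun x => g x t) x1 x2) t1 t2 u v
                     (ex_RInt_RInt_slice f _ _ c d _ _ Hx Hc Ht Hd Hf)
                     (ex_RInt_RInt_slice g _ _ c d _ _ Hx Hc Ht Hd Hg))).
apply RInt_ext; intros t Htt; rewrite Rmin_left, Rmax_right in Htt by lra.
apply (RInt_lin (fun x => f x t) (fun x => g x t)); apply ex_RInt_slice; auto;
  intros; [apply Hf | apply Hg]; lra.
Qed.

Lemma continuity_2d_lin (f g : R -> R -> R) x t u v :
  continuity_2d_pt f x t -> continuity_2d_pt g x t ->
  continuity_2d_pt (fun x t => u * f x t + v * g x t) x t.
Proof.
intros Hf Hg; apply continuity_2d_pt_plus; apply continuity_2d_pt_mult; auto;
  apply continuity_2d_pt_const.
Qed.

Lemma RInt_RInt_pos (g : R -> R -> R) x1 x2 c d t1 t2 :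
  x1 < x2 -> c < t1 -> t1 < t2 -> t2 < d ->
  (forall x s, x1 <= x <= x2 -> c < s < d -> continuity_2d_pt g x s) ->
  (forall x s, x1 <= x <= x2 -> t1 <= s <= t2 -> 0 < g x s) ->
  0 < RInt (fun t => RInt (fun x => g x t) x1 x2) t1 t2.
Proof.
intros Hx Hc Ht Hd Hg Hp.
apply RInt_gt_0; [lra | | ].
- intros t Htt; apply RInt_gt_0; [lra | | ].
  + intros; apply Hp; lra.
  + intros; apply continuous_slice_x, Hg; lra.
- intros t Htt; apply continuous_RInt_slice with c d; auto; lra.
Qed.

Lemma pos_near (G : R -> R -> R) (T x t : R) :
  0 < x < 1 -> 0 < t < T -> continuity_2d_pt G x t -> 0 < G x t ->
  exists h, 0 < h /\ 0 < x - h /\ x + h < 1 /\ 0 < t - h /\ t + h < T /\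
    forall y s, x - h <= y <= x + h -> t - h <= s <= t + h -> 0 < G y s.
Proof.
intros Hx Ht HG Hp.
destruct (HG (mkposreal _ Hp)) as [del Hdel]; simpl in Hdel.
set (k := Rmin del (Rmin (Rmin x (1 - x)) (Rmin t (T - t)))).
assert (Hk : 0 < k).
{ unfold k; repeat apply Rmin_glb_lt; try lra; apply cond_pos. }
assert (K1 : k <= del) by apply Rmin_l.
assert (K2 : k <= Rmin (Rmin x (1 - x)) (Rmin t (T - t))) by apply Rmin_r.
assert (K3 := Rmin_l (Rmin x (1 - x)) (Rmin t (T - t))).
assert (K4 := Rmin_r (Rmin x (1 - x)) (Rmin t (T - t))).
assert (K5 := Rmin_l x (1 - x)). assert (K6 := Rmin_r x (1 - x)).
assert (K7 := Rmin_l t (T - t)). assert (K8 := Rmin_r t (T - t)).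
exists (k / 2); repeat split; try lra.
intros y s Hy Hs.
assert (H1 : Rabs (y - x) < del) by (apply Rabs_def1; lra).
assert (H2 : Rabs (s - t) < del) by (apply Rabs_def1; lra).
specialize (Hdel y s H1 H2); apply Rabs_def2 in Hdel; lra.
Qed.

Lemma pde_integrated_pointwise (T D l : R) (mx V phi phit phix phixx : R -> R -> R) :
  (forall x t, 0 < x < 1 -> 0 < t < T ->
     continuity_2d_pt mx x t /\ continuity_2d_pt V x t /\
     continuity_2d_pt phi x t /\ continuity_2d_pt phix x t /\
     continuity_2d_pt phit x t /\ continuity_2d_pt phixx x t) ->
  (forall x t, 0 < x < 1 -> 0 < t < T ->
     is_derive (fun s => phi x s) t (phit x t) /\
     is_derive (fun y => phi y t) x (phix x t) /\
     is_derive (fun y => phix y t) x (phixx x t)) ->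
  pde_integrated T D mx V l phi phix <->
  (forall x t, 0 < x < 1 -> 0 < t < T ->
     phit x t - D * phixx x t - mx x t * phix x t + V x t * phi x t
     = l * phi x t).
Proof.
intros Hc Hd.
set (G := fun x t => 1 * (1 * (1 * (1 * phit x t + (- D) * phixx x t)
            + (-1) * (mx x t * phix x t)) + 1 * (V x t * phi x t))
            + (- l) * phi x t).
assert (C1 : forall x t, 0 < x < 1 -> 0 < t < T ->
  continuity_2d_pt (fun x t => mx x t * phix x t) x t).
{ intros; apply continuity_2d_pt_mult; now apply Hc. }
assert (C2 : forall x t, 0 < x < 1 -> 0 < t < T ->
  continuity_2d_pt (fun x t => V x t * phi x t) x t).
{ intros; apply continuity_2d_pt_mult; now apply Hc. }
assert (C3 : forall x t, 0 < x < 1 -> 0 < t < T ->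
  continuity_2d_pt (fun x t => 1 * phit x t + (- D) * phixx x t) x t).
{ intros; apply continuity_2d_lin; now apply Hc. }
assert (C4 : forall x t, 0 < x < 1 -> 0 < t < T ->
  continuity_2d_pt (fun x t => 1 * (1 * phit x t + (- D) * phixx x t)
    + (-1) * (mx x t * phix x t)) x t).
{ intros; apply (continuity_2d_lin (fun x t => 1 * phit x t + (- D) * phixx x t)
    (fun x t => mx x t * phix x t)); auto. }
assert (C5 : forall x t, 0 < x < 1 -> 0 < t < T ->
  continuity_2d_pt (fun x t => 1 * (1 * (1 * phit x t + (- D) * phixx x t)
    + (-1) * (mx x t * phix x t)) + 1 * (V x t * phi x t)) x t).
{ intros; apply (continuity_2d_lin (fun x t => 1 * (1 * phit x t + (- D) * phixx x t)
    + (-1) * (mx x t * phix x t)) (fun x t => V x t * phi x t)); auto. }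
assert (CG : forall x t, 0 < x < 1 -> 0 < t < T -> continuity_2d_pt G x t).
{ intros; unfold G; apply (continuity_2d_lin (fun x t => 1 * (1 * (1 * phit x t
    + (- D) * phixx x t) + (-1) * (mx x t * phix x t)) + 1 * (V x t * phi x t)) phi);
  [auto | now apply Hc]. }
assert (main : forall x1 x2 t1 t2, 0 < x1 -> x1 < x2 -> x2 < 1 ->
   0 < t1 -> t1 < t2 -> t2 < T ->
   RInt (fun t => RInt (fun x => G x t) x1 x2) t1 t2 =
    RInt (fun x => phi x t2 - phi x t1) x1 x2
    - D * RInt (fun t => phix x2 t - phix x1 t) t1 t2
    - RInt (fun t => RInt (fun x => mx x t * phix x t) x1 x2) t1 t2
    + RInt (fun t => RInt (fun x => V x t * phi x t) x1 x2) t1 t2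
    - l * RInt (fun t => RInt (fun x => phi x t) x1 x2) t1 t2).
{ intros x1 x2 t1 t2 X1 X2 X3 T1 T2 T3.
  assert (E1 : RInt (fun x => phi x t2 - phi x t1) x1 x2 =
               RInt (fun t => RInt (fun x => phit x t) x1 x2) t1 t2).
  { rewrite (RInt_minus (V := R_CompleteNormedModule) (fun x => phi x t2) (fun x => phi x t1));
      try (apply ex_RInt_slice; [lra | intros; apply Hc; lra]).
    symmetry; apply is_RInt_unique.
    apply (is_RInt_derive (V := R_CompleteNormedModule)
             (fun t => RInt (fun x => phi x t) x1 x2)).
    - intros t Ht; rewrite Rmin_left, Rmax_right in Ht by lra.
      assert (N : locally t (fun s => 0 < s < T)).
      { apply (locally_interval _ t 0 T); simpl; try lra; intros; lra. }
      replace (RInt (fun x => phit x t) x1 x2)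
        with (RInt (fun x => Derive (fun s => phi x s) t) x1 x2).
      2:{ apply RInt_ext; intros x Hx; rewrite Rmin_left, Rmax_right in Hx by lra.
          apply is_derive_unique; refine (proj1 (Hd x t _ _)); lra. }
      apply (is_derive_RInt_param (fun s x => phi x s)).
      + revert N; apply filter_imp; intros s Hs x Hx.
        rewrite Rmin_left, Rmax_right in Hx by lra.
        exists (phit x s); refine (proj1 (Hd x s _ _)); lra.
      + intros x Hx; rewrite Rmin_left, Rmax_right in Hx by lra.
        apply (continuity_2d_pt_ext_loc (fun s y => phit y s)).
        * assert (Hm : 0 < Rmin (Rmin t (T - t)) (Rmin x (1 - x))).
          { repeat apply Rmin_glb_lt; lra. }
          exists (mkposreal _ Hm); simpl; intros s y Hs Hy.
          assert (K3 := Rmin_l (Rmin t (T - t)) (Rmin x (1 - x))).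
          assert (K4 := Rmin_r (Rmin t (T - t)) (Rmin x (1 - x))).
          assert (K5 := Rmin_l x (1 - x)). assert (K6 := Rmin_r x (1 - x)).
          assert (K7 := Rmin_l t (T - t)). assert (K8 := Rmin_r t (T - t)).
          apply Rabs_def2 in Hs; apply Rabs_def2 in Hy.
          symmetry; apply is_derive_unique; refine (proj1 (Hd y s _ _)); lra.
        * assert (C : continuity_2d_pt phit x t) by (apply Hc; lra).
          intros eps; destruct (C eps) as [del Hdel].
          exists del; intros; now apply Hdel.
      + revert N; apply filter_imp; intros s Hs.
        apply ex_RInt_slice; [lra | intros; apply Hc; lra].
    - intros t Ht; rewrite Rmin_left, Rmax_right in Ht by lra.
      apply continuous_RInt_slice with 0 T; try lra.
      intros; apply Hc; lra. }
  assert (E2 : RInt (fun t => phix x2 t - phix x1 t) t1 t2 =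
               RInt (fun t => RInt (fun x => phixx x t) x1 x2) t1 t2).
  { apply RInt_ext; intros t Ht; rewrite Rmin_left, Rmax_right in Ht by lra.
    symmetry; apply is_RInt_unique.
    apply (is_RInt_derive (V := R_CompleteNormedModule) (fun x => phix x t));
      intros x Hx; rewrite Rmin_left, Rmax_right in Hx by lra.
    - refine (proj2 (proj2 (Hd x t _ _))); lra.
    - apply continuous_slice_x, Hc; lra. }
  rewrite E1, E2; unfold G.
  rewrite (RInt_RInt_lin (fun x t => 1 * (1 * (1 * phit x t
    + (- D) * phixx x t) + (-1) * (mx x t * phix x t)) + 1 * (V x t * phi x t)) phi
    x1 x2 0 T); try lra; try (intros; first [apply C5 | apply Hc]; lra).
  rewrite (RInt_RInt_lin (fun x t => 1 * (1 * phit x t + (- D) * phixx x t)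
    + (-1) * (mx x t * phix x t)) (fun x t => V x t * phi x t)
    x1 x2 0 T); try lra; try (intros; first [apply C4 | apply C2]; lra).
  rewrite (RInt_RInt_lin (fun x t => 1 * phit x t + (- D) * phixx x t)
    (fun x t => mx x t * phix x t)
    x1 x2 0 T); try lra; try (intros; first [apply C3 | apply C1]; lra).
  rewrite (RInt_RInt_lin phit phixx x1 x2 0 T); try lra; intros; apply Hc; lra. }
split.
- intros H x t Hx Ht.
  assert (Z : forall x1 x2 t1 t2, 0 < x1 -> x1 < x2 -> x2 < 1 ->
     0 < t1 -> t1 < t2 -> t2 < T ->
     RInt (fun t => RInt (fun x => G x t) x1 x2) t1 t2 = 0).
  { intros x1 x2 t1 t2 X1 X2 X3 T1 T2 T3.
    rewrite main by assumption; rewrite (H x1 x2 t1 t2) by assumption.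
    apply Rminus_diag. }
  assert (G0 : G x t = 0).
  { destruct (Rtotal_order (G x t) 0) as [L | [E | L]]; [exfalso | exact E | exfalso].
    - assert (CN : forall y s, 0 < y < 1 -> 0 < s < T ->
        continuity_2d_pt (fun y s => (-1) * G y s + 0 * G y s) y s).
      { intros; apply continuity_2d_lin; auto. }
      destruct (pos_near (fun y s => (-1) * G y s + 0 * G y s) T x t)
        as [h (h0 & h1 & h2 & h3 & h4 & P)]; auto; try lra.
      assert (I : 0 < RInt (fun s => RInt (fun y => (-1) * G y s + 0 * G y s)
                      (x - h) (x + h)) (t - h) (t + h)).
      { apply (RInt_RInt_pos _ _ _ 0 T); try lra; [intros; apply CN; lra | exact P]. }
      rewrite (RInt_RInt_lin G G _ _ 0 T) in I; try lra; try (intros; apply CG; lra).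
      rewrite Z in I; lra.
    - destruct (pos_near G T x t) as [h (h0 & h1 & h2 & h3 & h4 & P)]; auto.
      assert (I : 0 < RInt (fun s => RInt (fun y => G y s)
                      (x - h) (x + h)) (t - h) (t + h)).
      { apply (RInt_RInt_pos _ _ _ 0 T); try lra; [intros; apply CG; lra | exact P]. }
      rewrite Z in I; lra. }
  unfold G in G0; lra.
- intros H x1 x2 t1 t2 X1 X2 X3 T1 T2 T3.
  assert (Z : RInt (fun t => RInt (fun x => G x t) x1 x2) t1 t2 = 0).
  { rewrite (RInt_ext _ (fun _ => 0)).
    - rewrite (RInt_const (V := R_CompleteNormedModule)); apply Rmult_0_r.
    - intros t Ht; rewrite Rmin_left, Rmax_right in Ht by lra.
      rewrite (RInt_ext _ (fun _ => 0)).
      + rewrite (RInt_const (V := R_CompleteNormedModule)); apply Rmult_0_r.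
      + intros x Hx; rewrite Rmin_left, Rmax_right in Hx by lra.
        assert (E : phit x t - D * phixx x t - mx x t * phix x t + V x t * phi x t
          = l * phi x t) by (apply H; lra).
        unfold G; lra. }
  rewrite main in Z by assumption; apply Rminus_diag_uniq; exact Z.
Qed.

(* Main.v *)
(** The eigenfunction, defined weakly in time, is a viscosity solution (average it over short times), so [lambda(D)] is compared with [C^{2,1}] sub- and supersolutions glued as minima of local pieces, by touching at an extremum of [ln phi - w].

    Upper bounds come from compactly supported subsolutions at each orbit: a truncated parabola at sources (orbits repelling for x' = -m_x) and at inflow endpoints, a truncated Gaussian of variance [D u(t)] at sinks.

    For the lower bound one uses [a(t) exp (K y^2)] at sources and [a(t) (D u(t) + y^2)^(-p)] at sinks, where y is the distance to the orbit; letting [p] be large gives the mean of V + m_xx. In a gap between consecutive orbits, the orbits of x' = -m_x + c that close up after one period have a constant c <> 0 of fixed sign (c = 0 would give a periodic solution). They serve as transversal curves [gamma_j] along which exponentials [exp (K_j (x - gamma_j))], with slopes decreasing toward the sink, make the drift term dominate. Such a chain runs out of the interval at an outflow endpoint, which explains the value +infinity there. *)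
Require Import Defs.
From Stdlib Require Import Reals Lra Lia ZArith ClassicalEpsilon List.
From Coquelicot Require Import Coquelicot.
Open Scope R_scope.

(** The pieces of the lower bound live on incompatible scales. At a sink the logarithm of the
    supersolution grows like [|ln D|] on the orbit, while chains and source pieces have heights that
    must be fixed before [D]. What makes them fit is that the sink piece is bounded independently of
    [D] away from its orbit, which is where it meets a chain. Hence the order of the constants:
    widths of the node tubes, geometry of the chains, bound of the sink pieces, slope [K] of the
    chains, height [Ks] of the source pieces, and [D] last. No regularity is asked of the minimum of
    the pieces: on each edge of a tube some other piece only has to be strictly lower, so that the
    touching point never lies on an edge. Every gap must run from a source to a node that is not
    one. The closing constant [c] decides this: it has one sign on a gap, and beside a node its sign
    is dictated by whether the flow is drawn to the node or leaves it. At an endpoint, inflow counts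
    as a source. Part (ii) is the case without orbits, the only gap joining the two endpoints. *)

(** * Clamping, and extension of functions beyond the cylinder *)

Definition clamp (a b x : R) : R := Rmax a (Rmin b x).

Lemma clamp_in a b x : a <= b -> a <= clamp a b x <= b.
Proof.
intros H; unfold clamp; split; [apply Rmax_l | apply Rmax_lub; [lra | apply Rmin_l]].
Qed.

Lemma clamp_id a b x : a <= x <= b -> clamp a b x = x.
Proof. intros [H1 H2]; unfold clamp; rewrite Rmin_right, Rmax_right; auto. Qed.

Lemma clamp_low a b x : a <= b -> x <= a -> clamp a b x = a.
Proof.
intros Hab H; unfold clamp; rewrite Rmin_right by lra; now apply Rmax_left.
Qed.

Lemma clamp_high a b x : a <= b -> b <= x -> clamp a b x = b.
Proof.
intros Hab H; unfold clamp; rewrite Rmin_left by lra; now apply Rmax_right.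
Qed.

Lemma clamp_lip a b x y : a <= b -> Rabs (clamp a b x - clamp a b y) <= Rabs (x - y).
Proof.
intros Hab; unfold clamp, Rmax, Rmin.
repeat (destruct (Rle_dec _ _)); split_Rabs; lra.
Qed.

Lemma clamp_continuous a b x : a <= b -> continuous (clamp a b) x.
Proof.
intros Hab; apply (filterlim_locally (F := locally x)); intros eps.
exists eps; intros y Hy.
change (Rabs (clamp a b y - clamp a b x) < eps).
eapply Rle_lt_trans; [now apply clamp_lip | exact Hy].
Qed.

(** Constant extension beyond the cylinder. Extended functions are continuous on the whole plane,
    and the extended drift is bounded, globally Lipschitz in [x], and keeps its endpoint value
    outside [0,1], so that orbits may leave the interval. *)
Definition ext (T : R) (f : R -> R -> R) (x t : R) : R :=
  f (clamp 0 1 x) (clamp 0 T t).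

Lemma ext_id T f x t : 0 <= x <= 1 -> 0 <= t <= T -> ext T f x t = f x t.
Proof. intros Hx Ht; unfold ext; now rewrite !clamp_id. Qed.

Lemma ext_continuous T f x t : 0 < T -> cont_cylinder T f ->
  continuity_2d_pt (ext T f) x t.
Proof.
intros HT Hf.
assert (Hp : cylinder T (clamp 0 1 x, clamp 0 T t)).
{ split; apply clamp_in; lra. }
specialize (Hf _ Hp).
intros eps.
assert (He := proj1 (filterlim_locally _ _) Hf eps).
destruct He as [d Hd].
exists d; intros u v Hu Hv.
apply (Hd (clamp 0 1 u, clamp 0 T v)).
- split; [eapply Rle_lt_trans; [apply clamp_lip; lra | exact Hu]
         | eapply Rle_lt_trans; [apply clamp_lip; lra | exact Hv]].
- split; apply clamp_in; lra.
Qed.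

Lemma continuity_2d_slice_t (f : R -> R -> R) x t :
  continuity_2d_pt f x t -> continuous (f x) t.
Proof.
intros H; apply (filterlim_locally (F := locally t)); intros eps.
destruct (H eps) as [d Hd]; exists d; intros s Hs.
apply Hd; [rewrite Rminus_diag, Rabs_R0; apply cond_pos | exact Hs].
Qed.

Lemma continuity_2d_comp (f g h : R -> R -> R) x t :
  continuity_2d_pt f (g x t) (h x t) -> continuity_2d_pt g x t -> continuity_2d_pt h x t ->
  continuity_2d_pt (fun y s => f (g y s) (h y s)) x t.
Proof.
intros Hf Hg Hh eps.
destruct (Hf eps) as [d Hd], (Hg d) as [d1 H1], (Hh d) as [d2 H2].
assert (Hm : 0 < Rmin d1 d2) by (apply Rmin_glb_lt; apply cond_pos).
exists (mkposreal _ Hm); simpl; intros u v Hu Hv; apply Hd.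
- apply H1; eapply Rlt_le_trans; [exact Hu | apply Rmin_l | exact Hv | apply Rmin_l].
- apply H2; eapply Rlt_le_trans; [exact Hu | apply Rmin_r | exact Hv | apply Rmin_r].
Qed.

Lemma continuity_2d_of_t (f : R -> R) x t :
  continuous f t -> continuity_2d_pt (fun _ s => f s) x t.
Proof.
intros Hf eps.
destruct (proj1 (filterlim_locally _ _) Hf eps) as [d Hd].
exists d; intros u v _ Hv; apply Hd; exact Hv.
Qed.

(** * Extreme values on compact subsets of the plane *)

Definition closed2 (S : R -> R -> Prop) : Prop :=
  forall x t, ~ S x t ->
    exists d : posreal, forall u v, Rabs (u - x) < d -> Rabs (v - t) < d -> ~ S u v.

(** Otherwise every point has a neighbourhood of some size [delta] on which [F] stays below
    [M - delta]. By compactness one size serves for the whole rectangle, and then [M] is not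
    approached. *)
Lemma sup_point (S : R -> R -> Prop) (F : R -> R -> R) (a b c d M : R) :
  (forall x t, S x t -> a <= x <= b /\ c <= t <= d) ->
  (forall x t, S x t -> F x t <= M) ->
  (forall e, 0 < e -> exists x t, S x t /\ M - e < F x t) ->
  exists x t, forall e : posreal,
    exists u v, S u v /\ Rabs (u - x) < e /\ Rabs (v - t) < e /\ M - e < F u v.
Proof.
intros HS HM Hsup.
destruct (classic (exists x t, forall e : posreal,
    exists u v, S u v /\ Rabs (u - x) < e /\ Rabs (v - t) < e /\ M - e < F u v))
  as [H | H]; [exact H | exfalso].
assert (H' : forall x t, exists e : posreal, forall u v, S u v ->
   Rabs (u - x) < e -> Rabs (v - t) < e -> F u v <= M - e).
{ intros x t; apply NNPP; intros N; apply H; exists x, t; intros e.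
  apply NNPP; intros N2; apply N; exists e; intros u v Huv Hu Hv.
  apply Rnot_lt_le; intros Hlt; apply N2; exists u, v; auto. }
set (delta := fun x t => proj1_sig (constructive_indefinite_description _ (H' x t))).
assert (Hdelta : forall x t u v, S u v -> Rabs (u - x) < delta x t ->
   Rabs (v - t) < delta x t -> F u v <= M - delta x t).
{ intros x t; unfold delta.
  destruct (constructive_indefinite_description _ (H' x t)); simpl; auto. }
destruct (compactness_value_2d a b c d delta) as [e He].
destruct (Hsup e (cond_pos e)) as [x [t [Hxt Hlt]]].
destruct (HS x t Hxt) as [Hx Ht].
apply (He x t Hx Ht); intros [u [v (Hu & Hv & H1 & H2 & H3)]].
specialize (Hdelta u v x t Hxt H1 H2); lra.
Qed.

Lemma max_on_closed (S : R -> R -> Prop) (F : R -> R -> R) (a b c d : R) :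
  closed2 S ->
  (forall x t, S x t -> a <= x <= b /\ c <= t <= d) ->
  (forall x t, S x t -> continuity_2d_pt F x t) ->
  (exists x t, S x t) ->
  exists x t, S x t /\ forall u v, S u v -> F u v <= F x t.
Proof.
intros HC HS HF [x0 [t0 H0]].
(* Squeeze the values into ]-1,1[ so that the supremum is finite. *)
set (g := fun y => y / (1 + Rabs y)).
assert (gb : forall y, g y <= 1).
{ intros y; unfold g; apply (Rmult_le_reg_r (1 + Rabs y)).
  - assert (P := Rabs_pos y); lra.
  - field_simplify; [split_Rabs; lra | split_Rabs; lra]. }
assert (gm : forall y z, y < z -> g y < g z).
{ intros y z Hyz; unfold g.
  assert (Py := Rabs_pos y); assert (Pz := Rabs_pos z).
  apply (Rmult_lt_reg_r ((1 + Rabs y) * (1 + Rabs z))).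
  - apply Rmult_lt_0_compat; lra.
  - replace (y / (1 + Rabs y) * ((1 + Rabs y) * (1 + Rabs z))) with (y * (1 + Rabs z))
      by (field; lra).
    replace (z / (1 + Rabs z) * ((1 + Rabs y) * (1 + Rabs z))) with (z * (1 + Rabs y))
      by (field; lra).
    split_Rabs; nra. }
assert (gi : forall y z, g y <= g z -> y <= z).
{ intros y z H; apply Rnot_lt_le; intros Hlt; apply gm in Hlt; lra. }
destruct (completeness (fun y => exists x t, S x t /\ y = g (F x t))) as [M [HM1 HM2]].
{ exists 1; intros y [x [t [_ ->]]]; apply gb. }
{ exists (g (F x0 t0)), x0, t0; auto. }
destruct (sup_point S (fun x t => g (F x t)) a b c d M) as [x [t Hxt]].
- exact HS.
- intros x t H; apply HM1; exists x, t; auto.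
- intros e He; apply NNPP; intros N.
  assert (B : M <= M - e); [apply HM2 | lra].
  intros y [x [t [H ->]]]; apply Rnot_lt_le; intros Hlt; apply N; exists x, t; auto.
- assert (Sxt : S x t).
  { apply NNPP; intros N; destruct (HC x t N) as [e He].
    destruct (Hxt e) as [u [v (Huv & Hu & Hv & _)]]; apply (He u v); auto. }
  exists x, t; split; [exact Sxt | intros u v Huv].
  apply gi; apply Rle_trans with M; [apply HM1; exists u, v; auto | ].
  apply Rnot_lt_le; intros Hlt.
  assert (Cg : continuity_2d_pt (fun x t => g (F x t)) x t).
  { apply (continuity_1d_2d_pt_comp g F); [ | now apply HF].
    apply continuity_pt_filterlim; unfold g.
    apply (continuous_mult (K := R_AbsRing) (fun y => y) (fun y => / (1 + Rabs y)));
      [apply continuous_id | ].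
    apply continuous_comp; [apply (continuous_plus (V := R_NormedModule) (fun _ => 1) Rabs);
      [apply continuous_const | apply (continuous_Rabs)] | ].
    apply continuous_Rinv; assert (P := Rabs_pos (F x t)); simpl; 
    unfold plus; simpl; lra. }
  assert (He : 0 < (M - g (F x t)) / 2) by lra.
  destruct (Cg (mkposreal _ He)) as [d1 Hd1]; simpl in Hd1.
  assert (Hm : 0 < Rmin d1 ((M - g (F x t)) / 2)) by (apply Rmin_glb_lt; [apply cond_pos | lra]).
  destruct (Hxt (mkposreal _ Hm)) as [u' [v' (Huv' & Hu & Hv & Hg)]]; simpl in *.
  specialize (Hd1 u' v' (Rlt_le_trans _ _ _ Hu (Rmin_l _ _)) (Rlt_le_trans _ _ _ Hv (Rmin_l _ _))).
  assert (R2 := Rmin_r d1 ((M - g (F x t)) / 2)).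
  apply Rabs_def2 in Hd1; lra.
Qed.

(** The pieces have different tubes and different formulas, so the maximum is taken over pairs of an
    index and a point. *)
Lemma max_on_closed_family {I : Type} (l : list I) (S : I -> R -> R -> Prop)
    (F : I -> R -> R -> R) (a b c d : R) :
  (forall i, In i l -> closed2 (S i)) ->
  (forall i x t, In i l -> S i x t -> a <= x <= b /\ c <= t <= d) ->
  (forall i x t, In i l -> S i x t -> continuity_2d_pt (F i) x t) ->
  (exists i x t, In i l /\ S i x t) ->
  exists i x t, In i l /\ S i x t /\
    forall j u v, In j l -> S j u v -> F j u v <= F i x t.
Proof.
induction l as [ | k l IH]; intros HC HS HF [i0 [x0 [t0 [Hi0 H0]]]]; [easy | ].
assert (HH : (exists i x t, In i l /\ S i x t) ->
  exists i x t, In i l /\ S i x t /\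
    forall j u v, In j l -> S j u v -> F j u v <= F i x t).
{ apply IH; intros; [apply HC | eapply HS; [ | eassumption] | apply HF]; auto; now right. }
destruct (classic (exists x t, S k x t)) as [Hk | Hk];
destruct (classic (exists i x t, In i l /\ S i x t)) as [Hl | Hl].
- destruct (max_on_closed (S k) (F k) a b c d) as [x1 [t1 [S1 M1]]]; auto.
  { apply HC; now left. }
  { intros; apply (HS k); auto; now left. }
  { intros; apply (HF k); auto; now left. }
  destruct (HH Hl) as [i [x [t (Hi & Si & Mi)]]].
  destruct (Rle_dec (F k x1 t1) (F i x t)) as [Hle | Hgt].
  + exists i, x, t; repeat split; [now right | exact Si | ].
    intros j u v [<- | Hj] Sj; [apply Rle_trans with (F k x1 t1); auto | auto].
  + exists k, x1, t1; repeat split; [now left | exact S1 | ].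
    intros j u v [<- | Hj] Sj; [auto | specialize (Mi j u v Hj Sj); lra].
- destruct (max_on_closed (S k) (F k) a b c d) as [x1 [t1 [S1 M1]]]; auto.
  { apply HC; now left. }
  { intros; apply (HS k); auto; now left. }
  { intros; apply (HF k); auto; now left. }
  exists k, x1, t1; repeat split; [now left | exact S1 | ].
  intros j u v [<- | Hj] Sj; [auto | exfalso; apply Hl; exists j, u, v; auto].
- destruct (HH Hl) as [i [x [t (Hi & Si & Mi)]]].
  exists i, x, t; repeat split; [now right | exact Si | ].
  intros j u v [<- | Hj] Sj; [exfalso; apply Hk; exists u, v; auto | auto].
- exfalso; destruct Hi0 as [<- | Hi0]; [apply Hk; eauto | apply Hl; eauto].
Qed.

(** * Weak solutions are viscosity solutions *)

Lemma is_derive_Rabs_spec (f : R -> R) x d : is_derive f x d ->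
  forall e, 0 < e -> exists r, 0 < r /\
    forall y, Rabs (y - x) < r -> Rabs (f y - f x - d * (y - x)) <= e * Rabs (y - x).
Proof.
intros [_ H] e He.
destruct (H x (fun P HP => HP) (mkposreal e He)) as [r Hr].
exists r; split; [apply cond_pos | intros y Hy].
specialize (Hr y Hy); simpl in Hr.
unfold norm, minus, plus, opp, scal in Hr; simpl in Hr; unfold abs, mult in Hr; simpl in Hr.
replace (f y - f x - d * (y - x)) with (f y + - f x + - ((y + - x) * d)) by ring.
exact Hr.
Qed.

Lemma backward_min_derive (g : R -> R) t d r : 0 < r -> is_derive g t d ->
  (forall s, t - r < s <= t -> g t <= g s) -> d <= 0.
Proof.
intros Hr Hg Hmin; apply Rnot_lt_le; intros Hd.
destruct (is_derive_Rabs_spec g t d Hg (d / 2)) as [q [Hq Hq2]]; [lra | ].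
set (s := Rmin q r / 2).
assert (S1 := Rmin_l q r). assert (S2 := Rmin_r q r).
assert (S3 : 0 < Rmin q r) by (apply Rmin_glb_lt; lra).
assert (S4 : 0 < s < q /\ s < r) by (unfold s; lra).
specialize (Hq2 (t - s)); replace (t - s - t) with (- s) in Hq2 by ring.
rewrite Rabs_Ropp, (Rabs_pos_eq s) in Hq2 by lra.
specialize (Hq2 ltac:(lra)); specialize (Hmin (t - s) ltac:(lra)).
assert (0 < d * s) by (apply Rmult_lt_0_compat; lra).
split_Rabs; lra.
Qed.

Lemma forward_min_derive (g : R -> R) t d r : 0 < r -> is_derive g t d ->
  (forall s, t <= s < t + r -> g t <= g s) -> 0 <= d.
Proof.
intros Hr Hg Hmin; apply Rnot_lt_le; intros Hd.
destruct (is_derive_Rabs_spec g t d Hg (- d / 2)) as [q [Hq Hq2]]; [lra | ].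
set (s := Rmin q r / 2).
assert (S1 := Rmin_l q r). assert (S2 := Rmin_r q r).
assert (S3 : 0 < Rmin q r) by (apply Rmin_glb_lt; lra).
assert (S4 : 0 < s < q /\ s < r) by (unfold s; lra).
specialize (Hq2 (t + s)); replace (t + s - t) with s in Hq2 by ring.
rewrite (Rabs_pos_eq s) in Hq2 by lra.
specialize (Hq2 ltac:(lra)); specialize (Hmin (t + s) ltac:(lra)).
assert (0 < - d * s) by (apply Rmult_lt_0_compat; lra).
split_Rabs; lra.
Qed.

Lemma min_derive2 (f f' : R -> R) x d r : 0 < r ->
  (forall y, Rabs (y - x) < r -> is_derive f y (f' y)) -> is_derive f' x d ->
  (forall y, Rabs (y - x) < r -> f x <= f y) -> 0 <= d.
Proof.
intros Hr Hf Hf' Hmin; apply Rnot_lt_le; intros Hd.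
assert (Hx : is_derive f x (f' x)) by (apply Hf; rewrite Rminus_diag, Rabs_R0; lra).
assert (Z : f' x = 0).
{ apply Rle_antisym.
  - apply (backward_min_derive f x _ r); auto; intros s Hs; apply Hmin; apply Rabs_def1; lra.
  - apply (forward_min_derive f x _ r); auto; intros s Hs; apply Hmin; apply Rabs_def1; lra. }
destruct (is_derive_Rabs_spec f' x d Hf' (- d / 2)) as [q [Hq Hq2]]; [lra | ].
set (s := Rmin q r / 2).
assert (S1 := Rmin_l q r). assert (S2 := Rmin_r q r).
assert (S3 : 0 < Rmin q r) by (apply Rmin_glb_lt; lra).
assert (S4 : 0 < s < q /\ s < r) by (unfold s; lra).
destruct (MVT_cor2 f f' x (x + s)) as [c [Hc1 Hc2]]; [lra | | ].
{ intros c Hc; apply is_derive_Reals, Hf; apply Rabs_def1; lra. }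
assert (N : f' c < 0).
{ specialize (Hq2 c ltac:(apply Rabs_def1; lra)).
  rewrite Z, (Rabs_pos_eq (c - x)) in Hq2 by lra.
  assert (0 < - d * (c - x)) by (apply Rmult_lt_0_compat; lra).
  split_Rabs; lra. }
specialize (Hmin (x + s) ltac:(apply Rabs_def1; lra)).
replace (x + s - x) with s in Hc1 by ring.
assert (0 < - f' c * s) by (apply Rmult_lt_0_compat; lra).
lra.
Qed.

Lemma is_derive_window (g : R -> R) h t : (forall s, continuous g s) ->
  is_derive (fun u => RInt g u (u + h)) t (g (t + h) - g t).
Proof.
intros Hg.
assert (E : is_derive (fun u => RInt g u (u + h)) t
              (minus (scal 1 (g (t + h))) (scal 1 (g t)))).
{ apply (is_derive_RInt_bound_comp (V := R_NormedModule) g (RInt g) (fun u => u) (fun u => u + h)).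
  - apply filter_forall; intros u; apply (RInt_correct (V := R_CompleteNormedModule)).
    apply (ex_RInt_continuous (V := R_CompleteNormedModule)); auto.
  - apply Hg.
  - apply Hg.
  - apply (is_derive_id (K := R_AbsRing)).
  - auto_derive; auto; ring. }
replace (g (t + h) - g t) with (minus (scal 1 (g (t + h))) (scal 1 (g t))); [exact E | ].
unfold minus, plus, opp, scal; simpl; unfold mult; simpl; ring.
Qed.

(** An average over a square in both variables, up to the factor [h * h]. It has a [t]-derivative
    and a second [x]-derivative although the eigenfunction has only a continuous [x]-derivative, and
    the weak equation on the same square is an exact identity between them. *)
Definition steklov (f : R -> R -> R) (h x t : R) : R :=
  RInt (fun y => RInt (f y) t (t + h)) x (x + h).

Lemma continuous_window_x (f : R -> R -> R) h t x :
  (forall x t, continuity_2d_pt f x t) -> 0 < h ->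
  continuous (fun y => RInt (f y) t (t + h)) x.
Proof.
intros Hf Hh.
apply (continuous_RInt_slice (fun s y => f y s) t (t + h) (x - 1) (x + 1) x); try lra.
intros s y _ _ e; destruct (Hf y s e) as [d Hd]; exists d; intros; apply Hd; auto.
Qed.

Lemma is_derive_steklov_x (f : R -> R -> R) h x t :
  (forall x t, continuity_2d_pt f x t) -> 0 < h ->
  is_derive (fun y => steklov f h y t) x
    (RInt (f (x + h)) t (t + h) - RInt (f x) t (t + h)).
Proof.
intros Hf Hh; apply (is_derive_window (fun y => RInt (f y) t (t + h))).
intros s; now apply continuous_window_x.
Qed.

Lemma is_derive_steklov_t (f : R -> R -> R) h x t :
  (forall x t, continuity_2d_pt f x t) -> 0 < h ->
  is_derive (fun s => steklov f h x s) t (RInt (fun y => f y (t + h) - f y t) x (x + h)).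
Proof.
intros Hf Hh.
assert (Hw : forall y u, is_derive (fun z => RInt (f y) z (z + h)) u (f y (u + h) - f y u)).
{ intros y u; apply is_derive_window; intros s; apply continuity_2d_slice_t, Hf. }
replace (RInt (fun y => f y (t + h) - f y t) x (x + h)) with
  (RInt (fun y => Derive (fun z => RInt (f y) z (z + h)) t) x (x + h)).
2:{ apply RInt_ext; intros y _; now apply is_derive_unique. }
apply (is_derive_RInt_param (fun z y => RInt (f y) z (z + h))).
- apply filter_forall; intros z y _; eexists; apply Hw.
- intros y _.
  apply (continuity_2d_pt_ext (fun u v => f v (u + h) - f v u)).
  { intros u v; symmetry; now apply is_derive_unique. }
  apply continuity_2d_pt_minus.
  + apply (continuity_2d_comp f (fun _ v => v) (fun u _ => u + h)); [apply Hf | apply continuity_2d_pt_id2 | ].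
    apply continuity_2d_pt_plus; [apply continuity_2d_pt_id1 | apply continuity_2d_pt_const].
  + apply (continuity_2d_comp f (fun _ v => v) (fun u _ => u)); [apply Hf | apply continuity_2d_pt_id2 | ].
    apply continuity_2d_pt_id1.
- apply filter_forall; intros z; apply (ex_RInt_continuous (V := R_CompleteNormedModule)).
  intros; now apply continuous_window_x.
Qed.

Lemma is_derive_window_x (f fx : R -> R -> R) h x t : 0 < h ->
  (forall x t, continuity_2d_pt f x t) -> (forall x t, continuity_2d_pt fx x t) ->
  (forall y s, 0 < y < 1 -> t <= s <= t + h -> is_derive (fun z => f z s) y (fx y s)) ->
  0 < x < 1 ->
  is_derive (fun y => RInt (f y) t (t + h)) x (RInt (fx x) t (t + h)).
Proof.
intros Hh Hf Hfx Hd Hx.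
replace (RInt (fx x) t (t + h)) with (RInt (fun s => Derive (fun y => f y s) x) t (t + h)).
2:{ apply RInt_ext; intros s Hs; rewrite Rmin_left, Rmax_right in Hs by lra.
    apply is_derive_unique, Hd; lra. }
assert (N : locally x (fun y => 0 < y < 1)).
{ apply (locally_interval _ x 0 1); simpl; try lra; intros; lra. }
(* Outside the window in time the derivative is not controlled, so the time variable is clamped. *)
set (g := fun y s => f y (clamp t (t + h) s)).
assert (Hg : forall y s, 0 < y < 1 -> is_derive (fun z => g z s) y (fx y (clamp t (t + h) s))).
{ intros y s Hy; apply Hd; [exact Hy | apply clamp_in; lra]. }
apply (is_derive_ext (fun y => RInt (g y) t (t + h))).
{ intros y; apply RInt_ext; intros s Hs; rewrite Rmin_left, Rmax_right in Hs by lra.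
  unfold g; rewrite clamp_id; [reflexivity | lra]. }
replace (RInt (fun s => Derive (fun y => f y s) x) t (t + h))
  with (RInt (fun s => Derive (fun y => g y s) x) t (t + h)).
2:{ apply RInt_ext; intros s Hs; rewrite Rmin_left, Rmax_right in Hs by lra.
    apply Derive_ext; intros y; unfold g; rewrite clamp_id; [reflexivity | lra]. }
assert (Hc : forall (k : R -> R -> R) y s, (forall x t, continuity_2d_pt k x t) ->
   continuity_2d_pt (fun y s => k y (clamp t (t + h) s)) y s).
{ intros k y s Hk; apply (continuity_2d_comp k (fun y _ => y) (fun _ s => clamp t (t + h) s)).
  - apply Hk.
  - apply continuity_2d_pt_id1.
  - apply continuity_2d_of_t, clamp_continuous; lra. }
apply (is_derive_RInt_param g).
- revert N; apply filter_imp; intros y Hy s _; eexists; now apply Hg.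
- intros s _; apply (continuity_2d_pt_ext_loc (fun y s => fx y (clamp t (t + h) s))).
  + destruct N as [e He]; exists e; intros u v Hu _; symmetry.
    apply is_derive_unique, Hg, He, Hu.
  + now apply Hc.
- apply filter_forall; intros y; apply (ex_RInt_continuous (V := R_CompleteNormedModule)).
  intros s _; apply (continuity_2d_slice_t g), Hc, Hf.
Qed.

Lemma RInt_RInt_close (g : R -> R -> R) x t h e v : 0 < h ->
  (forall x t, continuity_2d_pt g x t) ->
  (forall y s, x <= y <= x + h -> t <= s <= t + h -> Rabs (g y s - v) <= e) ->
  Rabs (RInt (fun s => RInt (fun y => g y s) x (x + h)) t (t + h) - h * h * v) <= h * h * e.
Proof.
intros Hh Hg H.
assert (In1 : forall s, ex_RInt (fun y => g y s) x (x + h)).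
{ intros s; apply (ex_RInt_continuous (V := R_CompleteNormedModule)).
  intros; apply continuous_slice_x, Hg. }
assert (In2 : ex_RInt (fun s => RInt (fun y => g y s) x (x + h)) t (t + h)).
{ apply (ex_RInt_RInt_slice g x (x + h) (t - 1) (t + h + 1)); try lra; auto. }
assert (Hs : forall s, t <= s <= t + h -> Rabs (RInt (fun y => g y s) x (x + h) - h * v) <= h * e).
{ intros s Hs.
  replace (h * v) with (RInt (fun _ => v) x (x + h)).
  2:{ rewrite (RInt_const (V := R_CompleteNormedModule)); unfold scal; simpl; unfold mult; simpl; ring. }
  rewrite <- (RInt_minus (V := R_CompleteNormedModule)); [ | apply In1 | apply ex_RInt_const].
  replace (h * e) with ((x + h - x) * e) by ring.
  apply abs_RInt_le_const; [lra | apply (ex_RInt_minus (V := R_NormedModule)); [apply In1 | apply ex_RInt_const] | ].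
  intros y Hy; apply H; lra. }
replace (h * h * v) with (RInt (fun _ => h * v) t (t + h)).
2:{ rewrite (RInt_const (V := R_CompleteNormedModule)); unfold scal; simpl; unfold mult; simpl; ring. }
rewrite <- (RInt_minus (V := R_CompleteNormedModule)); [ | exact In2 | apply ex_RInt_const].
replace (h * h * e) with ((t + h - t) * (h * e)) by ring.
apply abs_RInt_le_const; [lra | apply (ex_RInt_minus (V := R_NormedModule)); [exact In2 | apply ex_RInt_const] | ].
intros s Hs'; apply Hs; lra.
Qed.

Lemma steklov_close (g : R -> R -> R) x t h e v : 0 < h ->
  (forall x t, continuity_2d_pt g x t) ->
  (forall y s, x <= y <= x + h -> t <= s <= t + h -> Rabs (g y s - v) <= e) ->
  Rabs (steklov g h x t - h * h * v) <= h * h * e.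
Proof.
intros Hh Hg H.
apply (RInt_RInt_close (fun s y => g y s) t x h e v Hh); auto.
intros s y d; destruct (Hg y s d) as [q Hq]; exists q; auto.
Qed.

Definition weak_solution (T D : R) (mx V : R -> R -> R) (l : R) (phi phix : R -> R -> R) : Prop :=
  cont_cylinder T phi /\ cont_cylinder T phix /\
  (forall t, 0 <= t <= T -> deriv_unit (fun x => phi x t) (fun x => phix x t)) /\
  pde_integrated T D mx V l phi phix.

Lemma D_in_interior (f f' : R -> R) x : 0 < x < 1 ->
  D_in f f' (fun y => 0 <= y <= 1) x -> is_derive f x (f' x).
Proof.
intros Hx H; apply is_derive_Reals; intros e He.
destruct (H e He) as [a [Ha H1]].
assert (Hm : 0 < Rmin a (Rmin x (1 - x))) by (repeat apply Rmin_glb_lt; lra).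
exists (mkposreal _ Hm); intros h Hh0 Hh; simpl in Hh.
assert (R1 := Rmin_l a (Rmin x (1 - x))). assert (R2 := Rmin_r a (Rmin x (1 - x))).
assert (R3 := Rmin_l x (1 - x)). assert (R4 := Rmin_r x (1 - x)).
assert (Hh2 : Rabs h < a) by lra.
assert (Hh3 : - Rmin a (Rmin x (1 - x)) < h < Rmin a (Rmin x (1 - x))) by (split_Rabs; lra).
specialize (H1 (x + h)); simpl in H1; unfold R_dist, D_x, Rdist in H1.
replace (x + h - x) with h in H1 by ring.
apply H1; split; [split; [lra | lra] | exact Hh2].
Qed.

Lemma ext_is_derive_x T f fx x t : 0 <= t <= T -> 0 < x < 1 ->
  deriv_unit (fun y => f y t) (fun y => fx y t) ->
  is_derive (fun y => ext T f y t) x (ext T fx x t).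
Proof.
intros Ht Hx H.
rewrite ext_id by lra.
apply (is_derive_ext_loc (fun y => f y t)).
- apply (locally_interval _ x 0 1); simpl; try lra.
  intros y Hy1 Hy2; rewrite ext_id; auto; lra.
- apply (D_in_interior (fun y => f y t) (fun y => fx y t)); [exact Hx | apply H; lra].
Qed.

(** All lower-order terms are gathered in one continuous integrand, so that on a small square the
    right side is nearly a constant times the area. *)
Lemma weak_ext T D mx V l phi phix : 0 < T ->
  cont_cylinder T mx -> cont_cylinder T V -> weak_solution T D mx V l phi phix ->
  forall x1 x2 t1 t2, 0 < x1 -> x1 < x2 -> x2 < 1 -> 0 < t1 -> t1 < t2 -> t2 < T ->
  RInt (fun x => ext T phi x t2 - ext T phi x t1) x1 x2
  - D * RInt (fun t => ext T phix x2 t - ext T phix x1 t) t1 t2 =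
  RInt (fun t => RInt (fun x => ext T mx x t * ext T phix x t +
     (l - ext T V x t) * ext T phi x t) x1 x2) t1 t2.
Proof.
intros HT Hmx HV (Hp & Hpx & Hd & Hpde) x1 x2 t1 t2 X1 X2 X3 T1 T2 T3.
specialize (Hpde x1 x2 t1 t2 X1 X2 X3 T1 T2 T3).
assert (E : forall g g' : R -> R -> R, (forall x t, 0 < x < 1 -> 0 < t < T -> g x t = g' x t) ->
  RInt (fun t => RInt (fun x => g x t) x1 x2) t1 t2 = RInt (fun t => RInt (fun x => g' x t) x1 x2) t1 t2).
{ intros g g' Hg; apply RInt_ext; intros t Ht; rewrite Rmin_left, Rmax_right in Ht by lra.
  apply RInt_ext; intros x Hx; rewrite Rmin_left, Rmax_right in Hx by lra.
  apply Hg; lra. }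
assert (Cm : forall x t, continuity_2d_pt (fun x t => ext T mx x t * ext T phix x t) x t).
{ intros; apply continuity_2d_pt_mult; now apply ext_continuous. }
assert (CV : forall x t, continuity_2d_pt (fun x t => ext T V x t * ext T phi x t) x t).
{ intros; apply continuity_2d_pt_mult; now apply ext_continuous. }
assert (Cp : forall x t, continuity_2d_pt (ext T phi) x t) by (intros; now apply ext_continuous).
rewrite (E (fun x t => ext T mx x t * ext T phix x t + (l - ext T V x t) * ext T phi x t)
  (fun x t => 1 * (1 * (ext T mx x t * ext T phix x t) + (-1) * (ext T V x t * ext T phi x t))
     + l * ext T phi x t)) by (intros; ring).
rewrite (RInt_RInt_lin (fun x t => 1 * (ext T mx x t * ext T phix x t) + (-1) * (ext T V x t * ext T phi x t))
  (ext T phi) x1 x2 0 T) by (try lra; intros; auto; apply (continuity_2d_lin (fun x t => ext T mx x t * ext T phix x t)); auto).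
rewrite (RInt_RInt_lin (fun x t => ext T mx x t * ext T phix x t) (fun x t => ext T V x t * ext T phi x t)
  x1 x2 0 T) by (try lra; intros; auto).
rewrite (E _ (fun x t => mx x t * phix x t)) by (intros; rewrite !ext_id; auto; lra).
rewrite (E (fun x t => ext T V x t * ext T phi x t) (fun x t => V x t * phi x t))
  by (intros; rewrite !ext_id; auto; lra).
rewrite (E (ext T phi) phi) by (intros; rewrite !ext_id; auto; lra).
replace (RInt (fun x => ext T phi x t2 - ext T phi x t1) x1 x2)
  with (RInt (fun x => phi x t2 - phi x t1) x1 x2).
2:{ apply RInt_ext; intros x Hx; rewrite Rmin_left, Rmax_right in Hx by lra.
    rewrite !ext_id; auto; lra. }
replace (RInt (fun t => ext T phix x2 t - ext T phix x1 t) t1 t2)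
  with (RInt (fun t => phix x2 t - phix x1 t) t1 t2).
2:{ apply RInt_ext; intros x Hx; rewrite Rmin_left, Rmax_right in Hx by lra.
    rewrite !ext_id; auto; lra. }
lra.
Qed.

Lemma locally_2d_and_Rabs (P : R -> R -> Prop) x t : locally_2d P x t ->
  exists d, 0 < d /\ forall u v, Rabs (u - x) < d -> Rabs (v - t) < d -> P u v.
Proof. intros [d Hd]; exists d; split; [apply cond_pos | exact Hd]. Qed.

Lemma ext_bounded T f : 0 < T -> cont_cylinder T f ->
  exists C, 0 < C /\ forall x t, Rabs (ext T f x t) <= C.
Proof.
intros HT Hf.
destruct (max_on_closed (fun x t => 0 <= x <= 1 /\ 0 <= t <= T) (fun x t => Rabs (ext T f x t)) 0 1 0 T)
  as [x [t [_ H]]].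
- intros x t N.
  assert (exists d, 0 < d /\ (x + d < 0 \/ 1 < x - d \/ t + d < 0 \/ T < t - d)) as [d [Hd Hor]].
  { destruct (Rlt_dec x 0); [exists (- x / 2); lra | ].
    destruct (Rlt_dec 1 x); [exists ((x - 1) / 2); lra | ].
    destruct (Rlt_dec t 0); [exists (- t / 2); lra | ].
    destruct (Rlt_dec T t); [exists ((t - T) / 2); lra | ].
    exfalso; apply N; lra. }
  exists (mkposreal d Hd); simpl; intros u v Hu Hv HB.
  apply Rabs_def2 in Hu; apply Rabs_def2 in Hv; lra.
- auto.
- intros x t _; apply (continuity_1d_2d_pt_comp Rabs (ext T f)); [ | now apply ext_continuous].
  apply Rcontinuity_abs.
- exists 0, 0; lra.
- exists (Rabs (ext T f x t) + 1); split; [assert (P := Rabs_pos (ext T f x t)); lra | ].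
  intros y s.
  assert (E : ext T f y s = ext T f (clamp 0 1 y) (clamp 0 T s)).
  { unfold ext; rewrite (clamp_id 0 1 (clamp 0 1 y)), (clamp_id 0 T (clamp 0 T s)); auto; apply clamp_in; lra. }
  rewrite E; specialize (H (clamp 0 1 y) (clamp 0 T s)).
  assert (0 <= clamp 0 1 y <= 1) by (apply clamp_in; lra).
  assert (0 <= clamp 0 T s <= T) by (apply clamp_in; lra).
  specialize (H ltac:(auto)); lra.
Qed.

Lemma lipschitz_2d_continuous (f : R -> R -> R) C x t : 0 < C ->
  (forall y s z r, Rabs (f y s - f z r) <= C * (Rabs (y - z) + Rabs (s - r))) ->
  continuity_2d_pt f x t.
Proof.
intros HC H e.
assert (Hd : 0 < e / (2 * C)) by (apply Rdiv_lt_0_compat; [apply cond_pos | lra]).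
exists (mkposreal _ Hd); simpl; intros u v Hu Hv.
eapply Rle_lt_trans; [apply H | ].
replace (pos e) with (C * (e / (2 * C) + e / (2 * C))) by (field; lra).
apply Rmult_lt_compat_l; lra.
Qed.

Lemma Rabs_derive_bound (f : R -> R) (df : R -> R) C x y :
  (forall z, is_derive f z (df z)) -> (forall z, Rabs (df z) <= C) ->
  Rabs (f y - f x) <= C * Rabs (y - x).
Proof.
intros Hf HC.
destruct (MVT_gen f x y df) as [c [_ E]].
- intros; apply Hf.
- intros z _; apply continuity_pt_filterlim, (ex_derive_continuous (V := R_NormedModule)); eexists; apply Hf.
- rewrite E, Rabs_mult; apply Rmult_le_compat_r; [apply Rabs_pos | apply HC].
Qed.

(** Both partial derivatives of the average are bounded because [f] is, so the average is Lipschitz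
    in the plane. *)
Lemma steklov_continuous (f : R -> R -> R) h x t : 0 < h ->
  (forall x t, continuity_2d_pt f x t) ->
  (exists C, 0 < C /\ forall x t, Rabs (f x t) <= C) ->
  continuity_2d_pt (steklov f h) x t.
Proof.
intros Hh Hf [C [HC HB]].
assert (B : forall (g : R -> R) a, (forall y, Rabs (g y) <= C) -> (forall y, continuous g y) ->
   Rabs (RInt g a (a + h)) <= h * C).
{ intros g a Hg Cg; replace (h * C) with ((a + h - a) * C) by ring.
  apply abs_RInt_le_const; [lra | apply (ex_RInt_continuous (V := R_CompleteNormedModule)); auto | auto]. }
assert (Bt : forall y s, Rabs (RInt (f y) s (s + h)) <= h * C).
{ intros; apply B; [auto | intros; now apply continuity_2d_slice_t]. }
assert (Bx : forall y s, Rabs (RInt (fun z => f z s) y (y + h)) <= h * C).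
{ intros; apply B; [auto | intros; now apply continuous_slice_x]. }
apply (lipschitz_2d_continuous _ (2 * h * C)).
{ repeat apply Rmult_lt_0_compat; lra. }
intros y s z r.
replace (steklov f h y s - steklov f h z r)
  with ((steklov f h y s - steklov f h z s) + (steklov f h z s - steklov f h z r)) by ring.
eapply Rle_trans; [apply Rabs_triang | ]; rewrite Rmult_plus_distr_l; apply Rplus_le_compat.
- apply (Rabs_derive_bound (fun y => steklov f h y s)
    (fun y => RInt (f (y + h)) s (s + h) - RInt (f y) s (s + h))).
  + intros; now apply is_derive_steklov_x.
  + intros w; assert (B1 := Bt (w + h) s); assert (B2 := Bt w s).
    unfold Rminus; eapply Rle_trans; [apply Rabs_triang | rewrite Rabs_Ropp; lra].
- apply (Rabs_derive_bound (fun s => steklov f h z s)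
    (fun s => RInt (fun y => f y (s + h) - f y s) z (z + h))).
  + intros; now apply is_derive_steklov_t.
  + intros w; rewrite (RInt_minus (V := R_CompleteNormedModule) (fun y => f y (w + h)) (fun y => f y w));
      try (apply (ex_RInt_continuous (V := R_CompleteNormedModule)); intros; now apply continuous_slice_x).
    assert (B1 := Bx z (w + h)); assert (B2 := Bx z w).
    unfold minus, plus, opp; simpl; eapply Rle_trans; [apply Rabs_triang | rewrite Rabs_Ropp; lra].
Qed.

(** The viscosity property. The average of [phi] is smooth enough for the classical maximum
    principle and satisfies the equation up to a small error. Averaging displaces the contact point,
    hence a strict quadratic penalty that keeps it in a small box. Only times up to [t0] are
    compared, so the time derivative yields an inequality, in the direction wanted. *)
Lemma touch_above T D mx V l phi phix x0 t0 chi chit chix chixx rho :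
  0 < T -> 0 < D ->
  cont_cylinder T mx -> cont_cylinder T V -> weak_solution T D mx V l phi phix ->
  0 < x0 < 1 -> 0 < t0 < T -> 0 < rho ->
  (forall x t, Rabs (x - x0) < rho -> Rabs (t - t0) < rho ->
     continuity_2d_pt chi x t /\ is_derive (fun s => chi x s) t (chit x t) /\
     is_derive (fun y => chi y t) x (chix x t) /\
     is_derive (fun y => chix y t) x (chixx x t)) ->
  continuity_2d_pt chit x0 t0 -> continuity_2d_pt chixx x0 t0 ->
  (forall x t, Rabs (x - x0) < rho -> t0 - rho < t <= t0 -> ext T phi x t <= chi x t) ->
  ext T phi x0 t0 = chi x0 t0 ->
  chit x0 t0 - D * chixx x0 t0 - mx x0 t0 * chix x0 t0 + (V x0 t0 - l) * chi x0 t0 <= 0.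
Proof.
intros HT HD Hmx HV HW Hx0 Ht0 Hrho Hchi Cct Ccxx Htouch Heq.
assert (HWe := weak_ext T D mx V l phi phix HT Hmx HV HW).
destruct HW as (Hp & Hpx & Hder & _).
set (f := fun x t => ext T mx x t * ext T phix x t + (l - ext T V x t) * ext T phi x t) in HWe.
assert (Cp : forall x t, continuity_2d_pt (ext T phi) x t) by (intros; now apply ext_continuous).
assert (Cpx : forall x t, continuity_2d_pt (ext T phix) x t) by (intros; now apply ext_continuous).
assert (Cf : forall x t, continuity_2d_pt f x t).
{ intros; unfold f; apply continuity_2d_pt_plus; apply continuity_2d_pt_mult; auto.
  - now apply ext_continuous.
  - apply continuity_2d_pt_minus; [apply continuity_2d_pt_const | now apply ext_continuous]. }
assert (Dpx : forall y s, 0 < y < 1 -> 0 <= s <= T ->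
  is_derive (fun z => ext T phi z s) y (ext T phix y s)).
{ intros y s Hy Hs; apply ext_is_derive_x; auto. }
(* At the fixed time [t0] the contact is two-sided in [x], so the slopes agree. This lets the drift
   term of the conclusion be absorbed in the continuous right side [f]. *)
assert (Hx : ext T phix x0 t0 = chix x0 t0).
{ destruct (Hchi x0 t0) as (_ & _ & Hc & _); try (rewrite Rminus_diag, Rabs_R0; lra).
  assert (Hdiff : is_derive (fun y => chi y t0 - ext T phi y t0) x0 (chix x0 t0 - ext T phix x0 t0)).
  { apply (is_derive_minus (V := R_NormedModule)); [exact Hc | apply Dpx; lra]. }
  assert (A1 : chix x0 t0 - ext T phix x0 t0 <= 0).
  { apply (backward_min_derive _ _ _ rho Hrho Hdiff); intros s Hs; rewrite Heq, Rminus_diag.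
    specialize (Htouch s t0 ltac:(apply Rabs_def1; lra) ltac:(lra)); lra. }
  assert (A2 : 0 <= chix x0 t0 - ext T phix x0 t0).
  { apply (forward_min_derive _ _ _ rho Hrho Hdiff); intros s Hs; rewrite Heq, Rminus_diag.
    specialize (Htouch s t0 ltac:(apply Rabs_def1; lra) ltac:(lra)); lra. }
  lra. }
replace (chit x0 t0 - D * chixx x0 t0 - mx x0 t0 * chix x0 t0 + (V x0 t0 - l) * chi x0 t0)
  with (chit x0 t0 - D * chixx x0 t0 - f x0 t0).
2:{ unfold f; rewrite Hx, Heq, !ext_id by lra; ring. }
apply Rnot_lt_le; intros Hpos.
(* One eighth of the supposed excess: the oscillations of [chit], of [D * chixx] and of [f], and the
   penalty, cost at most [e] each. *)
set (e := (chit x0 t0 - D * chixx x0 t0 - f x0 t0) / 8).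
assert (He : 0 < e) by (unfold e; lra).
set (kap := e / (2 * (1 + D))).
assert (Hkap : 0 < kap) by (unfold kap; apply Rdiv_lt_0_compat; lra).
assert (Hkap2 : 2 * kap * (1 + D) = e) by (unfold kap; field; lra).
clearbody kap.
assert (He2 : 0 < e / (1 + D)) by (apply Rdiv_lt_0_compat; lra).
destruct (locally_2d_and_Rabs _ _ _ (Cct (mkposreal e He))) as [d1 [P1 Q1]]; simpl in Q1.
assert (CD : continuity_2d_pt (fun x t => D * chixx x t) x0 t0).
{ apply continuity_2d_pt_mult; [apply continuity_2d_pt_const | exact Ccxx]. }
destruct (locally_2d_and_Rabs _ _ _ (CD (mkposreal e He))) as [d2 [P2 Q2]]; simpl in Q2.
destruct (locally_2d_and_Rabs _ _ _ (Cf x0 t0 (mkposreal e He))) as [d3 [P3 Q3]]; simpl in Q3.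
assert (exists r, 0 < r /\ 4 * r < d1 /\ 4 * r < d2 /\ 4 * r < d3 /\ 4 * r < rho /\ r < 1 /\
   4 * r < x0 /\ 4 * r < 1 - x0 /\ 4 * r < t0 /\ 4 * r < T - t0) as
   [r (Hr & r1 & r2 & r3 & r4 & r5 & r6 & r7 & r8 & r9)].
{ set (q := Rmin (Rmin d1 d2) (Rmin (Rmin d3 rho) (Rmin (Rmin x0 (1 - x0)) (Rmin 1 (Rmin t0 (T - t0)))))).
  assert (0 < q) by (unfold q; repeat apply Rmin_glb_lt; lra).
  assert (q <= d1 /\ q <= d2 /\ q <= d3 /\ q <= rho /\ q <= x0 /\ q <= 1 - x0 /\ q <= 1 /\ q <= t0 /\ q <= T - t0).
  { unfold q, Rmin; repeat (destruct (Rle_dec _ _)); lra. }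
  exists (q / 5); lra. }
(* With this closeness the penalty at the maximum is at most [kap * (r * r) / 2], which keeps the
   maximum off the lateral and the initial sides of the box. *)
assert (Hk4 : 0 < kap * (r * r) / 4).
{ apply Rdiv_lt_0_compat; [ | lra]; repeat apply Rmult_lt_0_compat; lra. }
destruct (uniform_continuity_2d (ext T phi) (x0 - 4 * r) (x0 + 4 * r) (t0 - 4 * r) (t0 + 4 * r)
  (fun x t _ _ => Cp x t) (mkposreal _ Hk4)) as [d4 Q4]; simpl in Q4.
assert (exists h, 0 < h /\ h < r /\ h < d4) as [h (Hh & h1 & h2)].
{ exists (Rmin r d4 / 2); assert (P4 := cond_pos d4).
  assert (R1 := Rmin_l r d4). assert (R2 := Rmin_r r d4).
  assert (0 < Rmin r d4) by (apply Rmin_glb_lt; lra); lra. }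
set (chi' := fun x t => chi x t + kap * ((x - x0) * (x - x0) + (t - t0) * (t - t0))).
set (Phi := steklov (ext T phi) h).
assert (Close : forall x t, Rabs (x - x0) <= r -> t0 - r <= t <= t0 ->
  Rabs (Phi x t - h * h * ext T phi x t) <= h * h * (kap * (r * r) / 4)).
{ intros x t Hxx Htt; apply steklov_close; auto.
  intros y s Hy Hs; left.
  assert (x0 - r <= x <= x0 + r) by (split_Rabs; lra).
  apply Q4; try lra; apply Rabs_def1; lra. }
assert (Ck : forall x t, continuity_2d_pt (fun x t => kap * ((x - x0) * (x - x0) + (t - t0) * (t - t0))) x t).
{ intros; apply continuity_2d_pt_mult; [apply continuity_2d_pt_const | ].
  apply continuity_2d_pt_plus; apply continuity_2d_pt_mult; apply continuity_2d_pt_minus;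
   first [apply continuity_2d_pt_const | apply continuity_2d_pt_id1 | apply continuity_2d_pt_id2]. }
assert (CPhi : forall x t, continuity_2d_pt Phi x t).
{ intros; apply steklov_continuous; auto; apply ext_bounded; auto. }
assert (Cchi : forall x t, Rabs (x - x0) < rho -> Rabs (t - t0) < rho -> continuity_2d_pt chi' x t).
{ intros x t Hxx Htt; unfold chi'; apply continuity_2d_pt_plus; [now apply Hchi | apply Ck]. }
set (G := fun x t => Phi x t - h * h * chi' x t).
set (Box := fun x t => Rabs (x - x0) <= r /\ t0 - r <= t <= t0).
assert (BoxB : forall x t, Box x t -> x0 - r <= x <= x0 + r /\ t0 - r <= t <= t0).
{ intros x t [H1 H2]; split; [split_Rabs; lra | exact H2]. }
assert (Hhh : 0 < h * h) by (apply Rmult_lt_0_compat; lra).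
destruct (max_on_closed Box G (x0 - r) (x0 + r) (t0 - r) t0) as [x1 [t1 [HB1 Hmax]]].
{ intros x t N.
  assert (exists d, 0 < d /\ (x + d < x0 - r \/ x0 + r < x - d \/ t + d < t0 - r \/ t0 < t - d)) as [d [Hd Hor]].
  { destruct (Rlt_dec x (x0 - r)); [exists ((x0 - r - x) / 2); lra | ].
    destruct (Rlt_dec (x0 + r) x); [exists ((x - x0 - r) / 2); lra | ].
    destruct (Rlt_dec t (t0 - r)); [exists ((t0 - r - t) / 2); lra | ].
    destruct (Rlt_dec t0 t); [exists ((t - t0) / 2); lra | ].
    exfalso; apply N; split; [apply Rabs_le; lra | lra]. }
  exists (mkposreal d Hd); simpl; intros u v Hu Hv HB; apply BoxB in HB.
  apply Rabs_def2 in Hu; apply Rabs_def2 in Hv; lra. }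
{ exact BoxB. }
{ intros x t HB; apply BoxB in HB; unfold G; apply continuity_2d_pt_minus; [apply CPhi | ].
  apply continuity_2d_pt_mult; [apply continuity_2d_pt_const | apply Cchi; apply Rabs_def1; lra]. }
{ exists x0, t0; split; [rewrite Rminus_diag, Rabs_R0; lra | lra]. }
assert (B1 := BoxB _ _ HB1).
assert (HB0 : Box x0 t0) by (split; [rewrite Rminus_diag, Rabs_R0; lra | lra]).
assert (GB := Hmax x0 t0 HB0).
assert (Cl1 := Close x1 t1 (proj1 HB1) (proj2 HB1)).
assert (Cl0 := Close x0 t0 (proj1 HB0) (proj2 HB0)).
assert (Ht1 := Htouch x1 t1 ltac:(apply Rabs_def1; lra) ltac:(lra)).
assert (Hin : (x1 - x0) * (x1 - x0) + (t1 - t0) * (t1 - t0) < r * r).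
{ assert (G0 : - (h * h * (kap * (r * r) / 4)) <= G x0 t0).
  { unfold G, chi'; rewrite <- Heq; replace (x0 - x0) with 0 by ring; replace (t0 - t0) with 0 by ring.
    rewrite <- Rabs_Ropp in Cl0; apply (Rle_trans _ _ _ (Rle_abs _)) in Cl0; lra. }
  assert (G1 : G x1 t1 <= h * h * (kap * (r * r) / 4)
      - h * h * (kap * ((x1 - x0) * (x1 - x0) + (t1 - t0) * (t1 - t0)))).
  { unfold G, chi'; apply (Rle_trans _ _ _ (Rle_abs _)) in Cl1.
    assert (h * h * ext T phi x1 t1 <= h * h * chi x1 t1) by (apply Rmult_le_compat_l; lra).
    lra. }
  assert (G2 : h * h * kap * ((x1 - x0) * (x1 - x0) + (t1 - t0) * (t1 - t0)) <= h * h * kap * (r * r / 2)) by lra.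
  apply Rmult_le_reg_l in G2; [nra | apply Rmult_lt_0_compat; lra]. }
assert (Hx1 : - r < x1 - x0 < r) by nra.
assert (Hx1t : - r < t1 - t0).
{ apply Rnot_le_lt; intros N; assert (E : t1 - t0 = - r) by lra.
  rewrite E in Hin; assert (P := Rle_0_sqr (x1 - x0)); unfold Rsqr in P; lra. }
set (Phit := RInt (fun y => ext T phi y (t1 + h) - ext T phi y t1) x1 (x1 + h)).
set (Phixx := RInt (ext T phix (x1 + h)) t1 (t1 + h) - RInt (ext T phix x1) t1 (t1 + h)).
(* The maximum may lie on the final side [t = t0]; past times alone give this inequality. *)
assert (Gt : h * h * (chit x1 t1 + kap * (2 * (t1 - t0))) - Phit <= 0).
{ apply (backward_min_derive (fun s => h * h * chi' x1 s - Phi x1 s) t1 _ (r + (t1 - t0))); [lra | | ].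
  - apply (is_derive_minus (V := R_NormedModule)); [ | now apply is_derive_steklov_t].
    apply (is_derive_scal (fun s => chi' x1 s)); unfold chi'.
    apply (is_derive_plus (V := R_NormedModule)).
    + apply Hchi; apply Rabs_def1; lra.
    + auto_derive; auto; ring.
  - intros s Hs.
    assert (Bs : Box x1 s) by (split; [apply HB1 | lra]).
    specialize (Hmax x1 s Bs); unfold G in Hmax; lra. }
assert (Gx : 0 <= h * h * (chixx x1 t1 + kap * 2) - Phixx).
{ set (q := Rmin (r - (x1 - x0)) (r + (x1 - x0))).
  assert (Hq1 : q <= r - (x1 - x0)) by apply Rmin_l.
  assert (Hq2 : q <= r + (x1 - x0)) by apply Rmin_r.
  assert (Hq : 0 < q) by (apply Rmin_glb_lt; lra).
  apply (min_derive2 (fun y => h * h * chi' y t1 - Phi y t1)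
   (fun y => h * h * (chix y t1 + kap * (2 * (y - x0))) -
      (RInt (ext T phi (y + h)) t1 (t1 + h) - RInt (ext T phi y) t1 (t1 + h))) x1 _ q Hq).
  - intros y Hy; apply Rabs_def2 in Hy.
    apply (is_derive_minus (V := R_NormedModule)); [ | now apply is_derive_steklov_x].
    apply (is_derive_scal (fun s => chi' s t1)); unfold chi'.
    apply (is_derive_plus (V := R_NormedModule)).
    + apply Hchi; apply Rabs_def1; lra.
    + auto_derive; auto; ring.
  - apply (is_derive_minus (V := R_NormedModule)).
    + apply (is_derive_scal (fun s => chix s t1 + kap * (2 * (s - x0)))).
      apply (is_derive_plus (V := R_NormedModule)).
      * apply Hchi; apply Rabs_def1; lra.
      * auto_derive; auto; ring.
    + apply (is_derive_minus (V := R_NormedModule)).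
      * assert (E : is_derive (fun y => RInt (ext T phi y) t1 (t1 + h)) (x1 + h)
          (RInt (ext T phix (x1 + h)) t1 (t1 + h))).
        { apply is_derive_window_x; auto; try lra; intros; apply Dpx; lra. }
        apply (is_derive_comp (fun y => RInt (ext T phi y) t1 (t1 + h)) (fun y => y + h) x1 _ 1) in E.
        2:{ auto_derive; auto; ring. }
        unfold scal in E; simpl in E; unfold mult in E; simpl in E; rewrite Rmult_1_l in E; exact E.
      * apply is_derive_window_x; auto; try lra; intros; apply Dpx; lra.
  - intros y Hy; apply Rabs_def2 in Hy.
    assert (Bs : Box y t1) by (split; [apply Rabs_le; lra | apply HB1]).
    specialize (Hmax y t1 Bs); unfold G in Hmax; lra. }
specialize (HWe x1 (x1 + h) t1 (t1 + h) ltac:(lra) ltac:(lra) ltac:(lra) ltac:(lra) ltac:(lra) ltac:(lra)).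
assert (Eq : Phit - D * Phixx <= h * h * (f x0 t0 + e)).
{ unfold Phixx; rewrite <- (RInt_minus (V := R_CompleteNormedModule));
    try (apply (ex_RInt_continuous (V := R_CompleteNormedModule)); intros; apply continuity_2d_slice_t, Cpx).
  unfold minus, plus, opp; simpl; unfold Rminus in HWe; unfold Phit, Rminus; rewrite HWe.
  assert (I := RInt_RInt_close f x1 t1 h e (f x0 t0) Hh Cf).
  assert (I3 : Rabs (RInt (fun s => RInt (fun y => f y s) x1 (x1 + h)) t1 (t1 + h) - h * h * f x0 t0) <= h * h * e).
  { apply I; intros y s Hy Hs; left; apply Q3; apply Rabs_def1; lra. }
  apply (Rle_trans _ _ _ (Rle_abs _)) in I3.
  change (RInt (fun s => RInt (fun y => f y s) x1 (x1 + h)) t1 (t1 + h) <= h * h * (f x0 t0 + e)); lra. }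
specialize (Q1 x1 t1 ltac:(apply Rabs_def1; lra) ltac:(apply Rabs_def1; lra)).
specialize (Q2 x1 t1 ltac:(apply Rabs_def1; lra) ltac:(apply Rabs_def1; lra)).
apply Rabs_def2 in Q1; apply Rabs_def2 in Q2.
assert (D * 0 <= D * (h * h * (chixx x1 t1 + kap * 2) - Phixx)) by (apply Rmult_le_compat_l; lra).
assert (Fin : h * h * (chit x1 t1 + kap * (2 * (t1 - t0)) - D * chixx x1 t1 - D * kap * 2) <= h * h * (f x0 t0 + e)) by lra.
apply Rmult_le_reg_l in Fin; [ | exact Hhh].
assert (kap * (t0 - t1) <= kap * 1) by (apply Rmult_le_compat_l; lra).
assert (E8 : chit x0 t0 - D * chixx x0 t0 - f x0 t0 = 8 * e) by (unfold e; field); clearbody e; lra.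
Qed.

(** * Comparison with sub- and supersolutions *)

Lemma closed2_le (g : R -> R -> R) : (forall x t, continuity_2d_pt g x t) ->
  closed2 (fun x t => g x t <= 0).
Proof.
intros Hg x t N; apply Rnot_le_lt in N.
destruct (Hg x t (mkposreal _ N)) as [d Hd]; simpl in Hd.
exists d; intros u v Hu Hv; specialize (Hd u v Hu Hv); apply Rabs_def2 in Hd; lra.
Qed.

Lemma closed2_and (S1 S2 : R -> R -> Prop) : closed2 S1 -> closed2 S2 ->
  closed2 (fun x t => S1 x t /\ S2 x t).
Proof.
intros H1 H2 x t N.
destruct (classic (S1 x t)) as [Y | Y].
- destruct (H2 x t) as [d Hd]; [tauto | ].
  exists d; intros u v Hu Hv [_ H]; exact (Hd u v Hu Hv H).
- destruct (H1 x t Y) as [d Hd].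
  exists d; intros u v Hu Hv [H _]; exact (Hd u v Hu Hv H).
Qed.

Lemma closed2_ext (S1 S2 : R -> R -> Prop) : (forall x t, S1 x t <-> S2 x t) ->
  closed2 S1 -> closed2 S2.
Proof.
intros E H x t N; destruct (H x t) as [d Hd]; [rewrite E; exact N | ].
exists d; intros u v Hu Hv; rewrite <- E; auto.
Qed.

Lemma closed2_tube (a b : R -> R) (tau : R) :
  (forall t, continuous a t) -> (forall t, continuous b t) ->
  closed2 (fun x t => (0 <= x <= 1 /\ 0 <= t <= tau) /\ a t <= x <= b t).
Proof.
intros Ha Hb.
apply (closed2_ext (fun x t => (((0 - x <= 0 /\ x - 1 <= 0) /\ (0 - t <= 0 /\ t - tau <= 0)) /\
   (a t - x <= 0 /\ x - b t <= 0)))).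
{ intros x t; lra. }
repeat apply closed2_and; apply closed2_le; intros x t; apply continuity_2d_pt_minus;
  first [apply continuity_2d_pt_const | apply continuity_2d_pt_id1
       | apply continuity_2d_pt_id2 | now apply continuity_2d_of_t].
Qed.

(** The weak equation says nothing at time [T], so maxima are sought on [0, tau] with [tau < T].
    Unless one of them occurs at a positive time, all occur at time 0, and a single starting point
    then dominates the whole of [0, T). *)
Lemma parabolic_argmax {I : Type} (L : list I) (lo hi : I -> R -> R) (F : I -> R -> R -> R) T :
  0 < T ->
  (forall i, In i L -> (forall t, continuous (lo i) t) /\ (forall t, continuous (hi i) t) /\
     forall x t, continuity_2d_pt (F i) x t) ->
  (exists i x, In i L /\ 0 <= x <= 1 /\ lo i 0 <= x <= hi i 0) ->
  (exists i x t, In i L /\ 0 <= x <= 1 /\ 0 < t < T /\ lo i t <= x <= hi i t /\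
     forall j y s, In j L -> 0 <= y <= 1 -> 0 <= s <= t -> lo j s <= y <= hi j s ->
       F j y s <= F i x t) \/
  (exists i x, In i L /\ 0 <= x <= 1 /\ lo i 0 <= x <= hi i 0 /\
     forall j y s, In j L -> 0 <= y <= 1 -> 0 <= s < T -> lo j s <= y <= hi j s ->
       F j y s <= F i x 0).
Proof.
intros HT Hreg [i0 [x0 (Hi0 & Hx0 & Hd0)]].
match goal with |- ?A \/ _ => destruct (classic A) as [HA | HA]; [now left | right] end.
assert (Key : forall tau, 0 < tau < T -> exists i x, In i L /\ 0 <= x <= 1 /\ lo i 0 <= x <= hi i 0 /\
   forall j y s, In j L -> 0 <= y <= 1 -> 0 <= s <= tau -> lo j s <= y <= hi j s ->
       F j y s <= F i x 0).
{ intros tau Htau.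
  destruct (max_on_closed_family L
    (fun i x t => (0 <= x <= 1 /\ 0 <= t <= tau) /\ lo i t <= x <= hi i t) F 0 1 0 tau)
    as [i [x [t (Hi & ((Hx & Ht) & Hd) & Hmax)]]].
  - intros i Hi; apply closed2_tube; now apply Hreg.
  - intros i x t Hi [H _]; exact H.
  - intros i x t Hi _; now apply Hreg.
  - exists i0, x0, 0; repeat split; auto; lra.
  - destruct (Rle_lt_or_eq_dec 0 t (proj1 Ht)) as [Hpos | Hz].
    + exfalso; apply HA; exists i, x, t.
      split; [exact Hi | split; [exact Hx | split; [lra | split; [exact Hd | ]]]].
      intros j y s Hj Hy Hs Hds; apply Hmax; auto; repeat split; lra.
    + subst t; exists i, x; split; [exact Hi | split; [exact Hx | split; [exact Hd | ]]].
      intros j y s Hj Hy Hs Hds; apply Hmax; auto. }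
destruct (Key (T / 2)) as [i [x (Hi & Hx & Hd & Hm)]]; [lra | ].
exists i, x; split; [exact Hi | split; [exact Hx | split; [exact Hd | ]]].
intros j y s Hj Hy Hs Hds.
destruct (Key (Rmax s (T / 2))) as [i' [x' (Hi' & Hx' & Hd' & Hm')]].
{ split; [eapply Rlt_le_trans; [ | apply Rmax_r]; lra | apply Rmax_lub_lt; lra]. }
apply Rle_trans with (F i' x' 0).
- apply Hm'; auto; split; [lra | apply Rmax_l].
- apply Hm; auto; lra.
Qed.

(* A test function [pw] with its derivatives, to be used on the tube [plow t <= x <= phigh t]. *)
Record piece := Piece {
  plow : R -> R; phigh : R -> R;
  pw : R -> R -> R; pwt : R -> R -> R; pwx : R -> R -> R; pwxx : R -> R -> R }.

Definition in_tube (p : piece) (x t : R) : Prop := plow p t <= x <= phigh p t.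

(** Derivatives are asked for inside (0, T), where the weak equation holds; continuity is global so
    that [t] may tend to [T]; the closing conditions match the periodicity of the eigenfunction. *)
Definition regular (T : R) (p : piece) : Prop :=
  ((forall t, continuous (plow p) t) /\ (forall t, continuous (phigh p) t) /\
   (forall x t, continuity_2d_pt (pw p) x t)) /\
  (forall x t, 0 < t < T ->
     is_derive (fun s => pw p x s) t (pwt p x t) /\
     is_derive (fun y => pw p y t) x (pwx p x t) /\
     is_derive (fun y => pwx p y t) x (pwxx p x t) /\
     continuity_2d_pt (pwt p) x t /\ continuity_2d_pt (pwx p) x t /\
     continuity_2d_pt (pwxx p) x t) /\
  (plow p T = plow p 0 /\ phigh p T = phigh p 0 /\ forall x, pw p x T = pw p x 0).

Lemma locally_interval_Rabs (P : R -> Prop) x : locally x P ->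
  exists d, 0 < d /\ forall y, Rabs (y - x) < d -> P y.
Proof. intros [d Hd]; exists d; split; [apply cond_pos | exact Hd]. Qed.

Lemma tube_open (a b : R -> R) x t :
  continuous a t -> continuous b t -> a t < x < b t ->
  exists d, 0 < d /\ forall y s, Rabs (y - x) < d -> Rabs (s - t) < d -> a s < y < b s.
Proof.
intros Ha Hb Hx.
assert (Ea : 0 < (x - a t) / 2) by lra.
assert (Eb : 0 < (b t - x) / 2) by lra.
destruct (locally_interval_Rabs _ _ (proj1 (filterlim_locally _ _) Ha (mkposreal _ Ea))) as [d1 [P1 H1]].
destruct (locally_interval_Rabs _ _ (proj1 (filterlim_locally _ _) Hb (mkposreal _ Eb))) as [d2 [P2 H2]].
exists (Rmin (Rmin d1 d2) (Rmin ((x - a t) / 2) ((b t - x) / 2))); split.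
{ repeat apply Rmin_glb_lt; lra. }
assert (R1 := Rmin_l (Rmin d1 d2) (Rmin ((x - a t) / 2) ((b t - x) / 2))).
assert (R2 := Rmin_r (Rmin d1 d2) (Rmin ((x - a t) / 2) ((b t - x) / 2))).
assert (R3 := Rmin_l d1 d2). assert (R4 := Rmin_r d1 d2).
assert (R5 := Rmin_l ((x - a t) / 2) ((b t - x) / 2)). assert (R6 := Rmin_r ((x - a t) / 2) ((b t - x) / 2)).
intros y s Hy Hs.
specialize (H1 s ltac:(lra)); specialize (H2 s ltac:(lra)).
unfold ball in H1, H2; simpl in H1, H2; unfold AbsRing_ball, abs, minus, plus, opp in H1, H2; simpl in H1, H2.
apply Rabs_def2 in H1; apply Rabs_def2 in H2; apply Rabs_def2 in Hy; lra.
Qed.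

Lemma limit_le_of_left (f : R -> R) T c r : 0 < r -> continuous f T ->
  (forall t, T - r < t < T -> f t <= c) -> f T <= c.
Proof.
intros Hr Hf H; apply Rnot_lt_le; intros N.
assert (He : 0 < f T - c) by lra.
destruct (locally_interval_Rabs _ _ (proj1 (filterlim_locally _ _) Hf (mkposreal _ He))) as [d [P Q]].
assert (R1 := Rmin_l d r). assert (R2 := Rmin_r d r).
assert (R3 : 0 < Rmin d r) by (apply Rmin_glb_lt; lra).
specialize (Q (T - Rmin d r / 2) ltac:(apply Rabs_def1; lra)).
specialize (H (T - Rmin d r / 2) ltac:(lra)).
unfold ball in Q; simpl in Q; unfold AbsRing_ball, abs, minus, plus, opp in Q; simpl in Q.
apply Rabs_def2 in Q; lra.
Qed.

Definition eigenpair (T D : R) (mx V : R -> R -> R) (l : R) (phi phix : R -> R -> R) : Prop :=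
  weak_solution T D mx V l phi phix /\
  (forall x t, 0 <= x <= 1 -> 0 <= t <= T -> 0 < phi x t) /\
  (forall t, 0 <= t <= T -> phix 0 t = 0 /\ phix 1 t = 0) /\
  (forall x, 0 < x < 1 -> phi x 0 = phi x T).

Lemma ext_pos T phi x t : 0 < T ->
  (forall x t, 0 <= x <= 1 -> 0 <= t <= T -> 0 < phi x t) -> 0 < ext T phi x t.
Proof. intros HT H; apply H; apply clamp_in; lra. Qed.

(* Continuity extends the periodicity of an eigenfunction to the endpoints of the interval. *)
Lemma eigen_periodic T D mx V l phi phix x : 0 < T ->
  eigenpair T D mx V l phi phix -> ext T phi x T = ext T phi x 0.
Proof.
intros HT ((Hp & _) & _ & _ & Hper).
assert (H : forall x, 0 <= x <= 1 -> ext T phi x T = ext T phi x 0).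
{ clear x; intros x Hx.
  assert (C : continuous (fun y => ext T phi y T - ext T phi y 0) x).
  { apply (continuous_minus (V := R_NormedModule)); apply (continuous_slice_x (ext T phi)); now apply ext_continuous. }
  assert (Z : forall y, 0 < y < 1 -> ext T phi y T - ext T phi y 0 = 0).
  { intros y Hy; rewrite !ext_id by lra; rewrite (Hper y Hy); ring. }
  destruct (Req_dec (ext T phi x T - ext T phi x 0) 0) as [E | E]; [lra | exfalso].
  assert (He : 0 < Rabs (ext T phi x T - ext T phi x 0)) by now apply Rabs_pos_lt.
  destruct (locally_interval_Rabs _ _ (proj1 (filterlim_locally _ _) C (mkposreal _ He))) as [d [P Q]].
  assert (exists y, 0 < y < 1 /\ Rabs (y - x) < d) as [y [Hy1 Hy2]].
  { assert (R1 := Rmin_l d (1 / 2)). assert (R2 := Rmin_r d (1 / 2)).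
    assert (R3 : 0 < Rmin d (1 / 2)) by (apply Rmin_glb_lt; lra).
    destruct (Rle_dec x (1 / 2)).
    - exists (x + Rmin d (1 / 2) / 2); split; [lra | apply Rabs_def1; lra].
    - exists (x - Rmin d (1 / 2) / 2); split; [lra | apply Rabs_def1; lra]. }
  specialize (Q y Hy2); rewrite Z in Q by exact Hy1.
  unfold ball in Q; simpl in Q; unfold AbsRing_ball, abs, minus, plus, opp in Q; simpl in Q.
  rewrite Rplus_0_l, Rabs_Ropp in Q; lra. }
assert (E : forall t, ext T phi x t = ext T phi (clamp 0 1 x) t).
{ intros t; unfold ext; rewrite (clamp_id 0 1 (clamp 0 1 x)); auto; apply clamp_in; lra. }
rewrite E, (E 0); apply H, clamp_in; lra.
Qed.

Lemma ext_derive_0 T phi phix t : 0 <= t <= T ->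
  deriv_unit (fun y => phi y t) (fun y => phix y t) -> phix 0 t = 0 ->
  forall e, 0 < e -> exists r, 0 < r /\ forall y, 0 <= y <= 1 -> y < r ->
    Rabs (ext T phi y t - ext T phi 0 t) <= e * y.
Proof.
intros Ht Hd Hz e He.
destruct (Hd 0 ltac:(lra) e He) as [r [Hr H]].
exists r; split; [exact Hr | intros y Hy Hyr].
rewrite !ext_id by lra.
destruct (Req_dec y 0) as [-> | Hy0].
- rewrite Rminus_diag, Rabs_R0; lra.
- specialize (H y); simpl in H; unfold R_dist, Rdist, D_x in H; rewrite Hz in H.
  assert (A : Rabs ((phi y t - phi 0 t) / (y - 0) - 0) < e).
  { apply H; split; [split; [lra | lra] | ]. rewrite Rminus_0_r, Rabs_pos_eq; lra. }
  rewrite !Rminus_0_r in A; unfold Rdiv in A; rewrite Rabs_mult, Rabs_inv, (Rabs_pos_eq y) in A by lra.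
  apply (Rmult_lt_compat_r y) in A; [ | lra].
  rewrite Rmult_assoc, Rinv_l, Rmult_1_r in A by lra; lra.
Qed.

Lemma ext_derive_1 T phi phix t : 0 <= t <= T ->
  deriv_unit (fun y => phi y t) (fun y => phix y t) -> phix 1 t = 0 ->
  forall e, 0 < e -> exists r, 0 < r /\ forall y, 0 <= y <= 1 -> 1 - y < r ->
    Rabs (ext T phi y t - ext T phi 1 t) <= e * (1 - y).
Proof.
intros Ht Hd Hz e He.
destruct (Hd 1 ltac:(lra) e He) as [r [Hr H]].
exists r; split; [exact Hr | intros y Hy Hyr].
rewrite !ext_id by lra.
destruct (Req_dec y 1) as [-> | Hy0].
- rewrite !Rminus_diag, Rabs_R0; lra.
- specialize (H y); simpl in H; unfold R_dist, Rdist, D_x in H; rewrite Hz in H.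
  assert (A : Rabs ((phi y t - phi 1 t) / (y - 1) - 0) < e).
  { apply H; split; [split; [lra | lra] | ]. rewrite <- Rabs_Ropp, Rabs_pos_eq; lra. }
  rewrite !Rminus_0_r in A; unfold Rdiv in A; rewrite Rabs_mult, Rabs_inv in A.
  rewrite <- (Rabs_Ropp (y - 1)), (Rabs_pos_eq (- (y - 1))) in A by lra.
  apply (Rmult_lt_compat_r (- (y - 1))) in A; [ | lra].
  rewrite Rmult_assoc, Rinv_l, Rmult_1_r in A by lra; lra.
Qed.

(** Since [f] has zero slope at the endpoint, a function touching it from above there cannot
    decrease inwards. A strict sign of the boundary slope of a test function thus excludes contact,
    and no Hopf lemma is called for. *)
Lemma boundary_contact_0 (f g : R -> R) d r : 0 < r ->
  (forall e, 0 < e -> exists q, 0 < q /\ forall y, 0 <= y <= 1 -> y < q ->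
     Rabs (f y - f 0) <= e * y) ->
  is_derive g 0 d -> f 0 = g 0 ->
  (forall y, 0 <= y <= 1 -> y < r -> f y <= g y) -> 0 <= d.
Proof.
intros Hr Hf Hg H0 H; apply Rnot_lt_le; intros Hd.
destruct (Hf (- d / 4)) as [q [Hq Q]]; [lra | ].
destruct (is_derive_Rabs_spec g 0 d Hg (- d / 4)) as [p [Hp P]]; [lra | ].
set (y := Rmin (Rmin q p) (Rmin r 1) / 2).
assert (0 < Rmin (Rmin q p) (Rmin r 1)) by (repeat apply Rmin_glb_lt; lra).
assert (R1 := Rmin_l (Rmin q p) (Rmin r 1)). assert (R2 := Rmin_r (Rmin q p) (Rmin r 1)).
assert (R3 := Rmin_l q p). assert (R4 := Rmin_r q p).
assert (R5 := Rmin_l r 1). assert (R6 := Rmin_r r 1).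
assert (Y : 0 < y < 1 /\ y < q /\ y < p /\ y < r) by (unfold y; lra).
specialize (Q y ltac:(lra) ltac:(lra)).
specialize (P y ltac:(apply Rabs_def1; lra)).
specialize (H y ltac:(lra) ltac:(lra)).
rewrite Rminus_0_r, (Rabs_pos_eq y) in P by lra.
assert (0 < - d * y) by (apply Rmult_lt_0_compat; lra).
apply Rabs_le_between in Q; apply Rabs_le_between in P; lra.
Qed.

Lemma boundary_contact_1 (f g : R -> R) d r : 0 < r ->
  (forall e, 0 < e -> exists q, 0 < q /\ forall y, 0 <= y <= 1 -> 1 - y < q ->
     Rabs (f y - f 1) <= e * (1 - y)) ->
  is_derive g 1 d -> f 1 = g 1 ->
  (forall y, 0 <= y <= 1 -> 1 - y < r -> f y <= g y) -> d <= 0.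
Proof.
intros Hr Hf Hg H0 H.
assert (E : 0 <= - d); [ | lra].
apply (boundary_contact_0 (fun y => f (1 - y)) (fun y => g (1 - y)) (- d) r Hr).
- intros e He; destruct (Hf e He) as [q [Hq Q]]; exists q; split; [exact Hq | intros y Hy Hyq].
  specialize (Q (1 - y) ltac:(lra) ltac:(lra)).
  replace (1 - (1 - y)) with y in Q by ring; rewrite Rminus_0_r; exact Q.
- replace (- d) with (scal (-1) d) by (unfold scal; simpl; unfold mult; simpl; ring).
  apply (is_derive_comp g (fun y => 1 - y)).
  + rewrite Rminus_0_r; exact Hg.
  + auto_derive; auto; ring.
- rewrite Rminus_0_r; exact H0.
- intros y Hy Hyr; apply H; lra.
Qed.

(* In terms of [psi = exp w], the first alternative is [mu * psi <= L psi]. *)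
Definition supersolution_point (D : R) (mx V : R -> R -> R) (mu : R) (L : list piece)
    (p : piece) (x t : R) : Prop :=
  (plow p t < x < phigh p t /\ 0 < x < 1 /\
   mu <= pwt p x t - D * (pwxx p x t + pwx p x t * pwx p x t) - mx x t * pwx p x t + V x t) \/
  (x = 0 /\ plow p t < 0 < phigh p t /\ pwx p x t < 0) \/
  (x = 1 /\ plow p t < 1 < phigh p t /\ 0 < pwx p x t) \/
  (exists k, In k L /\ in_tube k x t /\ pw k x t < pw p x t).

(** If [l < mu], maximize [phi exp (de t - w)] over all pieces, [w] being the logarithm of the
    piece. At a positive time this is a contact from above that violates the equation by [de]. On an
    edge, a lower piece would give a larger product. At time 0, periodicity produces near [T] a
    value larger by the factor [exp (de T)]. *)
Lemma eigenvalue_ge T D mx V l phi phix mu L : 0 < T -> 0 < D ->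
  cont_cylinder T mx -> cont_cylinder T V -> eigenpair T D mx V l phi phix ->
  (forall p, In p L -> regular T p) ->
  (exists p x, In p L /\ 0 <= x <= 1 /\ in_tube p x 0) ->
  (forall p x t, In p L -> 0 <= x <= 1 -> 0 <= t <= T -> in_tube p x t ->
     supersolution_point D mx V mu L p x t) ->
  mu <= l.
Proof.
intros HT HD Hmx HV He Hreg Hne Hsup.
assert (Hperiod := fun x => eigen_periodic _ _ _ _ _ _ _ x HT He).
destruct He as (Hw & Hpos & Hneu & _).
assert (Hepos := fun x t => ext_pos T phi x t HT Hpos).
apply Rnot_lt_le; intros Hlt.
set (de := (mu - l) / 2). assert (Hde : 0 < de) by (unfold de; lra).
set (F := fun (p : piece) x t => ext T phi x t * exp (de * t - pw p x t)).
assert (Fle : forall p x t C, F p x t <= C -> ext T phi x t <= C * exp (pw p x t - de * t)).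
{ intros p x t C H; unfold F in H.
  apply (Rmult_le_compat_r (exp (pw p x t - de * t))) in H; [ | left; apply exp_pos].
  rewrite Rmult_assoc, <- exp_plus in H.
  replace (de * t - pw p x t + (pw p x t - de * t)) with 0 in H by ring.
  rewrite exp_0, Rmult_1_r in H; exact H. }
assert (Feq : forall p x t, ext T phi x t = F p x t * exp (pw p x t - de * t)).
{ intros p x t; unfold F; rewrite Rmult_assoc, <- exp_plus.
  replace (de * t - pw p x t + (pw p x t - de * t)) with 0 by ring.
  rewrite exp_0; ring. }
assert (Fpos : forall p x t, 0 < F p x t).
{ intros; apply Rmult_lt_0_compat; [apply Hepos | apply exp_pos]. }
assert (Fdom : forall p k x t, pw k x t < pw p x t -> F p x t < F k x t).
{ intros p k x t H; apply Rmult_lt_compat_l; [apply Hepos | apply exp_increasing; lra]. }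
destruct (parabolic_argmax L plow phigh F T HT) as
  [[p [x [t (Hp & Hx & Ht & Hd & Hmax)]]] | [p [x (Hp & Hx & Hd & Hmax)]]].
- intros p Hp; destruct (Hreg p Hp) as ((H1 & H2 & H3) & _); repeat split; auto.
  intros x t; unfold F; apply continuity_2d_pt_mult.
  + apply ext_continuous; [exact HT | apply Hw].
  + apply (continuity_1d_2d_pt_comp exp (fun x t => de * t - pw p x t)).
    * apply derivable_continuous_pt, derivable_pt_exp.
    * apply continuity_2d_pt_minus; [ | apply H3].
      apply continuity_2d_pt_mult; [apply continuity_2d_pt_const | apply continuity_2d_pt_id2].
- exact Hne.
- destruct (Hreg p Hp) as ((C1 & C2 & C3) & Hder & _).
  set (chi := fun y s => F p x t * exp (pw p y s - de * s)).
  assert (Dx : forall y s, 0 < s < T -> is_derive (fun y => chi y s) y (chi y s * pwx p y s)).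
  { intros y s Hs; unfold chi.
    assert (Dw := proj1 (proj2 (Hder y s Hs))).
    assert (E : is_derive (fun y => exp (pw p y s - de * s)) y (pwx p y s * exp (pw p y s - de * s))).
    { apply (is_derive_comp exp (fun y => pw p y s - de * s)).
      - apply is_derive_exp.
      - replace (pwx p y s) with (minus (pwx p y s) 0) by (unfold minus, plus, opp; simpl; ring).
        apply (is_derive_minus (V := R_NormedModule)); [exact Dw | auto_derive; auto]. }
    apply (is_derive_scal _ _ (F p x t)) in E.
    replace (F p x t * exp (pw p y s - de * s) * pwx p y s) with
      (F p x t * (pwx p y s * exp (pw p y s - de * s))) by ring; exact E. }
  assert (Dt : forall y s, 0 < s < T -> is_derive (fun s => chi y s) s (chi y s * (pwt p y s - de))).
  { intros y s Hs; unfold chi.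
    assert (Dw := proj1 (Hder y s Hs)).
    assert (E : is_derive (fun s => exp (pw p y s - de * s)) s ((pwt p y s - de) * exp (pw p y s - de * s))).
    { apply (is_derive_comp exp (fun s => pw p y s - de * s)).
      - apply is_derive_exp.
      - apply (is_derive_minus (V := R_NormedModule)); [exact Dw | auto_derive; auto; ring]. }
    apply (is_derive_scal _ _ (F p x t)) in E.
    replace (F p x t * exp (pw p y s - de * s) * (pwt p y s - de)) with
      (F p x t * ((pwt p y s - de) * exp (pw p y s - de * s))) by ring; exact E. }
  assert (Chi : forall y s, continuity_2d_pt chi y s).
  { intros y s; unfold chi; apply continuity_2d_pt_mult; [apply continuity_2d_pt_const | ].
    apply (continuity_1d_2d_pt_comp exp (fun x t => pw p x t - de * t)).
    - apply derivable_continuous_pt, derivable_pt_exp.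
    - apply continuity_2d_pt_minus; [apply C3 | ].
      apply continuity_2d_pt_mult; [apply continuity_2d_pt_const | apply continuity_2d_pt_id2]. }
  assert (Hchi0 : 0 < chi x t) by (apply Rmult_lt_0_compat; [apply Fpos | apply exp_pos]).
  assert (Hle : forall y s, 0 <= y <= 1 -> 0 <= s <= t -> in_tube p y s -> ext T phi y s <= chi y s).
  { intros y s Hy Hs Hin; apply Fle, Hmax; auto. }
  destruct (Hsup p x t Hp Hx ltac:(lra) Hd) as
    [(Hin & Hx' & Hmu) | [(-> & Hin & Hneg) | [(-> & Hin & Hneg) | (k & Hk & Hkin & Hkw)]]].
  + destruct (tube_open _ _ x t (C1 t) (C2 t) Hin) as [d [Pd Hopen]].
    assert (exists rho, 0 < rho /\ rho <= d /\ rho < t /\ rho < T - t /\ rho < x /\ rho < 1 - x)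
      as [rho (r0 & r1 & r2 & r3 & r4 & r5)].
    { exists (Rmin d (Rmin (Rmin t (T - t)) (Rmin x (1 - x))) / 2).
      assert (0 < Rmin d (Rmin (Rmin t (T - t)) (Rmin x (1 - x)))) by (repeat apply Rmin_glb_lt; lra).
      assert (A1 := Rmin_l d (Rmin (Rmin t (T - t)) (Rmin x (1 - x)))).
      assert (A2 := Rmin_r d (Rmin (Rmin t (T - t)) (Rmin x (1 - x)))).
      assert (A3 := Rmin_l (Rmin t (T - t)) (Rmin x (1 - x))).
      assert (A4 := Rmin_r (Rmin t (T - t)) (Rmin x (1 - x))).
      assert (A5 := Rmin_l t (T - t)). assert (A6 := Rmin_r t (T - t)).
      assert (A7 := Rmin_l x (1 - x)). assert (A8 := Rmin_r x (1 - x)). lra. }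
    assert (Hw' := Hw).
    apply (touch_above T D mx V l phi phix x t chi (fun y s => chi y s * (pwt p y s - de))
      (fun y s => chi y s * pwx p y s)
      (fun y s => chi y s * (pwxx p y s + pwx p y s * pwx p y s)) rho) in Hw'; auto.
    * assert (Hc : 0 < chi x t * (pwt p x t - de - D * (pwxx p x t + pwx p x t * pwx p x t)
        - mx x t * pwx p x t + V x t - l)).
      { apply Rmult_lt_0_compat; [exact Hchi0 | unfold de in *; lra]. }
      lra.
    * intros y s Hy Hs; apply Rabs_def2 in Hy; apply Rabs_def2 in Hs.
      split; [apply Chi | split; [apply Dt; lra | split; [apply Dx; lra | ]]].
      assert (E := is_derive_mult (fun y => chi y s) (fun y => pwx p y s) y _ _ (Dx y s ltac:(lra))
         (proj1 (proj2 (proj2 (Hder y s ltac:(lra))))) Rmult_comm).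
      unfold plus, mult in E; simpl in E.
      replace (chi y s * (pwxx p y s + pwx p y s * pwx p y s)) with
        (chi y s * pwx p y s * pwx p y s + chi y s * pwxx p y s) by ring; exact E.
    * apply continuity_2d_pt_mult; [apply Chi | apply continuity_2d_pt_minus; [apply Hder; lra | apply continuity_2d_pt_const]].
    * apply continuity_2d_pt_mult; [apply Chi | ].
      apply continuity_2d_pt_plus; [apply Hder; lra | apply continuity_2d_pt_mult; apply Hder; lra].
    * intros y s Hy Hs; apply Hle; [apply Rabs_def2 in Hy; lra | lra | ].
      assert (Hys := Hopen y s ltac:(lra) ltac:(apply Rabs_def1; lra)); unfold in_tube; lra.
    * apply Feq.
  + destruct (tube_open _ _ 0 t (C1 t) (C2 t) Hin) as [d [Pd Hopen]].
    assert (Hs : 0 <= chi 0 t * pwx p 0 t).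
    { apply (boundary_contact_0 (fun y => ext T phi y t) (fun y => chi y t) _ d Pd).
      - apply (ext_derive_0 T phi phix); [lra | apply Hw; lra | apply Hneu; lra].
      - apply Dx; lra.
      - apply Feq.
      - intros y Hy Hyd; apply Hle; [exact Hy | lra | ].
        assert (Hys := Hopen y t ltac:(rewrite Rminus_0_r, Rabs_pos_eq; lra)
          ltac:(rewrite Rminus_diag, Rabs_R0; lra)); unfold in_tube; lra. }
    nra.
  + destruct (tube_open _ _ 1 t (C1 t) (C2 t) Hin) as [d [Pd Hopen]].
    assert (Hs : chi 1 t * pwx p 1 t <= 0).
    { apply (boundary_contact_1 (fun y => ext T phi y t) (fun y => chi y t) _ d Pd).
      - apply (ext_derive_1 T phi phix); [lra | apply Hw; lra | apply Hneu; lra].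
      - apply Dx; lra.
      - apply Feq.
      - intros y Hy Hyd; apply Hle; [exact Hy | lra | ].
        assert (Hys := Hopen y t ltac:(apply Rabs_def1; lra)
          ltac:(rewrite Rminus_diag, Rabs_R0; lra)); unfold in_tube; lra. }
    nra.
  + assert (M := Hmax k x t Hk Hx ltac:(lra) Hkin); assert (M2 := Fdom p k x t Hkw); lra.
- destruct (Hreg p Hp) as ((C1 & C2 & C3) & Hder & (P1 & P2 & P3)).
  (* At time 0 the four cases serve only to place [x] strictly inside the tube, so that it is still
     in the tube for times just before [T]. *)
  assert (Hin : plow p 0 < x < phigh p 0).
  { destruct (Hsup p x 0 Hp Hx ltac:(lra) Hd) as
    [(Hin & _) | [(-> & Hin & Hneg) | [(-> & Hin & Hneg) | (k & Hk & Hkin & Hkw)]]]; auto.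
    assert (M := Hmax k x 0 Hk Hx ltac:(lra) Hkin); assert (M2 := Fdom p k x 0 Hkw); lra. }
  rewrite <- P1, <- P2 in Hin.
  destruct (tube_open _ _ x T (C1 T) (C2 T) Hin) as [d [Pd Hopen]].
  assert (E : F p x T <= F p x 0).
  { apply (limit_le_of_left (F p x) T _ (Rmin d T)).
    - apply Rmin_glb_lt; lra.
    - apply (continuity_2d_slice_t (F p)); unfold F; apply continuity_2d_pt_mult.
      + apply ext_continuous; [exact HT | apply Hw].
      + apply (continuity_1d_2d_pt_comp exp (fun x t => de * t - pw p x t)).
        * apply derivable_continuous_pt, derivable_pt_exp.
        * apply continuity_2d_pt_minus; [ | apply C3].
          apply continuity_2d_pt_mult; [apply continuity_2d_pt_const | apply continuity_2d_pt_id2].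
    - intros s Hs; assert (A1 := Rmin_l d T); assert (A2 := Rmin_r d T).
      apply Hmax; auto; [lra | ].
      assert (Hys := Hopen x s ltac:(rewrite Rminus_diag, Rabs_R0; lra) ltac:(apply Rabs_def1; lra)); lra. }
  unfold F in E; rewrite P3, Hperiod in E.
  apply Rmult_le_reg_l in E; [ | apply Hepos].
  assert (E2 : exp (de * 0 - pw p x 0) < exp (de * T - pw p x 0)); [ | lra].
  apply exp_increasing; nra.
Qed.

Lemma continuous_on_opp T f : cont_cylinder T f -> cont_cylinder T (fun x t => - f x t).
Proof.
intros H p Hp; eapply filterlim_comp; [apply (H p Hp) | ].
apply (filterlim_opp (V := R_NormedModule)).
Qed.

(** The equation is linear: contact from below for [phi] is contact from above for [- phi], so
    [touch_above] serves for both comparisons. *)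
Lemma weak_solution_opp T D mx V l phi phix : 0 < T -> cont_cylinder T mx -> cont_cylinder T V ->
  weak_solution T D mx V l phi phix ->
  weak_solution T D mx V l (fun x t => - phi x t) (fun x t => - phix x t).
Proof.
intros HT Hmx HV (Hp & Hpx & Hd & Hpde); repeat split; try now apply continuous_on_opp.
- intros t Ht x Hx.
  assert (E := Dopp (fun y => 0 <= y <= 1) (fun y => phi y t) (fun y => phix y t) x (Hd t Ht x Hx)).
  exact E.
- intros x1 x2 t1 t2 X1 X2 X3 T1 T2 T3.
  specialize (Hpde x1 x2 t1 t2 X1 X2 X3 T1 T2 T3).
  assert (E1 : forall f g : R -> R, (forall x, f x = - g x) -> forall a b, ex_RInt g a b -> RInt f a b = - RInt g a b).
  { intros f g Hfg a b Hg; rewrite (RInt_ext f (fun x => opp (g x))) by (intros; apply Hfg).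
    apply (RInt_opp (V := R_CompleteNormedModule)), Hg. }
  assert (Cx : forall f x t, 0 < x < 1 -> 0 < t < T -> cont_cylinder T f -> continuity_2d_pt f x t).
  { intros f x t Hx Ht Hf.
    apply (continuity_2d_pt_ext_loc (ext T f)); [ | apply ext_continuous; auto; lra].
    assert (0 < Rmin (Rmin x (1 - x)) (Rmin t (T - t))) by (repeat apply Rmin_glb_lt; lra).
    exists (mkposreal _ H); simpl; intros u v Hu Hv.
    assert (A2 := Rmin_l (Rmin x (1 - x)) (Rmin t (T - t))). assert (A1 := Rmin_r (Rmin x (1 - x)) (Rmin t (T - t))).
    assert (A5 := Rmin_l t (T - t)). assert (A6 := Rmin_r t (T - t)).
    assert (A7 := Rmin_l x (1 - x)). assert (A8 := Rmin_r x (1 - x)).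
    apply Rabs_def2 in Hu; apply Rabs_def2 in Hv.
    apply ext_id; lra. }
  assert (E2 : forall f g : R -> R -> R, (forall x t, f x t = - g x t) ->
     (forall x t, 0 < x < 1 -> 0 < t < T -> continuity_2d_pt g x t) ->
     RInt (fun t => RInt (fun x => f x t) x1 x2) t1 t2 = - RInt (fun t => RInt (fun x => g x t) x1 x2) t1 t2).
  { intros f g Hfg Cg.
    rewrite (RInt_ext (fun t => RInt (fun x => f x t) x1 x2) (fun t => opp (RInt (fun x => g x t) x1 x2))).
    - apply (RInt_opp (V := R_CompleteNormedModule)).
      apply (ex_RInt_RInt_slice g x1 x2 0 T); try lra; intros; apply Cg; lra.
    - intros t Ht; rewrite Rmin_left, Rmax_right in Ht by lra.
      apply E1; [auto | apply ex_RInt_slice; [lra | intros; apply Cg; lra]]. }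
  rewrite (E1 (fun x => - phi x t2 - - phi x t1) (fun x => phi x t2 - phi x t1)).
  2:{ intros; ring. }
  2:{ apply (ex_RInt_minus (V := R_NormedModule)); apply ex_RInt_slice; try lra; intros; apply Cx; auto; lra. }
  rewrite (E1 (fun t => - phix x2 t - - phix x1 t) (fun t => phix x2 t - phix x1 t)).
  2:{ intros; ring. }
  2:{ apply (ex_RInt_minus (V := R_NormedModule));
      apply (ex_RInt_continuous (V := R_CompleteNormedModule)); intros z Hz;
      rewrite Rmin_left, Rmax_right in Hz by lra; apply continuity_2d_slice_t, Cx; auto; lra. }
  rewrite (E2 (fun x t => mx x t * - phix x t) (fun x t => mx x t * phix x t)).
  2:{ intros; ring. }
  2:{ intros; apply continuity_2d_pt_mult; apply Cx; auto. }
  rewrite (E2 (fun x t => V x t * - phi x t) (fun x t => V x t * phi x t)).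
  2:{ intros; ring. }
  2:{ intros; apply continuity_2d_pt_mult; apply Cx; auto. }
  rewrite (E2 (fun x t => - phi x t) phi).
  2:{ intros; ring. }
  2:{ intros; apply Cx; auto. }
  lra.
Qed.

(** Here [pw] is the subsolution itself rather than its logarithm, because a compactly supported one
    has to vanish. *)
Definition subsolution_point (D : R) (mx V : R -> R -> R) (mu : R) (p : piece) (x t : R) : Prop :=
  (plow p t < x < phigh p t /\ 0 < x < 1 /\
   pwt p x t - D * pwxx p x t - mx x t * pwx p x t + V x t * pw p x t <= mu * pw p x t) \/
  (x = 0 /\ plow p t < 0 < phigh p t /\ 0 < pwx p x t) \/
  (x = 1 /\ plow p t < 1 < phigh p t /\ pwx p x t < 0).

(** The quotient [pw exp (de t) / phi] has a positive maximum, hence one where [pw] is positive;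
    there the conditions exclude the edges of the tube, and one piece is enough. *)
Lemma eigenvalue_le T D mx V l phi phix mu p : 0 < T -> 0 < D ->
  cont_cylinder T mx -> cont_cylinder T V -> eigenpair T D mx V l phi phix ->
  regular T p ->
  (exists x, 0 <= x <= 1 /\ in_tube p x 0 /\ 0 < pw p x 0) ->
  (forall x t, 0 <= x <= 1 -> 0 <= t <= T -> in_tube p x t -> 0 < pw p x t ->
     subsolution_point D mx V mu p x t) ->
  l <= mu.
Proof.
intros HT HD Hmx HV He Hreg [x0 (Hx0 & Htube0 & Hpos0)] Hsub.
assert (Hperiod := fun x => eigen_periodic _ _ _ _ _ _ _ x HT He).
destruct He as (Hw & Hpos & Hneu & _).
assert (Hepos := fun x t => ext_pos T phi x t HT Hpos).
apply Rnot_lt_le; intros Hlt.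
set (de := (l - mu) / 2). assert (Hde : 0 < de) by (unfold de; lra).
set (F := fun x t => pw p x t * exp (de * t) / ext T phi x t).
destruct Hreg as ((C1 & C2 & C3) & Hder & (P1 & P2 & P3)).
assert (Cexp : forall x t, continuity_2d_pt (fun _ s => exp (de * s)) x t).
{ intros x t; apply (continuity_1d_2d_pt_comp exp (fun x t => de * t)).
  - apply derivable_continuous_pt, derivable_pt_exp.
  - apply continuity_2d_pt_mult; [apply continuity_2d_pt_const | apply continuity_2d_pt_id2]. }
assert (CF : forall x t, continuity_2d_pt F x t).
{ intros x t; unfold F, Rdiv; apply continuity_2d_pt_mult.
  - apply continuity_2d_pt_mult; [apply C3 | apply Cexp].
  - apply continuity_2d_pt_inv; [apply ext_continuous; [exact HT | apply Hw] | ].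
    assert (P := Hepos x t); lra. }
assert (Hpw : forall x t, 0 < F x t -> 0 < pw p x t).
{ intros x t H; unfold F in H.
  assert (Q1 := exp_pos (de * t)); assert (Q2 := Hepos x t).
  replace (pw p x t) with (pw p x t * exp (de * t) / ext T phi x t * (ext T phi x t * / exp (de * t)))
    by (field; lra).
  apply Rmult_lt_0_compat; [exact H | ].
  apply Rmult_lt_0_compat; [exact Q2 | now apply Rinv_0_lt_compat]. }
assert (F0 : 0 < F x0 0).
{ unfold F, Rdiv; repeat apply Rmult_lt_0_compat; auto; [apply exp_pos | apply Rinv_0_lt_compat, Hepos]. }
destruct (parabolic_argmax (p :: nil) plow phigh (fun _ => F) T HT) as
  [[p' [x [t (Hp & Hx & Ht & Hd & Hmax)]]] | [p' [x (Hp & Hx & Hd & Hmax)]]].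
- intros q [<- | []]; auto.
- exists p, x0; split; [now left | split; [exact Hx0 | exact Htube0]].
- destruct Hp as [<- | []].
  assert (Fx : 0 < F x t).
  { eapply Rlt_le_trans; [exact F0 | apply (Hmax p x0 0)]; auto; [now left | lra]. }
  assert (Hps := Hpw x t Fx).
  (* The test function that touches [- phi] from above: the quotient is frozen at its maximal
     value. *)
  set (chi := fun y s => - (/ F x t) * (pw p y s * exp (de * s))).
  assert (Dx : forall y s, 0 < s < T -> is_derive (fun y => chi y s) y (- (/ F x t) * (pwx p y s * exp (de * s)))).
  { intros y s Hs; unfold chi.
    assert (Dw := proj1 (proj2 (Hder y s Hs))).
    apply (is_derive_scal (fun y => pw p y s * exp (de * s))).
    apply (is_derive_ext (fun y => exp (de * s) * pw p y s)); [intros; apply Rmult_comm | ].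
    rewrite (Rmult_comm (pwx p y s)); now apply is_derive_scal. }
  assert (Dxx : forall y s, 0 < s < T -> is_derive (fun y => - (/ F x t) * (pwx p y s * exp (de * s))) y
       (- (/ F x t) * (pwxx p y s * exp (de * s)))).
  { intros y s Hs; unfold chi.
    assert (Dw := proj1 (proj2 (proj2 (Hder y s Hs)))).
    apply (is_derive_scal (fun y => pwx p y s * exp (de * s))).
    apply (is_derive_ext (fun y => exp (de * s) * pwx p y s)); [intros; apply Rmult_comm | ].
    rewrite (Rmult_comm (pwxx p y s)); now apply is_derive_scal. }
  assert (Dt : forall y s, 0 < s < T -> is_derive (fun s => chi y s) s
      (- (/ F x t) * ((pwt p y s + de * pw p y s) * exp (de * s)))).
  { intros y s Hs; unfold chi.
    assert (Dw := proj1 (Hder y s Hs)).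
    apply (is_derive_scal (fun s => pw p y s * exp (de * s))).
    replace ((pwt p y s + de * pw p y s) * exp (de * s)) with
      (plus (mult (pwt p y s) (exp (de * s))) (mult (pw p y s) (de * exp (de * s))))
      by (unfold plus, mult; simpl; ring).
    apply (is_derive_mult (fun s => pw p y s) (fun s => exp (de * s))); [exact Dw | | exact Rmult_comm].
    auto_derive; auto; ring. }
  assert (Chi : forall f, (forall y s, 0 < s < T -> continuity_2d_pt f y s) -> forall y s, 0 < s < T ->
     continuity_2d_pt (fun y s => - (/ F x t) * (f y s * exp (de * s))) y s).
  { intros f Hf y s Hs; apply continuity_2d_pt_mult; [apply continuity_2d_pt_const | ].
    apply continuity_2d_pt_mult; auto. }
  assert (Hle : forall y s, 0 <= y <= 1 -> 0 <= s <= t -> in_tube p y s -> - ext T phi y s <= chi y s).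
  { intros y s Hy Hs Hin; assert (M : F y s <= F x t).
    { apply (Hmax p y s); auto; now left. }
    assert (Q := Hepos y s).
    apply (Rmult_le_compat_r (ext T phi y s)) in M; [ | lra].
    unfold F at 1 in M; unfold Rdiv in M; rewrite Rmult_assoc, Rinv_l, Rmult_1_r in M by lra.
    unfold chi; apply (Rmult_le_compat_l (/ F x t)) in M; [ | left; now apply Rinv_0_lt_compat].
    rewrite <- (Rmult_assoc _ (F x t)), Rinv_l in M by lra; lra. }
  assert (Heq : - ext T phi x t = chi x t).
  { unfold chi, F; assert (Q1 := exp_pos (de * t)); assert (Q2 := Hepos x t); field; lra. }
  assert (Hf : 0 < / F x t) by now apply Rinv_0_lt_compat.
  assert (Hexp := exp_pos (de * t)).
  assert (Hf2 : 0 < / F x t * exp (de * t)) by now apply Rmult_lt_0_compat.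
  destruct (Hsub x t Hx ltac:(lra) Hd Hps) as
    [(Hin & Hx' & Hmu) | [(-> & Hin & Hneg) | (-> & Hin & Hneg)]].
  + destruct (tube_open _ _ x t (C1 t) (C2 t) Hin) as [d [Pd Hopen]].
    assert (exists rho, 0 < rho /\ rho <= d /\ rho < t /\ rho < T - t /\ rho < x /\ rho < 1 - x)
      as [rho (r0 & r1 & r2 & r3 & r4 & r5)].
    { exists (Rmin d (Rmin (Rmin t (T - t)) (Rmin x (1 - x))) / 2).
      assert (0 < Rmin d (Rmin (Rmin t (T - t)) (Rmin x (1 - x)))) by (repeat apply Rmin_glb_lt; lra).
      assert (A1 := Rmin_l d (Rmin (Rmin t (T - t)) (Rmin x (1 - x)))).
      assert (A2 := Rmin_r d (Rmin (Rmin t (T - t)) (Rmin x (1 - x)))).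
      assert (A3 := Rmin_l (Rmin t (T - t)) (Rmin x (1 - x))).
      assert (A4 := Rmin_r (Rmin t (T - t)) (Rmin x (1 - x))).
      assert (A5 := Rmin_l t (T - t)). assert (A6 := Rmin_r t (T - t)).
      assert (A7 := Rmin_l x (1 - x)). assert (A8 := Rmin_r x (1 - x)). lra. }
    assert (Hw' := weak_solution_opp T D mx V l phi phix HT Hmx HV Hw).
    apply (touch_above T D mx V l _ _ x t chi
      (fun y s => - (/ F x t) * ((pwt p y s + de * pw p y s) * exp (de * s)))
      (fun y s => - (/ F x t) * (pwx p y s * exp (de * s)))
      (fun y s => - (/ F x t) * (pwxx p y s * exp (de * s))) rho) in Hw'; auto.
    * unfold chi in Hw'.
      assert (Hc : 0 < (/ F x t * exp (de * t)) * (de * pw p x t)).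
      { apply Rmult_lt_0_compat; [exact Hf2 | now apply Rmult_lt_0_compat]. }
      assert (Hm2 : (/ F x t * exp (de * t)) * (pwt p x t - D * pwxx p x t - mx x t * pwx p x t + V x t * pw p x t)
          <= (/ F x t * exp (de * t)) * (mu * pw p x t)) by (apply Rmult_le_compat_l; lra).
      assert (El : l = mu + 2 * de) by (unfold de; field).
      rewrite El in Hw'; clear - Hw' Hc Hm2; nra.
    * intros y s Hy Hs; apply Rabs_def2 in Hy; apply Rabs_def2 in Hs.
      split; [apply (Chi (pw p)); auto; lra | split; [apply Dt; lra | split; [apply Dx; lra | apply Dxx; lra]]].
    * apply (Chi (fun y s => pwt p y s + de * pw p y s)); [ | lra].
      intros y s Hs; apply continuity_2d_pt_plus; [now apply Hder | ].
      apply continuity_2d_pt_mult; [apply continuity_2d_pt_const | apply C3].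
    * apply Chi; [intros; now apply Hder | lra].
    * intros y s Hy Hs; apply Hle; [apply Rabs_def2 in Hy; lra | lra | ].
      assert (Hys := Hopen y s ltac:(lra) ltac:(apply Rabs_def1; lra)); unfold in_tube; lra.
  + destruct (tube_open _ _ 0 t (C1 t) (C2 t) Hin) as [d [Pd Hopen]].
    assert (Hs : 0 <= - (/ F 0 t) * (pwx p 0 t * exp (de * t))).
    { apply (boundary_contact_0 (fun y => - ext T phi y t) (fun y => chi y t) _ d Pd).
      - intros e He; destruct (ext_derive_0 T phi phix t ltac:(lra) ltac:(apply Hw; lra) ltac:(apply Hneu; lra) e He)
          as [q [Hq Q]]; exists q; split; [exact Hq | intros y Hy Hyq].
        specialize (Q y Hy Hyq); rewrite <- Rabs_Ropp in Q.
        replace (- ext T phi y t - - ext T phi 0 t) with (- (ext T phi y t - ext T phi 0 t)) by ring; exact Q.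
      - apply Dx; lra.
      - exact Heq.
      - intros y Hy Hyd; apply Hle; [exact Hy | lra | ].
        assert (Hys := Hopen y t ltac:(rewrite Rminus_0_r, Rabs_pos_eq; lra)
          ltac:(rewrite Rminus_diag, Rabs_R0; lra)); unfold in_tube; lra. }
    assert (0 < / F 0 t * exp (de * t) * pwx p 0 t) by now apply Rmult_lt_0_compat.
    lra.
  + destruct (tube_open _ _ 1 t (C1 t) (C2 t) Hin) as [d [Pd Hopen]].
    assert (Hs : - (/ F 1 t) * (pwx p 1 t * exp (de * t)) <= 0).
    { apply (boundary_contact_1 (fun y => - ext T phi y t) (fun y => chi y t) _ d Pd).
      - intros e He; destruct (ext_derive_1 T phi phix t ltac:(lra) ltac:(apply Hw; lra) ltac:(apply Hneu; lra) e He)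
          as [q [Hq Q]]; exists q; split; [exact Hq | intros y Hy Hyq].
        specialize (Q y Hy Hyq); rewrite <- Rabs_Ropp in Q.
        replace (- ext T phi y t - - ext T phi 1 t) with (- (ext T phi y t - ext T phi 1 t)) by ring; exact Q.
      - apply Dx; lra.
      - exact Heq.
      - intros y Hy Hyd; apply Hle; [exact Hy | lra | ].
        assert (Hys := Hopen y t ltac:(apply Rabs_def1; lra)
          ltac:(rewrite Rminus_diag, Rabs_R0; lra)); unfold in_tube; lra. }
    assert (0 < / F 1 t * exp (de * t) * - pwx p 1 t) by (apply Rmult_lt_0_compat; lra).
    lra.
- destruct Hp as [<- | []].
  assert (Fx : 0 < F x 0).
  { eapply Rlt_le_trans; [exact F0 | apply (Hmax p x0 0)]; auto; [now left | lra]. }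
  assert (Hps := Hpw x 0 Fx).
  assert (Hin : plow p 0 < x < phigh p 0).
  { destruct (Hsub x 0 Hx ltac:(lra) Hd Hps) as
    [(Hin & _) | [(-> & Hin & Hneg) | (-> & Hin & Hneg)]]; auto. }
  rewrite <- P1, <- P2 in Hin.
  destruct (tube_open _ _ x T (C1 T) (C2 T) Hin) as [d [Pd Hopen]].
  assert (E : F x T <= F x 0).
  { apply (limit_le_of_left (F x) T _ (Rmin d T)).
    - apply Rmin_glb_lt; lra.
    - now apply continuity_2d_slice_t.
    - intros s Hs; assert (A1 := Rmin_l d T); assert (A2 := Rmin_r d T).
      apply (Hmax p); auto; [now left | lra | ].
      assert (Hys := Hopen x s ltac:(rewrite Rminus_diag, Rabs_R0; lra) ltac:(apply Rabs_def1; lra)); lra. }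
  unfold F in E; rewrite P3, Hperiod, Rmult_0_r, exp_0 in E.
  assert (Q := Hepos x 0).
  unfold Rdiv in E; apply Rmult_le_reg_r in E; [ | now apply Rinv_0_lt_compat].
  assert (E2 : 1 < exp (de * T)).
  { rewrite <- exp_0; apply exp_increasing, Rmult_lt_0_compat; lra. }
  assert (pw p x 0 * 1 < pw p x 0 * exp (de * T)) by (apply Rmult_lt_compat_l; lra).
  lra.
Qed.

(** * Periodic orbits of x' = B(x,t) + c *)

Lemma nondecreasing_of_derive (f f' : R -> R) a b : a <= b ->
  (forall t, a <= t <= b -> continuous f t) ->
  (forall t, a < t < b -> is_derive f t (f' t)) -> (forall t, a < t < b -> 0 <= f' t) ->
  f a <= f b.
Proof.
intros Hab Cf Df Hp.
(* The mean value theorem may return an endpoint, where nothing is known on [f']. *)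
set (g := fun t => match Rlt_dec a t with left _ => match Rlt_dec t b with left _ => f' t | right _ => 0 end
   | right _ => 0 end).
destruct (MVT_gen f a b g) as [c [_ E]].
- intros x Hx; rewrite Rmin_left, Rmax_right in Hx by lra; unfold g.
  destruct (Rlt_dec a x); [ | lra]; destruct (Rlt_dec x b); [now apply Df | lra].
- intros x Hx; rewrite Rmin_left, Rmax_right in Hx by lra.
  now apply continuity_pt_filterlim, Cf.
- assert (0 <= g c).
  { unfold g; destruct (Rlt_dec a c); [ | lra]; destruct (Rlt_dec c b); [apply Hp; lra | lra]. }
  assert (0 <= g c * (b - a)) by (apply Rmult_le_pos; lra); lra.
Qed.

(** The square of the negative part is continuously differentiable, so an energy argument needs no
    splitting at the zeros of the function. *)
Lemma is_derive_neg_part_sqr z : is_derive (fun y => Rmin y 0 * Rmin y 0) z (2 * Rmin z 0).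
Proof.
apply is_derive_Reals; intros e He; exists (mkposreal e He); simpl; intros h Hh Hhe.
assert (A : Rabs (Rmin (z + h) 0 * Rmin (z + h) 0 - Rmin z 0 * Rmin z 0 - 2 * Rmin z 0 * h) <= h * h).
{ unfold Rmin; repeat destruct (Rle_dec _ _); apply Rabs_le; nra. }
replace ((Rmin (z + h) 0 * Rmin (z + h) 0 - Rmin z 0 * Rmin z 0) / h - 2 * Rmin z 0)
  with ((Rmin (z + h) 0 * Rmin (z + h) 0 - Rmin z 0 * Rmin z 0 - 2 * Rmin z 0 * h) / h) by (field; exact Hh).
unfold Rdiv; rewrite Rabs_mult, Rabs_inv.
assert (Ph : 0 < Rabs h) by now apply Rabs_pos_lt.
apply Rle_lt_trans with (h * h * / Rabs h).
- apply Rmult_le_compat_r; [left; now apply Rinv_0_lt_compat | exact A].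
- replace (h * h) with (Rabs h * Rabs h) by (rewrite <- Rabs_mult; apply Rabs_pos_eq; nra).
  rewrite Rmult_assoc, Rinv_r, Rmult_1_r by lra; exact Hhe.
Qed.

Lemma exp_monotone a b : a <= b -> exp a <= exp b.
Proof. intros [H | ->]; [left; now apply exp_increasing | lra]. Qed.

(** The energy of the negative part times [exp (- 2 L t)] cannot grow, so [Z] stays nonnegative.
    Then the absolute value disappears and the integrating factor [exp (L t)] gives the bound. *)
Lemma linear_comparison (Z Z' : R -> R) a b L kap : 0 <= L -> 0 <= kap -> a <= b ->
  (forall t, continuous Z t) -> (forall t, a < t < b -> is_derive Z t (Z' t)) ->
  (forall t, a < t < b -> kap - L * Rabs (Z t) <= Z' t) -> 0 <= Z a ->
  exp (- (L * (b - a))) * (Z a + kap * (b - a)) <= Z b.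
Proof.
intros HL Hk Hab CZ DZ HZ Ha.
assert (Cexp : forall k t, continuous (fun t => exp (k * t)) t).
{ intros k t; apply (ex_derive_continuous (V := R_NormedModule)); auto_derive; auto. }
assert (Dexp : forall k t, is_derive (fun t => exp (k * t)) t (k * exp (k * t))).
{ intros k t; auto_derive; auto; ring. }
assert (Pos : forall t, a <= t <= b -> 0 <= Z t).
{ intros t Ht.
  set (q := fun y => Rmin y 0 * Rmin y 0).
  assert (E : - (q (Z a) * exp (- 2 * L * a)) <= - (q (Z t) * exp (- 2 * L * t))).
  { apply (nondecreasing_of_derive (fun t => - (q (Z t) * exp (- 2 * L * t)))
     (fun t => - ((2 * Rmin (Z t) 0 * Z' t) * exp (- 2 * L * t)
        + q (Z t) * (- 2 * L * exp (- 2 * L * t))))); [lra | | | ].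
    - intros s _; apply (continuous_opp (V := R_NormedModule)).
      apply (continuous_mult (K := R_AbsRing)); [ | apply Cexp].
      apply continuous_comp; [apply CZ | ].
      apply (ex_derive_continuous (V := R_NormedModule)); eexists; apply is_derive_neg_part_sqr.
    - intros s Hs; apply (is_derive_opp (V := R_NormedModule)).
      apply (is_derive_mult (fun t => q (Z t)) (fun t => exp (- 2 * L * t))); [ | apply Dexp | exact Rmult_comm].
      assert (E := is_derive_comp q Z s _ _ (is_derive_neg_part_sqr (Z s)) (DZ s ltac:(lra))).
      unfold scal in E; simpl in E; unfold mult in E; simpl in E; rewrite Rmult_comm in E; exact E.
    - intros s Hs; specialize (HZ s ltac:(lra)); unfold q.
      assert (P := exp_pos (- 2 * L * s)).
      assert (A : 0 <= - (2 * Rmin (Z s) 0 * Z' s - 2 * L * (Rmin (Z s) 0 * Rmin (Z s) 0))).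
      { unfold Rmin; destruct (Rle_dec (Z s) 0) as [Y | Y]; [ | lra].
        rewrite <- (Ropp_involutive (Z s)), Rabs_Ropp, (Rabs_pos_eq (- Z s)) in HZ by lra.
        assert (0 <= - Z s * (Z' s - L * Z s)) by (apply Rmult_le_pos; lra); lra. }
      replace (- (2 * Rmin (Z s) 0 * Z' s * exp (-2 * L * s) + Rmin (Z s) 0 * Rmin (Z s) 0 * (-2 * L * exp (-2 * L * s))))
       with (- (2 * Rmin (Z s) 0 * Z' s - 2 * L * (Rmin (Z s) 0 * Rmin (Z s) 0)) * exp (-2 * L * s)) by ring.
      apply Rmult_le_pos; lra. }
  unfold q in E; rewrite (Rmin_right (Z a) 0), Rmult_0_l, Rmult_0_l, Ropp_0 in E by exact Ha.
  assert (P := exp_pos (- 2 * L * t)).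
  apply Rnot_lt_le; intros N; rewrite (Rmin_left (Z t) 0) in E by lra.
  assert (0 < Z t * Z t * exp (-2 * L * t)) by (apply Rmult_lt_0_compat; nra); lra. }
assert (E : Z a * exp (L * a) - kap * exp (L * a) * a <= Z b * exp (L * b) - kap * exp (L * a) * b).
{ apply (nondecreasing_of_derive (fun t => Z t * exp (L * t) - kap * exp (L * a) * t)
     (fun t => (Z' t * exp (L * t) + Z t * (L * exp (L * t))) - kap * exp (L * a))); [lra | | | ].
  - intros s _; apply (continuous_minus (V := R_NormedModule)).
    + apply (continuous_mult (K := R_AbsRing)); [apply CZ | apply Cexp].
    + apply (ex_derive_continuous (V := R_NormedModule)); auto_derive; auto.
  - intros s Hs; apply (is_derive_minus (V := R_NormedModule)).
    + apply (is_derive_mult Z (fun t => exp (L * t))); [now apply DZ | apply Dexp | exact Rmult_comm].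
    + auto_derive; auto; ring.
  - intros s Hs; specialize (HZ s Hs); rewrite Rabs_pos_eq in HZ by (apply Pos; lra).
    assert (P := exp_pos (L * a)).
    assert (Q : exp (L * a) <= exp (L * s)) by (apply exp_monotone; nra).
    replace (Z' s * exp (L * s) + Z s * (L * exp (L * s)) - kap * exp (L * a))
      with ((Z' s + L * Z s - kap) * exp (L * s) + kap * (exp (L * s) - exp (L * a))) by ring.
    apply Rplus_le_le_0_compat; apply Rmult_le_pos; lra. }
assert (P := exp_pos (- (L * b))).
apply (Rmult_le_compat_r (exp (- (L * b)))) in E; [ | lra].
replace ((Z b * exp (L * b) - kap * exp (L * a) * b) * exp (- (L * b)))
  with (Z b * (exp (L * b) * exp (- (L * b))) - kap * (exp (L * a) * exp (- (L * b))) * b) in E by ring.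
replace ((Z a * exp (L * a) - kap * exp (L * a) * a) * exp (- (L * b)))
  with ((Z a - kap * a) * (exp (L * a) * exp (- (L * b)))) in E by ring.
rewrite <- !exp_plus, Rplus_opp_r, exp_0 in E.
replace (L * a + - (L * b)) with (- (L * (b - a))) in E by ring; lra.
Qed.

Definition field_ok (B : R -> R -> R) (M L : R) : Prop :=
  (forall x t, continuity_2d_pt B x t) /\ (forall x t, Rabs (B x t) <= M) /\
  (forall x y t, Rabs (B x t - B y t) <= L * Rabs (x - y)) /\ 0 < M /\ 0 < L.

Definition orbit (B : R -> R -> R) (T c : R) (X : R -> R) : Prop :=
  (forall t, continuous X t) /\ forall t, 0 < t < T -> is_derive X t (B (X t) t + c).

Lemma field_comp_continuous (B : R -> R -> R) M L (X : R -> R) t : field_ok B M L ->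
  continuous X t -> continuous (fun s => B (X s) s) t.
Proof.
intros HB HX.
apply (continuity_2d_slice_t (fun _ s => B (X s) s) 0 t).
apply (continuity_2d_comp B (fun _ s => X s) (fun _ s => s)).
- apply HB.
- now apply continuity_2d_of_t.
- apply continuity_2d_pt_id2.
Qed.

Fixpoint picard (B : R -> R -> R) (c x : R) (n : nat) (t : R) : R :=
  match n with
  | O => x
  | S k => x + RInt (fun s => B (picard B c x k s) s + c) 0 t
  end.

Lemma picard_continuous B M L c x n t : field_ok B M L -> continuous (picard B c x n) t.
Proof.
intros HB; revert t; induction n as [ | n IH]; intros t; simpl.
- apply continuous_const.
- apply (continuous_plus (V := R_NormedModule)); [apply continuous_const | ].
  apply (ex_derive_continuous (V := R_NormedModule)).
  exists (B (picard B c x n t) t + c).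
  apply (is_derive_RInt (V := R_NormedModule) (fun s => B (picard B c x n s) s + c) _ 0).
  + apply filter_forall; intros u; apply (RInt_correct (V := R_CompleteNormedModule)).
    apply (ex_RInt_continuous (V := R_CompleteNormedModule)); intros s _.
    apply (continuous_plus (V := R_NormedModule)); [eapply field_comp_continuous; eauto | apply continuous_const].
  + apply (continuous_plus (V := R_NormedModule)); [eapply field_comp_continuous; eauto | apply continuous_const].
Qed.

Lemma field_ex_RInt B M L c (X : R -> R) a b : field_ok B M L -> (forall t, continuous X t) ->
  ex_RInt (fun s => B (X s) s + c) a b.
Proof.
intros HB HX; apply (ex_RInt_continuous (V := R_CompleteNormedModule)); intros s _.
apply (continuous_plus (V := R_NormedModule)); [eapply field_comp_continuous; eauto | apply continuous_const].
Qed.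


Lemma RInt_minus_R (f g : R -> R) a b : ex_RInt f a b -> ex_RInt g a b ->
  RInt f a b - RInt g a b = RInt (fun s => f s - g s) a b.
Proof. intros Hf Hg; symmetry; exact (RInt_minus (V := R_CompleteNormedModule) f g a b Hf Hg). Qed.

Lemma ex_RInt_minus_R (f g : R -> R) a b : ex_RInt f a b -> ex_RInt g a b ->
  ex_RInt (fun s => f s - g s) a b.
Proof. intros Hf Hg; exact (ex_RInt_minus (V := R_NormedModule) f g a b Hf Hg). Qed.

Lemma Rplus_minus_cancel (x a b : R) : x + a - (x + b) = a - b.
Proof. ring. Qed.

(** The weight [exp (2 L t)] makes the Picard map contract by 1/2 on the whole half-line, without
    restriction to short times. *)
Lemma picard_step B M L c x n t : field_ok B M L -> 0 <= t ->
  Rabs (picard B c x (S n) t - picard B c x n t) <= ((M + Rabs c) / (2 * L)) * (1 / 2) ^ n * exp (2 * L * t).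
Proof.
intros HB; assert (HB' := HB); destruct HB' as (_ & HM & HL & M0 & L0).
assert (Pc := Rabs_pos c).
revert t; induction n as [ | n IH]; intros t Ht.
- simpl; rewrite Rplus_minus_l.
  assert (I : Rabs (RInt (fun s => B x s + c) 0 t) <= (t - 0) * (M + Rabs c)).
  { apply abs_RInt_le_const; [exact Ht | | ].
    - apply (field_ex_RInt B M L c (fun _ => x)); [exact HB | intros; apply continuous_const].
    - intros s _; eapply Rle_trans; [apply Rabs_triang | specialize (HM x s); lra]. }
  assert (E := exp_ineq1_le (2 * L * t)).
  assert (A : 2 * L * t <= exp (2 * L * t)) by lra.
  apply (Rmult_le_compat_l ((M + Rabs c) / (2 * L))) in A.
  + replace ((M + Rabs c) / (2 * L) * (2 * L * t)) with ((t - 0) * (M + Rabs c)) in A by (field; lra); lra.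
  + left; apply Rdiv_lt_0_compat; lra.
- set (A := (M + Rabs c) / (2 * L)) in *.
  assert (A0 : 0 < A) by (unfold A; apply Rdiv_lt_0_compat; lra).
  change (Rabs ((x + RInt (fun s => B (picard B c x (S n) s) s + c) 0 t) -
     (x + RInt (fun s => B (picard B c x n s) s + c) 0 t)) <= A * (1 / 2) ^ S n * exp (2 * L * t)).
  rewrite Rplus_minus_cancel.
  assert (I1 : forall k, ex_RInt (fun s => B (picard B c x k s) s + c) 0 t).
  { intros k; eapply field_ex_RInt; [exact HB | intros; eapply picard_continuous; eauto]. }
  rewrite RInt_minus_R by apply I1.
  set (k := A * (1 / 2) ^ n).
  assert (k0 : 0 < k) by (unfold k; apply Rmult_lt_0_compat; [exact A0 | apply pow_lt; lra]).
  assert (Dg : forall s, is_derive (fun s => k / 2 * exp (2 * L * s)) s (L * (k * exp (2 * L * s)))).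
  { intros s; auto_derive; auto; field. }
  assert (Cg : forall s, continuous (fun s => L * (k * exp (2 * L * s))) s).
  { intros s; apply (ex_derive_continuous (V := R_NormedModule)); auto_derive; auto. }
  assert (Ig : is_RInt (fun s => L * (k * exp (2 * L * s))) 0 t
     (minus (k / 2 * exp (2 * L * t)) (k / 2 * exp (2 * L * 0)))).
  { apply (is_RInt_derive (V := R_CompleteNormedModule) (fun s => k / 2 * exp (2 * L * s))); auto. }
  apply Rle_trans with (minus (k / 2 * exp (2 * L * t)) (k / 2 * exp (2 * L * 0))).
  + refine (norm_RInt_le (V := R_NormedModule) _ _ 0 t _ _ Ht _
      (RInt_correct (V := R_CompleteNormedModule) _ _ _ (ex_RInt_minus_R _ _ _ _ (I1 (S n)) (I1 n))) Ig).
    intros s Hs.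
    change (Rabs ((B (picard B c x (S n) s) s + c) - (B (picard B c x n s) s + c)) <= L * (k * exp (2 * L * s))).
    replace ((B (picard B c x (S n) s) s + c) - (B (picard B c x n s) s + c)) with
      (B (picard B c x (S n) s) s - B (picard B c x n s) s) by ring.
    eapply Rle_trans; [apply HL | apply Rmult_le_compat_l; [lra | apply IH; lra]].
  + unfold minus, plus, opp; simpl; rewrite Rmult_0_r, exp_0.
    replace (A * (1 / 2 * (1 / 2) ^ n) * exp (2 * L * t)) with (k / 2 * exp (2 * L * t)) by (unfold k; field).
    lra.
Qed.

Lemma flow_exists B M L T c x : field_ok B M L -> 0 < T ->
  exists X, orbit B T c X /\ X 0 = x.
Proof.
intros HB HT; assert (HB' := HB); destruct HB' as (_ & HM & HL & M0 & L0).
assert (Pc := Rabs_pos c).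
set (A := (M + Rabs c) / (2 * L) * exp (2 * L * T)).
assert (A0 : 0 < A).
{ unfold A; apply Rmult_lt_0_compat; [apply Rdiv_lt_0_compat; lra | apply exp_pos]. }
assert (Hstep : forall n t, 0 <= t <= T -> Rabs (picard B c x (S n) t - picard B c x n t) <= A * (1 / 2) ^ n).
{ intros n t Ht; eapply Rle_trans; [apply (picard_step B M L); [exact HB | lra] | ].
  unfold A; replace ((M + Rabs c) / (2 * L) * exp (2 * L * T) * (1 / 2) ^ n) with
   ((M + Rabs c) / (2 * L) * (1 / 2) ^ n * exp (2 * L * T)) by ring.
  apply Rmult_le_compat_l; [ | apply exp_monotone; nra].
  apply Rmult_le_pos; [left; apply Rdiv_lt_0_compat; lra | apply pow_le; lra]. }
clearbody A.
assert (Hcau : forall n k t, 0 <= t <= T ->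
   Rabs (picard B c x (n + k) t - picard B c x n t) <= 2 * A * (1 / 2) ^ n - 2 * A * (1 / 2) ^ (n + k)).
{ intros n k t Ht; induction k as [ | k IHk].
  - rewrite Nat.add_0_r, Rminus_diag, Rabs_R0; lra.
  - rewrite Nat.add_succ_r.
    replace (picard B c x (S (n + k)) t - picard B c x n t) with
      ((picard B c x (S (n + k)) t - picard B c x (n + k) t) + (picard B c x (n + k) t - picard B c x n t)) by ring.
    eapply Rle_trans; [apply Rabs_triang | ].
    assert (H1 := Hstep (n + k)%nat t Ht).
    change ((1 / 2) ^ S (n + k)) with (1 / 2 * (1 / 2) ^ (n + k)); lra. }
assert (Hcau2 : forall n k t, 0 <= t <= T -> (n <= k)%nat ->
   Rabs (picard B c x k t - picard B c x n t) <= 2 * A * (1 / 2) ^ n).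
{ intros n k t Ht Hk; replace k with (n + (k - n))%nat by lia.
  assert (H1 := Hcau n (k - n)%nat t Ht).
  assert (0 < 2 * A * (1 / 2) ^ (n + (k - n))) by (repeat apply Rmult_lt_0_compat; try lra; apply pow_lt; lra).
  lra. }
assert (Hgeo : is_lim_seq (fun n => 2 * A * (1 / 2) ^ n) 0).
{ replace (Finite 0) with (Rbar_mult (2 * A) 0) by (simpl; f_equal; ring).
  apply is_lim_seq_scal_l, is_lim_seq_geom; rewrite Rabs_pos_eq; lra. }
assert (Hex : forall t, 0 <= t <= T -> ex_finite_lim_seq (fun n => picard B c x n t)).
{ intros t Ht; apply ex_lim_seq_cauchy_corr; intros e.
  apply is_lim_seq_spec in Hgeo; destruct (Hgeo (pos_div_2 e)) as [N HN].
  exists N; intros n m Hn Hm.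
  specialize (HN N (Nat.le_refl N)); rewrite Rminus_0_r in HN; apply Rabs_def2 in HN; simpl in HN.
  assert (H1 := Hcau2 N n t Ht Hn). assert (H2 := Hcau2 N m t Ht Hm).
  replace (picard B c x n t - picard B c x m t) with
    ((picard B c x n t - picard B c x N t) - (picard B c x m t - picard B c x N t)) by ring.
  eapply Rle_lt_trans; [apply Rabs_triang | rewrite Rabs_Ropp; lra]. }
set (Y := fun t => real (Lim_seq (fun n => picard B c x n t))).
assert (HY : forall t, 0 <= t <= T -> is_lim_seq (fun n => picard B c x n t) (Y t)).
{ intros t Ht; apply Lim_seq_correct', Hex, Ht. }
assert (HYn : forall n t, 0 <= t <= T -> Rabs (Y t - picard B c x n t) <= 2 * A * (1 / 2) ^ n).
{ intros n t Ht.
  assert (E : is_lim_seq (fun k => Rabs (picard B c x k t - picard B c x n t)) (Rabs (Y t - picard B c x n t))).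
  { apply (is_lim_seq_abs _ (Finite (Y t - picard B c x n t))).
    apply is_lim_seq_minus'; [now apply HY | apply is_lim_seq_const]. }
  apply (is_lim_seq_le_loc _ (fun _ => 2 * A * (1 / 2) ^ n) _ (2 * A * (1 / 2) ^ n)) in E;
    [exact E | | apply is_lim_seq_const].
  exists n; intros k Hk; now apply Hcau2. }
assert (Hlip : forall n t s, 0 <= s -> s <= t -> Rabs (picard B c x n t - picard B c x n s) <= (M + Rabs c) * (t - s)).
{ intros n t s Hs Hst; destruct n as [ | n].
  - simpl; rewrite Rminus_diag, Rabs_R0; apply Rmult_le_pos; lra.
  - simpl.
    assert (I1 : forall a b, ex_RInt (fun s => B (picard B c x n s) s + c) a b).
    { intros; eapply field_ex_RInt; [exact HB | intros; eapply picard_continuous; eauto]. }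
    assert (Ch := RInt_Chasles (V := R_CompleteNormedModule) _ 0 s t (I1 0 s) (I1 s t)).
    unfold plus in Ch; simpl in Ch; rewrite <- Ch.
    rewrite Rplus_minus_cancel, Rplus_minus_l.
    rewrite Rmult_comm; apply abs_RInt_le_const; [exact Hst | apply I1 | ].
    intros u _; eapply Rle_trans; [apply Rabs_triang | specialize (HM (picard B c x n u) u); lra]. }
assert (HYlip : forall t s, 0 <= s -> s <= t -> t <= T -> Rabs (Y t - Y s) <= (M + Rabs c) * (t - s)).
{ intros t s Hs Hst Ht.
  assert (E : is_lim_seq (fun k => Rabs (picard B c x k t - picard B c x k s)) (Rabs (Y t - Y s))).
  { apply (is_lim_seq_abs _ (Finite (Y t - Y s))).
    apply is_lim_seq_minus'; apply HY; lra. }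
  apply (is_lim_seq_le _ (fun _ => (M + Rabs c) * (t - s)) _ ((M + Rabs c) * (t - s))) in E;
    [exact E | | apply is_lim_seq_const].
  intros k; now apply Hlip. }
(* The limit is controlled on [0, T] only; clamping makes it continuous on the whole line, as
   [orbit] demands. *)
set (X := fun t => Y (clamp 0 T t)).
assert (HXl : forall t s, Rabs (X t - X s) <= (M + Rabs c) * Rabs (t - s)).
{ assert (W : forall t s, s <= t -> Rabs (X t - X s) <= (M + Rabs c) * Rabs (t - s)).
  { intros t s Hst; unfold X.
    assert (C1 := clamp_in 0 T t ltac:(lra)). assert (C2 := clamp_in 0 T s ltac:(lra)).
    assert (C3 : clamp 0 T s <= clamp 0 T t).
    { unfold clamp, Rmax, Rmin; repeat destruct (Rle_dec _ _); lra. }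
    assert (C4 := clamp_lip 0 T t s ltac:(lra)).
    eapply Rle_trans; [apply HYlip; lra | apply Rmult_le_compat_l; [lra | ]].
    eapply Rle_trans; [apply Rle_abs | exact C4]. }
  intros t s; destruct (Rle_dec s t); [now apply W | ].
  rewrite <- (Rabs_Ropp (X t - X s)), <- (Rabs_Ropp (t - s)), !Ropp_minus_distr; apply W; lra. }
assert (CX : forall t, continuous X t).
{ intros t; apply (filterlim_locally (F := locally t)); intros e.
  assert (Hd : 0 < e / (M + Rabs c)) by (apply Rdiv_lt_0_compat; [apply cond_pos | lra]).
  exists (mkposreal _ Hd); intros s Hs.
  change (Rabs (s - t) < e / (M + Rabs c)) in Hs.
  change (Rabs (X s - X t) < e).
  eapply Rle_lt_trans; [apply HXl | ].
  replace (pos e) with ((M + Rabs c) * (e / (M + Rabs c))) by (field; lra).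
  apply Rmult_lt_compat_l; lra. }
assert (HXY : forall t, 0 <= t <= T -> X t = Y t) by (intros t Ht; unfold X; now rewrite clamp_id).
assert (Heq : forall t, 0 <= t <= T -> X t = x + RInt (fun s => B (X s) s + c) 0 t).
{ intros t Ht.
  assert (I1 : ex_RInt (fun s => B (X s) s + c) 0 t) by (eapply field_ex_RInt; eauto).
  assert (Hb : forall n, Rabs (picard B c x (S n) t - (x + RInt (fun s => B (X s) s + c) 0 t)) <= T * L * (2 * A * (1 / 2) ^ n)).
  { intros n; simpl.
    assert (I2 : ex_RInt (fun s => B (picard B c x n s) s + c) 0 t).
    { eapply field_ex_RInt; [exact HB | intros; eapply picard_continuous; eauto]. }
    rewrite Rplus_minus_cancel.
    rewrite RInt_minus_R by assumption.
    assert (P2 : 0 < 2 * A * (1 / 2) ^ n) by (repeat apply Rmult_lt_0_compat; try lra; apply pow_lt; lra).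
    apply Rle_trans with ((t - 0) * (L * (2 * A * (1 / 2) ^ n))).
    - apply abs_RInt_le_const; [lra | now apply ex_RInt_minus_R | ].
      intros s Hs.
      replace (B (picard B c x n s) s + c - (B (X s) s + c)) with (B (picard B c x n s) s - B (X s) s) by ring.
      eapply Rle_trans; [apply HL | apply Rmult_le_compat_l; [lra | ]].
      rewrite HXY, <- Rabs_Ropp, Ropp_minus_distr by lra; apply HYn; lra.
    - rewrite (Rmult_assoc T L); apply Rmult_le_compat_r; [apply Rmult_le_pos; lra | lra]. }
  rewrite HXY by exact Ht.
  assert (U1 : is_lim_seq (fun n => picard B c x (S n) t) (Y t)) by (apply -> (is_lim_seq_incr_1 (fun n => picard B c x n t)); now apply HY).
  assert (U2 : is_lim_seq (fun n => picard B c x (S n) t - (x + RInt (fun s => B (X s) s + c) 0 t)) 0).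
  { apply is_lim_seq_abs_0.
    apply (is_lim_seq_le_le (fun _ => 0) _ (fun n => T * L * (2 * A * (1 / 2) ^ n))).
    - intros n; split; [apply Rabs_pos | apply Hb].
    - apply is_lim_seq_const.
    - replace (Finite 0) with (Rbar_mult (T * L) 0) by (simpl; f_equal; ring).
      now apply is_lim_seq_scal_l. }
  assert (U3 := is_lim_seq_minus' _ _ _ _ U1 U2).
  apply (is_lim_seq_ext _ (fun _ => x + RInt (fun s => B (X s) s + c) 0 t)) in U3; [ | intros; ring].
  apply is_lim_seq_unique in U3; rewrite Lim_seq_const in U3.
  injection U3; lra. }
exists X; split; [split; [exact CX | ] | ].
- intros t Ht.
  apply (is_derive_ext_loc (fun t => x + RInt (fun s => B (X s) s + c) 0 t)).
  + apply (locally_interval _ t 0 T); simpl; try lra.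
    intros s H1 H2; symmetry; apply Heq; lra.
  + replace (B (X t) t + c) with (plus 0 (B (X t) t + c)) by (unfold plus; simpl; ring).
    apply (is_derive_plus (V := R_NormedModule)); [auto_derive; auto | ].
    apply (is_derive_RInt (V := R_NormedModule) (fun s => B (X s) s + c) _ 0).
    * apply filter_forall; intros u; apply (RInt_correct (V := R_CompleteNormedModule)).
      eapply field_ex_RInt; eauto.
    * apply (continuous_plus (V := R_NormedModule)); [eapply field_comp_continuous; eauto | apply continuous_const].
- rewrite Heq by lra; rewrite RInt_point; unfold zero; simpl; ring.
Qed.

(** The Lipschitz constant shrinks the gap at most exponentially, while the excess of the constants
    feeds it. *)
Lemma orbit_gap B M L T c c' X Y a b : field_ok B M L -> orbit B T c X -> orbit B T c' Y ->
  c <= c' -> 0 <= a -> a <= b -> b <= T -> X a <= Y a ->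
  exp (- (L * (b - a))) * (Y a - X a + (c' - c) * (b - a)) <= Y b - X b.
Proof.
intros (_ & _ & HL & _ & L0) [CX DX] [CY DY] Hc Ha Hab Hb H.
apply (linear_comparison (fun t => Y t - X t) (fun t => (B (Y t) t + c') - (B (X t) t + c))); try lra.
- intros t; now apply (continuous_minus (V := R_NormedModule)).
- intros t Ht; apply (is_derive_minus (V := R_NormedModule)); [apply DY; lra | apply DX; lra].
- intros t Ht; specialize (HL (Y t) (X t) t); apply Rabs_le_between in HL; lra.
Qed.

(** [linear_comparison] applied to the difference between the exponential bound and [Z]. *)
Lemma gronwall (Z Z' : R -> R) T L kap t : 0 < L -> 0 <= kap -> 0 <= t <= T ->
  (forall t, continuous Z t) -> (forall t, 0 < t < T -> is_derive Z t (Z' t)) ->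
  (forall t, 0 < t < T -> Z' t <= kap + L * Rabs (Z t)) ->
  Z t <= exp (L * t) * (Rabs (Z 0) + kap * t).
Proof.
intros HL Hk Ht CZ DZ HZ.
set (G := fun s => exp (L * s) * (Rabs (Z 0) + kap * s)).
assert (PZ := Rabs_pos (Z 0)).
assert (E : exp (- (L * (t - 0))) * ((G 0 - Z 0) + 0 * (t - 0)) <= G t - Z t).
{ apply (linear_comparison (fun s => G s - Z s)
   (fun s => (L * exp (L * s) * (Rabs (Z 0) + kap * s) + exp (L * s) * kap) - Z' s)); try lra.
  - intros s; apply (continuous_minus (V := R_NormedModule)); [ | apply CZ].
    apply (ex_derive_continuous (V := R_NormedModule)); unfold G; auto_derive; auto.
  - intros s Hs; apply (is_derive_minus (V := R_NormedModule)); [ | apply DZ; lra].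
    unfold G; auto_derive; auto; ring.
  - intros s Hs; specialize (HZ s ltac:(lra)).
    assert (E := exp_ineq1_le (L * s)).
    assert (0 < L * s) by (apply Rmult_lt_0_compat; lra).
    assert (0 <= kap * s) by (apply Rmult_le_pos; lra).
    assert (kap * 1 <= exp (L * s) * kap) by (rewrite Rmult_comm; apply Rmult_le_compat_r; lra).
    assert (A : L * (Rabs (Z s) - G s) <= L * Rabs (G s - Z s)).
    { apply Rmult_le_compat_l; [lra | ].
      assert (T1 := Rabs_triang (Z s - G s) (G s)).
      replace (Z s - G s + G s) with (Z s) in T1 by ring.
      rewrite <- (Rabs_Ropp (Z s - G s)), Ropp_minus_distr in T1.
      assert (0 <= G s) by (unfold G; apply Rmult_le_pos; [left; apply exp_pos | lra]).
      rewrite (Rabs_pos_eq (G s)) in T1 by assumption; lra. }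
    assert (L * exp (L * s) * (Rabs (Z 0) + kap * s) = L * G s) by (unfold G; ring).
    lra.
  - unfold G; rewrite !Rmult_0_r, exp_0; assert (Q := Rle_abs (Z 0)); lra. }
assert (G0 : 0 <= G 0 - Z 0).
{ unfold G; rewrite !Rmult_0_r, exp_0; assert (Q := Rle_abs (Z 0)); lra. }
assert (0 <= exp (- (L * (t - 0))) * (G 0 - Z 0 + 0 * (t - 0))).
{ apply Rmult_le_pos; [left; apply exp_pos | lra]. }
unfold G in *; lra.
Qed.

Lemma orbit_gronwall B M L T c c' X Y t : field_ok B M L -> orbit B T c X -> orbit B T c' Y ->
  0 <= t <= T -> Rabs (Y t - X t) <= exp (L * t) * (Rabs (Y 0 - X 0) + Rabs (c' - c) * t).
Proof.
intros (_ & _ & HL & _ & L0) [CX DX] [CY DY] Ht.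
assert (A : forall s, Rabs (B (Y s) s - B (X s) s) <= L * Rabs (Y s - X s)) by (intros; apply HL).
assert (Pc := Rabs_pos (c' - c)).
apply Rabs_le; split.
- assert (H : - (Y t - X t) <= exp (L * t) * (Rabs (- (Y 0 - X 0)) + Rabs (c' - c) * t)); [ | rewrite Rabs_Ropp in H; lra].
  apply (gronwall (fun t => - (Y t - X t)) (fun t => - ((B (Y t) t + c') - (B (X t) t + c))) T); auto.
  + intros s; apply (continuous_opp (V := R_NormedModule)); now apply (continuous_minus (V := R_NormedModule)).
  + intros s Hs; apply (is_derive_opp (V := R_NormedModule)); apply (is_derive_minus (V := R_NormedModule)); auto.
  + intros s Hs; specialize (A s); apply Rabs_le_between in A; rewrite Rabs_Ropp.
    assert (Q := Rle_abs (- (c' - c))); rewrite Rabs_Ropp in Q; lra.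
- apply (gronwall (fun t => Y t - X t) (fun t => (B (Y t) t + c') - (B (X t) t + c)) T); auto.
  + intros s; now apply (continuous_minus (V := R_NormedModule)).
  + intros s Hs; apply (is_derive_minus (V := R_NormedModule)); auto.
  + intros s Hs; specialize (A s); apply Rabs_le_between in A.
    assert (Q := Rle_abs (c' - c)); lra.
Qed.

(* For every [x] there is a unique constant [c x] for which the orbit of the field [B + c x]
   through [x] is periodic. *)
Definition periodic_family (B : R -> R -> R) (T : R) (c : R -> R) (g : R -> R -> R) : Prop :=
  forall x, orbit B T (c x) (g x) /\ g x 0 = x /\ g x T = x.

Lemma orbit_derive_bound B M L T c X t : field_ok B M L -> orbit B T c X -> 0 <= t <= T ->
  (c - M) * t <= X t - X 0 <= (c + M) * t.
Proof.
intros (_ & HM & _) [CX DX] Ht; split.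
- assert (E : X 0 - (c - M) * 0 <= X t - (c - M) * t); [ | lra].
  apply (nondecreasing_of_derive (fun s => X s - (c - M) * s) (fun s => B (X s) s + c - (c - M))); [lra | | | ].
  + intros s _; apply (continuous_minus (V := R_NormedModule)); [apply CX | ].
    apply (ex_derive_continuous (V := R_NormedModule)); auto_derive; auto.
  + intros s Hs; apply (is_derive_minus (V := R_NormedModule)); [apply DX; lra | auto_derive; auto; ring].
  + intros s Hs; specialize (HM (X s) s); apply Rabs_le_between in HM; lra.
- assert (E : (c + M) * 0 - X 0 <= (c + M) * t - X t); [ | lra].
  apply (nondecreasing_of_derive (fun s => (c + M) * s - X s) (fun s => (c + M) - (B (X s) s + c))); [lra | | | ].
  + intros s _; apply (continuous_minus (V := R_NormedModule)); [ | apply CX].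
    apply (ex_derive_continuous (V := R_NormedModule)); auto_derive; auto.
  + intros s Hs; apply (is_derive_minus (V := R_NormedModule)); [auto_derive; auto; ring | apply DX; lra].
  + intros s Hs; specialize (HM (X s) s); apply Rabs_le_between in HM; lra.
Qed.

(** The end of the orbit from [x] depends continuously on the constant added to the field, and the
    constants [- M] and [M] push it to the two sides of [x]; an intermediate constant closes the
    orbit. *)
Lemma periodic_family_exists B M L T : field_ok B M L -> 0 < T ->
  exists c g, periodic_family B T c g.
Proof.
intros HB HT.
assert (HB' := HB); destruct HB' as (_ & HM & _ & M0 & L0).
assert (K : forall x, exists cX : R * (R -> R), orbit B T (fst cX) (snd cX) /\ snd cX 0 = x /\ snd cX T = x).
{ intros x.
  set (X := fun c => proj1_sig (constructive_indefinite_description _ (flow_exists B M L T c x HB HT))).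
  assert (HX : forall c, orbit B T c (X c) /\ X c 0 = x).
  { intros c; unfold X; destruct (constructive_indefinite_description _ (flow_exists B M L T c x HB HT)); auto. }
  assert (Cf : continuity (fun c => X c T)).
  { intros c; apply continuity_pt_filterlim.
    apply (filterlim_locally (F := locally c)); intros e.
    assert (Hd : 0 < e / (exp (L * T) * T)).
    { apply Rdiv_lt_0_compat; [apply cond_pos | apply Rmult_lt_0_compat; [apply exp_pos | lra]]. }
    exists (mkposreal _ Hd); intros c' Hc'.
    change (Rabs (c' - c) < e / (exp (L * T) * T)) in Hc'.
    change (Rabs (X c' T - X c T) < e).
    assert (G := orbit_gronwall B M L T c c' (X c) (X c') T HB (proj1 (HX c)) (proj1 (HX c')) ltac:(lra)).
    rewrite (proj2 (HX c)), (proj2 (HX c')), Rminus_diag, Rabs_R0, Rplus_0_l in G.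
    eapply Rle_lt_trans; [exact G | ].
    assert (P := exp_pos (L * T)).
    replace (pos e) with (exp (L * T) * (e / (exp (L * T) * T) * T)) by (field; lra).
    apply Rmult_lt_compat_l; [exact P | apply Rmult_lt_compat_r; lra]. }
  assert (B1 := orbit_derive_bound B M L T M (X M) T HB (proj1 (HX M)) ltac:(lra)).
  assert (B2 := orbit_derive_bound B M L T (- M) (X (- M)) T HB (proj1 (HX (- M))) ltac:(lra)).
  rewrite (proj2 (HX M)) in B1; rewrite (proj2 (HX (- M))) in B2.
  destruct (IVT_gen (fun c => X c T) (- M) M x Cf) as [c [_ Hc]].
  { rewrite Rmin_left, Rmax_right by lra; lra. }
  exists (c, X c); simpl; split; [apply HX | split; [apply HX | exact Hc]]. }
set (f := fun x => proj1_sig (constructive_indefinite_description _ (K x))).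
exists (fun x => fst (f x)), (fun x => snd (f x)).
intros x; unfold f; destruct (constructive_indefinite_description _ (K x)); auto.
Qed.

(** If [c y] exceeds [c x], the curve from [y] gains on the curve from [x] over a period by a
    definite multiple of the excess. But both curves close up, so the final offset is the initial
    one, and the excess is bounded by it. *)
Lemma family_speed_lipschitz B M L T c g : field_ok B M L -> 0 < T -> periodic_family B T c g ->
  exists C, 0 < C /\ forall x y, Rabs (c x - c y) <= C * Rabs (x - y).
Proof.
intros HB HT Hf.
assert (HB' := HB); destruct HB' as (_ & HM & HL & M0 & L0).
set (E := exp (L * T)). assert (PE : 0 < E) by apply exp_pos.
assert (E1 : 1 <= E).
{ assert (Q := exp_ineq1_le (L * T)); assert (0 < L * T) by (apply Rmult_lt_0_compat; lra); unfold E; lra. }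
assert (W : forall x y, c x <= c y -> c y - c x <= E * (1 + E) / T * Rabs (x - y)).
{ intros x y Hc.
  destruct (Hf x) as ([CX DX] & X0 & XT). destruct (Hf y) as ([CY DY] & Y0 & YT).
  (* the shift by [e^{Lt} |x-y|] makes the initial difference nonnegative *)
  assert (Q : exp (- (L * (T - 0))) * ((g y 0 - g x 0 + exp (L * 0) * Rabs (x - y)) + (c y - c x) * (T - 0))
     <= g y T - g x T + exp (L * T) * Rabs (x - y)).
  { apply (linear_comparison (fun t => g y t - g x t + exp (L * t) * Rabs (x - y))
      (fun t => ((B (g y t) t + c y) - (B (g x t) t + c x)) + L * exp (L * t) * Rabs (x - y))); try lra.
    - intros t; apply (continuous_plus (V := R_NormedModule)); [now apply (continuous_minus (V := R_NormedModule)) | ].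
      apply (ex_derive_continuous (V := R_NormedModule)); auto_derive; auto.
    - intros t Ht; apply (is_derive_plus (V := R_NormedModule)).
      + apply (is_derive_minus (V := R_NormedModule)); auto.
      + auto_derive; auto; ring.
    - intros t Ht; assert (A := HL (g y t) (g x t) t); apply Rabs_le_between in A.
      assert (P : 0 <= exp (L * t) * Rabs (x - y)) by (apply Rmult_le_pos; [left; apply exp_pos | apply Rabs_pos]).
      assert (A2 : L * Rabs (g y t - g x t) <= L * (Rabs (g y t - g x t + exp (L * t) * Rabs (x - y)) + exp (L * t) * Rabs (x - y))).
      { apply Rmult_le_compat_l; [lra | ].
        assert (T1 := Rabs_triang (g y t - g x t + exp (L * t) * Rabs (x - y)) (- (exp (L * t) * Rabs (x - y)))).
        rewrite Rabs_Ropp, (Rabs_pos_eq (exp (L * t) * Rabs (x - y))) in T1 by exact P.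
        replace (g y t - g x t + exp (L * t) * Rabs (x - y) + - (exp (L * t) * Rabs (x - y)))
          with (g y t - g x t) in T1 by ring; exact T1. }
      lra.
    - rewrite X0, Y0, Rmult_0_r, exp_0; assert (A := Rle_abs (x - y)); lra. }
  rewrite X0, Y0, XT, YT, Rmult_0_r, exp_0, Rminus_0_r in Q.
  fold E in Q; assert (EE : exp (- (L * T)) * E = 1).
  { unfold E; rewrite <- exp_plus, Rplus_opp_l; apply exp_0. }
  apply (Rmult_le_compat_l E) in Q; [ | lra].
  rewrite <- Rmult_assoc, (Rmult_comm E), EE, Rmult_1_l in Q.
  assert (A := Rle_abs (x - y)); assert (A' := Rle_abs (- (x - y))); rewrite Rabs_Ropp in A'.
  assert (A2 : E * (y - x + E * Rabs (x - y)) <= E * ((1 + E) * Rabs (x - y))) by (apply Rmult_le_compat_l; lra).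
  apply (Rmult_le_reg_r T); [lra | ].
  replace (E * (1 + E) / T * Rabs (x - y) * T) with (E * ((1 + E) * Rabs (x - y))) by (field; lra).
  lra. }
exists (E * (1 + E) / T); split.
{ apply Rdiv_lt_0_compat; [apply Rmult_lt_0_compat; lra | lra]. }
intros x y; destruct (Rle_dec (c x) (c y)) as [H | H].
- rewrite <- Rabs_Ropp, Ropp_minus_distr, Rabs_pos_eq by lra; now apply W.
- rewrite Rabs_pos_eq by lra; rewrite <- (Rabs_Ropp (x - y)), Ropp_minus_distr; apply W; lra.
Qed.

Lemma family_lipschitz B M L T c g : field_ok B M L -> 0 < T -> periodic_family B T c g ->
  exists C, 0 < C /\ forall x y t, 0 <= t <= T -> Rabs (g x t - g y t) <= C * Rabs (x - y).
Proof.
intros HB HT Hf.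
destruct (family_speed_lipschitz B M L T c g HB HT Hf) as [C [C0 HC]].
assert (HB' := HB); destruct HB' as (_ & HM & HL & M0 & L0).
exists (exp (L * T) * (1 + C * T)); split.
{ apply Rmult_lt_0_compat; [apply exp_pos | ]. assert (0 < C * T) by (apply Rmult_lt_0_compat; lra); lra. }
intros x y t Ht.
destruct (Hf x) as (OX & X0 & XT). destruct (Hf y) as (OY & Y0 & YT).
assert (G := orbit_gronwall B M L T _ _ _ _ t HB OY OX Ht).
rewrite X0, Y0 in G; eapply Rle_trans; [exact G | ].
rewrite Rmult_assoc; apply Rmult_le_compat; [left; apply exp_pos | | apply exp_monotone; nra | ].
- apply Rplus_le_le_0_compat; [apply Rabs_pos | apply Rmult_le_pos; [apply Rabs_pos | lra]].
- assert (A : Rabs (c x - c y) * t <= (C * Rabs (x - y)) * T).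
  { apply Rmult_le_compat; [apply Rabs_pos | lra | apply HC | lra]. }
  lra.
Qed.

(** If the curve from [y] has the larger constant, the order propagates forward from time 0. If not,
    a violation at time [t] would propagate to time [T], where the curves are back at [x] and
    [y]. *)
Lemma family_monotone B M L T c g x y t : field_ok B M L -> 0 < T -> periodic_family B T c g ->
  x <= y -> 0 <= t <= T -> g x t <= g y t.
Proof.
intros HB HT Hf Hxy Ht.
destruct (Hf x) as (OX & X0 & XT). destruct (Hf y) as (OY & Y0 & YT).
destruct (Rle_dec (c x) (c y)) as [H | H].
- assert (G := orbit_gap B M L T _ _ _ _ 0 t HB OX OY H ltac:(lra) ltac:(lra) ltac:(lra) ltac:(lra)).
  rewrite X0, Y0 in G.
  assert (0 <= exp (- (L * (t - 0))) * (y - x + (c y - c x) * (t - 0))); [ | lra].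
  apply Rmult_le_pos; [left; apply exp_pos | ].
  apply Rplus_le_le_0_compat; [lra | apply Rmult_le_pos; lra].
- apply Rnot_lt_le; intros N.
  assert (G := orbit_gap B M L T _ _ _ _ t T HB OY OX ltac:(lra) ltac:(lra) ltac:(lra) ltac:(lra) ltac:(lra)).
  rewrite XT, YT in G.
  assert (0 < exp (- (L * (T - t))) * (g x t - g y t + (c x - c y) * (T - t))); [ | lra].
  apply Rmult_lt_0_compat; [apply exp_pos | ].
  apply Rplus_lt_le_0_compat; [lra | apply Rmult_le_pos; lra].
Qed.

Lemma family_speed_bound B M L T c g x : field_ok B M L -> 0 < T -> periodic_family B T c g ->
  Rabs (c x) <= M.
Proof.
intros HB HT Hf; destruct (Hf x) as (OX & X0 & XT).
assert (A := orbit_derive_bound B M L T _ _ T HB OX ltac:(lra)).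
rewrite X0, XT, Rminus_diag in A; apply Rabs_le; split; apply Rnot_lt_le; intros N; nra.
Qed.

(** A closed curve has bounded excursion. Started far enough outside [0,1] it never enters, which is
    how a chain is made to run out of the interval. *)
Lemma family_near_start B M L T c g x t : field_ok B M L -> 0 < T -> periodic_family B T c g ->
  0 <= t <= T -> Rabs (g x t - x) <= 2 * M * T.
Proof.
intros HB HT Hf Ht; destruct (Hf x) as (OX & X0 & XT).
assert (A := orbit_derive_bound B M L T _ _ t HB OX Ht).
assert (S := family_speed_bound B M L T c g x HB HT Hf).
assert (HB' := HB); destruct HB' as (_ & _ & _ & M0 & L0).
rewrite X0 in A; apply Rabs_le_between in S.
assert ((c x + M) * t <= 2 * M * T) by (apply Rmult_le_compat; lra).
assert (- (2 * M * T) <= (c x - M) * t).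
{ assert ((M - c x) * t <= 2 * M * T) by (apply Rmult_le_compat; lra); lra. }
apply Rabs_le; lra.
Qed.

(** The flow crosses the closed curve [al] in the direction [s]. If the constant did not push back,
    the orbit starting on [al] would end the period on the side [s] of it and could not close. *)
Lemma family_speed_sign B M L T c g s (al al' : R -> R) kap : field_ok B M L -> 0 < T ->
  periodic_family B T c g -> (s = 1 \/ s = -1) -> 0 < kap ->
  (forall t, continuous al t) -> (forall t, 0 < t < T -> is_derive al t (al' t)) ->
  al T = al 0 ->
  (forall t, 0 < t < T -> kap <= s * (B (al t) t - al' t)) ->
  s * c (al 0) < 0.
Proof.
intros HB HT Hf Hs Hk Ca Da Hp Ha.
assert (HB' := HB); destruct HB' as (_ & _ & HL & M0 & L0).
destruct (Hf (al 0)) as ([CX DX] & X0 & XT).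
apply Rnot_le_lt; intros N.
assert (G : exp (- (L * (T - 0))) * (s * (g (al 0) 0 - al 0) + kap * (T - 0)) <= s * (g (al 0) T - al T)).
{ apply (linear_comparison (fun t => s * (g (al 0) t - al t)) (fun t => s * ((B (g (al 0) t) t + c (al 0)) - al' t))); try lra.
  - intros t; apply (continuous_scal_r (V := R_NormedModule) s); now apply (continuous_minus (V := R_NormedModule)).
  - intros t Ht; apply is_derive_scal; apply (is_derive_minus (V := R_NormedModule)); auto.
  - intros t Ht; specialize (Ha t Ht); assert (A := HL (g (al 0) t) (al t) t); apply Rabs_le_between in A.
    rewrite Rabs_mult; replace (Rabs s) with 1; [ | destruct Hs as [-> | ->]; split_Rabs; lra].
    destruct Hs as [-> | ->]; lra.
  - rewrite X0, Rminus_diag; lra. }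
rewrite X0, XT, Hp, !Rminus_diag, !Rmult_0_r, Rplus_0_l in G.
assert (0 < exp (- (L * (T - 0))) * (kap * (T - 0))).
{ apply Rmult_lt_0_compat; [apply exp_pos | apply Rmult_lt_0_compat; lra]. }
lra.
Qed.

(** * Chains of transversal curves between consecutive orbits *)

Lemma positive_lower_bound (f : R -> R) a b : a <= b ->
  (forall x, a <= x <= b -> continuous f x) -> (forall x, a <= x <= b -> 0 < f x) ->
  exists e, 0 < e /\ forall x, a <= x <= b -> e <= f x.
Proof.
intros Hab Cf Hf.
destruct (continuity_ab_min f a b Hab) as [z [Hz1 Hz2]].
{ intros x Hx; now apply continuity_pt_filterlim, Cf. }
exists (f z); split; [now apply Hf | exact Hz1].
Qed.

Lemma discrete_crossing (f : nat -> R) n y e :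
  f O <= y + e -> y <= f n -> (forall j, (j < n)%nat -> f (S j) <= f j + e) ->
  exists j, (j <= n)%nat /\ y <= f j <= y + e.
Proof.
induction n as [ | n IH]; intros H0 Hn Hs.
- exists O; split; [lia | lra].
- destruct (Rle_dec y (f n)) as [H | H].
  + destruct IH as [j [Hj Hfj]]; auto; exists j; split; [lia | exact Hfj].
  + exists (S n); split; [lia | ]. specialize (Hs n ltac:(lia)); lra.
Qed.

(** The curve moves with velocity [B + c], so time derivative and drift combine to
    [k s (B(x,t) - B(ga,t) - c)]. A constant [c] of sign opposite to [s] thus gives a gain
    proportional to the slope [k]. *)
Definition chain_piece (B : R -> R -> R) (s r k c : R) (ga : R -> R) : piece :=
  Piece (fun t => ga t - r) (fun t => ga t + r)
    (fun x t => k * (s * (x - ga t))) (fun _ t => - (k * (s * (B (ga t) t + c))))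
    (fun _ _ => k * s) (fun _ _ => 0).

Lemma chain_piece_regular B M L T s r k c ga : field_ok B M L -> orbit B T c ga ->
  ga T = ga 0 -> regular T (chain_piece B s r k c ga).
Proof.
intros HB [Cg Dg] Hp; split; [ | split]; simpl.
- split; [ | split].
  + intros t; apply (continuous_minus (V := R_NormedModule)); [apply Cg | apply continuous_const].
  + intros t; apply (continuous_plus (V := R_NormedModule)); [apply Cg | apply continuous_const].
  + intros x t; repeat apply continuity_2d_pt_mult; try apply continuity_2d_pt_const.
    apply continuity_2d_pt_minus; [apply continuity_2d_pt_id1 | now apply continuity_2d_of_t].
- intros x t Ht; split; [ | split; [ | split; [ | split; [ | split]]]].
  + replace (- (k * (s * (B (ga t) t + c)))) with (k * (s * (0 - (B (ga t) t + c)))) by ring.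
    apply (is_derive_scal (fun u => s * (x - ga u))), (is_derive_scal (fun u => x - ga u)).
    apply (is_derive_minus (V := R_NormedModule)); [apply (is_derive_const (V := R_NormedModule)) | now apply Dg].
  + auto_derive; auto; ring.
  + apply (is_derive_const (V := R_NormedModule)).
  + apply continuity_2d_of_t with (f := fun t => - (k * (s * (B (ga t) t + c)))).
    apply (continuous_opp (V := R_NormedModule)).
    apply (continuous_scal_r (V := R_NormedModule) k), (continuous_scal_r (V := R_NormedModule) s).
    apply (continuous_plus (V := R_NormedModule)); [ | apply continuous_const].
    eapply field_comp_continuous; eauto.
  + apply continuity_2d_pt_const.
  + apply continuity_2d_pt_const.
- rewrite Hp; repeat split; auto.
Qed.

(* The pieces of a chain oriented by [s] from the curve [ga] to the curve [gb]. Their levels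
   lie in [-Kmax r, Kmax r]; the only edges which no other piece of the chain covers are the
   outer ones. *)
Definition chain_spec (B : R -> R -> R) (T s : R) (ga gb : R -> R) (r eta K Kmax : R)
    (ch : list piece) : Prop :=
  (forall p, In p ch -> regular T p) /\
  (forall p x t, In p ch -> 0 <= t <= T -> in_tube p x t ->
     (forall D, 0 < D -> D * (Kmax * Kmax) <= 1 ->
        K * eta - 1 <= pwt p x t - D * (pwxx p x t + pwx p x t * pwx p x t) + B x t * pwx p x t) /\
     0 < s * pwx p x t /\ Rabs (pw p x t) <= Kmax * r /\
     s * ga t - r <= s * x <= s * gb t + r /\
     (plow p t < x < phigh p t \/ (exists k, In k ch /\ in_tube k x t /\ pw k x t < pw p x t) \/
      s * x = s * ga t - r \/ (s * x = s * gb t + r /\ K * r <= pw p x t))) /\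
  (forall x t, 0 <= t <= T -> s * ga t <= s * x -> s * x + r <= s * gb t ->
     exists p, In p ch /\ in_tube p x t /\ pw p x t <= - (K * r / 2)).

(** The curves start at equally spaced points, so densely that neighbours stay within [r / 4], and
    the slope is halved from each curve to the next. Halving makes each of two neighbours strictly
    lower on the edge of the other that faces it. The number of curves, hence the largest ratio
    [2 ^ J] of slopes, depends on the gap but not on [K]. *)
Lemma chain_exists B M L T c g s a b r0 : field_ok B M L -> 0 < T -> periodic_family B T c g ->
  (s = 1 \/ s = -1) -> s * a <= s * b -> 0 < r0 ->
  (forall x, s * a <= s * x <= s * b -> s * c x < 0) ->
  exists r eta Q, 0 < r <= r0 /\ 0 < eta /\ 1 <= Q /\
    forall K, 0 < K -> exists ch, chain_spec B T s (g a) (g b) r eta K (K * Q) ch.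
Proof.
intros HB HT Hf Hs Hab Hr0 Hc.
assert (HB' := HB); destruct HB' as (_ & HM & HL & M0 & L0).
assert (Hss : s * s = 1) by (destruct Hs as [-> | ->]; ring).
assert (Has : Rabs s = 1) by (destruct Hs as [-> | ->]; split_Rabs; lra).
destruct (family_speed_lipschitz B M L T c g HB HT Hf) as [C1 [C10 HC1]].
destruct (family_lipschitz B M L T c g HB HT Hf) as [C2 [C20 HC2]].
assert (exists eta, 0 < eta /\ forall x, s * a <= s * x <= s * b -> s * c x <= - eta) as [eta [He0 Heta]].
{ destruct (positive_lower_bound (fun z => - (s * c (s * z))) (s * a) (s * b)) as [e [He1 He2]]; auto.
  - intros z _; apply (filterlim_locally (F := locally z)); intros e.
    assert (Hd : 0 < e / C1) by (apply Rdiv_lt_0_compat; [apply cond_pos | lra]).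
    exists (mkposreal _ Hd); intros y Hy.
    change (Rabs (y - z) < e / C1) in Hy.
    change (Rabs (- (s * c (s * y)) - - (s * c (s * z))) < e).
    replace (- (s * c (s * y)) - - (s * c (s * z))) with (- (s * (c (s * y) - c (s * z)))) by ring.
    rewrite Rabs_Ropp, Rabs_mult, Has, Rmult_1_l.
    eapply Rle_lt_trans; [apply HC1 | ].
    replace (s * y - s * z) with (s * (y - z)) by ring; rewrite Rabs_mult, Has, Rmult_1_l.
    replace (pos e) with (C1 * (e / C1)) by (field; lra); apply Rmult_lt_compat_l; lra.
  - intros z Hz; assert (A := Hc (s * z)); rewrite <- Rmult_assoc, Hss, Rmult_1_l in A; specialize (A Hz); lra.
  - exists e; split; [exact He1 | intros x Hx; specialize (He2 (s * x) Hx)].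
    rewrite <- Rmult_assoc, Hss, Rmult_1_l in He2; lra. }
(* Within this radius the drift varies by at most [eta / 2], so half of the gain [eta] survives. *)
set (r := Rmin r0 (eta / (2 * L))).
assert (Hr : 0 < r) by (apply Rmin_glb_lt; [lra | apply Rdiv_lt_0_compat; lra]).
assert (Hr1 : r <= r0) by apply Rmin_l.
assert (Hr2 : r <= eta / (2 * L)) by apply Rmin_r.
assert (Hr3 : L * r <= eta / 2).
{ apply (Rmult_le_compat_l L) in Hr2; [ | lra]. replace (L * (eta / (2 * L))) with (eta / 2) in Hr2 by (field; lra); lra. }
clearbody r.
assert (exists J, (1 <= J)%nat /\ C2 * (Rabs (b - a) / INR J) <= r / 4) as [J [HJ1 HJ2]].
{ assert (P0 := Rabs_pos (b - a)).
  destruct (archimed (4 * C2 * Rabs (b - a) / r)) as [Ha _].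
  assert (Q0 : 0 <= 4 * C2 * Rabs (b - a) / r).
  { apply Rmult_le_pos; [ | left; now apply Rinv_0_lt_compat]. repeat apply Rmult_le_pos; lra. }
  assert (Z0 : (0 < up (4 * C2 * Rabs (b - a) / r))%Z) by (apply lt_IZR; lra).
  exists (Z.to_nat (up (4 * C2 * Rabs (b - a) / r))); split; [lia | ].
  rewrite INR_IZR_INZ, Z2Nat.id by lia.
  apply (Rmult_le_reg_r (IZR (up (4 * C2 * Rabs (b - a) / r)))); [lra | ].
  replace (C2 * (Rabs (b - a) / IZR (up (4 * C2 * Rabs (b - a) / r))) * IZR (up (4 * C2 * Rabs (b - a) / r)))
    with (r / 4 * (4 * C2 * Rabs (b - a) / r)) by (field; lra).
  apply Rmult_le_compat_l; lra. }
assert (HJ0 : 0 < INR J) by (apply lt_0_INR; lia).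
set (x_ := fun j : nat => a + (b - a) * (INR j / INR J)).
set (ga := fun j => g (x_ j)).
assert (Hx0 : x_ O = a) by (unfold x_; simpl; field; lra).
assert (HxJ : x_ J = b) by (unfold x_; field; lra).
assert (Hsx : forall i j, (i <= j)%nat -> s * x_ i <= s * x_ j).
{ intros i j Hij; apply le_INR in Hij; unfold x_.
  assert (INR i / INR J <= INR j / INR J) by (apply Rmult_le_compat_r; [left; now apply Rinv_0_lt_compat | lra]).
  assert ((s * b - s * a) * (INR i / INR J) <= (s * b - s * a) * (INR j / INR J)) by (apply Rmult_le_compat_l; lra).
  lra. }
assert (Hxin : forall j, (j <= J)%nat -> s * a <= s * x_ j <= s * b).
{ intros j Hj; assert (G1 := Hsx O j ltac:(lia)); assert (G2 := Hsx j J Hj).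
  rewrite Hx0 in G1; rewrite HxJ in G2; lra. }
assert (Hga : forall i j t, (i <= j)%nat -> 0 <= t <= T -> s * ga i t <= s * ga j t).
{ intros i j t Hij Ht; specialize (Hsx i j Hij); unfold ga; destruct Hs as [-> | ->].
  - rewrite !Rmult_1_l in *; now apply (family_monotone B M L T c g).
  - assert (g (x_ j) t <= g (x_ i) t) by (apply (family_monotone B M L T c g); auto; lra); lra. }
assert (Hstep : forall j t, 0 <= t <= T -> s * ga (S j) t - s * ga j t <= r / 4).
{ intros j t Ht; unfold ga; eapply Rle_trans; [ | exact HJ2].
  replace (s * g (x_ (S j)) t - s * g (x_ j) t) with (s * (g (x_ (S j)) t - g (x_ j) t)) by ring.
  eapply Rle_trans; [apply Rle_abs | ]; rewrite Rabs_mult, Has, Rmult_1_l.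
  eapply Rle_trans; [now apply HC2 | ].
  replace (x_ (S j) - x_ j) with ((b - a) / INR J) by (unfold x_; rewrite S_INR; field; lra).
  unfold Rdiv at 1; rewrite Rabs_mult, (Rabs_pos_eq (/ INR J)) by (left; now apply Rinv_0_lt_compat).
  unfold Rdiv; lra. }
exists r, (eta / 2), (2 ^ J); repeat split; auto; try lra.
{ apply pow_R1_Rle; lra. }
intros K HK.
set (k := fun j => K * 2 ^ (J - j)).
assert (Hk0 : forall j, K <= k j).
{ intros j; unfold k; rewrite <- (Rmult_1_r K) at 1; apply Rmult_le_compat_l; [lra | apply pow_R1_Rle; lra]. }
assert (HkQ : forall j, k j <= K * 2 ^ J).
{ intros j; unfold k; apply Rmult_le_compat_l; [lra | apply Rle_pow; [lra | lia]]. }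
assert (HkS : forall j, (j < J)%nat -> k j = 2 * k (S j)).
{ intros j Hj; unfold k; replace (J - j)%nat with (S (J - S j)) by lia; simpl; ring. }
assert (HkJ : k J = K) by (unfold k; rewrite Nat.sub_diag; simpl; ring).
set (pc := fun j => chain_piece B s r (k j) (c (x_ j)) (ga j)).
assert (Hin : forall p, In p (map pc (seq 0 (S J))) <-> exists j, (j <= J)%nat /\ p = pc j).
{ intros p; rewrite in_map_iff; split.
  - intros [j [<- Hj]]; apply in_seq in Hj; exists j; split; [lia | auto].
  - intros [j [Hj ->]]; exists j; split; [auto | apply in_seq; lia]. }
assert (Htube : forall j x t, in_tube (pc j) x t <-> - r <= s * (x - ga j t) <= r).
{ intros j x t; unfold in_tube, pc; simpl; destruct Hs as [-> | ->]; lra. }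
exists (map pc (seq 0 (S J))); split; [ | split].
- intros p Hp; apply Hin in Hp; destruct Hp as [j [Hj ->]].
  destruct (Hf (x_ j)) as (O & X0 & XT).
  eapply chain_piece_regular; eauto; unfold ga; lra.
- intros p x t Hp Ht Hd; apply Hin in Hp; destruct Hp as [j [Hj ->]]; apply Htube in Hd.
  specialize (Hk0 j); specialize (HkQ j).
  split; [ | split; [ | split; [ | split]]].
  + intros D HD HDK; unfold pc; simpl.
    assert (A := HL x (ga j t) t).
    assert (A2 : - (L * r) <= s * (B x t - B (ga j t) t)).
    { assert (Q : Rabs (s * (B x t - B (ga j t) t)) <= L * r).
      { rewrite Rabs_mult, Has, Rmult_1_l; eapply Rle_trans; [exact A | apply Rmult_le_compat_l; [lra | ]].
        rewrite <- (Rmult_1_l (Rabs (x - ga j t))), <- Has, <- Rabs_mult; now apply Rabs_le. }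
      apply Rabs_le_between in Q; lra. }
    specialize (Heta (x_ j) (Hxin j Hj)).
    assert (A3 : K * (eta / 2) <= k j * (s * (B x t - B (ga j t) t) - s * c (x_ j))).
    { apply Rmult_le_compat; lra. }
    assert (A4 : D * (k j * k j) <= 1).
    { eapply Rle_trans; [ | exact HDK]; apply Rmult_le_compat_l; [lra | apply Rmult_le_compat; lra]. }
    replace (D * (0 + k j * s * (k j * s))) with (D * (k j * k j) * (s * s)) by ring.
    rewrite Hss; lra.
  + unfold pc; simpl; replace (s * (k j * s)) with (k j * (s * s)) by ring; rewrite Hss; lra.
  + unfold pc; simpl; rewrite Rabs_mult, (Rabs_pos_eq (k j)) by lra.
    apply Rmult_le_compat; [lra | apply Rabs_pos | lra | now apply Rabs_le].
  + assert (G1 := Hga O j t ltac:(lia) Ht); assert (G2 := Hga j J t Hj Ht).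
    unfold ga in G1, G2; rewrite Hx0 in G1; rewrite HxJ in G2; fold (ga j) in G1, G2; lra.
  + destruct (Rlt_dec (- r) (s * (x - ga j t))) as [Hlo | Hlo];
    [destruct (Rlt_dec (s * (x - ga j t)) r) as [Hhi | Hhi] | ].
    * left; unfold pc; simpl; destruct Hs as [-> | ->]; lra.
    * right; assert (E : s * (x - ga j t) = r) by lra.
      destruct (Nat.eq_dec j J) as [-> | Nj].
      -- right; right; unfold pc; simpl; rewrite E, HkJ; split; [ | lra].
         unfold ga in E; rewrite HxJ in E; lra.
      -- left; exists (pc (S j)); split; [apply Hin; exists (S j); split; [lia | auto] | ].
         assert (G1 := Hga j (S j) t ltac:(lia) Ht); specialize (Hstep j t Ht).
         split; [apply Htube; lra | unfold pc; simpl; rewrite E, (HkS j) by lia].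
         assert (0 < k (S j)) by (rewrite (HkS j) in Hk0 by lia; lra).
         replace (2 * k (S j) * r) with (k (S j) * (2 * r)) by ring.
         apply Rmult_lt_compat_l; [assumption | lra].
    * right; assert (E : s * (x - ga j t) = - r) by lra.
      destruct j as [ | j].
      -- right; left; unfold ga in E; rewrite Hx0 in E; lra.
      -- left; exists (pc j); split; [apply Hin; exists j; split; [lia | auto] | ].
         assert (G1 := Hga j (S j) t ltac:(lia) Ht); specialize (Hstep j t Ht).
         split; [apply Htube; lra | unfold pc; simpl; rewrite E, (HkS j) by lia].
         assert (k (S j) * (2 * (s * (x - ga j t))) < k (S j) * - r) by (apply Rmult_lt_compat_l; lra).
         lra.
- intros x t Ht H1 H2.
  (* The curve sought lies between [r / 2] and [3 r / 4] ahead of [x]: inside the radius, yet far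
     enough for a definitely negative level. *)
  destruct (discrete_crossing (fun j => s * ga j t) J (s * x + r / 2) (r / 4)) as [j [Hj Hfj]].
  + unfold ga; rewrite Hx0; lra.
  + unfold ga; rewrite HxJ; lra.
  + intros j _; specialize (Hstep j t Ht); lra.
  + exists (pc j); split; [apply Hin; eauto | split; [apply Htube; lra | ]].
    unfold pc; simpl; specialize (Hk0 j).
    assert (k j * (r / 2) <= k j * - (s * (x - ga j t))) by (apply Rmult_le_compat_l; lra).
    assert (K * (r / 2) <= k j * (r / 2)) by (apply Rmult_le_compat_r; lra).
    lra.
Qed.

(** * Periodic solutions of scalar linear equations *)

Definition smooth_t (T : R) (f f' : R -> R) : Prop :=
  (forall t, continuous f t) /\ (forall t, 0 < t < T -> is_derive f t (f' t)) /\
  (forall t, 0 < t < T -> continuous f' t) /\ f T = f 0.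

Ltac eqR := match goal with |- @eq _ ?a ?b => change (@eq R a b) end.

Lemma ex_RInt_cont (f : R -> R) a b : (forall t, continuous f t) -> ex_RInt f a b.
Proof. intros H; apply (ex_RInt_continuous (V := R_CompleteNormedModule)); auto. Qed.

Lemma is_derive_primitive (q : R -> R) t : (forall t, continuous q t) ->
  is_derive (fun t => RInt q 0 t) t (q t).
Proof.
intros Cq; apply (is_derive_RInt (V := R_NormedModule) q _ 0); [ | apply Cq].
apply filter_forall; intros u; apply (RInt_correct (V := R_CompleteNormedModule)).
now apply ex_RInt_cont.
Qed.

Lemma RInt_pt (f : R -> R) a : RInt f a a = 0.
Proof. exact (RInt_point (V := R_CompleteNormedModule) a f). Qed.

Lemma RInt_cst a b c : RInt (fun _ => c) a b = (b - a) * c.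
Proof. exact (RInt_const (V := R_CompleteNormedModule) a b c). Qed.

(** Supplies the time factor of the test functions: it absorbs the deviation of a coefficient from
    its mean, so that only the mean enters the eigenvalue bound. *)
Lemma periodic_primitive (q : R -> R) T : (forall t, continuous q t) -> RInt q 0 T = 0 ->
  exists l, smooth_t T l q.
Proof.
intros Cq H0; exists (fun t => RInt q 0 t); split; [ | split; [ | split]].
- intros t; apply (ex_derive_continuous (V := R_NormedModule)); eexists; now apply is_derive_primitive.
- intros t _; now apply is_derive_primitive.
- auto.
- rewrite H0, RInt_pt; reflexivity.
Qed.

Lemma RInt_minus_const (q : R -> R) T v : (forall t, continuous q t) -> RInt q 0 T = v * T ->
  RInt (fun t => v - q t) 0 T = 0.
Proof.
intros Cq H.
rewrite <- (RInt_minus_R (fun _ => v) q); [ | apply ex_RInt_const | now apply ex_RInt_cont].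
rewrite RInt_cst, H; eqR; ring.
Qed.

Lemma Derive_eta (f : R -> R) t d : is_derive f t d -> Derive (fun s : R => f s) t = d.
Proof. exact (is_derive_unique f t d). Qed.

(** The integrating factor [exp (2 Q)] solves the equation, and [u0] is the fixed point of the
    period map. The integral of [1 / u] comes from integrating [(ln u)' = c / u - 2 q] over a
    period; this is how the width [D u(t)] of a test function brings the mean contraction rate into
    the bounds. *)
Lemma periodic_linear_ode (q : R -> R) T c : 0 < T -> 0 < c -> (forall t, continuous q t) ->
  0 < RInt q 0 T ->
  exists u, smooth_t T u (fun t => c - 2 * q t * u t) /\ (forall t, 0 < u t) /\
    RInt (fun t => / u t) 0 T = 2 * RInt q 0 T / c.
Proof.
intros HT Hc Cq Hq.
set (Q := fun t => RInt q 0 t).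
assert (DQ : forall t, is_derive Q t (q t)) by (intros; now apply is_derive_primitive).
assert (CQ : forall t, continuous Q t).
{ intros t; apply (ex_derive_continuous (V := R_NormedModule)); eexists; apply DQ. }
assert (Q0 : Q 0 = 0) by apply RInt_pt.
assert (QT : 0 < Q T) by exact Hq.
assert (QTe : Q T = RInt q 0 T) by reflexivity.
clearbody Q.
set (E := fun t => exp (2 * Q t)).
assert (DE : forall t, is_derive E t (2 * q t * E t)).
{ intros t; unfold E; auto_derive; [eexists; apply DQ | ].
  rewrite (Derive_eta Q t _ (DQ t)); ring. }
assert (CE : forall t, continuous E t).
{ intros t; apply (ex_derive_continuous (V := R_NormedModule)); eexists; apply DE. }
assert (PE : forall t, 0 < E t) by (intros; apply exp_pos).
assert (E0 : E 0 = 1) by (unfold E; rewrite Q0, Rmult_0_r; apply exp_0).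
assert (ET : 1 < E T).
{ rewrite <- E0; unfold E; apply exp_increasing; rewrite Q0; lra. }
clearbody E.
set (I := fun t => RInt E 0 t).
assert (DI : forall t, is_derive I t (E t)) by (intros; now apply is_derive_primitive).
assert (I0 : I 0 = 0) by apply RInt_pt.
assert (IP : forall t, 0 <= t -> 0 <= I t).
{ intros t Ht; unfold I; apply RInt_ge_0; [exact Ht | now apply ex_RInt_cont | intros; left; apply PE]. }
assert (IT : 0 < I T).
{ unfold I; apply RInt_gt_0; [exact HT | intros; apply PE | intros; apply CE]. }
clearbody I.
set (u0 := c * I T / (E T - 1)).
assert (Hu0 : 0 < u0) by (unfold u0; apply Rdiv_lt_0_compat; [apply Rmult_lt_0_compat; lra | lra]).
set (v := fun t => (u0 + c * I t) / E t).
assert (Pv : forall t, 0 <= t -> 0 < v t).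
{ intros t Ht; unfold v; apply Rdiv_lt_0_compat; [ | apply PE].
  assert (0 <= c * I t) by (apply Rmult_le_pos; [lra | now apply IP]); lra. }
assert (Dv : forall t, is_derive v t (c - 2 * q t * v t)).
{ intros t; assert (P := PE t); unfold v; auto_derive.
  - split; [eexists; apply DI | split; [eexists; apply DE | split; [lra | auto]]].
  - rewrite (Derive_eta I t _ (DI t)), (Derive_eta E t _ (DE t)); field; lra. }
assert (Cv : forall t, continuous v t).
{ intros t; apply (ex_derive_continuous (V := R_NormedModule)); eexists; apply Dv. }
assert (vT : v T = v 0).
{ unfold v; rewrite I0, E0; unfold u0; field; assert (P := PE T); lra. }
exists (fun t => v (clamp 0 T t)); split; [split; [ | split; [ | split]] | split].
- intros t; apply continuous_comp; [apply clamp_continuous; lra | apply Cv].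
- intros t Ht; rewrite clamp_id by lra.
  apply (is_derive_ext_loc v); [ | apply Dv].
  apply (locally_interval _ t 0 T); simpl; try lra.
  intros s H1 H2; rewrite clamp_id; auto; lra.
- intros t Ht; apply (continuous_minus (V := R_NormedModule)); [apply continuous_const | ].
  apply (continuous_mult (K := R_AbsRing)).
  + apply (continuous_scal_r (V := R_NormedModule) 2), Cq.
  + apply continuous_comp; [apply clamp_continuous; lra | apply Cv].
- rewrite !clamp_id by lra; exact vT.
- intros t; apply Pv, clamp_in; lra.
- rewrite (RInt_ext _ (fun t => / v t)).
  2:{ intros t Ht; rewrite Rmin_left, Rmax_right in Ht by lra; rewrite clamp_id; auto; lra. }
  assert (W : is_RInt (fun t => c * / v t - 2 * q t) 0 T (minus (ln (v T)) (ln (v 0)))).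
  { apply (is_RInt_derive (V := R_CompleteNormedModule) (fun t => ln (v t))).
    - intros t Ht; rewrite Rmin_left, Rmax_right in Ht by lra.
      assert (P := Pv t ltac:(lra)); auto_derive; [split; [eexists; apply Dv | split; [exact P | auto]] | ].
      rewrite (Derive_eta v t _ (Dv t)); field; lra.
    - intros t Ht; rewrite Rmin_left, Rmax_right in Ht by lra.
      assert (P := Pv t ltac:(lra)).
      apply (continuous_minus (V := R_NormedModule)).
      + apply (continuous_scal_r (V := R_NormedModule) c); apply continuous_comp; [apply Cv | apply continuous_Rinv; lra].
      + apply (continuous_scal_r (V := R_NormedModule) 2), Cq. }
  apply (is_RInt_unique (V := R_CompleteNormedModule)) in W; rewrite vT in W.
  assert (Iv : ex_RInt (fun t => / v t) 0 T).
  { apply (ex_RInt_continuous (V := R_CompleteNormedModule)); intros t Ht.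
    rewrite Rmin_left, Rmax_right in Ht by lra; assert (P := Pv t ltac:(lra)).
    apply continuous_comp; [apply Cv | apply continuous_Rinv; lra]. }
  assert (Iq : ex_RInt q 0 T) by now apply ex_RInt_cont.
  rewrite (RInt_ext _ (fun t => c * / v t + (-2) * q t)) in W by (intros; eqR; ring).
  rewrite (proj2 (RInt_lin (fun t => / v t) q 0 T c (-2) Iv Iq)) in W.
  unfold minus, plus, opp in W; simpl in W; rewrite Rplus_opp_r in W.
  change (c * RInt (fun t => / v t) 0 T + -2 * RInt q 0 T = 0) in W.
  assert (H : forall a b d : R, c * a + -2 * b = 0 -> d = b -> a = 2 * d / c).
  { intros a b d H1 ->; apply (Rmult_eq_reg_l c); [ | lra]; field_simplify; lra. }
  exact (H _ _ _ W QTe).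
Qed.

(** * Test functions near an orbit *)

Lemma smooth_continuous_2d T f f' x t : smooth_t T f f' -> continuity_2d_pt (fun _ s => f s) x t.
Proof. intros H; apply continuity_2d_of_t, H. Qed.

Lemma smooth_continuous_2d' T f f' x t : smooth_t T f f' -> 0 < t < T ->
  continuity_2d_pt (fun _ s => f' s) x t.
Proof. intros H Ht; now apply continuity_2d_of_t, H. Qed.

Lemma smooth_ex T f f' t : smooth_t T f f' -> 0 < t < T -> ex_derive f t.
Proof. intros H Ht; eexists; now apply H. Qed.

Lemma smooth_Derive T f f' t : smooth_t T f f' -> 0 < t < T -> Derive (fun s => f s) t = f' t.
Proof. intros H Ht; now apply is_derive_unique, H. Qed.

Ltac cont2d := repeat first
  [ assumption | apply continuity_2d_pt_const | apply continuity_2d_pt_id1 | apply continuity_2d_pt_id2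
  | eapply smooth_continuous_2d; eassumption
  | eapply smooth_continuous_2d'; eassumption
  | apply continuity_2d_pt_plus | apply continuity_2d_pt_minus | apply continuity_2d_pt_opp
  | apply continuity_2d_pt_mult ].

Lemma continuity_2d_exp f x t : continuity_2d_pt f x t -> continuity_2d_pt (fun x t => exp (f x t)) x t.
Proof.
intros H; apply (continuity_1d_2d_pt_comp exp f); [ | exact H].
apply derivable_continuous_pt, derivable_pt_exp.
Qed.

Lemma continuity_2d_ln f x t : 0 < f x t -> continuity_2d_pt f x t ->
  continuity_2d_pt (fun x t => ln (f x t)) x t.
Proof.
intros P H; apply (continuity_1d_2d_pt_comp ln f); [ | exact H].
apply derivable_continuous_pt; exists (/ f x t); now apply derivable_pt_lim_ln.
Qed.

Lemma continuity_2d_div f g x t : g x t <> 0 -> continuity_2d_pt f x t -> continuity_2d_pt g x t ->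
  continuity_2d_pt (fun x t => f x t / g x t) x t.
Proof.
intros P Hf Hg; apply continuity_2d_pt_mult; [exact Hf | now apply continuity_2d_pt_inv].
Qed.

(** The shift [e] of the vertex will be zero at interior orbits and point into the interval at an
    endpoint, where it gives the boundary slope its strict sign. The constant [A] puts the levels
    near the centre and on the edges on opposite sides of 0. *)
Definition source_super (A K e d : R) (l l' P P' : R -> R) : piece :=
  Piece (fun t => P t - d) (fun t => P t + d)
   (fun x t => A + l t + K * ((x - P t - e) * (x - P t - e)))
   (fun x t => l' t - 2 * K * (x - P t - e) * P' t)
   (fun x t => 2 * K * (x - P t - e)) (fun _ _ => 2 * K).

Lemma tube_regular T P P' d : smooth_t T P P' ->
  (forall t, continuous (fun t => P t - d) t) /\ (forall t, continuous (fun t => P t + d) t).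
Proof.
intros HP; split; intros t.
- apply (continuous_minus (V := R_NormedModule)); [apply HP | apply continuous_const].
- apply (continuous_plus (V := R_NormedModule)); [apply HP | apply continuous_const].
Qed.

Lemma source_super_regular T A K e d l l' P P' : smooth_t T l l' -> smooth_t T P P' ->
  regular T (source_super A K e d l l' P P').
Proof.
intros Hl HP; split; [ | split]; simpl.
- split; [ | split]; [apply (tube_regular T P P' d HP) | apply (tube_regular T P P' d HP) | ].
  intros x t; cont2d.
- intros x t Ht; split; [ | split; [ | split; [ | split; [ | split]]]].
  + auto_derive; [repeat split; auto; eapply smooth_ex; eauto | ].
    rewrite (smooth_Derive T l l'), (smooth_Derive T P P') by assumption; ring.
  + auto_derive; auto; ring.
  + auto_derive; auto; ring.
  + cont2d.
  + cont2d.
  + cont2d.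
- destruct Hl as (_ & _ & _ & El); destruct HP as (_ & _ & _ & EP); rewrite El, EP; auto.
Qed.

(** The drift helps, since the flow leaves the orbit. The losses from the shift and from diffusion
    are explicit, and small once [K] is fixed. *)
Lemma source_super_ineq D K e d M2 eps v l' V VP B P' y : 0 < K -> 0 < D -> Rabs y <= d ->
  l' = v - VP -> VP - eps <= V -> 0 <= y * (B - P') -> Rabs (B - P') <= M2 ->
  v - eps - 2 * K * (Rabs e * M2) - D * (2 * K + 4 * K * K * ((d + Rabs e) * (d + Rabs e)))
  <= (l' - 2 * K * (y - e) * P') - D * (2 * K + (2 * K * (y - e)) * (2 * K * (y - e)))
     + B * (2 * K * (y - e)) + V.
Proof.
intros HK HD Hy -> HV HB HM.
assert (A1 : e * (B - P') <= Rabs e * M2).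
{ eapply Rle_trans; [apply Rle_abs | rewrite Rabs_mult; apply Rmult_le_compat_l; [apply Rabs_pos | exact HM]]. }
assert (A2 : (y - e) * (y - e) <= (d + Rabs e) * (d + Rabs e)).
{ assert (Q : Rabs (y - e) <= d + Rabs e).
  { unfold Rminus; eapply Rle_trans; [apply Rabs_triang | rewrite Rabs_Ropp; lra]. }
  replace ((y - e) * (y - e)) with (Rabs (y - e) * Rabs (y - e)) by (rewrite <- Rabs_mult; apply Rabs_pos_eq, Rle_0_sqr).
  apply Rmult_le_compat; auto; apply Rabs_pos. }
assert (A3 : 2 * K * (e * (B - P')) <= 2 * K * (Rabs e * M2)) by (apply Rmult_le_compat_l; lra).
assert (A4 : 0 <= 2 * K * (y * (B - P'))) by (apply Rmult_le_pos; lra).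
assert (A5 : (D * (4 * K * K)) * ((y - e) * (y - e)) <= (D * (4 * K * K)) * ((d + Rabs e) * (d + Rabs e))).
{ apply Rmult_le_compat_l; [ | exact A2]; repeat apply Rmult_le_pos; lra. }
lra.
Qed.

Definition sink_super (D p d : R) (l l' u u' P P' : R -> R) : piece :=
  Piece (fun t => P t - d) (fun t => P t + d)
   (fun x t => l t - p * ln (D * u t + (x - P t) * (x - P t)))
   (fun x t => l' t - p * ((D * u' t - 2 * (x - P t) * P' t) / (D * u t + (x - P t) * (x - P t))))
   (fun x t => - (2 * p) * ((x - P t) / (D * u t + (x - P t) * (x - P t))))
   (fun x t => - (2 * p) * ((D * u t - (x - P t) * (x - P t)) /
      ((D * u t + (x - P t) * (x - P t)) * (D * u t + (x - P t) * (x - P t))))).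

Lemma sink_super_regular T D p d l l' u u' P P' : 0 < D -> smooth_t T l l' -> smooth_t T P P' ->
  smooth_t T u u' -> (forall t, 0 < u t) -> regular T (sink_super D p d l l' u u' P P').
Proof.
intros HD Hl HP Hu Pu.
assert (PQ : forall x t, 0 < D * u t + (x - P t) * (x - P t)).
{ intros x t; assert (0 < D * u t) by (apply Rmult_lt_0_compat; auto).
  assert (Q := Rle_0_sqr (x - P t)); unfold Rsqr in Q; lra. }
assert (CQ : forall x t, continuity_2d_pt (fun x t => D * u t + (x - P t) * (x - P t)) x t) by (intros; cont2d).
split; [ | split]; simpl.
- split; [ | split]; [apply (tube_regular T P P' d HP) | apply (tube_regular T P P' d HP) | ].
  intros x t; cont2d; apply (continuity_2d_ln (fun x t => D * u t + (x - P t) * (x - P t))); auto.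
- intros x t Ht; assert (PQ' := PQ x t); split; [ | split; [ | split; [ | split; [ | split]]]].
  + auto_derive; [repeat split; auto; eapply smooth_ex; eauto | ].
    rewrite (smooth_Derive T l l'), (smooth_Derive T P P'), (smooth_Derive T u u') by assumption; field; lra.
  + auto_derive; [auto | field; lra].
  + auto_derive; [lra | field; lra].
  + apply continuity_2d_pt_minus; [cont2d | apply continuity_2d_pt_mult; [cont2d | ]].
    apply (continuity_2d_div (fun x t => D * u' t - 2 * (x - P t) * P' t)); [lra | cont2d | auto].
  + apply continuity_2d_pt_mult; [cont2d | ].
    apply (continuity_2d_div (fun x t => x - P t)); [lra | cont2d | auto].
  + apply continuity_2d_pt_mult; [cont2d | ].
    apply (continuity_2d_div (fun x t => D * u t - (x - P t) * (x - P t))); [ | cont2d | ].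
    * assert (0 < (D * u t + (x - P t) * (x - P t)) * (D * u t + (x - P t) * (x - P t))) by now apply Rmult_lt_0_compat.
      lra.
    * apply continuity_2d_pt_mult; auto.
- destruct Hl as (_ & _ & _ & El); destruct HP as (_ & _ & _ & EP); destruct Hu as (_ & _ & _ & Eu).
  rewrite El, EP, Eu; auto.
Qed.

(** Put [z = D u / Q] with [Q = D u + y y], so [y y = Q (1 - z)]. With the constant [4 p + 6] in the
    equation of [u] and the term [4 p (p + 1) / u] in [l'], what diffusion and the motion of [u]
    leave is the perfect square [4 p (p + 1) (1 - z)^2 / u], the nonnegative term [A2]. *)
Lemma sink_super_ineq D p q eps v l' u u' V VP B P' y : 0 < D -> 0 < p -> 0 < u ->
  u' = (4 * p + 6) - 2 * q * u -> q * (y * y) <= - (y * (B - P')) ->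
  l' = v - VP - (2 * p * q - 4 * p * (p + 1) / u) -> VP - eps <= V ->
  v - eps <= (l' - p * ((D * u' - 2 * y * P') / (D * u + y * y)))
    - D * (- (2 * p) * ((D * u - y * y) / ((D * u + y * y) * (D * u + y * y)))
         + - (2 * p) * (y / (D * u + y * y)) * (- (2 * p) * (y / (D * u + y * y))))
    + B * (- (2 * p) * (y / (D * u + y * y))) + V.
Proof.
intros HD Hp Hu -> HB -> HV.
set (Q := D * u + y * y).
assert (PQ : 0 < Q) by (assert (0 < D * u) by (apply Rmult_lt_0_compat; lra); unfold Q; nra).
assert (EQ : y * y = Q - D * u) by (unfold Q; ring).
assert (A1 : p * (2 * (- (y * (B - P')) - q * (y * y))) / Q >= 0).
{ apply Rle_ge; apply Rmult_le_pos; [apply Rmult_le_pos; lra | left; now apply Rinv_0_lt_compat]. }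
assert (A2 : 0 <= 4 * p * (p + 1) * ((y * y) * (y * y) / (u * (Q * Q)))).
{ apply Rmult_le_pos; [apply Rmult_le_pos; lra | ].
  apply Rmult_le_pos; [nra | left; apply Rinv_0_lt_compat; repeat apply Rmult_lt_0_compat; lra]. }
match goal with |- _ <= ?rhs => assert (E : rhs - (v - eps) =
  p * (2 * (- (y * (B - P')) - q * (y * y))) / Q + 4 * p * (p + 1) * ((y * y) * (y * y) / (u * (Q * Q)))
   + (V - (VP - eps))) end.
{ clearbody Q. rewrite EQ; clear A1 A2.
  replace (B * (- (2 * p) * (y / Q))) with (P' * (- (2 * p) * (y / Q)) + (- 2 * p * (y * (B - P')) / Q)) by (field; lra).
  replace (- (2 * p) * (y / Q) * (- (2 * p) * (y / Q))) with (4 * p * p * (y * y) / (Q * Q)) by (field; lra).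
  rewrite EQ; field; lra. }
lra.
Qed.

Definition source_sub (e d : R) (l l' P P' : R -> R) : piece :=
  Piece (fun t => P t - 2 * d) (fun t => P t + 2 * d)
   (fun x t => exp (l t) * (1 - (x - P t - e) * (x - P t - e) / (d * d)))
   (fun x t => exp (l t) * (l' t * (1 - (x - P t - e) * (x - P t - e) / (d * d))
       + 2 * (x - P t - e) * P' t / (d * d)))
   (fun x t => exp (l t) * (- 2 * (x - P t - e) / (d * d)))
   (fun x t => exp (l t) * (- 2 / (d * d))).

Lemma source_sub_regular T e d l l' P P' : 0 < d -> smooth_t T l l' -> smooth_t T P P' ->
  regular T (source_sub e d l l' P P').
Proof.
intros Hd Hl HP.
assert (Hdd : d * d <> 0) by (assert (0 < d * d) by (apply Rmult_lt_0_compat; lra); lra).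
assert (Ce : forall x t, continuity_2d_pt (fun _ t => exp (l t)) x t).
{ intros x t; apply (continuity_2d_exp (fun _ t => l t)); cont2d. }
split; [ | split]; simpl.
- split; [ | split]; [apply (tube_regular T P P' (2 * d) HP) | apply (tube_regular T P P' (2 * d) HP) | ].
  intros x t; unfold Rdiv; apply continuity_2d_pt_mult; [apply Ce | cont2d].
- intros x t Ht; split; [ | split; [ | split; [ | split; [ | split]]]].
  + auto_derive; [repeat split; auto; eapply smooth_ex; eauto | ].
    rewrite (smooth_Derive T l l'), (smooth_Derive T P P') by assumption; field; lra.
  + auto_derive; [auto | field; lra].
  + auto_derive; [auto | field; lra].
  + unfold Rdiv; apply continuity_2d_pt_mult; [apply Ce | cont2d].
  + unfold Rdiv; apply continuity_2d_pt_mult; [apply Ce | cont2d].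
  + unfold Rdiv; apply continuity_2d_pt_mult; [apply Ce | cont2d].
- destruct Hl as (_ & _ & _ & El); destruct HP as (_ & _ & _ & EP); rewrite El, EP; auto.
Qed.

(** Where the profile is at least 1/2, the slack [eps] pays for diffusion and for the shift.
    Elsewhere the profile may be tiny, but there [y * y] is at least [3 * (d * d) / 16] and the
    outward drift pays. *)
Lemma source_sub_ineq D e d M2 kap eps v E l' V VP B P' y : 0 < D -> 0 < d -> 0 < E -> 0 < eps -> 0 < kap ->
  l' = v - VP -> V <= VP + eps -> kap * (y * y) <= y * (B - P') -> Rabs (B - P') <= M2 ->
  Rabs e <= d / 4 -> 2 * (Rabs e * M2) + 2 * D <= eps * (d * d) / 2 ->
  2 * (Rabs e * M2) + 2 * D <= 3 * kap * (d * d) / 8 ->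
  0 < 1 - (y - e) * (y - e) / (d * d) ->
  E * (l' * (1 - (y - e) * (y - e) / (d * d)) + 2 * (y - e) * P' / (d * d))
   - D * (E * (- 2 / (d * d))) + B * (E * (- 2 * (y - e) / (d * d)))
   + V * (E * (1 - (y - e) * (y - e) / (d * d)))
  <= (v + 2 * eps) * (E * (1 - (y - e) * (y - e) / (d * d))).
Proof.
intros HD Hd HE Heps Hk -> HV HB HM He H1 H2 HS.
assert (Hdd : 0 < d * d) by now apply Rmult_lt_0_compat.
set (S := 1 - (y - e) * (y - e) / (d * d)) in *.
assert (ES : (y - e) * (y - e) = (1 - S) * (d * d)) by (unfold S; field; lra).
assert (A1 : e * (B - P') <= Rabs e * M2).
{ eapply Rle_trans; [apply Rle_abs | rewrite Rabs_mult; apply Rmult_le_compat_l; [apply Rabs_pos | exact HM]]. }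
assert (A2 : e * e <= (d * d) / 16).
{ replace (e * e) with (Rabs e * Rabs e) by (rewrite <- Rabs_mult; apply Rabs_pos_eq, Rle_0_sqr).
  assert (Pe := Rabs_pos e); replace (d * d / 16) with (d / 4 * (d / 4)) by field.
  apply Rmult_le_compat; lra. }
assert (A3 : (1 - S) * (d * d) <= 2 * (y * y) + 2 * (e * e)).
{ rewrite <- ES; assert (Q := Rle_0_sqr (y + e)); unfold Rsqr in Q; lra. }
assert (A4 : (V - VP - 2 * eps) * S <= - eps * S) by (apply Rmult_le_compat_r; lra).
assert (Fin : (V - VP - 2 * eps) * S * (d * d) - 2 * ((y - e) * (B - P')) + 2 * D <= 0).
{ assert (A5 : (V - VP - 2 * eps) * S * (d * d) <= - eps * S * (d * d)) by (apply Rmult_le_compat_r; lra).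
  destruct (Rle_dec (1 / 2) S) as [Y | Y].
  - assert (eps * (d * d) * (1 / 2) <= eps * (d * d) * S) by (apply Rmult_le_compat_l; [apply Rmult_le_pos; lra | lra]).
    assert (0 <= kap * (y * y)) by (apply Rmult_le_pos; [lra | apply Rle_0_sqr]).
    lra.
  - assert (d * d * (1 / 2) <= d * d * (1 - S)) by (apply Rmult_le_compat_l; lra).
    assert (kap * (3 * (d * d) / 16) <= kap * (y * y)) by (apply Rmult_le_compat_l; lra).
    assert (0 <= eps * S * (d * d)) by (repeat apply Rmult_le_pos; lra).
    lra. }
apply Rminus_le.
match goal with |- ?a <= 0 => replace a with
  (E * / (d * d) * ((V - VP - 2 * eps) * S * (d * d) - 2 * ((y - e) * (B - P')) + 2 * D)) by (field; lra) end.
assert (0 <= E * / (d * d)) by (apply Rmult_le_pos; [lra | left; now apply Rinv_0_lt_compat]).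
assert (0 <= (E * / (d * d)) * - ((V - VP - 2 * eps) * S * (d * d) - 2 * ((y - e) * (B - P')) + 2 * D)) by (apply Rmult_le_pos; lra).
lra.
Qed.

(** For a drift linear about the orbit, the Gaussian of variance [D u], with [u' = 2 - 2 q u], is an
    exact solution up to a factor depending on time, which [l] compensates. Subtracting [c] cuts its
    support down to a width of order the square root of [D]. *)
Definition sink_sub (D c d : R) (l l' u u' P P' : R -> R) : piece :=
  Piece (fun t => P t - d) (fun t => P t + d)
   (fun x t => exp (l t) * (exp (- ((x - P t) * (x - P t) / (2 * D * u t))) - c))
   (fun x t => exp (l t) * (l' t * (exp (- ((x - P t) * (x - P t) / (2 * D * u t))) - c)
      + exp (- ((x - P t) * (x - P t) / (2 * D * u t))) *
        ((x - P t) * (x - P t) * u' t / (2 * D * (u t * u t)) + (x - P t) * P' t / (D * u t))))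
   (fun x t => exp (l t) * (exp (- ((x - P t) * (x - P t) / (2 * D * u t))) * (- ((x - P t) / (D * u t)))))
   (fun x t => exp (l t) * (exp (- ((x - P t) * (x - P t) / (2 * D * u t))) *
        ((x - P t) * (x - P t) / (D * D * (u t * u t)) - 1 / (D * u t)))).

Lemma sink_sub_regular T D c d l l' u u' P P' : 0 < D -> smooth_t T l l' -> smooth_t T P P' ->
  smooth_t T u u' -> (forall t, 0 < u t) -> regular T (sink_sub D c d l l' u u' P P').
Proof.
intros HD Hl HP Hu Pu.
assert (Ce : forall x t, continuity_2d_pt (fun _ t => exp (l t)) x t).
{ intros x t; apply (continuity_2d_exp (fun _ t => l t)); cont2d. }
assert (N : forall a b, 0 < a -> 0 < b -> a * b <> 0).
{ intros a b Ha Hb; assert (0 < a * b) by (apply Rmult_lt_0_compat; lra); lra. }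
assert (CG : forall x t, continuity_2d_pt (fun x t => exp (- ((x - P t) * (x - P t) / (2 * D * u t)))) x t).
{ intros x t; apply (continuity_2d_exp (fun x t => - ((x - P t) * (x - P t) / (2 * D * u t)))).
  apply continuity_2d_pt_opp.
  apply (continuity_2d_div (fun x t => (x - P t) * (x - P t)) (fun _ t => 2 * D * u t)); [ | cont2d | cont2d].
  apply N; [lra | apply Pu]. }
split; [ | split]; simpl.
- split; [ | split]; [apply (tube_regular T P P' d HP) | apply (tube_regular T P P' d HP) | ].
  intros x t; apply continuity_2d_pt_mult; [apply Ce | cont2d; apply CG].
- intros x t Ht; assert (Put := Pu t); split; [ | split; [ | split; [ | split; [ | split]]]].
  + auto_derive.
    * repeat match goal with |- _ /\ _ => split end; try exact I;
        first [eapply smooth_ex; eassumption | apply N; lra].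
    * rewrite (smooth_Derive T l l'), (smooth_Derive T P P'), (smooth_Derive T u u') by assumption.
      unfold Rminus, Rdiv; set (G := exp (- (_ * _ * / _))); field; lra.
  + auto_derive; [auto | unfold Rminus, Rdiv; set (G := exp (- (_ * _ * / _))); field; lra].
  + auto_derive; [auto | unfold Rminus, Rdiv; set (G := exp (- (_ * _ * / _))); field; lra].
  + apply continuity_2d_pt_mult; [apply Ce | ].
    apply continuity_2d_pt_plus; [cont2d; apply CG | apply continuity_2d_pt_mult; [apply CG | ]].
    apply continuity_2d_pt_plus.
    * apply (continuity_2d_div (fun x t => (x - P t) * (x - P t) * u' t) (fun _ t => 2 * D * (u t * u t))); [ | cont2d | cont2d].
      apply N; [lra | now apply Rmult_lt_0_compat].
    * apply (continuity_2d_div (fun x t => (x - P t) * P' t) (fun _ t => D * u t)); [ | cont2d | cont2d].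
      apply N; lra.
  + apply continuity_2d_pt_mult; [apply Ce | ].
    apply continuity_2d_pt_mult; [apply CG | apply continuity_2d_pt_opp].
    apply (continuity_2d_div (fun x t => x - P t) (fun _ t => D * u t)); [ | cont2d | cont2d].
    apply N; lra.
  + apply continuity_2d_pt_mult; [apply Ce | ].
    apply continuity_2d_pt_mult; [apply CG | apply continuity_2d_pt_minus].
    * apply (continuity_2d_div (fun x t => (x - P t) * (x - P t)) (fun _ t => D * D * (u t * u t))); [ | cont2d | cont2d].
      apply N; now apply Rmult_lt_0_compat.
    * apply (continuity_2d_div (fun x t => 1) (fun _ t => D * u t)); [ | cont2d | cont2d].
      apply N; lra.
- destruct Hl as (_ & _ & _ & El); destruct HP as (_ & _ & _ & EP); destruct Hu as (_ & _ & _ & Eu).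
  rewrite El, EP, Eu; auto.
Qed.

(* If [y^2/(D u)] is large the drift term pays for the cut-off constant [c]; otherwise the
   Gaussian is bounded below independently of [D]. *)
Lemma sink_sub_ineq D c q e' eps v E l' u u' V VP B P' y M3 : 0 < D -> 0 < E -> 0 < u -> 0 < eps -> 0 < e' -> 0 < M3 ->
  u' = 2 - 2 * q * u -> - (y * (B - P')) <= (q - e') * (y * y) ->
  l' = v - VP - 1 / u -> V <= VP + eps -> - (l' + V - (v + 2 * eps)) <= M3 ->
  0 < c -> c * M3 <= eps * exp (- (M3 / (2 * e'))) ->
  c < exp (- (y * y / (2 * D * u))) ->
  E * (l' * (exp (- (y * y / (2 * D * u))) - c)
      + exp (- (y * y / (2 * D * u))) * (y * y * u' / (2 * D * (u * u)) + y * P' / (D * u)))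
  - D * (E * (exp (- (y * y / (2 * D * u))) * (y * y / (D * D * (u * u)) - 1 / (D * u))))
  + B * (E * (exp (- (y * y / (2 * D * u))) * (- (y / (D * u)))))
  + V * (E * (exp (- (y * y / (2 * D * u))) - c))
  <= (v + 2 * eps) * (E * (exp (- (y * y / (2 * D * u))) - c)).
Proof.
intros HD HE Hu Heps He' HM3 -> HB -> HV HM Hc Hc2 HG.
set (Y := y * y / (D * u)).
assert (EY : y * y / (2 * D * u) = Y / 2) by (unfold Y; field; lra).
rewrite EY in *.
set (G := exp (- (Y / 2))) in *.
set (R0 := v - VP - 1 / u + V - (v + 2 * eps)) in *.
assert (PG : 0 < G) by apply exp_pos.
assert (PDu : 0 < D * u) by now apply Rmult_lt_0_compat.
assert (A1 : (- (y * (B - P')) - (q - e') * (y * y)) / (D * u) <= 0).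
{ assert (0 <= - (- (y * (B - P')) - (q - e') * (y * y)) * / (D * u)).
  { apply Rmult_le_pos; [lra | left; now apply Rinv_0_lt_compat]. }
  unfold Rdiv; lra. }
assert (A2 : G * (- eps - e' * Y) + c * M3 <= 0).
{ destruct (Rle_dec M3 (e' * Y)) as [H | H].
  - assert (G * (- eps - e' * Y) <= G * - M3) by (apply Rmult_le_compat_l; lra).
    assert (M3 * c <= M3 * G) by (apply Rmult_le_compat_l; lra). lra.
  - assert (YY : Y <= M3 / e').
    { apply (Rmult_le_reg_l e'); [exact He' | ]; replace (e' * (M3 / e')) with M3 by (field; lra); lra. }
    assert (EG : exp (- (M3 / (2 * e'))) <= G).
    { unfold G; apply exp_monotone; replace (M3 / (2 * e')) with (M3 / e' / 2) by (field; lra); lra. }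
    assert (eps * exp (- (M3 / (2 * e'))) <= eps * G) by (apply Rmult_le_compat_l; lra).
    assert (PY : 0 <= Y) by (unfold Y; apply Rmult_le_pos; [apply Rle_0_sqr | left; now apply Rinv_0_lt_compat]).
    assert (0 <= G * (e' * Y)) by (apply Rmult_le_pos; [lra | apply Rmult_le_pos; lra]).
    lra. }
assert (A3 : - c * R0 <= c * M3).
{ replace (- c * R0) with (c * - R0) by ring; apply Rmult_le_compat_l; lra. }
assert (A4 : R0 + 1 / u + (- (y * (B - P')) - (q - e') * (y * y)) / (D * u) - e' * Y <= - eps - e' * Y).
{ unfold R0; lra. }
apply (Rmult_le_compat_l G) in A4; [ | lra].
apply Rminus_le.
match goal with |- ?a <= 0 => replace a with
  (E * (G * (R0 + 1 / u + (- (y * (B - P')) - (q - e') * (y * y)) / (D * u) - e' * Y) - c * R0)) end.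
2:{ unfold R0; replace Y with (y * y / (D * u)) by reflexivity; clearbody G; field; lra. }
assert (0 <= E * - (G * (R0 + 1 / u + (- (y * (B - P')) - (q - e') * (y * y)) / (D * u) - e' * Y) - c * R0)).
{ apply Rmult_le_pos; lra. }
lra.
Qed.

(** * Upper bounds *)

Lemma ext_uniform T f eps : 0 < T -> cont_cylinder T f -> 0 < eps ->
  exists d, 0 < d /\ forall x y t, 0 <= x <= 1 -> 0 <= y <= 1 -> 0 <= t <= T ->
    Rabs (x - y) <= d -> Rabs (ext T f x t - ext T f y t) <= eps.
Proof.
intros HT Hf He.
destruct (uniform_continuity_2d (ext T f) 0 1 0 T (fun x t _ _ => ext_continuous T f x t HT Hf) (mkposreal eps He))
  as [d Hd]; simpl in Hd.
assert (Pd := cond_pos d); exists (d / 2); split; [lra | intros x y t Hx Hy Ht Hxy]; left.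
apply Hd; auto; [lra | rewrite Rminus_diag, Rabs_R0; exact Pd].
Qed.

Lemma field_of_potential T mx mxx : 0 < T -> cont_cylinder T mx -> cont_cylinder T mxx ->
  (forall t, deriv_unit (fun x => mx x t) (fun x => mxx x t)) ->
  exists M L, field_ok (fun x t => - ext T mx x t) M L.
Proof.
intros HT Hmx Hmxx Hd.
destruct (ext_bounded T mx HT Hmx) as [M [M0 HM]].
destruct (ext_bounded T mxx HT Hmxx) as [L [L0 HL]].
assert (W : forall x y t, 0 <= x <= 1 -> 0 <= y <= 1 -> 0 <= t <= T -> x <= y ->
   Rabs (ext T mx x t - ext T mx y t) <= L * Rabs (x - y)).
{ intros x y t Hx Hy Ht Hxy.
  assert (D : forall s z, 0 < z < 1 -> is_derive (fun z => s * ext T mx z t) z (s * ext T mxx z t)).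
  { intros s z Hz; apply is_derive_scal, ext_is_derive_x; auto. }
  assert (C : forall z, continuous (fun z => ext T mx z t) z).
  { intros z; apply (continuous_slice_x (ext T mx)); now apply ext_continuous. }
  assert (G : forall s, (s = 1 \/ s = -1) -> L * x - s * ext T mx x t <= L * y - s * ext T mx y t).
  { intros s Hs; apply (nondecreasing_of_derive (fun z => L * z - s * ext T mx z t) (fun z => L - s * ext T mxx z t)); [exact Hxy | | | ].
    - intros z _; apply (continuous_minus (V := R_NormedModule)).
      + apply (continuous_scal_r (V := R_NormedModule) L), continuous_id.
      + apply (continuous_scal_r (V := R_NormedModule) s), C.
    - intros z Hz; apply (is_derive_minus (V := R_NormedModule)); [auto_derive; auto; ring | apply D; lra].
    - intros z Hz; specialize (HL z t); apply Rabs_le_between in HL; destruct Hs as [-> | ->]; lra. }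
  assert (G1 := G 1 (or_introl eq_refl)); assert (G2 := G (-1) (or_intror eq_refl)).
  rewrite <- (Rabs_Ropp (x - y)), (Rabs_pos_eq (- (x - y))) by lra; apply Rabs_le; lra. }
exists M, L; repeat split; auto.
- intros x t; apply continuity_2d_pt_opp; now apply ext_continuous.
- intros x t; rewrite Rabs_Ropp; apply HM.
- intros x y t.
  replace (- ext T mx x t - - ext T mx y t) with (- (ext T mx x t - ext T mx y t)) by ring.
  rewrite Rabs_Ropp.
  assert (Ct := clamp_in 0 T t ltac:(lra)). assert (Cx := clamp_in 0 1 x ltac:(lra)). assert (Cy := clamp_in 0 1 y ltac:(lra)).
  assert (E : forall z, ext T mx z t = ext T mx (clamp 0 1 z) (clamp 0 T t)).
  { intros z; unfold ext; rewrite (clamp_id 0 T (clamp 0 T t)), (clamp_id 0 1 (clamp 0 1 z)); auto; apply clamp_in; lra. }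
  rewrite (E x), (E y); apply Rle_trans with (L * Rabs (clamp 0 1 x - clamp 0 1 y)).
  + destruct (Rle_dec (clamp 0 1 x) (clamp 0 1 y)); [now apply W | ].
    rewrite <- Rabs_Ropp, Ropp_minus_distr, <- (Rabs_Ropp (clamp 0 1 x - clamp 0 1 y)), Ropp_minus_distr.
    apply W; auto; lra.
  + apply Rmult_le_compat_l; [lra | apply clamp_lip; lra].
Qed.

(* [sg = 0]: an orbit inside (0,1);  [sg = 1]: the endpoint 0;  [sg = -1]: the endpoint 1. *)
Definition placed (T : R) (P : R -> R) (d sg : R) : Prop :=
  (sg = 0 /\ forall t, 0 <= t <= T -> 2 * d < P t < 1 - 2 * d) \/
  (sg = 1 /\ 2 * d < 1 /\ forall t, P t = 0) \/
  (sg = -1 /\ 2 * d < 1 /\ forall t, P t = 1).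

Lemma placed_range T P d sg t : 0 < d -> placed T P d sg -> 0 <= t <= T -> 0 <= P t <= 1.
Proof.
intros Hd [[_ H] | [(_ & H1 & H) | (_ & H1 & H)]] Ht; [specialize (H t Ht) | rewrite H | rewrite H]; lra.
Qed.

Lemma placed_shrink T P d d' sg : d' <= d -> placed T P d sg -> placed T P d' sg.
Proof.
intros Hd [[E H] | [(E & H1 & H) | (E & H1 & H)]]; [left | right; left | right; right].
- split; [exact E | intros t Ht; specialize (H t Ht); lra].
- repeat split; auto; lra.
- repeat split; auto; lra.
Qed.

(** Relative to the curve the flow moves away at least at a linear rate. In this form the condition
    also covers an inflow endpoint, where the drift does not vanish on the curve. *)
Definition source_node (T : R) (B : R -> R -> R) (P P' : R -> R) (d kap : R) : Prop :=
  smooth_t T P P' /\ 0 < d /\ 0 < kap /\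
  (forall x t, 0 <= x <= 1 -> 0 <= t <= T -> Rabs (x - P t) <= 2 * d ->
     kap * ((x - P t) * (x - P t)) <= (x - P t) * (B x t - P' t)) /\
  exists M2, 0 < M2 /\ forall x t, 0 <= x <= 1 -> 0 <= t <= T -> Rabs (B x t - P' t) <= M2.

(** [k] is the contraction rate, exact to within any [e] close to the orbit. The upper bound of the
    eigenvalue uses one of the two inequalities, the lower bound the other. *)
Definition sink_node (T : R) (B : R -> R -> R) (P P' k : R -> R) : Prop :=
  smooth_t T P P' /\ (forall t, continuous k t) /\ (exists k0, 0 < k0 /\ forall t, 0 <= t <= T -> k0 <= k t) /\
  forall e, 0 < e -> exists d, 0 < d /\
    forall x t, 0 <= x <= 1 -> 0 <= t <= T -> Rabs (x - P t) <= d ->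
     (k t - e) * ((x - P t) * (x - P t)) <= - ((x - P t) * (B x t - P' t)) <=
     (k t + e) * ((x - P t) * (x - P t)).

Lemma source_node_shrink T B P P' d d' kap : 0 < d' -> d' <= d -> source_node T B P P' d kap ->
  source_node T B P P' d' kap.
Proof.
intros H0 Hd (HP & Hd0 & Hk & H & HM); split; [exact HP | split; [exact H0 | split; [exact Hk | split; [ | exact HM]]]].
intros x t Hx Ht Hxt; apply H; auto; lra.
Qed.

Lemma V_curve_continuous T V P P' t : 0 < T -> cont_cylinder T V -> smooth_t T P P' ->
  continuous (fun t => ext T V (P t) t) t.
Proof.
intros HT HV HP.
apply (continuity_2d_slice_t (fun _ t => ext T V (P t) t) 0).
apply (continuity_2d_comp (ext T V) (fun _ t => P t) (fun _ t => t)).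
- now apply ext_continuous.
- apply continuity_2d_of_t, HP.
- apply continuity_2d_pt_id2.
Qed.

Lemma mean_mul (I T : R) : T <> 0 -> I = / T * I * T.
Proof. intros H; field; exact H. Qed.

Lemma exists_small (a b : R) : 0 < a -> 0 <= b -> exists d, 0 < d /\ forall x, 0 < x -> x <= d -> x * b <= a.
Proof.
intros Ha Hb; exists (a / (b + 1)); split; [apply Rdiv_lt_0_compat; lra | intros x Hx Hxd].
apply Rle_trans with (a / (b + 1) * (b + 1)); [ | right; field; lra].
apply Rmult_le_compat; lra.
Qed.

Lemma eigenvalue_le_source T mx V P P' d kap sg eps : 0 < T -> 0 < eps ->
  cont_cylinder T mx -> cont_cylinder T V ->
  source_node T (fun x t => - ext T mx x t) P P' d kap -> placed T P d sg ->
  exists D0, 0 < D0 /\ forall D l phi phix, 0 < D -> D < D0 ->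
    eigenpair T D mx V l phi phix -> l <= / T * RInt (fun t => ext T V (P t) t) 0 T + eps.
Proof.
intros HT Heps Hmx HV Hsrc Hpl.
set (v := / T * RInt (fun t => ext T V (P t) t) 0 T).
destruct (ext_uniform T V (eps / 2) HT HV) as [d1 [Hd1 HVu]]; [lra | ].
set (d2 := Rmin d (d1 / 2)).
assert (R1 : d2 <= d) by apply Rmin_l. assert (R2 : d2 <= d1 / 2) by apply Rmin_r.
assert (Hd0 : 0 < d) by apply Hsrc.
assert (Hd2 : 0 < d2) by (apply Rmin_glb_lt; lra).
apply (source_node_shrink _ _ _ _ _ d2) in Hsrc; auto.
apply (placed_shrink _ _ _ d2) in Hpl; auto.
clearbody d2; clear d Hd0 R1.
destruct Hsrc as (HP & _ & Hk & Hsrc & [M2 [HM20 HM2]]).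
assert (Cq : forall t, continuous (fun t => ext T V (P t) t) t).
{ intros t; eapply V_curve_continuous; eauto. }
destruct (periodic_primitive (fun t => v - ext T V (P t) t) T) as [l0 Hl0].
{ intros t; apply (continuous_minus (V := R_NormedModule)); [apply continuous_const | apply Cq]. }
{ apply RInt_minus_const; [exact Cq | apply mean_mul; lra]. }
assert (Hdd : 0 < d2 * d2) by now apply Rmult_lt_0_compat.
(* The smaller of the two budgets in [source_sub_ineq]; [D] and the cost of the shift are each
   allowed a quarter of it. *)
set (h := Rmin (eps / 2 * (d2 * d2) / 2) (3 * kap * (d2 * d2) / 8)).
assert (Hh : 0 < h).
{ apply Rmin_glb_lt; [ | repeat apply Rmult_lt_0_compat; lra].
  apply Rmult_lt_0_compat; [apply Rmult_lt_0_compat; lra | lra]. }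
assert (Hh1 : h <= eps / 2 * (d2 * d2) / 2) by apply Rmin_l.
assert (Hh2 : h <= 3 * kap * (d2 * d2) / 8) by apply Rmin_r.
clearbody h.
destruct (exists_small (h / 4) M2) as [e1 [He1 He1']]; [lra | lra | ].
set (e0 := Rmin e1 (d2 / 4)).
assert (E1 : e0 <= e1) by apply Rmin_l. assert (E2 : e0 <= d2 / 4) by apply Rmin_r.
assert (E0 : 0 < e0) by (apply Rmin_glb_lt; lra).
specialize (He1' e0 E0 E1); clearbody e0.
assert (Hsg : Rabs (sg * e0) <= e0).
{ rewrite Rabs_mult, (Rabs_pos_eq e0) by lra.
  rewrite <- (Rmult_1_l e0) at 2; apply Rmult_le_compat_r; [lra | ].
  destruct Hpl as [[-> _] | [[-> _] | [-> _]]]; split_Rabs; lra. }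
exists (h / 4); split; [lra | intros D l phi phix HD HDh Heig].
apply (eigenvalue_le T D mx V l phi phix _
  (source_sub (sg * e0) d2 l0 (fun t => v - ext T V (P t) t) P P') HT HD Hmx HV Heig).
- apply source_sub_regular; auto.
- exists (P 0); split; [ | split].
  + apply (placed_range T P d2 sg); auto; lra.
  + unfold in_tube; simpl; lra.
  + simpl; apply Rmult_lt_0_compat; [apply exp_pos | ].
    replace (P 0 - P 0 - sg * e0) with (- (sg * e0)) by ring.
    assert (A : (sg * e0) * (sg * e0) <= e0 * e0).
    { replace (sg * e0 * (sg * e0)) with (Rabs (sg * e0) * Rabs (sg * e0)) by (rewrite <- Rabs_mult; apply Rabs_pos_eq, Rle_0_sqr).
      apply Rmult_le_compat; auto; apply Rabs_pos. }
    assert (B : e0 * e0 <= d2 / 4 * (d2 / 4)) by (apply Rmult_le_compat; lra).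
    apply (Rmult_lt_reg_r (d2 * d2)); [exact Hdd | ].
    replace ((1 - - (sg * e0) * - (sg * e0) / (d2 * d2)) * (d2 * d2)) with (d2 * d2 - sg * e0 * (sg * e0)) by (field; lra).
    lra.
- intros x t Hx Ht Htube Hpos.
  unfold in_tube in Htube; simpl in Htube, Hpos.
  assert (HS : 0 < 1 - (x - P t - sg * e0) * (x - P t - sg * e0) / (d2 * d2)).
  { apply (Rmult_lt_reg_l (exp (l0 t))); [apply exp_pos | lra]. }
  (* Positivity confines [x] to distance [d2] from the vertex, well inside the tube of half-width
     [2 * d2]. *)
  assert (Hz : Rabs (x - P t - sg * e0) < d2).
  { apply (Rmult_lt_compat_r (d2 * d2)) in HS; [ | exact Hdd].
    replace ((1 - (x - P t - sg * e0) * (x - P t - sg * e0) / (d2 * d2)) * (d2 * d2))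
      with (d2 * d2 - (x - P t - sg * e0) * (x - P t - sg * e0)) in HS by (field; lra).
    apply Rabs_def1; nra. }
  assert (Hy : Rabs (x - P t) < 2 * d2).
  { replace (x - P t) with ((x - P t - sg * e0) + sg * e0) by ring.
    eapply Rle_lt_trans; [apply Rabs_triang | lra]. }
  assert (Hy' := Hy); apply Rabs_def2 in Hy'.
  unfold subsolution_point; simpl.
  destruct (Req_dec x 0) as [-> | Nx0]; [ | destruct (Req_dec x 1) as [-> | Nx1]].
  + right; left; destruct Hpl as [[_ Hp] | [(-> & _ & Hp) | (_ & H1 & Hp)]].
    * specialize (Hp t Ht); lra.
    * rewrite Hp; split; [auto | split; [lra | ]].
      apply Rmult_lt_0_compat; [apply exp_pos | ].
      replace (-2 * (0 - 0 - 1 * e0) / (d2 * d2)) with (2 * e0 / (d2 * d2)) by (field; lra).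
      apply Rdiv_lt_0_compat; lra.
    * rewrite Hp in Hy'; lra.
  + right; right; destruct Hpl as [[_ Hp] | [(_ & H1 & Hp) | (-> & _ & Hp)]].
    * specialize (Hp t Ht); lra.
    * rewrite Hp in Hy'; lra.
    * rewrite Hp; split; [auto | split; [lra | ]].
      replace (-2 * (1 - 1 - -1 * e0) / (d2 * d2)) with (- (2 * e0 / (d2 * d2))) by (field; lra).
      assert (0 < exp (l0 t) * (2 * e0 / (d2 * d2))); [ | lra].
      apply Rmult_lt_0_compat; [apply exp_pos | apply Rdiv_lt_0_compat; lra].
  + left; split; [lra | split; [lra | ]].
    assert (Hr := placed_range T P d2 sg t Hd2 Hpl Ht).
    assert (HVc := HVu x (P t) t Hx Hr Ht ltac:(lra)); apply Rabs_le_between in HVc.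
    assert (Q := source_sub_ineq D (sg * e0) d2 M2 kap (eps / 2) v (exp (l0 t))
      (v - ext T V (P t) t) (ext T V x t) (ext T V (P t) t) (- ext T mx x t) (P' t) (x - P t) HD Hd2 (exp_pos _)
      ltac:(lra) Hk eq_refl ltac:(lra) (Hsrc x t Hx Ht ltac:(lra)) (HM2 x t Hx Ht) ltac:(lra)).
    rewrite !ext_id in Q by lra. rewrite ext_id by lra.
    assert (A : Rabs (sg * e0) * M2 <= h / 4).
    { eapply Rle_trans; [ | exact He1']; apply Rmult_le_compat_r; lra. }
    specialize (Q ltac:(lra) ltac:(lra) HS); lra.
Qed.

Lemma continuous_bounded (f : R -> R) T : 0 <= T -> (forall t, continuous f t) ->
  exists C, 0 < C /\ forall t, 0 <= t <= T -> Rabs (f t) <= C.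
Proof.
intros HT Cf.
destruct (continuity_ab_maj (fun t => Rabs (f t)) 0 T HT) as [z [Hz _]].
{ intros t _; apply continuity_pt_filterlim; apply continuous_comp; [apply Cf | apply (continuous_Rabs)]. }
exists (Rabs (f z) + 1); split; [assert (P := Rabs_pos (f z)); lra | intros t Ht; specialize (Hz t Ht); simpl in Hz; lra].
Qed.

Lemma eigenvalue_le_sink T mx V P P' k d eps : 0 < T -> 0 < eps -> 0 < d ->
  cont_cylinder T mx -> cont_cylinder T V ->
  sink_node T (fun x t => - ext T mx x t) P P' k -> placed T P d 0 ->
  exists D0, 0 < D0 /\ forall D l phi phix, 0 < D -> D < D0 ->
    eigenpair T D mx V l phi phix ->
    l <= / T * RInt (fun t => ext T V (P t) t) 0 T + / T * RInt k 0 T + eps.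
Proof.
intros HT Heps Hd0 Hmx HV (HP & Ck & [k0 [Hk0 Hk]] & Hsink) Hpl.
set (v0 := / T * RInt (fun t => ext T V (P t) t) 0 T).
set (kb := / T * RInt k 0 T).
destruct (ext_uniform T V (eps / 4) HT HV) as [d1 [Hd1 HVu]]; [lra | ].
destruct (Hsink (eps / 4)) as [d2 [Hd2 Hs2]]; [lra | ].
set (d3 := Rmin d (Rmin d1 d2)).
assert (R1 : d3 <= d) by apply Rmin_l.
assert (R2 : d3 <= d1) by (eapply Rle_trans; [apply Rmin_r | apply Rmin_l]).
assert (R3 : d3 <= d2) by (eapply Rle_trans; [apply Rmin_r | apply Rmin_r]).
assert (Hd3 : 0 < d3) by (repeat apply Rmin_glb_lt; lra).
clearbody d3.
apply (placed_shrink _ _ _ d3) in Hpl; auto.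
assert (Hpl' : forall t, 0 <= t <= T -> 2 * d3 < P t < 1 - 2 * d3).
{ destruct Hpl as [[_ H] | [(H & _) | (H & _)]]; [exact H | lra | lra]. }
(* The rate is overestimated by [eps / 2] while the drift is known up to [eps / 4]; the difference
   is the [e'] of [sink_sub_ineq]. *)
set (q := fun t => k t + eps / 2).
assert (Cq : forall t, continuous q t).
{ intros t; apply (continuous_plus (V := R_NormedModule)); [apply Ck | apply continuous_const]. }
assert (Iq : RInt q 0 T = T * (kb + eps / 2)).
{ unfold q; rewrite (RInt_ext _ (fun t => 1 * k t + (eps / 2) * 1)) by (intros; eqR; ring).
  rewrite (proj2 (RInt_lin k (fun _ => 1) 0 T 1 (eps / 2) (ex_RInt_cont _ _ _ Ck) (ex_RInt_const _ _ _))), RInt_cst.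
  assert (H : forall I : R, 1 * I + eps / 2 * ((T - 0) * 1) = T * (/ T * I + eps / 2)) by (intros; field; lra); apply H. }
assert (Pk : 0 < RInt q 0 T).
{ apply RInt_gt_0; [exact HT | intros t Ht; unfold q; specialize (Hk t ltac:(lra)); lra | intros; apply Cq]. }
destruct (periodic_linear_ode q T 2 HT ltac:(lra) Cq Pk) as [u (Hu & Pu & Iu)].
assert (Ciu : forall t, continuous (fun t => / u t) t).
{ intros t; apply continuous_comp; [apply Hu | apply continuous_Rinv; assert (A := Pu t); lra]. }
assert (CV : forall t, continuous (fun t => ext T V (P t) t) t).
{ intros t; eapply V_curve_continuous; eauto. }
set (v := v0 + kb + eps / 2).
set (l' := fun t => v - (ext T V (P t) t + / u t)).
assert (Cs : forall t, continuous (fun t => ext T V (P t) t + / u t) t).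
{ intros t; apply (continuous_plus (V := R_NormedModule)); auto. }
assert (Cl' : forall t, continuous l' t).
{ intros t; apply (continuous_minus (V := R_NormedModule)); [apply continuous_const | apply Cs]. }
destruct (periodic_primitive l' T Cl') as [l0 Hl0].
{ apply RInt_minus_const; [exact Cs | ].
  rewrite (RInt_ext _ (fun t => 1 * ext T V (P t) t + 1 * / u t)) by (intros; eqR; ring).
  rewrite (proj2 (RInt_lin (fun t => ext T V (P t) t) (fun t => / u t) 0 T 1 1
     (ex_RInt_cont _ _ _ CV) (ex_RInt_cont _ _ _ Ciu))), Iu, Iq.
  assert (H : forall I : R, 1 * I + 1 * (2 * (T * (kb + eps / 2)) / 2) = (/ T * I + kb + eps / 2) * T) by (intros; field; lra); apply H. }
destruct (continuous_bounded l' T ltac:(lra) Cl') as [C1 [C10 HC1]].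
destruct (ext_bounded T V HT HV) as [C2 [C20 HC2]].
set (M3 := C1 + C2 + Rabs v + eps).
assert (HM3 : 0 < M3) by (unfold M3; assert (A := Rabs_pos v); lra).
(* The cut-off level rests on bounds uniform in [D], so it can be fixed before [D]; the bound 1/2
   keeps it below the peak value 1. *)
set (c := Rmin (1 / 2) (eps / 4 * exp (- (M3 / (2 * (eps / 4)))) / M3)).
assert (Hc : 0 < c).
{ apply Rmin_glb_lt; [lra | apply Rdiv_lt_0_compat; [apply Rmult_lt_0_compat; [lra | apply exp_pos] | exact HM3]]. }
assert (Hc1 : c <= 1 / 2) by apply Rmin_l.
assert (Hc2 : c * M3 <= eps / 4 * exp (- (M3 / (2 * (eps / 4))))).
{ apply (Rmult_le_reg_r (/ M3)); [now apply Rinv_0_lt_compat | ].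
  rewrite Rmult_assoc, Rinv_r, Rmult_1_r by lra; apply Rmin_r. }
clearbody c.
destruct (continuous_bounded u T ltac:(lra) (proj1 Hu)) as [U [U0 HU]].
assert (HN : 0 < - ln c).
{ assert (ln c < ln 1) by (apply ln_increasing; lra); rewrite ln_1 in H; lra. }
(* For [D] below this threshold the set where the Gaussian exceeds [c] fits inside the tube. *)
destruct (exists_small (d3 * d3) (2 * U * - ln c)) as [D0 [HD0 HD0']].
{ now apply Rmult_lt_0_compat. }
{ apply Rmult_le_pos; lra. }
exists D0; split; [exact HD0 | intros D l phi phix HD HDD Heig].
specialize (HD0' D HD ltac:(lra)).
assert (Hle : l <= v + 2 * (eps / 4)); [ | unfold v, v0, kb in *; lra].
apply (eigenvalue_le T D mx V l phi phix _ (sink_sub D c d3 l0 l' u (fun t => 2 - 2 * q t * u t) P P') HT HD Hmx HV Heig).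
- apply sink_sub_regular; auto.
- exists (P 0); specialize (Hpl' 0 ltac:(lra)); split; [lra | split; [unfold in_tube; simpl; lra | simpl]].
  apply Rmult_lt_0_compat; [apply exp_pos | ].
  replace (- ((P 0 - P 0) * (P 0 - P 0) / (2 * D * u 0))) with 0.
  + rewrite exp_0; lra.
  + assert (A := Pu 0); field; lra.
- intros x t Hx Ht Htube Hpos.
  unfold in_tube in Htube; simpl in Htube, Hpos.
  assert (HG : c < exp (- ((x - P t) * (x - P t) / (2 * D * u t)))).
  { assert (0 < exp (- ((x - P t) * (x - P t) / (2 * D * u t))) - c); [ | lra].
    apply (Rmult_lt_reg_l (exp (l0 t))); [apply exp_pos | lra]. }
  specialize (Hpl' t Ht). assert (Put := Pu t).
  assert (Hy : (x - P t) * (x - P t) < d3 * d3).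
  { assert (A := ln_increasing _ _ Hc HG); rewrite ln_exp in A.
    assert (P2 : 0 < 2 * D * u t) by (repeat apply Rmult_lt_0_compat; lra).
    apply (Rmult_lt_compat_l (2 * D * u t)) in A; [ | exact P2].
    replace (2 * D * u t * - ((x - P t) * (x - P t) / (2 * D * u t))) with (- ((x - P t) * (x - P t))) in A by (field; lra).
    specialize (HU t Ht); rewrite Rabs_pos_eq in HU by lra.
    assert (D * u t * - ln c <= D * U * - ln c).
    { apply Rmult_le_compat_r; [lra | apply Rmult_le_compat_l; lra]. }
    lra. }
  left; simpl; split; [split; nra | split; [lra | ]].
  assert (Hyl : Rabs (x - P t) <= d3) by (apply Rabs_le; lra).
  assert (HVc := HVu x (P t) t Hx ltac:(lra) Ht ltac:(lra)); apply Rabs_le_between in HVc.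
  destruct (Hs2 x t Hx Ht ltac:(lra)) as [_ Hs].
  assert (HC1' := HC1 t Ht); assert (HC2' := HC2 x t); apply Rabs_le_between in HC1'; apply Rabs_le_between in HC2'.
  assert (Q := sink_sub_ineq D c (q t) (eps / 4) (eps / 4) v (exp (l0 t)) (l' t) (u t) (2 - 2 * q t * u t)
    (ext T V x t) (ext T V (P t) t) (- ext T mx x t) (P' t) (x - P t) M3 HD (exp_pos _) Put ltac:(lra) ltac:(lra) HM3
    eq_refl).
  rewrite !ext_id in * by lra.
  assert (A1 := Rle_abs v).
  specialize (Q ltac:(unfold q; replace (k t + eps / 2 - eps / 4) with (k t + eps / 4) by field; exact Hs)).
  specialize (Q ltac:(unfold l'; rewrite ext_id by lra; unfold Rdiv; ring) ltac:(lra)).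
  specialize (Q ltac:(unfold M3; lra) Hc Hc2 HG).
  lra.
Qed.

(** * Lower bounds: the pieces at the orbits and at the endpoints *)

Definition interior_ineq (T D : R) (mx V : R -> R -> R) (mu : R) (p : piece) (x t : R) : Prop :=
  mu <= pwt p x t - D * (pwxx p x t + pwx p x t * pwx p x t) - ext T mx x t * pwx p x t + ext T V x t.

(** The order of quantifiers is the one the assembly requires: the width [d], a bound [osc] of the
    time factor that does not see [K], then an arbitrary height [K], then [D]. *)
Lemma source_piece_exists T mx V P P' d0 kap sg eps : 0 < T -> 0 < eps ->
  cont_cylinder T mx -> cont_cylinder T V ->
  source_node T (fun x t => - ext T mx x t) P P' d0 kap -> placed T P d0 sg ->
  exists dm, 0 < dm <= d0 /\ forall d, 0 < d <= dm -> exists osc, 0 < osc /\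
    forall K, 0 < K -> exists D0, 0 < D0 /\ forall D, 0 < D -> D < D0 ->
    exists p, regular T p /\ (forall t, plow p t = P t - d /\ phigh p t = P t + d) /\
      forall x t, 0 <= x <= 1 -> 0 <= t <= T -> Rabs (x - P t) <= d ->
        interior_ineq T D mx V (/ T * RInt (fun t => ext T V (P t) t) 0 T - eps) p x t /\
        (x = 0 -> pwx p x t < 0) /\ (x = 1 -> 0 < pwx p x t) /\
        (Rabs (x - P t) <= d / 2 -> pw p x t <= osc - K * (d * d) / 8) /\
        (Rabs (x - P t) = d -> K * (d * d) / 8 - osc <= pw p x t).
Proof.
intros HT Heps Hmx HV Hsrc Hpl.
set (v := / T * RInt (fun t => ext T V (P t) t) 0 T).
destruct (ext_uniform T V (eps / 2) HT HV) as [d1 [Hd1 HVu]]; [lra | ].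
assert (Hd00 : 0 < d0) by apply Hsrc.
exists (Rmin d0 d1); split; [split; [apply Rmin_glb_lt; lra | apply Rmin_l] | ].
intros d [Hd Hdm].
assert (R1 : d <= d0) by (eapply Rle_trans; [exact Hdm | apply Rmin_l]).
assert (R2 : d <= d1) by (eapply Rle_trans; [exact Hdm | apply Rmin_r]).
apply (source_node_shrink _ _ _ _ _ d) in Hsrc; auto.
apply (placed_shrink _ _ _ d) in Hpl; auto.
destruct Hsrc as (HP & _ & Hk & Hsrc & [M2 [HM20 HM2]]).
assert (Cq : forall t, continuous (fun t => ext T V (P t) t) t).
{ intros t; eapply V_curve_continuous; eauto. }
destruct (periodic_primitive (fun t => v - ext T V (P t) t) T) as [l0 Hl0].
{ intros t; apply (continuous_minus (V := R_NormedModule)); [apply continuous_const | apply Cq]. }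
{ apply RInt_minus_const; [exact Cq | apply mean_mul; lra]. }
destruct (continuous_bounded l0 T ltac:(lra) (proj1 Hl0)) as [osc [Hosc Hosc2]].
exists osc; split; [exact Hosc | intros K HK].
destruct (exists_small (eps / 4) (2 * K * M2)) as [e1 [He1 He1']]; [lra | apply Rmult_le_pos; lra | ].
(* With so small a shift the squared distance to the vertex is at most [3/8] of [d * d] in the inner
   half of the tube and at least [5/8] of it on the edges; the additive constant
   [- (K * (d * d) / 2)] separates these levels by 0. *)
set (e0 := Rmin e1 (d / 20)).
assert (E1 : e0 <= e1) by apply Rmin_l. assert (E2 : e0 <= d / 20) by apply Rmin_r.
assert (E0 : 0 < e0) by (apply Rmin_glb_lt; lra).
specialize (He1' e0 E0 E1); clearbody e0.
assert (Hsg : Rabs (sg * e0) <= e0).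
{ rewrite Rabs_mult, (Rabs_pos_eq e0) by lra.
  rewrite <- (Rmult_1_l e0) at 2; apply Rmult_le_compat_r; [lra | ].
  destruct Hpl as [[-> _] | [[-> _] | [-> _]]]; split_Rabs; lra. }
set (e := sg * e0) in *.
destruct (exists_small (eps / 4) (2 * K + 4 * K * K * ((d + Rabs e) * (d + Rabs e)))) as [D0 [HD0 HD0']].
{ lra. }
{ apply Rplus_le_le_0_compat; [lra | apply Rmult_le_pos; [nra | apply Rle_0_sqr]]. }
exists D0; split; [exact HD0 | intros D HD HDD].
specialize (HD0' D HD ltac:(lra)).
exists (source_super (- (K * (d * d) / 2)) K e d l0 (fun t => v - ext T V (P t) t) P P').
split; [now apply source_super_regular | split; [simpl; auto | ]].
intros x t Hx Ht Hxt.
assert (Hr := placed_range T P d sg t Hd Hpl Ht).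
assert (Hl := Hosc2 t Ht); apply Rabs_le_between in Hl.
assert (He := Hsg); apply Rabs_le_between in He.
split; [ | split; [ | split; [ | split]]]; simpl.
- unfold interior_ineq; simpl.
  assert (HVc := HVu x (P t) t Hx Hr Ht ltac:(lra)); apply Rabs_le_between in HVc.
  assert (Q := source_super_ineq D K e d M2 (eps / 2) v (v - ext T V (P t) t) (ext T V x t) (ext T V (P t) t)
    (- ext T mx x t) (P' t) (x - P t) HK HD Hxt eq_refl ltac:(lra)).
  specialize (Q (Rle_trans _ _ _ (Rmult_le_pos _ _ (Rlt_le _ _ Hk) (Rle_0_sqr _)) (Hsrc x t Hx Ht ltac:(lra)))
    (HM2 x t Hx Ht)).
  assert (2 * K * (Rabs e * M2) <= 2 * K * (e0 * M2)).
  { apply Rmult_le_compat_l; [lra | apply Rmult_le_compat_r; lra]. }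
  fold v; lra.
- intros ->; destruct Hpl as [[_ Hp] | [(Es & _ & Hp) | (_ & H1 & Hp)]].
  + specialize (Hp t Ht); apply Rabs_le_between in Hxt; lra.
  + rewrite Hp; unfold e; rewrite Es; assert (0 < K * e0) by now apply Rmult_lt_0_compat; lra.
    lra.
  + rewrite Hp in Hxt; apply Rabs_le_between in Hxt; lra.
- intros ->; destruct Hpl as [[_ Hp] | [(_ & H1 & Hp) | (Es & _ & Hp)]].
  + specialize (Hp t Ht); apply Rabs_le_between in Hxt; lra.
  + rewrite Hp in Hxt; apply Rabs_le_between in Hxt; lra.
  + rewrite Hp; unfold e; rewrite Es; assert (0 < K * e0) by now apply Rmult_lt_0_compat; lra.
    lra.
- intros Hy; apply Rabs_le_between in Hy.
  assert (A : (x - P t - e) * (x - P t - e) <= d * d * 3 / 8) by nra.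
  apply (Rmult_le_compat_l K) in A; lra.
- intros Hy.
  assert (A : d * d * 5 / 8 <= (x - P t - e) * (x - P t - e)).
  { unfold Rabs in Hy; destruct (Rcase_abs (x - P t)); nra. }
  apply (Rmult_le_compat_l K) in A; lra.
Qed.

Lemma ln_bounds a b z : 0 < a -> a <= z <= b -> Rabs (ln z) <= Rabs (ln a) + Rabs (ln b).
Proof.
intros Ha [H1 H2].
assert (A1 : ln a <= ln z) by (destruct H1 as [H1 | ->]; [left; now apply ln_increasing | lra]).
assert (A2 : ln z <= ln b) by (destruct H2 as [H2 | ->]; [left; apply ln_increasing; lra | lra]).
split_Rabs; lra.
Qed.

(** In the limit [D = 0] the logarithm is singular only on the orbit. On the ring
    [d1 <= |x - P t| <= d], where the piece meets the chains, it is bounded uniformly for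
    [D < 1]. *)
Lemma sink_piece_exists T mx V P P' k eps : 0 < T -> 0 < eps ->
  cont_cylinder T mx -> cont_cylinder T V ->
  sink_node T (fun x t => - ext T mx x t) P P' k -> (forall t, 0 <= t <= T -> 0 <= P t <= 1) ->
  exists dm, 0 < dm /\ forall d d1, 0 < d <= dm -> 0 < d1 <= d -> exists Bk, 0 < Bk /\
    forall D, 0 < D -> D < 1 ->
    exists p, regular T p /\ (forall t, plow p t = P t - d /\ phigh p t = P t + d) /\
      forall x t, 0 <= x <= 1 -> 0 <= t <= T -> Rabs (x - P t) <= d ->
        interior_ineq T D mx V (/ T * RInt (fun t => ext T V (P t) t) 0 T + / T * RInt k 0 T - eps) p x t /\
        (d1 <= Rabs (x - P t) -> Rabs (pw p x t) <= Bk).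
Proof.
intros HT Heps Hmx HV (HP & Ck & [k0 [Hk0 Hk]] & Hsink) Hr.
set (v0 := / T * RInt (fun t => ext T V (P t) t) 0 T).
set (kb := / T * RInt k 0 T).
set (e := Rmin (eps / 3) (k0 / 2)).
assert (He : 0 < e) by (apply Rmin_glb_lt; lra).
assert (He1 : e <= eps / 3) by apply Rmin_l. assert (He2 : e <= k0 / 2) by apply Rmin_r.
clearbody e.
destruct (ext_uniform T V (eps / 3) HT HV) as [d2 [Hd2 HVu]]; [lra | ].
destruct (Hsink e He) as [d3 [Hd3 Hs3]].
exists (Rmin d2 d3); split; [apply Rmin_glb_lt; lra | ].
intros d d1 [Hd Hdm] [Hd10 Hd11].
assert (R2 : d <= d2) by (eapply Rle_trans; [exact Hdm | apply Rmin_l]).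
assert (R3 : d <= d3) by (eapply Rle_trans; [exact Hdm | apply Rmin_r]).
set (q := fun t => k t - e).
assert (Cq : forall t, continuous q t).
{ intros t; apply (continuous_minus (V := R_NormedModule)); [apply Ck | apply continuous_const]. }
assert (Iq : RInt q 0 T = T * (kb - e)).
{ unfold q; rewrite (RInt_ext _ (fun t => 1 * k t + (- e) * 1)) by (intros; eqR; ring).
  rewrite (proj2 (RInt_lin k (fun _ => 1) 0 T 1 (- e) (ex_RInt_cont _ _ _ Ck) (ex_RInt_const _ _ _))), RInt_cst.
  assert (H : forall I : R, 1 * I + - e * ((T - 0) * 1) = T * (/ T * I - e)) by (intros; field; lra); apply H. }
assert (Pk : 0 < RInt q 0 T).
{ apply RInt_gt_0; [exact HT | intros t Ht; unfold q; specialize (Hk t ltac:(lra)); lra | intros; apply Cq]. }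
assert (Hkb : 0 < kb - e).
{ rewrite Iq in Pk; apply (Rmult_lt_reg_l T); lra. }
(* A finite exponent loses the fraction [3 / (2 p + 3)] of the mean rate; this [p] makes the loss at
   most [eps / 3]. *)
set (p := Rmax 1 (9 * kb / eps)).
assert (Hp1 : 1 <= p) by apply Rmax_l. assert (Hp2 : 9 * kb / eps <= p) by apply Rmax_r.
clearbody p.
assert (Hp3 : kb * 9 <= eps * p).
{ apply (Rmult_le_compat_l eps) in Hp2; [ | lra]. replace (eps * (9 * kb / eps)) with (kb * 9) in Hp2 by (field; lra); lra. }
destruct (periodic_linear_ode q T (4 * p + 6) HT ltac:(lra) Cq Pk) as [u (Hu & Pu & Iu)].
assert (Ciu : forall t, continuous (fun t => / u t) t).
{ intros t; apply continuous_comp; [apply Hu | apply continuous_Rinv; assert (A := Pu t); lra]. }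
assert (CV : forall t, continuous (fun t => ext T V (P t) t) t).
{ intros t; eapply V_curve_continuous; eauto. }
set (rho := fun t => 2 * p * q t + - (4 * p * (p + 1)) * / u t).
assert (Crho : forall t, continuous rho t).
{ intros t; apply (continuous_plus (V := R_NormedModule)).
  - apply (continuous_scal_r (V := R_NormedModule) (2 * p)), Cq.
  - apply (continuous_scal_r (V := R_NormedModule) (- (4 * p * (p + 1)))), Ciu. }
assert (Irho : RInt rho 0 T = 2 * p / (2 * p + 3) * (kb - e) * T).
{ unfold rho; rewrite (proj2 (RInt_lin q (fun t => / u t) 0 T (2 * p) (- (4 * p * (p + 1)))
     (ex_RInt_cont _ _ _ Cq) (ex_RInt_cont _ _ _ Ciu))), Iu, Iq.
  assert (H : forall z : R, 2 * p * (T * z) + - (4 * p * (p + 1)) * (2 * (T * z) / (4 * p + 6))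
    = 2 * p / (2 * p + 3) * z * T) by (intros; field; lra); apply H. }
set (v := v0 + 2 * p / (2 * p + 3) * (kb - e)).
assert (Hv : v0 + kb - 2 * (eps / 3) <= v).
{ unfold v.
  assert (A : 2 * p / (2 * p + 3) * (kb - e) = (kb - e) - 3 * (kb - e) / (2 * p + 3)) by (field; lra).
  assert (A2 : 3 * (kb - e) / (2 * p + 3) <= eps / 3).
  { apply (Rmult_le_reg_r (2 * p + 3)); [lra | ].
    replace (3 * (kb - e) / (2 * p + 3) * (2 * p + 3)) with (3 * (kb - e)) by (field; lra).
    assert (0 < eps * p) by (apply Rmult_lt_0_compat; lra); lra. }
  lra. }
set (l' := fun t => v - (ext T V (P t) t + rho t)).
assert (Cs : forall t, continuous (fun t => ext T V (P t) t + rho t) t).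
{ intros t; apply (continuous_plus (V := R_NormedModule)); auto. }
assert (Cl' : forall t, continuous l' t).
{ intros t; apply (continuous_minus (V := R_NormedModule)); [apply continuous_const | apply Cs]. }
destruct (periodic_primitive l' T Cl') as [l0 Hl0].
{ apply RInt_minus_const; [exact Cs | ].
  rewrite (RInt_ext _ (fun t => 1 * ext T V (P t) t + 1 * rho t)) by (intros; eqR; ring).
  rewrite (proj2 (RInt_lin (fun t => ext T V (P t) t) rho 0 T 1 1
     (ex_RInt_cont _ _ _ CV) (ex_RInt_cont _ _ _ Crho))), Irho.
  assert (H : forall I : R, 1 * I + 1 * (2 * p / (2 * p + 3) * (kb - e) * T) = (/ T * I + 2 * p / (2 * p + 3) * (kb - e)) * T)
    by (intros; field; lra); apply H. }
destruct (continuous_bounded l0 T ltac:(lra) (proj1 Hl0)) as [C1 [C10 HC1]].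
destruct (continuous_bounded u T ltac:(lra) (proj1 Hu)) as [U [U0 HU]].
set (Bk := C1 + p * (Rabs (ln (d1 * d1)) + Rabs (ln (U + d * d)))).
exists Bk; split.
{ unfold Bk; assert (A1 := Rabs_pos (ln (d1 * d1))); assert (A2 := Rabs_pos (ln (U + d * d))).
  assert (0 <= p * (Rabs (ln (d1 * d1)) + Rabs (ln (U + d * d)))) by (apply Rmult_le_pos; lra); lra. }
intros D HD HD1.
exists (sink_super D p d l0 l' u (fun t => 4 * p + 6 - 2 * q t * u t) P P').
split; [now apply sink_super_regular | split; [simpl; auto | ]].
intros x t Hx Ht Hxt.
assert (Put := Pu t).
split.
- unfold interior_ineq; simpl.
  assert (HVc := HVu x (P t) t Hx (Hr t Ht) Ht ltac:(lra)); apply Rabs_le_between in HVc.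
  destruct (Hs3 x t Hx Ht ltac:(lra)) as [Hs _].
  assert (Q := sink_super_ineq D p (q t) (eps / 3) v (l' t) (u t) (4 * p + 6 - 2 * q t * u t)
     (ext T V x t) (ext T V (P t) t) (- ext T mx x t) (P' t) (x - P t) HD ltac:(lra) Put eq_refl Hs).
  specialize (Q ltac:(unfold l', rho; field; lra) ltac:(lra)).
  fold v0 kb; lra.
- intros Hy; simpl.
  assert (A1 := HC1 t Ht).
  assert (HU' := HU t Ht); rewrite Rabs_pos_eq in HU' by lra.
  assert (Ey : (x - P t) * (x - P t) = Rabs (x - P t) * Rabs (x - P t)).
  { rewrite <- Rabs_mult; symmetry; apply Rabs_pos_eq, Rle_0_sqr. }
  assert (A2 : d1 * d1 <= (x - P t) * (x - P t)) by (rewrite Ey; apply Rmult_le_compat; lra).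
  assert (A3 : (x - P t) * (x - P t) <= d * d) by (rewrite Ey; apply Rmult_le_compat; try lra; apply Rabs_pos).
  assert (A4 : 0 < D * u t) by now apply Rmult_lt_0_compat.
  assert (A5 : D * u t <= 1 * U) by (apply Rmult_le_compat; lra).
  assert (A6 := ln_bounds (d1 * d1) (U + d * d) (D * u t + (x - P t) * (x - P t)) ltac:(apply Rmult_lt_0_compat; lra) ltac:(lra)).
  unfold Rminus at 1; eapply Rle_trans; [apply Rabs_triang | rewrite Rabs_Ropp, Rabs_mult, (Rabs_pos_eq p) by lra].
  unfold Bk; apply Rplus_le_compat; [exact A1 | apply Rmult_le_compat_l; lra].
Qed.

(** * Lower bounds: the gaps between consecutive orbits *)

Definition periodic_orbit (B : R -> R -> R) (T : R) (P : R -> R) : Prop :=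
  orbit B T 0 P /\ P T = P 0.

(** With a nonzero constant the two orbits issued from [P 0] would be apart after one period, though
    both close up. With equal constants Gronwall identifies them. *)
Lemma family_at_orbit B M L T c g P : field_ok B M L -> 0 < T -> periodic_family B T c g ->
  periodic_orbit B T P -> c (P 0) = 0 /\ forall t, 0 <= t <= T -> g (P 0) t = P t.
Proof.
intros HB HT Hf [OP PT].
destruct (Hf (P 0)) as (OX & X0 & XT).
assert (Pe := exp_pos (- (L * (T - 0)))).
assert (Hc : c (P 0) = 0).
{ destruct (Rtotal_order (c (P 0)) 0) as [H | [H | H]]; [exfalso | exact H | exfalso].
  - assert (G := orbit_gap B M L T _ _ _ _ 0 T HB OX OP ltac:(lra) ltac:(lra) ltac:(lra) ltac:(lra) ltac:(lra)).
    rewrite X0, XT, PT, !Rminus_diag in G.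
    assert (0 < exp (- (L * (T - 0))) * (0 + (0 - c (P 0)) * (T - 0))); [ | lra].
    apply Rmult_lt_0_compat; [exact Pe | rewrite Rplus_0_l; apply Rmult_lt_0_compat; lra].
  - assert (G := orbit_gap B M L T _ _ _ _ 0 T HB OP OX ltac:(lra) ltac:(lra) ltac:(lra) ltac:(lra) ltac:(lra)).
    rewrite X0, XT, PT, !Rminus_diag in G.
    assert (0 < exp (- (L * (T - 0))) * (0 + (c (P 0) - 0) * (T - 0))); [ | lra].
    apply Rmult_lt_0_compat; [exact Pe | rewrite Rplus_0_l; apply Rmult_lt_0_compat; lra]. }
split; [exact Hc | intros t Ht].
assert (G := orbit_gronwall B M L T _ _ _ _ t HB OP OX Ht).
rewrite X0, Hc, !Rminus_diag, !Rabs_R0, Rmult_0_l, Rplus_0_l, Rmult_0_r in G.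
assert (A := Rabs_pos (g (P 0) t - P t)).
destruct (Req_dec (g (P 0) t - P t) 0) as [E | E]; [lra | ].
apply Rabs_pos_lt in E; lra.
Qed.

(** Curves started close to an orbit stay close to it, so the first and last curves of a chain can
    be put inside the tubes of the nodes. *)
Lemma family_near_orbit B M L T c g P : field_ok B M L -> 0 < T -> periodic_family B T c g ->
  periodic_orbit B T P -> exists C, 0 < C /\ forall h s t, (s = 1 \/ s = -1) -> 0 <= h -> 0 <= t <= T ->
    s * P t <= s * g (P 0 + s * h) t <= s * P t + C * h.
Proof.
intros HB HT Hf HP.
destruct (family_lipschitz B M L T c g HB HT Hf) as [C [C0 HC]].
destruct (family_at_orbit B M L T c g P HB HT Hf HP) as [_ Hg].
exists C; split; [exact C0 | intros h s t Hs Hh Ht].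
specialize (HC (P 0 + s * h) (P 0) t Ht); rewrite (Hg t Ht) in HC.
replace (P 0 + s * h - P 0) with (s * h) in HC by ring.
rewrite Rabs_mult, (Rabs_pos_eq h) in HC by lra.
replace (Rabs s) with 1 in HC by (destruct Hs as [-> | ->]; split_Rabs; lra).
apply Rabs_le_between in HC; rewrite Rmult_1_l in HC.
destruct Hs as [-> | ->].
- assert (A := family_monotone B M L T c g (P 0) (P 0 + 1 * h) t HB HT Hf ltac:(lra) Ht); rewrite Hg in A by exact Ht; lra.
- assert (A := family_monotone B M L T c g (P 0 + -1 * h) (P 0) t HB HT Hf ltac:(lra) Ht); rewrite Hg in A by exact Ht; lra.
Qed.

(** The sink piece is bounded only away from its orbit, so the last curve of a chain has to keep a
    definite distance from it. The sign of the constant widens the gap and the Lipschitz constant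
    shrinks it at most by [exp (- L T)]. *)
Lemma family_off_orbit B M L T c g P : field_ok B M L -> 0 < T -> periodic_family B T c g ->
  periodic_orbit B T P -> forall h s, (s = 1 \/ s = -1) -> 0 < h -> s * c (P 0 - s * h) < 0 ->
  exists d, 0 < d /\ forall t, 0 <= t <= T -> s * g (P 0 - s * h) t + d <= s * P t.
Proof.
intros HB HT Hf [OP PT] h s Hs Hh Hc.
assert (L0 : 0 < L) by apply HB.
exists (exp (- (L * T)) * h); split; [apply Rmult_lt_0_compat; [apply exp_pos | lra] | intros t Ht].
destruct (Hf (P 0 - s * h)) as (OX & X0 & XT).
assert (A : exp (- (L * T)) <= exp (- (L * (t - 0)))) by (apply exp_monotone; nra).
assert (A2 : exp (- (L * T)) * h <= exp (- (L * (t - 0))) * h) by (apply Rmult_le_compat_r; lra).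
assert (Pe := exp_pos (- (L * (t - 0)))).
destruct Hs as [-> | ->].
- assert (G := orbit_gap B M L T _ _ _ _ 0 t HB OX OP ltac:(lra) ltac:(lra) ltac:(lra) ltac:(lra) ltac:(lra)).
  rewrite X0 in G.
  assert (exp (- (L * (t - 0))) * h <= exp (- (L * (t - 0))) * (P 0 - (P 0 - 1 * h) + (0 - c (P 0 - 1 * h)) * (t - 0))).
  { apply Rmult_le_compat_l; [lra | ]. assert (0 <= (0 - c (P 0 - 1 * h)) * (t - 0)) by (apply Rmult_le_pos; lra); lra. }
  lra.
- assert (G := orbit_gap B M L T _ _ _ _ 0 t HB OP OX ltac:(lra) ltac:(lra) ltac:(lra) ltac:(lra) ltac:(lra)).
  rewrite X0 in G.
  assert (exp (- (L * (t - 0))) * h <= exp (- (L * (t - 0))) * (P 0 - -1 * h - P 0 + (c (P 0 - -1 * h) - 0) * (t - 0))).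
  { apply Rmult_le_compat_l; [lra | ]. assert (0 <= (c (P 0 - -1 * h) - 0) * (t - 0)) by (apply Rmult_le_pos; lra); lra. }
  lra.
Qed.

(* The chain of a gap, oriented by [s] from the source end [Pa] to the sink end [Pb]; if [out]
   holds, [Pb] is an endpoint of [0,1] and the chain runs out of [0,1]. *)
Definition gap_spec (B : R -> R -> R) (T s : R) (Pa : R -> R) (da : R) (Pb : R -> R) (db : R)
    (out : Prop) (ga gb : R -> R) (r eta Q d1 : R) : Prop :=
  0 < r /\ 0 < eta /\ 1 <= Q /\ 0 < d1 <= db /\
  (forall K, 0 < K -> exists ch, chain_spec B T s ga gb r eta K (K * Q) ch) /\
  (forall t x, 0 <= t <= T -> 0 <= x <= 1 -> s * ga t - r <= s * x ->
     s * x = s * ga t - r \/ (s = 1 /\ x = 0) \/ (s = -1 /\ x = 1) -> Rabs (x - Pa t) <= da / 2) /\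
  (forall t, 0 <= t <= T -> s * ga t <= s * Pa t + da /\ s * Pa t + da + r <= s * gb t) /\
  (forall t x, 0 <= t <= T -> 0 <= x <= 1 -> s * x = s * gb t + r ->
     ~ out /\ d1 <= Rabs (x - Pb t) <= db) /\
  (~ out -> forall t, 0 <= t <= T -> s * ga t <= s * Pb t - db /\ s * Pb t - db + r <= s * gb t).

(** At an interior orbit the extreme curve of the chain is taken close to the orbit. At an endpoint
    of [0,1] it is taken so far outside that it stays there during the whole period. [inn] says that
    the source end is an interior orbit. *)
Lemma gap_exists B M L T c g s Pa da Pb db (inn out : Prop) : field_ok B M L -> 0 < T ->
  periodic_family B T c g -> (s = 1 \/ s = -1) -> 0 < da -> 0 < db ->
  (inn /\ periodic_orbit B T Pa /\ placed T Pa da 0) \/ (~ inn /\ placed T Pa da s) ->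
  (~ out /\ periodic_orbit B T Pb /\ placed T Pb db 0) \/ (out /\ placed T Pb db (- s)) ->
  (forall t, 0 <= t <= T -> s * Pa t + da + db <= s * Pb t) ->
  (forall x, (inn -> s * Pa 0 < s * x) -> (~ out -> s * x < s * Pb 0) -> s * c x < 0) ->
  exists ga gb r eta Q d1, gap_spec B T s Pa da Pb db out ga gb r eta Q d1.
Proof.
intros HB HT Hf Hs Hda Hdb Ha Hb Hsep Hsign.
assert (HB' := HB); destruct HB' as (_ & _ & _ & M0 & L0).
assert (Hss : s * s = 1) by (destruct Hs as [-> | ->]; ring).
assert (MT : 0 < M * T) by now apply Rmult_lt_0_compat.
assert (SA : exists xa ra, 0 < ra /\ (inn -> s * Pa 0 < s * xa) /\ s * xa < s * Pa 0 + da / 2 /\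
  (forall t, 0 <= t <= T -> s * g xa t <= s * Pa t + da / 2) /\
  (forall r t x, 0 < r <= ra -> 0 <= t <= T -> 0 <= x <= 1 -> s * g xa t - r <= s * x ->
     s * x = s * g xa t - r \/ (s = 1 /\ x = 0) \/ (s = -1 /\ x = 1) -> Rabs (x - Pa t) <= da / 2)).
{ destruct Ha as [(Hi & Po & Hp) | (Ni & Hp)].
  - destruct (family_near_orbit B M L T c g Pa HB HT Hf Po) as [C [C0 HC]].
    set (h := Rmin (da / 4) (da / (4 * C))).
    assert (h1 : h <= da / 4) by apply Rmin_l. assert (h2 : h <= da / (4 * C)) by apply Rmin_r.
    assert (h0 : 0 < h) by (apply Rmin_glb_lt; [lra | apply Rdiv_lt_0_compat; lra]).
    assert (h3 : C * h <= da / 4).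
    { apply (Rmult_le_compat_l C) in h2; [ | lra]. replace (C * (da / (4 * C))) with (da / 4) in h2 by (field; lra); lra. }
    clearbody h.
    assert (Es : s * (Pa 0 + s * h) = s * Pa 0 + h).
    { replace (s * (Pa 0 + s * h)) with (s * Pa 0 + (s * s) * h) by ring; rewrite Hss; ring. }
    exists (Pa 0 + s * h), (da / 4); split; [lra | split; [intros _; lra | split; [lra | split]]].
    + intros t Ht; specialize (HC h s t Hs ltac:(lra) Ht); lra.
    + intros r t x Hr Ht Hx H1 H2; specialize (HC h s t Hs ltac:(lra) Ht).
      destruct Hp as [[_ Hp] | [(H & _) | (H & _)]]; [ | lra | lra].
      specialize (Hp t Ht).
      destruct H2 as [H2 | [[-> ->] | [-> ->]]]; [ | exfalso; lra | exfalso; lra].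
      destruct Hs as [-> | ->]; apply Rabs_le; lra.
  - assert (Hp' : forall t, Pa t = (1 - s) / 2).
    { destruct Hp as [[E H] | [(E & _ & H) | (E & _ & H)]].
      - exfalso; destruct Hs; lra.
      - intros t; rewrite H, E; field.
      - intros t; rewrite H, E; field. }
    (* Beyond the excursion [2 M T] of a closed curve: neither the first curve nor its outer edge
       ever meets [0,1], and only the endpoint itself is left to the source piece. *)
    set (xa := - s * (2 * M * T + 2) + (1 - s) / 2).
    assert (Hg : forall t, 0 <= t <= T -> s * g xa t <= s * ((1 - s) / 2) - 2).
    { intros t Ht; assert (A := family_near_start B M L T c g xa t HB HT Hf Ht).
      apply Rabs_le_between in A; unfold xa in *; destruct Hs as [-> | ->]; lra. }
    assert (Ex : s * xa = s * ((1 - s) / 2) - (2 * M * T + 2)).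
    { unfold xa; replace (s * (- s * (2 * M * T + 2) + (1 - s) / 2)) with (- (s * s) * (2 * M * T + 2) + s * ((1 - s) / 2)) by ring.
      rewrite Hss; ring. }
    exists xa, (1 / 2); rewrite Hp'; split; [lra | split; [tauto | split; [lra | split]]].
    + intros t Ht; rewrite Hp'; specialize (Hg t Ht); lra.
    + intros r t x Hr Ht Hx H1 H2; rewrite Hp'; specialize (Hg t Ht).
      destruct H2 as [H2 | [[-> ->] | [-> ->]]].
      * exfalso; destruct Hs as [-> | ->]; lra.
      * replace (0 - (1 - 1) / 2) with 0 by field; rewrite Rabs_R0; lra.
      * replace (1 - (1 - -1) / 2) with 0 by field; rewrite Rabs_R0; lra. }
destruct SA as [xa [ra (Hra & SA1 & SA2 & SA3 & SA4)]].
assert (SB : exists xb rb d1, 0 < rb /\ 0 < d1 <= db /\ s * xa < s * xb /\ (~ out -> s * xb < s * Pb 0) /\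
  ((forall x, s * xa <= s * x <= s * xb -> s * c x < 0) -> forall r, r <= rb ->
   (forall t, 0 <= t <= T -> s * Pb t - db + r <= s * g xb t) /\
   (forall t x, 0 <= t <= T -> 0 <= x <= 1 -> s * x = s * g xb t + r -> 0 < r ->
     ~ out /\ d1 <= Rabs (x - Pb t) <= db))).
{ specialize (Hsep 0 ltac:(lra)).
  destruct Hb as [(No & Po & Hp) | (Ho & Hp)].
  - destruct (family_near_orbit B M L T c g Pb HB HT Hf Po) as [C [C0 HC]].
    set (h := Rmin (db / 4) (db / (4 * C))).
    assert (h1 : h <= db / 4) by apply Rmin_l. assert (h2 : h <= db / (4 * C)) by apply Rmin_r.
    assert (h0 : 0 < h) by (apply Rmin_glb_lt; [lra | apply Rdiv_lt_0_compat; lra]).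
    assert (h3 : C * h <= db / 4).
    { apply (Rmult_le_compat_l C) in h2; [ | lra]. replace (C * (db / (4 * C))) with (db / 4) in h2 by (field; lra); lra. }
    clearbody h.
    assert (Es : s * (Pb 0 - s * h) = s * Pb 0 - h).
    { replace (s * (Pb 0 - s * h)) with (s * Pb 0 - (s * s) * h) by ring; rewrite Hss; ring. }
    assert (HC' : forall t, 0 <= t <= T -> s * Pb t - db / 4 <= s * g (Pb 0 - s * h) t <= s * Pb t).
    { intros t Ht; specialize (HC h (- s) t ltac:(destruct Hs; lra) ltac:(lra) Ht).
      replace (Pb 0 + - s * h) with (Pb 0 - s * h) in HC by ring; lra. }
    (* The sign of the constant at this curve is available only when both [xa] and [xb] are known,
       so the distance is fixed by a case distinction and the sign is supplied afterwards. *)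
    assert (W : exists d, 0 < d /\ (s * c (Pb 0 - s * h) < 0 -> forall t, 0 <= t <= T -> s * g (Pb 0 - s * h) t + d <= s * Pb t)).
    { destruct (Rlt_dec (s * c (Pb 0 - s * h)) 0) as [Hc | Hc].
      - destruct (family_off_orbit B M L T c g Pb HB HT Hf Po h s Hs h0 Hc) as [d [Hd Hd']].
        exists d; auto.
      - exists 1; split; [lra | intros; contradiction]. }
    destruct W as [d [Hd Hd']].
    assert (m1 := Rmin_l d db). assert (m2 := Rmin_r d db).
    assert (m0 : 0 < Rmin d db) by (apply Rmin_glb_lt; lra).
    exists (Pb 0 - s * h), (Rmin d db / 2), (Rmin d db / 2).
    split; [lra | split; [lra | split; [lra | split; [intros _; lra | ]]]].
    intros Hc r Hr; specialize (Hd' (Hc (Pb 0 - s * h) ltac:(lra))).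
    split.
    + intros t Ht; specialize (HC' t Ht); lra.
    + intros t x Ht Hx Ex r0; split; [exact No | ].
      specialize (HC' t Ht); specialize (Hd' t Ht).
      destruct Hs as [-> | ->]; unfold Rabs; destruct (Rcase_abs _); lra.
  - assert (Hp' : forall t, Pb t = (1 + s) / 2).
    { destruct Hp as [[E H] | [(E & _ & H) | (E & _ & H)]].
      - exfalso; destruct Hs; lra.
      - intros t; rewrite H; assert (s = -1) as -> by lra; field.
      - intros t; rewrite H; assert (s = 1) as -> by lra; field. }
    set (xb := s * (2 * M * T + 2) + (1 + s) / 2).
    assert (Ex : s * xb = s * ((1 + s) / 2) + (2 * M * T + 2)).
    { unfold xb; replace (s * (s * (2 * M * T + 2) + (1 + s) / 2)) with ((s * s) * (2 * M * T + 2) + s * ((1 + s) / 2)) by ring.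
      rewrite Hss; ring. }
    rewrite Hp' in Hsep.
    assert (Hg : forall t, 0 <= t <= T -> s * ((1 + s) / 2) + 2 <= s * g xb t).
    { intros t Ht; assert (A := family_near_start B M L T c g xb t HB HT Hf Ht).
      apply Rabs_le_between in A; unfold xb in *; destruct Hs as [-> | ->]; lra. }
    exists xb, 1, db; split; [lra | split; [lra | split; [lra | split; [tauto | ]]]].
    intros _ r Hr; split.
    + intros t Ht; rewrite Hp'; specialize (Hg t Ht); lra.
    + intros t x Ht Hx E r0; exfalso; specialize (Hg t Ht); destruct Hs as [-> | ->]; lra. }
destruct SB as [xb [rb [d1 (Hrb & Hd1 & Hab & SB1 & SB2)]]].
assert (Hc : forall x, s * xa <= s * x <= s * xb -> s * c x < 0).
{ intros x Hx; apply Hsign.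
  - intros Hi; specialize (SA1 Hi); lra.
  - intros No; specialize (SB1 No); lra. }
specialize (SB2 Hc).
set (r0 := Rmin ra (Rmin rb db)).
assert (a1 : r0 <= ra) by apply Rmin_l.
assert (a2 : r0 <= rb) by (eapply Rle_trans; [apply Rmin_r | apply Rmin_l]).
assert (Hr0 : 0 < r0) by (repeat apply Rmin_glb_lt; lra).
destruct (chain_exists B M L T c g s xa xb r0 HB HT Hf Hs ltac:(lra) Hr0 Hc) as [r [eta [Q (Hr & Heta & HQ & Hch)]]].
exists (g xa), (g xb), r, eta, Q, d1.
destruct (SB2 r ltac:(lra)) as [SB3 SB4].
split; [lra | split; [exact Heta | split; [exact HQ | split; [exact Hd1 | split; [exact Hch | ]]]]].
split; [ | split; [ | split]].
- intros t x Ht Hx H1 H2; apply (SA4 r); auto; lra.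
- intros t Ht; specialize (SA3 t Ht); specialize (SB3 t Ht); specialize (Hsep t Ht); lra.
- intros t x Ht Hx E; apply SB4; auto; lra.
- intros _ t Ht; specialize (SA3 t Ht); specialize (SB3 t Ht); specialize (Hsep t Ht); lra.
Qed.

(** * Lower bounds: assembly *)

(** Turns constants found separately for finitely many nodes or gaps into functions of the index;
    the default [a0] fills the other indices. *)
Lemma choice_upto {A : Type} (a0 : A) (Q : nat -> A -> Prop) n :
  (forall i, (i <= n)%nat -> exists a, Q i a) ->
  exists f, forall i, (i <= n)%nat -> Q i (f i).
Proof.
intros H.
assert (H' : forall i, exists a, (i <= n)%nat -> Q i a).
{ intros i; destruct (le_dec i n) as [Hi | Hi]; [destruct (H i Hi) as [a Ha]; exists a; auto | exists a0; easy]. }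
exists (fun i => proj1_sig (constructive_indefinite_description _ (H' i))).
intros i; destruct (constructive_indefinite_description _ (H' i)); auto.
Qed.

Lemma finite_max (f : nat -> R) n : exists M, 0 < M /\ forall i, (i <= n)%nat -> f i <= M.
Proof.
induction n as [ | n [M [HM IH]]].
- exists (Rabs (f O) + 1); split; [assert (P := Rabs_pos (f O)); lra | ].
  intros i Hi; replace i with O by lia; assert (P := Rle_abs (f O)); lra.
- exists (M + Rabs (f (S n))); assert (P := Rabs_pos (f (S n))); split; [lra | ].
  intros i Hi; destruct (Nat.eq_dec i (S n)) as [-> | Ni].
  + assert (P2 := Rle_abs (f (S n))); lra.
  + specialize (IH i ltac:(lia)); lra.
Qed.

Lemma finite_min (f : nat -> R) n : (forall i, (i <= n)%nat -> 0 < f i) ->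
  exists m, 0 < m /\ forall i, (i <= n)%nat -> m <= f i.
Proof.
intros Hf; destruct (finite_max (fun i => / f i) n) as [M [HM H]].
exists (/ M); split; [now apply Rinv_0_lt_compat | intros i Hi].
specialize (H i Hi); specialize (Hf i Hi).
rewrite <- (Rinv_inv (f i)); apply Rinv_le_contravar; [now apply Rinv_0_lt_compat | exact H].
Qed.

(** [Outflow] is meant for endpoints only. Such a node receives no piece: the chain of the adjacent
    gap covers it. *)
Inductive node_kind := Source | Sink | Outflow.

Definition node_spec (T : R) (mx V : R -> R -> R) (rho : R) (kd : node_kind)
    (P P' k : R -> R) (d kap : R) : Prop :=
  match kd with
  | Source => source_node T (fun x t => - ext T mx x t) P P' d kap /\
              rho <= / T * RInt (fun t => ext T V (P t) t) 0 T
  | Sink => sink_node T (fun x t => - ext T mx x t) P P' k /\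
            rho <= / T * RInt (fun t => ext T V (P t) t) 0 T + / T * RInt k 0 T
  | Outflow => True
  end.

(** The last argument of [placed] for node [i], the nodes 0 and [S N] being the endpoints. *)
Definition side (N i : nat) : R := if Nat.eqb i 0 then 1 else if Nat.eqb i (S N) then -1 else 0.

Definition node_piece_spec (T : R) (mx V : R -> R -> R) (mu D : R) (kd : node_kind)
    (P : R -> R) (d osc Ks dd Bk : R) (p : piece) : Prop :=
  regular T p /\ (forall t, plow p t = P t - d /\ phigh p t = P t + d) /\
  forall x t, 0 <= x <= 1 -> 0 <= t <= T -> Rabs (x - P t) <= d ->
    interior_ineq T D mx V mu p x t /\
    match kd with
    | Source => (x = 0 -> pwx p x t < 0) /\ (x = 1 -> 0 < pwx p x t) /\
        (Rabs (x - P t) <= d / 2 -> pw p x t <= osc - Ks * (d * d) / 8) /\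
        (Rabs (x - P t) = d -> Ks * (d * d) / 8 - osc <= pw p x t)
    | _ => dd <= Rabs (x - P t) -> Rabs (pw p x t) <= Bk
    end.

Lemma interior_ineq_weaken T D mx V mu mu' p x t : mu' <= mu ->
  interior_ineq T D mx V mu p x t -> interior_ineq T D mx V mu' p x t.
Proof. unfold interior_ineq; lra. Qed.

(** In gap [i], [a i] is the source end, [b i] the other end and [s i] the direction from the one to
    the other. Levels decide which piece is lowest: near its centre a source lies below every chain
    and on its edges above 0, where some chain is negative; a sink on its ring has values of
    absolute value at most [Bm], which a chain exceeds at its last edge and undercuts at the edge of
    the sink. *)
Lemma eigenvalue_ge_nodes T mx V M L c g N (P P' k : nat -> R -> R) (kd : nat -> node_kind)
    (d0 kap s : nat -> R) (a b : nat -> nat) rho eps :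
  0 < T -> 0 < eps -> cont_cylinder T mx -> cont_cylinder T V ->
  field_ok (fun x t => - ext T mx x t) M L ->
  periodic_family (fun x t => - ext T mx x t) T c g ->
  (forall i, (i <= S N)%nat -> 0 < d0 i /\ placed T (P i) (d0 i) (side N i) /\
     node_spec T mx V rho (kd i) (P i) (P' i) (k i) (d0 i) (kap i)) ->
  (forall i, (1 <= i <= N)%nat -> periodic_orbit (fun x t => - ext T mx x t) T (P i) /\ kd i <> Outflow) ->
  kd 0%nat <> Sink -> kd (S N) <> Sink ->
  (forall i, (i <= N)%nat -> kd (a i) = Source /\ kd (b i) <> Source /\
     ((s i = 1 /\ a i = i /\ b i = S i) \/ (s i = -1 /\ a i = S i /\ b i = i))) ->
  (forall i x, (i <= N)%nat -> ((1 <= i)%nat -> P i 0 < x) -> ((S i <= N)%nat -> x < P (S i) 0) -> s i * c x < 0) ->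
  (forall i t, (i <= N)%nat -> 0 <= t <= T -> P i t + d0 i + d0 (S i) <= P (S i) t) ->
  exists D0, 0 < D0 /\ forall D l phi phix, 0 < D -> D < D0 ->
    eigenpair T D mx V l phi phix -> rho - eps <= l.
Proof.
intros HT Heps Hmx HV HB Hf Hnode Horb Hk0 HkN Hgap Hsign Hsep.
set (B := fun x t => - ext T mx x t) in *.
(* The widths come before anything attached to the gaps; the remaining quantifiers of the two
   existence lemmas are kept open for the later choices. *)
destruct (choice_upto 0 (fun i d => 0 < d <= d0 i /\
   (kd i = Source -> exists osc, 0 < osc /\ forall Ks, 0 < Ks -> exists D0, 0 < D0 /\
      forall D, 0 < D -> D < D0 -> exists p, node_piece_spec T mx V (rho - eps) D (kd i) (P i) d osc Ks 0 0 p) /\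
   (kd i = Sink -> forall d1, 0 < d1 <= d -> exists Bk, 0 < Bk /\ forall D, 0 < D -> D < 1 ->
      exists p, node_piece_spec T mx V (rho - eps) D (kd i) (P i) d 0 0 d1 Bk p)) (S N)) as [d Hd].
{ intros i Hi; destruct (Hnode i Hi) as (Hd0 & Hpl & Hsp); unfold node_spec in Hsp.
  destruct (kd i) eqn:Ek.
  - destruct Hsp as [Hsrc Hrho].
    destruct (source_piece_exists T mx V (P i) (P' i) (d0 i) (kap i) (side N i) eps HT Heps Hmx HV Hsrc Hpl) as [dm [Hdm H]].
    exists dm; split; [exact Hdm | split; [intros _ | discriminate]].
    destruct (H dm ltac:(lra)) as [osc [Hosc H2]]; exists osc; split; [exact Hosc | intros Ks HKs].
    destruct (H2 Ks HKs) as [D0 [HD0 H3]]; exists D0; split; [exact HD0 | intros D HD HDD].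
    destruct (H3 D HD HDD) as [p (Hp1 & Hp2 & Hp3)]; exists p; split; [exact Hp1 | split; [exact Hp2 | ]].
    intros x t Hx Ht Hxt; destruct (Hp3 x t Hx Ht Hxt) as (Q1 & Q2); split; [ | exact Q2].
    eapply interior_ineq_weaken; [ | exact Q1]; lra.
  - destruct Hsp as [Hsnk Hrho].
    destruct (sink_piece_exists T mx V (P i) (P' i) (k i) eps HT Heps Hmx HV Hsnk) as [dm [Hdm H]].
    { intros t Ht; now apply (placed_range T (P i) (d0 i) (side N i)). }
    exists (Rmin dm (d0 i)).
    assert (m0 : 0 < Rmin dm (d0 i)) by (apply Rmin_glb_lt; lra).
    split; [split; [exact m0 | apply Rmin_r] | split; [discriminate | intros _ d1 Hd1]].
    destruct (H (Rmin dm (d0 i)) d1 (conj m0 (Rmin_l _ _)) Hd1) as [Bk [HBk H2]].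
    exists Bk; split; [exact HBk | intros D HD HDD].
    destruct (H2 D HD HDD) as [p (Hp1 & Hp2 & Hp3)]; exists p; split; [exact Hp1 | split; [exact Hp2 | ]].
    intros x t Hx Ht Hxt; destruct (Hp3 x t Hx Ht Hxt) as (Q1 & Q2); split; [ | exact Q2].
    eapply interior_ineq_weaken; [ | exact Q1]; lra.
  - exists (d0 i); split; [lra | split; discriminate]. }
assert (Hdpos : forall i, (i <= S N)%nat -> 0 < d i) by (intros i Hi; apply (Hd i Hi)).
assert (Hddle : forall i, (i <= S N)%nat -> d i <= d0 i) by (intros i Hi; apply (Hd i Hi)).
assert (Hplace : forall i, (i <= S N)%nat -> placed T (P i) (d i) (side N i)).
{ intros i Hi; apply (placed_shrink T (P i) (d0 i)); [now apply Hddle | now apply Hnode]. }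
assert (Habi : forall i, (i <= N)%nat -> (a i <= S N)%nat /\ (b i <= S N)%nat).
{ intros i Hi; destruct (Hgap i Hi) as (_ & _ & [(_ & -> & ->) | (_ & -> & ->)]); lia. }
destruct (choice_upto (fun _ : R => 0, (fun _ : R => 0, (0, (0, (0, 0)))))
  (fun i z => gap_spec B T (s i) (P (a i)) (d (a i)) (P (b i)) (d (b i)) (kd (b i) = Outflow)
     (fst z) (fst (snd z)) (fst (snd (snd z))) (fst (snd (snd (snd z)))) (fst (snd (snd (snd (snd z)))))
     (snd (snd (snd (snd (snd z)))))) N) as [z Hz].
{ intros i Hi; destruct (Hgap i Hi) as (Hka & Hkb & Hab); destruct (Habi i Hi) as [Hia Hib].
  assert (Hside : forall j, (j <= S N)%nat -> (1 <= j <= N)%nat /\ side N j = 0 \/ j = 0%nat /\ side N j = 1 \/ j = S N /\ side N j = -1).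
  { intros j Hj; unfold side; destruct (Nat.eqb_spec j 0); [auto | ]; destruct (Nat.eqb_spec j (S N)); [auto | left; split; [lia | auto]]. }
  destruct (gap_exists B M L T c g (s i) (P (a i)) (d (a i)) (P (b i)) (d (b i)) (1 <= a i <= N)%nat (kd (b i) = Outflow)
    HB HT Hf) as (ga & gb & r & eta & Q & d1 & Hg); auto.
  - destruct Hab as [(-> & _) | (-> & _)]; auto.
  - assert (Hp := Hplace (a i) Hia); destruct (Hside (a i) Hia) as [[H1 H2] | [[H1 H2] | [H1 H2]]]; rewrite H2 in Hp.
    + left; split; [exact H1 | split; [now apply Horb | exact Hp]].
    + right; split; [lia | ]. destruct Hab as [(-> & Ea & _) | (_ & Ea & _)]; [exact Hp | lia].
    + right; split; [lia | ]. destruct Hab as [(_ & Ea & _) | (-> & Ea & _)]; [lia | exact Hp].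
  - assert (Hp := Hplace (b i) Hib); destruct (Hside (b i) Hib) as [[H1 H2] | [[H1 H2] | [H1 H2]]]; rewrite H2 in Hp.
    + left; destruct (Horb (b i) H1); auto.
    + right; split.
      * destruct (kd (b i)) eqn:E; [contradiction | rewrite H1 in E; contradiction | reflexivity].
      * destruct Hab as [(_ & _ & Eb) | (-> & _ & Eb)]; [lia | replace (- -1) with 1 by ring; exact Hp].
    + right; split.
      * destruct (kd (b i)) eqn:E; [contradiction | rewrite H1 in E; contradiction | reflexivity].
      * destruct Hab as [(-> & _ & Eb) | (_ & _ & Eb)]; [exact Hp | lia].
  - intros t Ht; specialize (Hsep i t Hi Ht).
    assert (X1 := Hddle i ltac:(lia)); assert (X2 := Hddle (S i) ltac:(lia)).
    destruct Hab as [(-> & -> & ->) | (-> & -> & ->)]; lra.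
  - intros x Hx1 Hx2; apply Hsign; [exact Hi | | ].
    + intros H1; destruct Hab as [(Es & Ea & Eb) | (Es & Ea & Eb)]; rewrite Es, ?Ea, ?Eb in *.
      * specialize (Hx1 ltac:(lia)); lra.
      * specialize (Hx2 ltac:(apply Horb; lia)); lra.
    + intros H1; destruct Hab as [(Es & Ea & Eb) | (Es & Ea & Eb)]; rewrite Es, ?Ea, ?Eb in *.
      * specialize (Hx2 ltac:(apply Horb; lia)); lra.
      * specialize (Hx1 ltac:(lia)); lra.
  - exists (ga, (gb, (r, (eta, (Q, d1))))); exact Hg. }
set (ga := fun i => fst (z i)) in *. set (gb := fun i => fst (snd (z i))) in *.
set (r := fun i => fst (snd (snd (z i)))) in *. set (eta := fun i => fst (snd (snd (snd (z i))))) in *.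
set (Q := fun i => fst (snd (snd (snd (snd (z i)))))) in *.
set (d1 := fun i => snd (snd (snd (snd (snd (z i)))))) in *.
assert (Hz' : forall i, (i <= N)%nat -> gap_spec B T (s i) (P (a i)) (d (a i)) (P (b i)) (d (b i)) (kd (b i) = Outflow)
   (ga i) (gb i) (r i) (eta i) (Q i) (d1 i)) by exact Hz.
clear Hz; rename Hz' into Hz; clearbody ga gb r eta Q d1; clear z.
(* A single distance from the sinks respected by the last edges of all chains; it fixes the ring on
   which the sink pieces are bounded. *)
destruct (finite_min d1 N) as [dd [Hdd Hdd1]]; [intros i Hi; destruct (Hz i Hi) as (_ & _ & _ & H & _); lra | ].
destruct (choice_upto 0 (fun i Bk => 0 < Bk /\ (kd i = Sink -> forall D, 0 < D -> D < 1 ->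
      exists p, node_piece_spec T mx V (rho - eps) D (kd i) (P i) (d i) 0 0 (Rmin dd (d i)) Bk p)) (S N)) as [Bk HBk].
{ intros i Hi; destruct (Hd i Hi) as (Hdi & _ & H); destruct (kd i) eqn:Ek.
  - exists 1; split; [lra | discriminate].
  - destruct (H eq_refl (Rmin dd (d i))) as [Bk [HB1 HB2]]; [split; [apply Rmin_glb_lt; lra | apply Rmin_r] | ].
    exists Bk; auto.
  - exists 1; split; [lra | discriminate]. }
destruct (finite_max Bk (S N)) as [Bm [HBm HBm1]].
destruct (ext_bounded T V HT HV) as [Vm [HVm HVm1]].
(* [K1] lifts the levels of the chains near sinks above all the bounds [Bk]; [K2] makes the gain of
   the drift beat [rho] and the potential. *)
destruct (finite_max (fun i => 2 * (Bm + 1) / r i) N) as [K1 [HK1 HK1']].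
destruct (finite_max (fun i => (rho + 1 + Vm) / eta i) N) as [K2 [HK2 HK2']].
set (K := K1 + K2).
assert (HK : 0 < K) by (unfold K; lra).
assert (HKr : forall i, (i <= N)%nat -> Bm < K * r i / 2).
{ intros i Hi; specialize (HK1' i Hi); destruct (Hz i Hi) as (Hr & _).
  apply (Rmult_le_compat_r (r i)) in HK1'; [ | lra].
  replace (2 * (Bm + 1) / r i * r i) with (2 * (Bm + 1)) in HK1' by (field; lra).
  assert (0 < K2 * r i) by now apply Rmult_lt_0_compat. unfold K; lra. }
assert (HKe : forall i, (i <= N)%nat -> rho + Vm <= K * eta i - 1).
{ intros i Hi; specialize (HK2' i Hi); destruct (Hz i Hi) as (_ & He & _).
  apply (Rmult_le_compat_r (eta i)) in HK2'; [ | lra].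
  replace ((rho + 1 + Vm) / eta i * eta i) with (rho + 1 + Vm) in HK2' by (field; lra).
  assert (0 < K1 * eta i) by now apply Rmult_lt_0_compat. unfold K; lra. }
clearbody K.
destruct (choice_upto nil (fun i ch => chain_spec B T (s i) (ga i) (gb i) (r i) (eta i) K (K * Q i) ch) N) as [ch Hch].
{ intros i Hi; destruct (Hz i Hi) as (_ & _ & _ & _ & H & _); now apply H. }
destruct (finite_max (fun i => K * Q i * r i) N) as [W [HW HW1]].
destruct (finite_max (fun i => (K * Q i) * (K * Q i)) N) as [W2 [HW2 HW21]].
destruct (choice_upto 0 (fun i osc => 0 < osc /\ (kd i = Source -> forall Ks, 0 < Ks -> exists D0, 0 < D0 /\
      forall D, 0 < D -> D < D0 -> exists p, node_piece_spec T mx V (rho - eps) D (kd i) (P i) (d i) osc Ks 0 0 p)) (S N)) as [osc Hosc].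
{ intros i Hi; destruct (Hd i Hi) as (Hdi & H & _); destruct (kd i) eqn:Ek.
  - destruct (H eq_refl) as [o [Ho1 Ho2]]; exists o; auto.
  - exists 1; split; [lra | discriminate].
  - exists 1; split; [lra | discriminate]. }
(* [W] bounds the levels of all chains. This height puts every source piece above [W] on its edges
   and below [- W] near its centre. *)
destruct (finite_max (fun i => 8 * (W + osc i + 1) / (d i * d i)) (S N)) as [Ks [HKs HKs1]].
assert (HKs2 : forall i, (i <= S N)%nat -> W < Ks * (d i * d i) / 8 - osc i).
{ intros i Hi; specialize (HKs1 i Hi); assert (X := Hdpos i Hi).
  assert (X2 : 0 < d i * d i) by now apply Rmult_lt_0_compat.
  apply (Rmult_le_compat_r (d i * d i)) in HKs1; [ | lra].
  replace (8 * (W + osc i + 1) / (d i * d i) * (d i * d i)) with (8 * (W + osc i + 1)) in HKs1 by (field; lra).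
  lra. }
destruct (choice_upto 0 (fun i D0 => 0 < D0 /\ (kd i = Source -> 
      forall D, 0 < D -> D < D0 -> exists p, node_piece_spec T mx V (rho - eps) D (kd i) (P i) (d i) (osc i) Ks 0 0 p)) (S N)) as [Ds HDs].
{ intros i Hi; destruct (Hosc i Hi) as (_ & H); destruct (kd i) eqn:Ek.
  - destruct (H eq_refl Ks HKs) as [D0 [H1 H2]]; exists D0; auto.
  - exists 1; split; [lra | discriminate].
  - exists 1; split; [lra | discriminate]. }
destruct (finite_min Ds (S N)) as [D1 [HD1 HD11]]; [intros i Hi; apply (HDs i Hi) | ].
(* The bound by [/ W2] gives [D] times the square of any chain slope at most 1; the bound 1 is that
   of the sink pieces. *)
set (D0 := Rmin D1 (Rmin 1 (/ W2))).
exists D0; split; [unfold D0; repeat apply Rmin_glb_lt; try lra; now apply Rinv_0_lt_compat | ].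
intros D l phi phix HD HDD Heig.
assert (HDD1 : D < D1) by (eapply Rlt_le_trans; [exact HDD | apply Rmin_l]).
assert (HDD2 : D < 1) by (eapply Rlt_le_trans; [exact HDD | eapply Rle_trans; [apply Rmin_r | apply Rmin_l]]).
assert (HDD3 : D * W2 <= 1).
{ assert (X : D <= / W2) by (left; eapply Rlt_le_trans; [exact HDD | eapply Rle_trans; [apply Rmin_r | apply Rmin_r]]).
  apply (Rmult_le_compat_r W2) in X; [ | lra]; rewrite Rinv_l in X by lra; exact X. }
destruct (choice_upto (Piece (fun _ => 0) (fun _ => 0) (fun _ _ => 0) (fun _ _ => 0) (fun _ _ => 0) (fun _ _ => 0))
  (fun i p => kd i <> Outflow -> node_piece_spec T mx V (rho - eps) D (kd i) (P i) (d i) (osc i) Ks (Rmin dd (d i)) (Bk i) p) (S N)) as [pn Hpn].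
{ intros i Hi; destruct (HDs i Hi) as [_ H1]; destruct (HBk i Hi) as [_ H2].
  destruct (kd i) eqn:Ek.
  - destruct (H1 eq_refl D HD) as [p Hp]; [specialize (HD11 i Hi); lra | exists p; intros _; exact Hp].
  - destruct (H2 eq_refl D HD HDD2) as [p Hp]; exists p; intros _; exact Hp.
  - exists (Piece (fun _ => 0) (fun _ => 0) (fun _ _ => 0) (fun _ _ => 0) (fun _ _ => 0) (fun _ _ => 0)); easy. }
set (LL := flat_map ch (seq 0 (S N)) ++ flat_map (fun i => match kd i with Outflow => nil | _ => pn i :: nil end) (seq 0 (S (S N)))).
assert (InC : forall i p, (i <= N)%nat -> In p (ch i) -> In p LL).
{ intros i p Hi Hp; apply in_or_app; left; apply in_flat_map; exists i; split; [apply in_seq; lia | exact Hp]. }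
assert (InN : forall i, (i <= S N)%nat -> kd i <> Outflow -> In (pn i) LL).
{ intros i Hi Hk; apply in_or_app; right; apply in_flat_map; exists i; split; [apply in_seq; lia | ].
  destruct (kd i); [now left | now left | contradiction]. }
assert (InE : forall p, In p LL -> (exists i, (i <= N)%nat /\ In p (ch i)) \/
   (exists i, (i <= S N)%nat /\ kd i <> Outflow /\ p = pn i)).
{ intros p Hp; apply in_app_or in Hp; destruct Hp as [Hp | Hp]; apply in_flat_map in Hp; destruct Hp as [i [Hi Hp]]; apply in_seq in Hi.
  - left; exists i; split; [lia | exact Hp].
  - right; exists i; destruct (kd i) eqn:E; [ | | easy]; destruct Hp as [<- | []]; repeat split; try discriminate; lia. }
assert (Tn : forall i x t, (i <= S N)%nat -> kd i <> Outflow -> in_tube (pn i) x t <-> Rabs (x - P i t) <= d i).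
{ intros i x t Hi Hk; destruct (Hpn i Hi Hk) as (_ & E & _); destruct (E t) as [E1 E2].
  unfold in_tube; rewrite E1, E2; split; intros H; [apply Rabs_le; lra | apply Rabs_le_between in H; lra]. }
apply (eigenvalue_ge T D mx V l phi phix (rho - eps) LL HT HD Hmx HV Heig).
- intros p Hp; destruct (InE p Hp) as [[i [Hi Hpi]] | [i (Hi & Hk & ->)]].
  + now apply (proj1 (Hch i Hi)).
  + apply (Hpn i Hi Hk).
- destruct (Hgap 0%nat ltac:(lia)) as (Hka & _ & _); destruct (Habi 0%nat ltac:(lia)) as [Hia _].
  exists (pn (a 0%nat)), (P (a 0%nat) 0); split; [apply InN; [exact Hia | rewrite Hka; discriminate] | split].
  + apply (placed_range T _ (d (a 0%nat)) (side N (a 0%nat))); [now apply Hdpos | now apply Hplace | lra].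
  + apply Tn; [exact Hia | rewrite Hka; discriminate | rewrite Rminus_diag, Rabs_R0; left; now apply Hdpos].
- intros p x t Hp Hx Ht Htube.
  destruct (InE p Hp) as [[i [Hi Hpi]] | [i (Hi & Hk & ->)]].
  + 
    destruct (Hch i Hi) as (_ & C2 & _).
    destruct (C2 p x t Hpi Ht Htube) as (Cin & Cx & Cw & Cb & Cedge).
    destruct (Hz i Hi) as (Hr & Heta & HQ & Hd1 & _ & S1 & S2 & K1s & K2s).
    destruct (Hgap i Hi) as (Hka & Hkb & Hab); destruct (Habi i Hi) as [Hia Hib].
    assert (Hs1 : s i = 1 \/ s i = -1) by (destruct Hab as [(? & _) | (? & _)]; auto).
    (* Settles both weak spots of a chain on its source side, the first edge and an inflow
       endpoint. *)
    assert (SrcDom : Rabs (x - P (a i) t) <= d (a i) / 2 -> exists q, In q LL /\ in_tube q x t /\ pw q x t < pw p x t).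
    { intros Hy; exists (pn (a i)).
      assert (Hko : kd (a i) <> Outflow) by (rewrite Hka; discriminate).
      assert (X := Hdpos (a i) Hia).
      split; [now apply InN | split; [apply Tn; auto; lra | ]].
      destruct (Hpn (a i) Hia Hko) as (_ & _ & H); destruct (H x t Hx Ht ltac:(lra)) as [_ H2].
      rewrite Hka in H2; destruct H2 as (_ & _ & H2 & _); specialize (H2 Hy).
      specialize (HKs2 (a i) Hia); specialize (HW1 i Hi); apply Rabs_le_between in Cw; lra. }
    destruct Cedge as [Hin | [[q (Hq1 & Hq2 & Hq3)] | [He | [He1 He2]]]].
    (* At the upstream endpoint the slope of the chain has the wrong sign and the source piece takes
       over; at the downstream one it has the strict sign required. *)
    * destruct (Req_dec x 0) as [Ex0 | Nx0]; [ | destruct (Req_dec x 1) as [Ex1 | Nx1]].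
      -- destruct Hs1 as [Es | Es].
         ++ right; right; right; apply SrcDom, (S1 t x Ht Hx); [apply Cb | right; left; auto].
         ++ right; left; rewrite Es in Cx; split; [exact Ex0 | split; [rewrite Ex0 in Hin; exact Hin | lra]].
      -- destruct Hs1 as [Es | Es].
         ++ right; right; left; rewrite Es in Cx; split; [exact Ex1 | split; [rewrite Ex1 in Hin; exact Hin | lra]].
         ++ right; right; right; apply SrcDom, (S1 t x Ht Hx); [apply Cb | right; right; auto].
      -- left; split; [exact Hin | split; [lra | ]].
         specialize (HW21 i Hi); specialize (HKe i Hi).
         assert (D * (K * Q i * (K * Q i)) <= 1).
         { eapply Rle_trans; [ | exact HDD3]; apply Rmult_le_compat_l; lra. }
         specialize (Cin D HD H); unfold B in Cin; specialize (HVm1 x t); apply Rabs_le_between in HVm1.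
         rewrite ext_id in Cin, HVm1 by lra. lra.
    * right; right; right; exists q; split; [now apply (InC i) | auto].
    * right; right; right; apply SrcDom, (S1 t x Ht Hx); [apply Cb | left; exact He].
    * right; right; right.
      destruct (K1s t x Ht Hx He1) as [No Hy].
      exists (pn (b i)); split; [now apply InN | split; [apply Tn; auto; lra | ]].
      destruct (Hpn (b i) Hib No) as (_ & _ & H); destruct (H x t Hx Ht ltac:(lra)) as [_ H2].
      assert (Hl : Rmin dd (d (b i)) <= Rabs (x - P (b i) t)).
      { eapply Rle_trans; [apply Rmin_l | specialize (Hdd1 i Hi); lra]. }
      specialize (HBm1 (b i) Hib); specialize (HKr i Hi).
      assert (Hp2 : Rabs (pw (pn (b i)) x t) <= Bk (b i)) by (destruct (kd (b i)); [contradiction | auto | auto]).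
      apply Rabs_le_between in Hp2.
      assert (0 < K * r i) by now apply Rmult_lt_0_compat.
      lra.
  + 
    apply Tn in Htube; auto.
    destruct (Hpn i Hi Hk) as (_ & E & H); destruct (E t) as [E1 E2]; destruct (H x t Hx Ht Htube) as [H1 H2].
    destruct (Req_dec (Rabs (x - P i t)) (d i)) as [Hedge | Hnedge].
    * 
      right; right; right.
      assert (Hpl := Hplace i Hi).
      assert (Hdi := Hdpos i Hi).
      (* An edge of a node tube lies in the gap on its side, the node being the source end or the
         other end of that gap. At an endpoint node only the inner edge is in [0,1]. *)
      assert (Hj : exists j, (j <= N)%nat /\ ((a j = i /\ x = P i t + s j * d i) \/ (b j = i /\ x = P i t - s j * d i))).
      { assert (Hx' : x = P i t + d i \/ x = P i t - d i) by (unfold Rabs in Hedge; destruct (Rcase_abs (x - P i t)); lra).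
        destruct Hx' as [Ex | Ex].
        - assert (Hi' : (i <= N)%nat).
          { destruct (Nat.eq_dec i (S N)) as [Ei | ]; [exfalso | lia].
            unfold side in Hpl; rewrite Ei in *; rewrite Nat.eqb_refl in Hpl; simpl in Hpl.
            destruct Hpl as [[X _] | [(X & _) | (_ & _ & X)]]; [lra | lra | rewrite X in Ex; lra]. }
          exists i; split; [exact Hi' | ].
          destruct (Hgap i Hi') as (_ & _ & [(-> & -> & ->) | (-> & -> & ->)]); [left | right]; split; auto; lra.
        - assert (Hi' : (1 <= i)%nat).
          { destruct (Nat.eq_dec i 0) as [Ei | ]; [exfalso | lia].
            unfold side in Hpl; rewrite Ei in *; simpl in Hpl.
            destruct Hpl as [[X _] | [(_ & _ & X) | (X & _)]]; [lra | rewrite X in Ex; lra | lra]. }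
          exists (i - 1)%nat; split; [lia | ].
          destruct (Hgap (i - 1)%nat ltac:(lia)) as (_ & _ & [(-> & -> & ->) | (-> & -> & ->)]); [right | left]; split; try lia; lra. }
      destruct Hj as [j [Hjn Hj]].
      destruct (Hz j Hjn) as (Hr & Heta & HQ & Hd1 & _ & S1 & S2 & K1s & K2s).
      destruct (Hgap j Hjn) as (Hka & Hkb & Hab).
      assert (Hss : s j * s j = 1) by (destruct Hab as [(-> & _) | (-> & _)]; ring).
      destruct (Hch j Hjn) as (_ & _ & Ccov).
      specialize (HKr j Hjn).
      destruct Hj as [[Ej Ex] | [Ej Ex]].
      -- rewrite Ej in *.
         assert (Esx : s j * x = s j * P i t + d i).
         { rewrite Ex; replace (s j * (P i t + s j * d i)) with (s j * P i t + s j * s j * d i) by ring; rewrite Hss; ring. }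
         destruct (S2 t Ht) as [S3 S4].
         destruct (Ccov x t Ht ltac:(lra) ltac:(lra)) as [q (Hq1 & Hq2 & Hq3)].
         exists q; split; [now apply (InC j) | split; [exact Hq2 | ]].
         rewrite Hka in H2; destruct H2 as (_ & _ & _ & H2); specialize (H2 Hedge).
         specialize (HKs2 i Hi); lra.
      -- rewrite Ej in *.
         assert (Esx : s j * x = s j * P i t - d i).
         { rewrite Ex; replace (s j * (P i t - s j * d i)) with (s j * P i t - s j * s j * d i) by ring; rewrite Hss; ring. }
         destruct (K2s Hk t Ht) as [S3 S4].
         destruct (Ccov x t Ht ltac:(lra) ltac:(lra)) as [q (Hq1 & Hq2 & Hq3)].
         exists q; split; [now apply (InC j) | split; [exact Hq2 | ]].
         specialize (HBm1 i Hi).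
         assert (Hp2 : Rabs (pw (pn i) x t) <= Bk i).
         { assert (Hm : Rmin dd (d i) <= Rabs (x - P i t)) by (rewrite Hedge; apply Rmin_r).
           destruct (kd i); [contradiction | auto | contradiction]. }
         apply Rabs_le_between in Hp2; lra.
    * assert (Hin : plow (pn i) t < x < phigh (pn i) t).
      { rewrite E1, E2; assert (Hlt : Rabs (x - P i t) < d i) by lra; apply Rabs_def2 in Hlt; lra. }
      destruct (Req_dec x 0) as [Ex0 | Nx0]; [ | destruct (Req_dec x 1) as [Ex1 | Nx1]].
      -- right; left; split; [exact Ex0 | split; [rewrite <- Ex0; exact Hin | ]].
         destruct (kd i) eqn:Ek; [now apply H2 | exfalso | contradiction].
         assert (Hpl := Hplace i Hi); unfold side in Hpl.
         destruct (Nat.eqb_spec i 0) as [-> | ]; [contradiction | ].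
         destruct (Nat.eqb_spec i (S N)) as [-> | ]; [contradiction | ].
         destruct Hpl as [[_ X] | [(X & _) | (X & _)]]; [ | lra | lra].
         specialize (X t Ht); apply Rabs_le_between in Htube; rewrite Ex0 in Htube; lra.
      -- right; right; left; split; [exact Ex1 | split; [rewrite <- Ex1; exact Hin | ]].
         destruct (kd i) eqn:Ek; [now apply H2 | exfalso | contradiction].
         assert (Hpl := Hplace i Hi); unfold side in Hpl.
         destruct (Nat.eqb_spec i 0) as [-> | ]; [contradiction | ].
         destruct (Nat.eqb_spec i (S N)) as [-> | ]; [contradiction | ].
         destruct Hpl as [[_ X] | [(X & _) | (X & _)]]; [ | lra | lra].
         specialize (X t Ht); apply Rabs_le_between in Htube; rewrite Ex1 in Htube; lra.
      -- left; split; [exact Hin | split; [lra | ]].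
         unfold interior_ineq in H1; rewrite !ext_id in H1 by lra; exact H1.
Qed.

(** * Periodic orbits and periodic solutions *)

(** Each point of [0,1] is a limit of other points of it, so relative derivatives are unique; this
    passes periodicity from [m] to [mx], endpoints included. *)
Lemma D_in_unit_unique (f g f' g' : R -> R) x : 0 <= x <= 1 ->
  (forall y, 0 <= y <= 1 -> f y = g y) ->
  D_in f f' (fun y => 0 <= y <= 1) x -> D_in g g' (fun y => 0 <= y <= 1) x -> f' x = g' x.
Proof.
intros Hx E Hf Hg.
apply (single_limit (fun y => (f y - f x) / (y - x)) (D_x (fun y => 0 <= y <= 1) x) (f' x) (g' x) x).
- intros a Ha; set (h := Rmin a (1 / 2) / 2).
  assert (m1 := Rmin_l a (1 / 2)). assert (m2 := Rmin_r a (1 / 2)).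
  assert (m0 : 0 < Rmin a (1 / 2)) by (apply Rmin_glb_lt; lra).
  assert (Hh : 0 < h < a /\ h <= 1 / 4) by (unfold h; lra).
  unfold D_x; destruct (Rle_dec x (1 / 2)).
  + exists (x + h); split; [split; [lra | lra] | ].
    unfold R_dist; simpl; unfold Rdist; replace (x + h - x) with h by ring; rewrite Rabs_pos_eq; lra.
  + exists (x - h); split; [split; [lra | lra] | ].
    unfold R_dist; simpl; unfold Rdist; replace (x - h - x) with (- h) by ring; rewrite Rabs_Ropp, Rabs_pos_eq; lra.
- exact Hf.
- intros e He; destruct (Hg e He) as [a [Ha H]]; exists a; split; [exact Ha | ].
  intros y [Hy Hya]; rewrite (E y), (E x); [apply H; split; assumption | exact Hx | apply Hy].
Qed.

Lemma periodic_derivative T (m mx : R -> R -> R) : periodic_in_t T m ->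
  (forall t, deriv_unit (fun x => m x t) (fun x => mx x t)) -> periodic_in_t T mx.
Proof.
intros Hp Hd x t Hx.
apply (D_in_unit_unique (fun x => m x (t + T)) (fun x => m x t) (fun x => mx x (t + T)) (fun x => mx x t)); auto.
- exact (Hd (t + T) x Hx).
- exact (Hd t x Hx).
Qed.

Definition floor_div (T t : R) : Z := Int_part (t / T).
Definition frac_part_T (T t : R) : R := t - T * IZR (floor_div T t).

Lemma frac_part_T_bounds T t : 0 < T -> 0 <= frac_part_T T t < T.
Proof.
intros HT; unfold frac_part_T, floor_div.
destruct (base_Int_part (t / T)) as [H1 H2].
assert (E : T * (t / T) = t) by (field; lra).
split.
- apply (Rmult_le_compat_l T) in H1; lra.
- assert (T * (t / T - IZR (Int_part (t / T))) < T * 1) by (apply Rmult_lt_compat_l; lra). lra.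
Qed.

Lemma floor_div_unique T t n : 0 < T -> T * IZR n <= t < T * IZR n + T -> floor_div T t = n.
Proof.
intros HT Ht; unfold floor_div.
assert (E : T * (t / T) = t) by (field; lra).
assert (H1 : IZR n <= t / T) by (apply (Rmult_le_reg_l T); lra).
assert (H2 : t / T < IZR n + 1) by (apply (Rmult_lt_reg_l T); lra).
symmetry; apply Int_part_spec; lra.
Qed.

(** At a multiple of [T] two translates of [H] meet, with equal values because [H T = H 0];
    elsewhere one translate describes the function. *)
Lemma periodic_extension_continuous T (H : R -> R) t : 0 < T -> (forall s, continuous H s) -> H T = H 0 ->
  continuous (fun s => H (frac_part_T T s)) t.
Proof.
intros HT CH HTe.
assert (G : forall n s, T * IZR n <= s <= T * IZR n + T -> H (frac_part_T T s) = H (s - T * IZR n)).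
{ intros n s [H1 [H2 | H2]].
  - unfold frac_part_T; now rewrite (floor_div_unique T s n HT (conj H1 H2)).
  - unfold frac_part_T; rewrite (floor_div_unique T s (n + 1) HT); rewrite plus_IZR; [ | lra].
    replace (s - T * (IZR n + 1)) with 0 by (rewrite H2; ring).
    replace (s - T * IZR n) with T by (rewrite H2; ring); auto. }
assert (CHs : forall n s, continuous (fun s => H (s - T * IZR n)) s).
{ intros n s; apply (continuous_comp (fun s => s - T * IZR n) H); [ | apply CH].
  apply (continuous_minus (V := R_NormedModule)); [apply continuous_id | apply continuous_const]. }
set (n := floor_div T t).
assert (Hb := frac_part_T_bounds T t HT).
assert (Hn : T * IZR n <= t < T * IZR n + T) by (unfold frac_part_T in Hb; fold n in Hb; lra).
apply (filterlim_locally (F := locally t)); intros e.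
destruct (locally_interval_Rabs _ _ (proj1 (filterlim_locally _ _) (CHs n t) e)) as [d1 [P1 Q1]].
destruct (locally_interval_Rabs _ _ (proj1 (filterlim_locally _ _) (CHs (n - 1)%Z t) e)) as [d2 [P2 Q2]].
destruct (proj1 Hn) as [Hlt | Heq].
- assert (Hd : 0 < Rmin d1 (Rmin (t - T * IZR n) (T * IZR n + T - t))) by (repeat apply Rmin_glb_lt; lra).
  assert (m1 := Rmin_l d1 (Rmin (t - T * IZR n) (T * IZR n + T - t))).
  assert (m2 := Rmin_r d1 (Rmin (t - T * IZR n) (T * IZR n + T - t))).
  assert (m3 := Rmin_l (t - T * IZR n) (T * IZR n + T - t)). assert (m4 := Rmin_r (t - T * IZR n) (T * IZR n + T - t)).
  exists (mkposreal _ Hd); intros s Hs.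
  change (Rabs (s - t) < Rmin d1 (Rmin (t - T * IZR n) (T * IZR n + T - t))) in Hs.
  assert (Hs' := Rabs_def2 _ _ Hs).
  rewrite (G n s), (G n t) by lra; apply Q1; lra.
- assert (Hd : 0 < Rmin (Rmin d1 d2) T) by (repeat apply Rmin_glb_lt; lra).
  assert (m1 := Rmin_l (Rmin d1 d2) T). assert (m2 := Rmin_r (Rmin d1 d2) T).
  assert (m3 := Rmin_l d1 d2). assert (m4 := Rmin_r d1 d2).
  exists (mkposreal _ Hd); intros s Hs.
  change (Rabs (s - t) < Rmin (Rmin d1 d2) T) in Hs.
  assert (Hs' := Rabs_def2 _ _ Hs).
  destruct (Rle_dec t s) as [Hts | Hts].
  + rewrite (G n s), (G n t) by lra; apply Q1; lra.
  + rewrite (G (n - 1)%Z s), (G (n - 1)%Z t) by (rewrite minus_IZR; lra); apply Q2; lra.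
Qed.

Lemma periodic_Z (T : R) (f : R -> R) : (forall t, f (t + T) = f t) -> forall n t, f (t + T * IZR n) = f t.
Proof.
intros H.
assert (Hnat : forall n t, f (t + T * INR n) = f t).
{ induction n as [ | n IH]; intros t; [simpl; f_equal; ring | ].
  rewrite S_INR; replace (t + T * (INR n + 1)) with ((t + T * INR n) + T) by ring; now rewrite H. }
intros n t; destruct (Z_le_gt_dec 0 n) as [Hn | Hn].
- replace (IZR n) with (INR (Z.to_nat n)); [apply Hnat | ].
  rewrite INR_IZR_INZ, Z2Nat.id; auto.
- rewrite <- (Hnat (Z.to_nat (- n)) (t + T * IZR n)); f_equal.
  rewrite INR_IZR_INZ, Z2Nat.id by lia; rewrite opp_IZR; ring.
Qed.

Lemma constant_of_derive_0 (f : R -> R) a b : a <= b ->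
  (forall t, a <= t <= b -> continuous f t) -> (forall t, a < t < b -> is_derive f t 0) -> f b = f a.
Proof.
intros Hab Cf Df; apply Rle_antisym.
- assert (H : - f a <= - f b); [ | lra].
  apply (nondecreasing_of_derive (fun t => - f t) (fun _ => - 0)); auto; intros t Ht.
  + apply (continuous_opp (V := R_NormedModule)); auto.
  + apply (is_derive_opp (V := R_NormedModule)); auto.
  + lra.
- apply (nondecreasing_of_derive f (fun _ => 0)); auto; intros; lra.
Qed.

(** Repeating [X] periodically would leave its derivative at the multiples of [T] to be examined.
    Instead the periodic extension of its velocity, which is continuous, is integrated: the result
    is differentiable everywhere, periodic, and equal to [X] on one period. *)
Lemma orbit_periodic_solution T mx X : 0 < T -> cont_cylinder T mx -> periodic_in_t T mx ->
  periodic_orbit (fun x t => - ext T mx x t) T X -> (forall t, 0 <= t <= T -> 0 <= X t <= 1) ->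
  exists Q, periodic_solution T mx Q /\ forall t, 0 <= t <= T -> Q t = X t.
Proof.
intros HT Hmx Hper [[CX DX] XT] Hr.
set (H := fun s => - ext T mx (X s) s).
assert (CH : forall s, continuous H s).
{ intros s; apply (continuous_opp (V := R_NormedModule)).
  apply (continuity_2d_slice_t (fun _ t => ext T mx (X t) t) 0).
  apply (continuity_2d_comp (ext T mx) (fun _ t => X t) (fun _ t => t)).
  - now apply ext_continuous.
  - apply continuity_2d_of_t, CX.
  - apply continuity_2d_pt_id2. }
assert (HH : H T = H 0).
{ unfold H; rewrite XT, !ext_id by (try apply Hr; lra).
  rewrite <- (Hper (X 0) 0) by (apply Hr; lra); do 2 f_equal; ring. }
set (G := fun s => H (frac_part_T T s)).
assert (CG : forall s, continuous G s) by (intros; now apply periodic_extension_continuous).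
set (Q := fun t => X 0 + RInt G 0 t).
assert (DQ : forall t, is_derive Q t (G t)).
{ intros t; unfold Q; replace (G t) with (plus 0 (G t)) by (unfold plus; simpl; ring).
  apply (is_derive_plus (V := R_NormedModule)); [auto_derive; auto | now apply is_derive_primitive]. }
assert (CQ : forall t, continuous Q t).
{ intros t; apply (ex_derive_continuous (V := R_NormedModule)); eexists; apply DQ. }
assert (Q0 : Q 0 = X 0) by (unfold Q; rewrite RInt_pt; ring).
assert (QX : forall t, 0 <= t <= T -> Q t = X t).
{ intros t Ht.
  assert (E : Q t - X t = Q 0 - X 0).
  { apply (constant_of_derive_0 (fun t => Q t - X t)); [lra | | ].
    - intros s _; now apply (continuous_minus (V := R_NormedModule)).
    - intros s Hs; replace 0 with (minus (G s) (H s + 0)).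
      + apply (is_derive_minus (V := R_NormedModule)); [apply DQ | unfold H; apply DX; lra].
      + unfold G, frac_part_T; rewrite (floor_div_unique T s 0 HT) by lra.
        rewrite Rmult_0_r, Rminus_0_r; unfold minus, plus, opp; simpl; ring. }
  lra. }
assert (PQ : forall t, Q (t + T) = Q t).
{ assert (D0 : forall t, is_derive (fun t => Q (t + T) - Q t) t 0).
  { intros t; replace 0 with (minus (G (t + T)) (G t)).
    - apply (is_derive_minus (V := R_NormedModule)); [ | apply DQ].
      replace (G (t + T)) with (scal 1 (G (t + T))) by (unfold scal; simpl; unfold mult; simpl; ring).
      apply (is_derive_comp Q (fun t => t + T)); [apply DQ | auto_derive; auto; ring].
    - unfold G, frac_part_T.
      assert (B := frac_part_T_bounds T t HT); unfold frac_part_T in B.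
      rewrite (floor_div_unique T (t + T) (floor_div T t + 1) HT) by (rewrite plus_IZR; lra).
      rewrite plus_IZR; replace (t + T - T * (IZR (floor_div T t) + 1)) with (t - T * IZR (floor_div T t)) by ring.
      unfold minus; apply (plus_opp_r (G := R_AbelianGroup)). }
  assert (C0 : forall t, continuous (fun t => Q (t + T) - Q t) t).
  { intros t; apply (ex_derive_continuous (V := R_NormedModule)); eexists; apply D0. }
  assert (E0 : Q (0 + T) - Q 0 = 0).
  { rewrite Rplus_0_l, (QX T), (QX 0) by lra; rewrite XT; ring. }
  intros t; destruct (Rle_dec 0 t) as [Ht | Ht].
  - assert (E := constant_of_derive_0 (fun t => Q (t + T) - Q t) 0 t Ht (fun t _ => C0 t) (fun t _ => D0 t)); simpl in E; lra.
  - assert (E := constant_of_derive_0 (fun t => Q (t + T) - Q t) t 0 ltac:(lra) (fun t _ => C0 t) (fun t _ => D0 t)); simpl in E; lra. }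
assert (QF : forall t, Q t = X (frac_part_T T t)).
{ intros t; assert (B := frac_part_T_bounds T t HT).
  rewrite <- (QX (frac_part_T T t)) by lra; unfold frac_part_T.
  rewrite <- (periodic_Z T Q PQ (floor_div T t) (t - T * IZR (floor_div T t))); f_equal; ring. }
exists Q; split; [split; [ | split] | exact QX].
- intros t; rewrite QF; apply Hr; assert (B := frac_part_T_bounds T t HT); lra.
- intros t; replace (- mx (Q t) t) with (G t); [apply DQ | ].
  assert (B := frac_part_T_bounds T t HT).
  assert (Hx := Hr (frac_part_T T t) ltac:(lra)).
  unfold G, H; rewrite ext_id, QF by lra; f_equal.
  rewrite <- (periodic_Z T (mx (X (frac_part_T T t))) (fun s => Hper _ s Hx) (floor_div T t)).
  f_equal; unfold frac_part_T; ring.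
- intros t; symmetry; apply PQ.
Qed.

Lemma periodic_solution_orbit T mx Q : 0 < T -> periodic_solution T mx Q ->
  periodic_orbit (fun x t => - ext T mx x t) T Q.
Proof.
intros HT (Hr & HD & Hp); split; [split | ].
- intros t; apply (ex_derive_continuous (V := R_NormedModule)); eexists; apply HD.
- intros t Ht; rewrite ext_id, Rplus_0_r by (try apply Hr; lra); apply HD.
- rewrite (Hp 0); f_equal; ring.
Qed.

(** The flow crosses the level [y] in one direction only. On the side it points to, forward
    comparison keeps the orbit there; on the other side a crossing could not be undone before time
    [T], against [X T = X 0]. *)
Lemma orbit_stays B M L T X y sg kap tau : field_ok B M L -> 0 < T -> periodic_orbit B T X ->
  (sg = 1 \/ sg = -1) -> (tau = 1 \/ tau = -1) -> 0 < kap ->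
  (forall t, 0 < t < T -> kap <= sg * B y t) -> 0 < tau * (X 0 - y) ->
  forall t, 0 <= t <= T -> 0 < tau * (X t - y).
Proof.
intros HB HT [[CX DX] XT] Hs Ht Hk Hy H0 t Htt.
assert (HB' := HB); destruct HB' as (_ & _ & HL & M0 & L0).
assert (Hrho : forall rho u, (rho = 1 \/ rho = -1) -> 
   rho * B y u - L * Rabs (rho * (X u - y)) <= rho * (B (X u) u + 0)).
{ intros rho u Hrho; specialize (HL (X u) y u); apply Rabs_le_between in HL.
  rewrite Rabs_mult; replace (Rabs rho) with 1 by (destruct Hrho as [-> | ->]; split_Rabs; lra).
  destruct Hrho as [-> | ->]; lra. }
assert (Main : forall rho a b, (rho = 1 \/ rho = -1) -> rho = sg -> 0 <= a -> a <= b -> b <= T -> 0 <= rho * (X a - y) ->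
   exp (- (L * (b - a))) * (rho * (X a - y) + kap * (b - a)) <= rho * (X b - y)).
{ intros rho a b Hr E Ha Hab Hb H.
  apply (linear_comparison (fun u => rho * (X u - y)) (fun u => rho * (B (X u) u + 0))); try lra.
  - intros u; apply (continuous_scal_r (V := R_NormedModule) rho).
    apply (continuous_minus (V := R_NormedModule)); [apply CX | apply continuous_const].
  - intros u Hu; apply is_derive_scal.
    replace (B (X u) u + 0) with (minus (B (X u) u + 0) 0) by (unfold minus, plus, opp; simpl; ring).
    apply (is_derive_minus (V := R_NormedModule)); [apply DX; lra | apply (is_derive_const (V := R_NormedModule))].
  - intros u Hu; specialize (Hrho rho u Hr); specialize (Hy u ltac:(lra)); rewrite E in *; lra. }
destruct (Req_dec tau sg) as [E | E].
- assert (A := Main tau 0 t Ht E ltac:(lra) ltac:(lra) ltac:(lra) ltac:(lra)).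
  eapply Rlt_le_trans; [ | exact A]; apply Rmult_lt_0_compat; [apply exp_pos | ].
  assert (0 <= kap * (t - 0)) by (apply Rmult_le_pos; lra); lra.
- apply Rnot_le_lt; intros N.
  assert (E' : - tau = sg) by (destruct Hs as [-> | ->], Ht as [-> | ->]; lra).
  assert (A := Main (- tau) t T ltac:(destruct Ht as [-> | ->]; lra) E' ltac:(lra) ltac:(lra) ltac:(lra) ltac:(lra)).
  assert (0 <= exp (- (L * (T - t))) * (- tau * (X t - y) + kap * (T - t))).
  { apply Rmult_le_pos; [left; apply exp_pos | ]. assert (0 <= kap * (T - t)) by (apply Rmult_le_pos; lra); lra. }
  rewrite XT in A; lra.
Qed.

(** * Classification of the nodes *)

Lemma ext_slice_continuous T f x t : 0 < T -> cont_cylinder T f -> continuous (fun s => ext T f x s) t.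
Proof. intros HT Hf; apply (continuity_2d_slice_t (ext T f)); now apply ext_continuous. Qed.

Lemma hat_ext T m x : 0 < T -> 0 <= x <= 1 -> hat T m x = / T * RInt (fun s => ext T m x s) 0 T.
Proof.
intros HT Hx; unfold hat; f_equal; apply RInt_ext; intros s Hs; rewrite Rmin_left, Rmax_right in Hs by lra.
rewrite ext_id; auto; lra.
Qed.

(** Near the endpoint the increments of [m] in [x], taken with the sign [sg], are bounded below
    uniformly in [t]. Averaging preserves this, without differentiation under the integral. *)
Lemma hat_derivative_sign T m mx mhx e sg : 0 < T -> cont_cylinder T m -> cont_cylinder T mx ->
  (forall t, deriv_unit (fun x => m x t) (fun x => mx x t)) -> deriv_unit (hat T m) mhx ->
  (e = 0 \/ e = 1) -> (sg = 1 \/ sg = -1) -> (forall t, 0 <= t <= T -> 0 < sg * mx e t) ->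
  0 < sg * mhx e.
Proof.
intros HT Hm Hmx Hd Hh He Hs Hpos.
assert (He1 : 0 <= e <= 1) by (destruct He; lra).
destruct (positive_lower_bound (fun t => sg * ext T mx e t) 0 T ltac:(lra)) as [kap [Hk Hk']].
{ intros t _; apply (continuous_scal_r (V := R_NormedModule) sg); now apply ext_slice_continuous. }
{ intros t Ht; rewrite ext_id by lra; now apply Hpos. }
destruct (ext_uniform T mx (kap / 2) HT Hmx) as [d [Hd0 Hd1]]; [lra | ].
assert (Hsg : Rabs sg = 1) by (destruct Hs as [-> | ->]; split_Rabs; lra).
assert (Mon : forall a b t, 0 <= a -> a <= b -> b <= 1 -> 0 <= t <= T -> Rabs (a - e) <= d -> Rabs (b - e) <= d ->
   kap / 2 * (b - a) <= sg * (ext T m b t - ext T m a t)).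
{ intros a b t Ha Hab Hb Ht Had Hbd.
  assert (A : sg * ext T m a t - kap / 2 * a <= sg * ext T m b t - kap / 2 * b); [ | lra].
  apply (nondecreasing_of_derive (fun z => sg * ext T m z t - kap / 2 * z) (fun z => sg * ext T mx z t - kap / 2)); [exact Hab | | | ].
  - intros z _; apply (continuous_minus (V := R_NormedModule)).
    + apply (continuous_scal_r (V := R_NormedModule) sg).
      apply (continuous_slice_x (ext T m)); now apply ext_continuous.
    + apply (continuous_scal_r (V := R_NormedModule) (kap / 2)), continuous_id.
  - intros z Hz; apply (is_derive_minus (V := R_NormedModule)); [ | auto_derive; auto; ring].
    apply is_derive_scal, ext_is_derive_x; auto; lra.
  - intros z Hz.
    assert (Hze : Rabs (z - e) <= d).
    { apply Rabs_le_between in Had; apply Rabs_le_between in Hbd; apply Rabs_le; lra. }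
    assert (A := Hd1 z e t ltac:(lra) He1 Ht Hze).
    assert (A2 : Rabs (sg * (ext T mx z t - ext T mx e t)) <= kap / 2) by (rewrite Rabs_mult, Hsg; lra).
    apply Rabs_le_between in A2; specialize (Hk' t Ht); lra. }
assert (Hmon : forall a b, 0 <= a -> a <= b -> b <= 1 -> Rabs (a - e) <= d -> Rabs (b - e) <= d ->
   kap / 2 * (b - a) <= sg * (hat T m b - hat T m a)).
{ intros a b Ha Hab Hb Had Hbd.
  rewrite !hat_ext by lra.
  assert (I : forall x, ex_RInt (fun s => ext T m x s) 0 T).
  { intros x; apply ex_RInt_cont; intros t; now apply ext_slice_continuous. }
  assert (A : (T - 0) * (kap / 2 * (b - a)) <= RInt (fun s => sg * ext T m b s + (- sg) * ext T m a s) 0 T).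
  { rewrite <- RInt_cst; apply RInt_le; [lra | apply ex_RInt_const | | ].
    - apply RInt_lin; apply I.
    - intros t Ht; specialize (Mon a b t Ha Hab Hb ltac:(lra) Had Hbd); lra. }
  rewrite (proj2 (RInt_lin (fun s => ext T m b s) (fun s => ext T m a s) 0 T sg (- sg) (I b) (I a))) in A.
  assert (W : forall I1 I2 z : R, (T - 0) * z <= sg * I1 + - sg * I2 -> z <= sg * (/ T * I1 - / T * I2)).
  { intros I1 I2 z Hz; apply (Rmult_le_reg_l T); [exact HT | ].
    replace (T * (sg * (/ T * I1 - / T * I2))) with (sg * I1 + - sg * I2) by (field; lra); lra. }
  now apply W. }
apply Rnot_le_lt; intros N.
destruct (Hh e He1 (kap / 4) ltac:(lra)) as [al [Hal H]].
set (h := Rmin al (Rmin d 1) / 2).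
assert (m0 : 0 < Rmin al (Rmin d 1)) by (repeat apply Rmin_glb_lt; lra).
assert (m1 := Rmin_l al (Rmin d 1)). assert (m2 := Rmin_r al (Rmin d 1)).
assert (m3 := Rmin_l d 1). assert (m4 := Rmin_r d 1).
assert (Hh' : 0 < h < al /\ h < d /\ h < 1) by (unfold h; lra); clearbody h.
assert (exists x, 0 <= x <= 1 /\ Rabs (x - e) = h /\ kap / 2 <= sg * ((hat T m x - hat T m e) / (x - e))) as [x (Hx & Hxe & Hq)].
{ destruct He as [-> | ->].
  - exists h; rewrite Rminus_0_r, Rabs_pos_eq by lra; split; [lra | split; [reflexivity | ]].
    assert (A := Hmon 0 h ltac:(lra) ltac:(lra) ltac:(lra) ltac:(rewrite Rminus_diag, Rabs_R0; lra) ltac:(rewrite Rminus_0_r, Rabs_pos_eq; lra)).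
    apply (Rmult_le_reg_r h); [lra | ].
    replace (sg * ((hat T m h - hat T m 0) / h) * h) with (sg * (hat T m h - hat T m 0)) by (field; lra); lra.
  - exists (1 - h); replace (1 - h - 1) with (- h) by ring; rewrite Rabs_Ropp, Rabs_pos_eq by lra; split; [lra | split; [reflexivity | ]].
    assert (A := Hmon (1 - h) 1 ltac:(lra) ltac:(lra) ltac:(lra)
      ltac:(replace (1 - h - 1) with (- h) by ring; rewrite Rabs_Ropp, Rabs_pos_eq; lra) ltac:(rewrite Rminus_diag, Rabs_R0; lra)).
    apply (Rmult_le_reg_r h); [lra | ].
    replace (sg * ((hat T m (1 - h) - hat T m 1) / - h) * h) with (sg * (hat T m 1 - hat T m (1 - h))) by (field; lra); lra. }
specialize (H x); simpl in H; unfold R_dist, Rdist, D_x in H.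
assert (A : Rabs ((hat T m x - hat T m e) / (x - e) - mhx e) < kap / 4).
{ apply H; split; [split; [exact Hx | ] | lra].
  intros E; rewrite E, Rminus_diag, Rabs_R0 in Hxe; lra. }
assert (A2 : Rabs (sg * ((hat T m x - hat T m e) / (x - e) - mhx e)) < kap / 4) by (rewrite Rabs_mult, Hsg; lra).
apply Rabs_def2 in A2; lra.
Qed.

(** First-order expansion of the drift, uniform in time: subtracting the tangent with slope
    [mxx (P t) t] leaves a function of slope at most [e] near the orbit. *)
Lemma local_expansion T mx mxx P e : 0 < T -> cont_cylinder T mx -> cont_cylinder T mxx ->
  (forall t, deriv_unit (fun x => mx x t) (fun x => mxx x t)) ->
  (forall t, 0 <= t <= T -> 0 <= P t <= 1) -> 0 < e ->
  exists d, 0 < d /\ forall x t, 0 <= x <= 1 -> 0 <= t <= T -> Rabs (x - P t) <= d ->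
    Rabs ((x - P t) * (- ext T mx x t - - ext T mx (P t) t) + ext T mxx (P t) t * ((x - P t) * (x - P t)))
     <= e * ((x - P t) * (x - P t)).
Proof.
intros HT Hmx Hmxx Hd HP He.
destruct (ext_uniform T mxx e HT Hmxx He) as [d [Hd0 Hd1]].
exists d; split; [exact Hd0 | intros x t Hx Ht Hxt].
specialize (HP t Ht); set (p := P t) in *; set (k := ext T mxx p t).
assert (Mon : forall s a b, (s = 1 \/ s = -1) -> 0 <= a -> a <= b -> b <= 1 -> Rabs (a - p) <= d -> Rabs (b - p) <= d ->
   s * ((ext T mx b t - k * b) - (ext T mx a t - k * a)) <= e * (b - a)).
{ intros s a b Hs Ha Hab Hb Had Hbd.
  assert (A : e * a - s * (ext T mx a t - k * a) <= e * b - s * (ext T mx b t - k * b)); [ | lra].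
  apply (nondecreasing_of_derive (fun z => e * z - s * (ext T mx z t - k * z)) (fun z => e - s * (ext T mxx z t - k))); [exact Hab | | | ].
  - intros z _; apply (continuous_minus (V := R_NormedModule)).
    + apply (continuous_scal_r (V := R_NormedModule) e), continuous_id.
    + apply (continuous_scal_r (V := R_NormedModule) s).
      apply (continuous_minus (V := R_NormedModule)).
      * apply (continuous_slice_x (ext T mx)); now apply ext_continuous.
      * apply (continuous_scal_r (V := R_NormedModule) k), continuous_id.
  - intros z Hz; apply (is_derive_minus (V := R_NormedModule)); [auto_derive; auto; ring | ].
    apply is_derive_scal; apply (is_derive_minus (V := R_NormedModule)); [ | auto_derive; auto; ring].
    apply ext_is_derive_x; auto; lra.
  - intros z Hz.
    assert (Hze : Rabs (z - p) <= d).
    { apply Rabs_le_between in Had; apply Rabs_le_between in Hbd; apply Rabs_le; lra. }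
    assert (A := Hd1 z p t ltac:(lra) HP Ht Hze); fold k in A; apply Rabs_le_between in A.
    destruct Hs as [-> | ->]; lra. }
assert (Z0 : Rabs (p - p) <= d) by (rewrite Rminus_diag, Rabs_R0; lra).
assert (A : Rabs ((ext T mx x t - k * x) - (ext T mx p t - k * p)) <= e * Rabs (x - p)).
{ destruct (Rle_dec p x) as [H | H].
  - assert (A1 := Mon 1 p x ltac:(auto) ltac:(lra) H ltac:(lra) Z0 Hxt).
    assert (A2 := Mon (-1) p x ltac:(auto) ltac:(lra) H ltac:(lra) Z0 Hxt).
    rewrite (Rabs_pos_eq (x - p)) by lra; apply Rabs_le; lra.
  - assert (A1 := Mon 1 x p ltac:(auto) ltac:(lra) ltac:(lra) ltac:(lra) Hxt Z0).
    assert (A2 := Mon (-1) x p ltac:(auto) ltac:(lra) ltac:(lra) ltac:(lra) Hxt Z0).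
    rewrite <- (Rabs_Ropp (x - p)), (Rabs_pos_eq (- (x - p))) by lra; apply Rabs_le; lra. }
replace ((x - p) * (- ext T mx x t - - ext T mx p t) + k * ((x - p) * (x - p)))
  with (- (x - p) * ((ext T mx x t - k * x) - (ext T mx p t - k * p))) by ring.
rewrite Rabs_mult, Rabs_Ropp.
replace ((x - p) * (x - p)) with (Rabs (x - p) * Rabs (x - p)) by (rewrite <- Rabs_mult; apply Rabs_pos_eq, Rle_0_sqr).
replace (e * (Rabs (x - p) * Rabs (x - p))) with (Rabs (x - p) * (e * Rabs (x - p))) by ring.
apply Rmult_le_compat_l; [apply Rabs_pos | exact A].
Qed.

Lemma orbit_smooth B M L T P : field_ok B M L -> periodic_orbit B T P -> smooth_t T P (fun t => B (P t) t).
Proof.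
intros HB [[CP DP] PT]; split; [exact CP | split; [ | split; [ | exact PT]]].
- intros t Ht; rewrite <- (Rplus_0_r (B (P t) t)); now apply DP.
- intros t _; eapply field_comp_continuous; eauto.
Qed.

Lemma constant_sign (f : R -> R) T : 0 < T -> (forall t, continuous f t) ->
  (forall t, 0 <= t <= T -> f t <> 0) ->
  exists sg kap, (sg = 1 \/ sg = -1) /\ 0 < kap /\ forall t, 0 <= t <= T -> kap <= sg * f t.
Proof.
intros HT Cf Hf.
assert (Hc : continuity f) by (intros t; apply continuity_pt_filterlim, Cf).
assert (S : forall sg, (sg = 1 \/ sg = -1) -> 0 < sg * f 0 -> forall t, 0 <= t <= T -> 0 < sg * f t).
{ intros sg Hs H0 t Ht; apply Rnot_le_lt; intros N.
  destruct (IVT_gen f 0 t 0 Hc) as [z [Hz1 Hz2]].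
  - unfold Rmin, Rmax; repeat destruct (Rle_dec _ _); destruct Hs as [-> | ->]; lra.
  - rewrite Rmin_left, Rmax_right in Hz1 by lra; apply (Hf z); [lra | exact Hz2]. }
assert (exists sg, (sg = 1 \/ sg = -1) /\ 0 < sg * f 0) as [sg [Hs H0]].
{ destruct (Rtotal_order (f 0) 0) as [H | [H | H]].
  - exists (-1); split; [auto | lra].
  - exfalso; apply (Hf 0); lra.
  - exists 1; split; [auto | lra]. }
destruct (positive_lower_bound (fun t => sg * f t) 0 T ltac:(lra)) as [kap [Hk Hk']].
{ intros t _; apply (continuous_scal_r (V := R_NormedModule) sg), Cf. }
{ intros t Ht; now apply S. }
exists sg, kap; auto.
Qed.

Definition node_core (T : R) (mx : R -> R -> R) (kd : node_kind) (P P' k : R -> R) (d kap : R) : Prop :=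
  match kd with
  | Source => source_node T (fun x t => - ext T mx x t) P P' d kap
  | Sink => sink_node T (fun x t => - ext T mx x t) P P' k
  | Outflow => True
  end.

Definition node_value (T : R) (V : R -> R -> R) (kd : node_kind) (P k : R -> R) : Rbar :=
  match kd with
  | Source => Finite (/ T * RInt (fun t => ext T V (P t) t) 0 T)
  | Sink => Finite (/ T * RInt (fun t => ext T V (P t) t) 0 T + / T * RInt k 0 T)
  | Outflow => p_infty
  end.

(** [mxx] has one sign along the orbit, positive at a sink since the drift is [- mx]. The closing
    constants on both sides are found by testing with the parallel curves [P + d] and [P - d], which
    the flow crosses towards a sink and away from a source. *)
Lemma interior_node T mx mxx V M L c g P sep : 0 < T -> 0 < sep ->
  cont_cylinder T mx -> cont_cylinder T mxx -> cont_cylinder T V ->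
  (forall t, deriv_unit (fun x => mx x t) (fun x => mxx x t)) ->
  field_ok (fun x t => - ext T mx x t) M L -> periodic_family (fun x t => - ext T mx x t) T c g ->
  periodic_orbit (fun x t => - ext T mx x t) T P -> (forall t, 0 <= t <= T -> 0 < P t < 1) ->
  (forall t, 0 <= t <= T -> mxx (P t) t <> 0) ->
  exists kd k d kap, 0 < d <= sep /\ placed T P d 0 /\ kd <> Outflow /\
    node_core T mx kd P (fun t => - ext T mx (P t) t) k d kap /\
    value_on_orbit T mxx V P = node_value T V kd P k /\
    (kd = Source -> c (P 0 + d) < 0 /\ 0 < c (P 0 - d)) /\
    (kd <> Source -> 0 < c (P 0 + d) /\ c (P 0 - d) < 0).
Proof.
intros HT Hsep Hmx Hmxx HV Hd HB Hf HP Hr Hne.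
set (B := fun x t => - ext T mx x t) in *.
assert (HPs := orbit_smooth B M L T P HB HP).
assert (HB' := HB); destruct HB' as (_ & HM & HL & M0 & L0).
assert (Ck : forall t, continuous (fun t => ext T mxx (P t) t) t).
{ intros t; eapply (V_curve_continuous T mxx P); eauto. }
destruct (constant_sign (fun t => ext T mxx (P t) t) T HT Ck) as [sg [k0 (Hs & Hk0 & Hk)]].
{ intros t Ht; specialize (Hr t Ht); rewrite ext_id by lra; now apply Hne. }
destruct (positive_lower_bound (fun t => Rmin (P t) (1 - P t)) 0 T ltac:(lra)) as [q [Hq Hq']].
{ intros t _; apply continuity_pt_filterlim.
  assert (E : forall s, (P s + (1 - P s) - Rabs (P s - (1 - P s))) / 2 = Rmin (P s) (1 - P s)).
  { intros s; unfold Rmin, Rabs; destruct (Rle_dec _ _), (Rcase_abs _); lra. }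
  apply (continuity_pt_ext _ _ _ E), continuity_pt_filterlim.
  apply (continuous_scal_l (V := R_NormedModule) (fun s => P s + (1 - P s) - Rabs (P s - (1 - P s)))).
  assert (C1 : continuous (fun s => 1 - P s) t).
  { apply (continuous_minus (V := R_NormedModule)); [apply continuous_const | apply HPs]. }
  apply (continuous_minus (V := R_NormedModule)).
  - apply (continuous_plus (V := R_NormedModule)); [apply HPs | exact C1].
  - apply continuous_comp; [ | apply continuous_Rabs].
    apply (continuous_minus (V := R_NormedModule)); [apply HPs | exact C1]. }
{ intros t Ht; specialize (Hr t Ht); apply Rmin_glb_lt; lra. }
assert (Hr' : forall t, 0 <= t <= T -> 0 <= P t <= 1) by (intros t Ht; specialize (Hr t Ht); lra).
destruct (local_expansion T mx mxx P (k0 / 2) HT Hmx Hmxx Hd Hr' ltac:(lra)) as [d1 [Hd1 Hloc]].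
set (d := Rmin sep (Rmin (q / 4) (d1 / 2))).
assert (a1 : d <= sep) by apply Rmin_l.
assert (a2 : d <= q / 4) by (eapply Rle_trans; [apply Rmin_r | apply Rmin_l]).
assert (a3 : d <= d1 / 2) by (eapply Rle_trans; [apply Rmin_r | apply Rmin_r]).
assert (a0 : 0 < d) by (repeat apply Rmin_glb_lt; lra); clearbody d.
assert (Hpl : forall t, 0 <= t <= T -> 2 * d < P t < 1 - 2 * d).
{ intros t Ht; specialize (Hq' t Ht); assert (m1 := Rmin_l (P t) (1 - P t)); assert (m2 := Rmin_r (P t) (1 - P t)); lra. }
assert (Htest : forall tau, (tau = 1 \/ tau = -1) -> (- sg * tau) * c (P 0 + tau * d) < 0).
{ intros tau Htau.
  assert (Hst : - sg * tau = 1 \/ - sg * tau = -1) by (destruct Hs as [-> | ->], Htau as [-> | ->]; lra).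
  apply (family_speed_sign B M L T c g (- sg * tau) (fun t => P t + tau * d) (fun t => B (P t) t) (k0 / 2 * d) HB HT Hf Hst).
  - apply Rmult_lt_0_compat; lra.
  - intros t; apply (continuous_plus (V := R_NormedModule)); [apply HPs | apply continuous_const].
  - intros t Ht; rewrite <- (Rplus_0_r (B (P t) t)).
    apply (is_derive_plus (V := R_NormedModule)); [now apply HPs | apply (is_derive_const (V := R_NormedModule))].
  - destruct HP as [_ ->]; reflexivity.
  - intros t Ht; specialize (Hpl t ltac:(lra)); specialize (Hk t ltac:(lra)).
    assert (A := Hloc (P t + tau * d) t ltac:(destruct Htau as [-> | ->]; lra) ltac:(lra)).
    replace (P t + tau * d - P t) with (tau * d) in A by ring.
    specialize (A ltac:(rewrite Rabs_mult, (Rabs_pos_eq d) by lra; destruct Htau as [-> | ->]; split_Rabs; lra)).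
    apply Rabs_le_between in A; fold (B (P t + tau * d) t) (B (P t) t) in A.
    change (- ext T mx (P t + tau * d) t) with (B (P t + tau * d) t) in A.
    change (- ext T mx (P t) t) with (B (P t) t) in A.
    replace (tau * d * (tau * d)) with (d * d) in A by (destruct Htau as [-> | ->]; ring).
    set (k := ext T mxx (P t) t) in *.
    apply (Rmult_le_reg_l d); [exact a0 | ].
    assert (k0 * (d * d) <= sg * k * (d * d)) by (apply Rmult_le_compat_r; [apply Rlt_le, Rmult_lt_0_compat; lra | exact Hk]).
    destruct Hs as [-> | ->], Htau as [-> | ->]; lra. }
assert (Hval : forall F : R -> R, (forall t, 0 <= t <= T -> Rmax (mxx (P t) t) 0 = F t) -> (forall t, continuous F t) ->
  value_on_orbit T mxx V P = Finite (/ T * RInt (fun t => ext T V (P t) t) 0 T + / T * RInt F 0 T)).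
{ intros F HF CF; unfold value_on_orbit; f_equal.
  rewrite (RInt_ext _ (fun t => 1 * ext T V (P t) t + 1 * F t)).
  - rewrite (proj2 (RInt_lin (fun t => ext T V (P t) t) F 0 T 1 1
      (ex_RInt_cont _ _ _ (fun t => V_curve_continuous T V P _ t HT HV HPs)) (ex_RInt_cont _ _ _ CF))).
    assert (W : forall I1 I2 : R, / T * (1 * I1 + 1 * I2) = / T * I1 + / T * I2) by (intros; ring); apply W.
  - intros t Ht; rewrite Rmin_left, Rmax_right in Ht by lra.
    rewrite ext_id by (try apply Hr'; lra); rewrite HF by lra; eqR; ring. }
assert (T1 := Htest 1 (or_introl eq_refl)). assert (T2 := Htest (-1) (or_intror eq_refl)).
replace (P 0 + 1 * d) with (P 0 + d) in T1 by ring.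
replace (P 0 + -1 * d) with (P 0 - d) in T2 by ring.
destruct Hs as [-> | ->].
- exists Sink, (fun t => ext T mxx (P t) t), d, 1.
  split; [lra | split; [left; auto | split; [discriminate | split; [ | split; [ | split; [discriminate | intros _; lra]]]]]].
  + simpl; split; [exact HPs | split; [exact Ck | split]].
    * exists k0; split; [exact Hk0 | intros t Ht; specialize (Hk t Ht); lra].
    * intros e He; destruct (local_expansion T mx mxx P e HT Hmx Hmxx Hd Hr' He) as [d2 [Hd2 H2]].
      exists d2; split; [exact Hd2 | intros x t Hx Ht Hxt; specialize (H2 x t Hx Ht Hxt)].
      apply Rabs_le_between in H2; lra.
  + simpl; apply Hval; [ | exact Ck].
    intros t Ht; specialize (Hk t Ht); rewrite ext_id in * by (try apply Hr'; lra); apply Rmax_left; lra.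
- exists Source, (fun _ => 0), d, (k0 / 2).
  split; [lra | split; [left; auto | split; [discriminate | split; [ | split; [ | split; [intros _; lra | easy]]]]]].
  + simpl; split; [exact HPs | split; [exact a0 | split; [lra | split]]].
    * intros x t Hx Ht Hxt; specialize (Hloc x t Hx Ht ltac:(lra)); specialize (Hk t Ht).
      apply Rabs_le_between in Hloc.
      assert (Sq := Rle_0_sqr (x - P t)); unfold Rsqr in Sq.
      assert (k0 * ((x - P t) * (x - P t)) <= -1 * ext T mxx (P t) t * ((x - P t) * (x - P t))) by (apply Rmult_le_compat_r; lra).
      lra.
    * exists (2 * M); split; [lra | intros x t Hx Ht].
      assert (A1 := HM x t); assert (A2 := HM (P t) t); apply Rabs_le_between in A1; apply Rabs_le_between in A2.
      unfold B in A1, A2; apply Rabs_le; lra.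
  + simpl; rewrite (Hval (fun _ => 0)).
    * rewrite RInt_cst; f_equal; rewrite !Rmult_0_r; apply Rplus_0_r.
    * intros t Ht; specialize (Hk t Ht); rewrite ext_id in * by (try apply Hr'; lra); apply Rmax_right; lra.
    * intros; apply continuous_const.
Qed.

Lemma ext_endpoint_constant T mx y e t : (e = 0 /\ y <= 0) \/ (e = 1 /\ 1 <= y) -> ext T mx y t = ext T mx e t.
Proof.
intros [[-> H] | [-> H]]; unfold ext; f_equal.
- rewrite !clamp_low; auto; lra.
- rewrite !clamp_high; auto; lra.
Qed.

(* [s = 1]: the endpoint 0;  [s = -1]: the endpoint 1. *)
Lemma boundary_node T m mx V mhx M L c g s sep : 0 < T -> 0 < sep -> (s = 1 \/ s = -1) ->
  cont_cylinder T m -> cont_cylinder T mx -> cont_cylinder T V ->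
  (forall t, deriv_unit (fun x => m x t) (fun x => mx x t)) -> deriv_unit (hat T m) mhx ->
  field_ok (fun x t => - ext T mx x t) M L -> periodic_family (fun x t => - ext T mx x t) T c g ->
  (forall t, 0 <= t <= T -> mx ((1 - s) / 2) t <> 0) ->
  exists kd d kap, 0 < d <= sep /\ placed T (fun _ => (1 - s) / 2) d s /\ kd <> Sink /\
    node_core T mx kd (fun _ => (1 - s) / 2) (fun _ => 0) (fun _ => 0) d kap /\
    (kd = Source -> s * mhx ((1 - s) / 2) < 0) /\ (kd = Outflow -> 0 < s * mhx ((1 - s) / 2)) /\
    (kd = Source -> s * c ((1 - s) / 2 - s) < 0) /\ (kd <> Source -> 0 < s * c ((1 - s) / 2 - s)) /\
    exists sg k0, (sg = 1 \/ sg = -1) /\ 0 < k0 /\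
      forall y t, 0 <= t <= T -> (s = 1 /\ y <= 0) \/ (s = -1 /\ 1 <= y) -> k0 <= sg * - ext T mx y t.
Proof.
intros HT Hsep Hs Hm Hmx HV Hd Hh HB Hf Hne.
set (e := (1 - s) / 2) in *.
assert (He : (s = 1 /\ e = 0) \/ (s = -1 /\ e = 1)) by (unfold e; destruct Hs as [-> | ->]; [left | right]; split; auto; field).
assert (He1 : 0 <= e <= 1) by (destruct He as [[_ ->] | [_ ->]]; lra).
clearbody e.
set (B := fun x t => - ext T mx x t) in *.
assert (HB' := HB); destruct HB' as (_ & HM & HL & M0 & L0).
destruct (constant_sign (fun t => - ext T mx e t) T HT) as [sg [k0 (Hsg & Hk0 & Hk)]].
{ intros t; apply (continuous_opp (V := R_NormedModule)); now apply ext_slice_continuous. }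
{ intros t Ht; rewrite ext_id by lra; specialize (Hne t Ht); lra. }
assert (Hout : forall y t, 0 <= t <= T -> (s = 1 /\ y <= 0) \/ (s = -1 /\ 1 <= y) -> k0 <= sg * - ext T mx y t).
{ intros y t Ht Hy; rewrite (ext_endpoint_constant T mx y e); [now apply Hk | ].
  destruct He as [[Es ->] | [Es ->]]; [left | right]; split; auto; lra. }
(* The test curve is constant, one unit outside the interval, where the clamped drift equals its
   endpoint value. *)
assert (Htest : sg * c (e - s) < 0).
{ apply (family_speed_sign B M L T c g sg (fun _ => e - s) (fun _ => 0) k0 HB HT Hf Hsg Hk0).
  - intros t; apply continuous_const.
  - intros t _; apply (is_derive_const (V := R_NormedModule)).
  - reflexivity.
  - intros t Ht; rewrite Rminus_0_r; unfold B; apply Hout; [lra | destruct He as [[-> ->] | [-> ->]]; lra]. }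
assert (Hmh : 0 < - sg * mhx e).
{ apply (hat_derivative_sign T m mx mhx e (- sg) HT Hm Hmx Hd Hh).
  - destruct He as [[_ ->] | [_ ->]]; auto.
  - destruct Hsg as [-> | ->]; [right | left]; ring.
  - intros t Ht; specialize (Hk t Ht); rewrite ext_id in Hk by lra; lra. }
set (d := Rmin sep (Rmin (1 / 4) (k0 / (4 * L)))).
assert (q0 : 0 < k0 / (4 * L)) by (apply Rdiv_lt_0_compat; lra).
assert (a1 : d <= sep) by apply Rmin_l.
assert (a2 : d <= 1 / 4) by (eapply Rle_trans; [apply Rmin_r | apply Rmin_l]).
assert (a3 : d <= k0 / (4 * L)) by (eapply Rle_trans; [apply Rmin_r | apply Rmin_r]).
assert (a0 : 0 < d) by (repeat apply Rmin_glb_lt; lra); clearbody d.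
assert (a4 : L * (2 * d) <= k0 / 2).
{ apply (Rmult_le_compat_l L) in a3; [ | lra]. replace (L * (k0 / (4 * L))) with (k0 / 4) in a3 by (field; lra); lra. }
assert (Hpl : placed T (fun _ => e) d s).
{ destruct He as [[-> ->] | [-> ->]]; right; [left | right]; repeat split; auto; lra. }
(* The drift at the endpoint points into the interval exactly when [sg = s]. *)
destruct (Req_dec sg s) as [E | E].
- exists Source, d, (k0 / 2); subst sg.
  split; [lra | split; [exact Hpl | split; [discriminate | split; [ | split; [intros _; lra | split; [discriminate | split; [auto | split; [easy | ]]]]]]]].
  + simpl; split; [ | split; [exact a0 | split; [lra | split]]].
    * split; [intros; apply continuous_const | split; [ | split; [intros; apply continuous_const | reflexivity]]].
      intros t _; apply (is_derive_const (V := R_NormedModule)).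
    * intros x t Hx Ht Hxe; specialize (Hk t Ht); rewrite Rminus_0_r.
      assert (A := HL x e t); unfold B in A.
      assert (A2 : L * Rabs (x - e) <= k0 / 2).
      { eapply Rle_trans; [apply Rmult_le_compat_l; [lra | exact Hxe] | exact a4]. }
      apply (fun H => Rle_trans _ _ _ H A2) in A; apply Rabs_le_between in A.
      assert (A3 : k0 / 2 <= s * - ext T mx x t) by (destruct Hs as [-> | ->]; lra).
      assert (A4 : 0 <= s * (x - e) <= 1) by (destruct He as [[-> ->] | [-> ->]]; lra).
      assert (A5 : s * (x - e) * (k0 / 2) <= s * (x - e) * (s * - ext T mx x t)) by (apply Rmult_le_compat_l; lra).
      assert (Ess : s * s = 1) by (destruct Hs as [-> | ->]; ring).
      replace (s * (x - e) * (s * - ext T mx x t)) with (s * s * ((x - e) * - ext T mx x t)) in A5 by ring.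
      rewrite Ess in A5.
      assert (A6 : (x - e) * (x - e) <= s * (x - e)) by (destruct Hs as [-> | ->]; nra).
      assert (k0 / 2 * ((x - e) * (x - e)) <= k0 / 2 * (s * (x - e))) by (apply Rmult_le_compat_l; lra).
      lra.
    * exists M; split; [exact M0 | intros x t _ _; rewrite Rminus_0_r; apply HM].
  + exists s, k0; auto.
- assert (Es : sg = - s) by (destruct Hs as [-> | ->], Hsg as [-> | ->]; lra).
  exists Outflow, d, 1; rewrite Es in *.
  split; [lra | split; [exact Hpl | split; [discriminate | split; [exact I | split; [discriminate | split; [intros _; lra | split; [discriminate | split; [intros _; lra | ]]]]]]]].
  exists (- s), k0; auto.
Qed.

(** * The limit *)

Lemma Rbar_min_upto_spec (e : nat -> Rbar) n :
  (exists i, (i <= n)%nat /\ Rbar_min_upto e n = e i) /\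
  (forall i, (i <= n)%nat -> Rbar_le (Rbar_min_upto e n) (e i)).
Proof.
assert (M1 : forall a b, Rbar_min a b = a \/ Rbar_min a b = b).
{ intros [a | | ] [b | | ]; simpl; auto; unfold Rmin; destruct (Rle_dec a b); auto. }
assert (M2 : forall a b, Rbar_le (Rbar_min a b) a /\ Rbar_le (Rbar_min a b) b).
{ intros [a | | ] [b | | ]; simpl; auto; split; try lra; auto; [apply Rmin_l | apply Rmin_r]. }
induction n as [ | n [[i [Hi E]] IH]].
- split; [exists O; split; auto | intros i Hi; replace i with O by lia; simpl; apply Rbar_le_refl].
- simpl; destruct (M2 (Rbar_min_upto e n) (e (S n))) as [L1 L2]; split.
  + destruct (M1 (Rbar_min_upto e n) (e (S n))) as [-> | ->]; [exists i | exists (S n)]; split; auto.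
  + intros j Hj; destruct (Nat.eq_dec j (S n)) as [-> | Nj]; [exact L2 | ].
    eapply Rbar_le_trans; [exact L1 | apply IH; lia].
Qed.

Lemma at_right_0_intro (Q : R -> Prop) :
  (exists D0, 0 < D0 /\ forall D, 0 < D -> D < D0 -> Q D) -> at_right 0 Q.
Proof.
intros [D0 [H0 H]]; exists (mkposreal _ H0); intros D HD Hp.
change (Rabs (D - 0) < D0) in HD; rewrite Rminus_0_r in HD; apply Rabs_def2 in HD; apply H; lra.
Qed.

(** The lower bound is required for every real [rho] below all the values; when the minimum is
    [p_infty] this is every [rho], so divergence comes from the same hypothesis as convergence. *)
Lemma limit_of_bounds (lam : R -> R) (e : nat -> Rbar) n :
  (forall i, (i <= n)%nat -> e i <> m_infty) ->
  (forall i r eps, (i <= n)%nat -> e i = Finite r -> 0 < eps ->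
     exists D0, 0 < D0 /\ forall D, 0 < D -> D < D0 -> lam D <= r + eps) ->
  (forall rho eps, (forall i, (i <= n)%nat -> Rbar_le (Finite rho) (e i)) -> 0 < eps ->
     exists D0, 0 < D0 /\ forall D, 0 < D -> D < D0 -> rho - eps <= lam D) ->
  filterlim lam (at_right 0) (Rbar_locally (Rbar_min_upto e n)).
Proof.
intros Hm Hup Hlow.
destruct (Rbar_min_upto_spec e n) as [[i [Hi E]] Hle].
destruct (Rbar_min_upto e n) as [r | | ].
- intros Q [eps HQ]; apply at_right_0_intro.
  assert (Pe := cond_pos eps).
  destruct (Hup i r (eps / 2) Hi (eq_sym E) ltac:(lra)) as [D1 [H1 H1']].
  destruct (Hlow r (eps / 2) Hle ltac:(lra)) as [D2 [H2 H2']].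
  exists (Rmin D1 D2); split; [apply Rmin_glb_lt; lra | intros D HD HDD].
  apply HQ; change (Rabs (lam D - r) < eps).
  assert (A1 := Rmin_l D1 D2). assert (A2 := Rmin_r D1 D2).
  specialize (H1' D HD ltac:(lra)); specialize (H2' D HD ltac:(lra)); apply Rabs_def1; lra.
- intros Q [M HQ]; apply at_right_0_intro.
  destruct (Hlow (M + 2) 1) as [D2 [H2 H2']]; [ | lra | ].
  { intros j Hj; specialize (Hle j Hj); destruct (e j); simpl in *; auto; contradiction. }
  exists D2; split; [exact H2 | intros D HD HDD; apply HQ; specialize (H2' D HD HDD); lra].
- exfalso; apply (Hm i Hi); auto.
Qed.

Lemma principal_eigenpair T D mx V l : is_principal_eigenvalue T D mx V l ->
  exists phi phix, eigenpair T D mx V l phi phix.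
Proof.
intros [phi [Hpos [phix (H1 & H2 & H3 & H4 & H5 & H6)]]].
exists phi, phix; repeat split; auto; now apply H5.
Qed.

(** A periodic orbit has closing constant 0, whereas at and beyond an endpoint the constant is
    nonzero, by testing with constant curves. So the orbit starts inside, and [orbit_stays] keeps it
    there. *)
Lemma periodic_orbit_inside B M L T c g X : field_ok B M L -> 0 < T -> periodic_family B T c g ->
  (exists sg k0, (sg = 1 \/ sg = -1) /\ 0 < k0 /\ forall y t, 0 <= t <= T -> y <= 0 -> k0 <= sg * B y t) ->
  (exists sg k0, (sg = 1 \/ sg = -1) /\ 0 < k0 /\ forall y t, 0 <= t <= T -> 1 <= y -> k0 <= sg * B y t) ->
  periodic_orbit B T X -> forall t, 0 <= t <= T -> 0 < X t < 1.
Proof.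
intros HB HT Hf (s0 & k0 & Hs0 & Hk0 & H0) (s1 & k1 & Hs1 & Hk1 & H1) HX t Ht.
destruct (family_at_orbit B M L T c g X HB HT Hf HX) as [Hc _].
assert (Hno : forall s k y, (s = 1 \/ s = -1) -> 0 < k -> (forall t, 0 <= t <= T -> k <= s * B y t) -> X 0 <> y).
{ intros s k y Hs Hk H E.
  assert (A : s * c y < 0).
  { apply (family_speed_sign B M L T c g s (fun _ => y) (fun _ => 0) k HB HT Hf Hs Hk).
    - intros u; apply continuous_const.
    - intros u _; apply (is_derive_const (V := R_NormedModule)).
    - reflexivity.
    - intros u Hu; rewrite Rminus_0_r; apply H; lra. }
  rewrite <- E, Hc in A; lra. }
assert (X0 : 0 < X 0).
{ apply Rnot_le_lt; intros N; apply (Hno s0 k0 (X 0) Hs0 Hk0); auto. }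
assert (X1 : X 0 < 1).
{ apply Rnot_le_lt; intros N; apply (Hno s1 k1 (X 0) Hs1 Hk1); auto. }
split.
- assert (A := orbit_stays B M L T X 0 s0 k0 1 HB HT HX Hs0 ltac:(auto) Hk0
    ltac:(intros u Hu; apply H0; lra) ltac:(lra) t Ht); lra.
- assert (A := orbit_stays B M L T X 1 s1 k1 (-1) HB HT HX Hs1 ltac:(auto) Hk1
    ltac:(intros u Hu; apply H1; lra) ltac:(lra) t Ht); lra.
Qed.

Lemma interval_constant_sign (f : R -> R) (I : R -> Prop) : continuity f ->
  (forall x y z, I x -> I y -> x <= z <= y -> I z) -> (forall x, I x -> f x <> 0) ->
  (forall x, I x -> f x < 0) \/ (forall x, I x -> 0 < f x).
Proof.
intros Cf HI Hf.
destruct (classic (exists x, I x /\ 0 < f x)) as [[x [Hx Hfx]] | N].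
- right; intros y Hy; apply Rnot_le_lt; intros Hn.
  destruct (IVT_gen f x y 0 Cf) as [z [Hz1 Hz2]].
  { unfold Rmin, Rmax; repeat destruct (Rle_dec _ _); lra. }
  apply (Hf z); [ | exact Hz2].
  unfold Rmin, Rmax in Hz1; destruct (Rle_dec x y); [apply (HI x y) | apply (HI y x)]; auto; lra.
- left; intros y Hy; destruct (Rtotal_order (f y) 0) as [H | [H | H]]; [exact H | exfalso; now apply (Hf y) | ].
  exfalso; apply N; eauto.
Qed.

(** A zero of the closing constant inside a gap would give a periodic solution missing from the
    list. Hence the constant keeps its sign on each gap, which is what orients the chain there and
    pairs each source with a node of another kind. *)
Lemma eigenvalue_limit T m mx mxx V mhx mhxx lam N (P : nat -> R -> R) : 0 < T ->
  periodic_in_t T m -> cont_cylinder T m -> cont_cylinder T mx -> cont_cylinder T mxx -> cont_cylinder T V ->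
  (forall t, deriv_unit (fun x => m x t) (fun x => mx x t)) ->
  (forall t, deriv_unit (fun x => mx x t) (fun x => mxx x t)) ->
  deriv_unit (hat T m) mhx ->
  (forall t, 0 <= t <= T -> mx 0 t <> 0 /\ mx 1 t <> 0) ->
  (forall D, 0 < D -> is_principal_eigenvalue T D mx V (lam D)) ->
  (forall i, (1 <= i <= N)%nat -> periodic_solution T mx (P i)) ->
  (forall Q, periodic_solution T mx Q -> exists i, (1 <= i <= N)%nat /\ forall t, Q t = P i t) ->
  (forall i t, (1 <= i < N)%nat -> P i t < P (S i) t) ->
  (forall i t, (1 <= i <= N)%nat -> 0 <= t <= T -> mxx (P i t) t <> 0) ->
  filterlim lam (at_right 0) (Rbar_locally (Rbar_min_upto (value T mxx V mhx mhxx N P) (S N))).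
Proof.
intros HT Hper Hm Hmx Hmxx HV Hd1 Hd2 Hh Hbd Hlam Hsol Hall Hord Hne.
destruct (field_of_potential T mx mxx HT Hmx Hmxx Hd2) as [M [L HB]].
destruct (periodic_family_exists _ M L T HB HT) as [c [g Hf]].
assert (Hperx := periodic_derivative T m mx Hper Hd1).
assert (Hc : continuity c).
{ destruct (family_speed_lipschitz _ M L T c g HB HT Hf) as [C [C0 HC]].
  intros x; apply continuity_pt_filterlim; apply (filterlim_locally (F := locally x)); intros e.
  assert (Hd : 0 < e / C) by (apply Rdiv_lt_0_compat; [apply cond_pos | lra]).
  exists (mkposreal _ Hd); intros y Hy; change (Rabs (y - x) < e / C) in Hy; change (Rabs (c y - c x) < e).
  eapply Rle_lt_trans; [apply HC | ].
  replace (pos e) with (C * (e / C)) by (field; lra); apply Rmult_lt_compat_l; lra. }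
assert (BN := fun s sep Hsep Hs Hne => boundary_node T m mx V mhx M L c g s sep HT Hsep Hs Hm Hmx HV Hd1 Hh HB Hf Hne).
assert (Hb0 : forall t, 0 <= t <= T -> mx ((1 - 1) / 2) t <> 0).
{ intros t Ht; replace ((1 - 1) / 2) with 0 by field; now apply Hbd. }
assert (Hb1 : forall t, 0 <= t <= T -> mx ((1 - -1) / 2) t <> 0).
{ intros t Ht; replace ((1 - -1) / 2) with 1 by field; now apply Hbd. }
set (B := fun x t => - ext T mx x t) in *.
assert (Hinside : forall X, periodic_orbit B T X -> forall t, 0 <= t <= T -> 0 < X t < 1).
{ intros X HX; apply (periodic_orbit_inside B M L T c g X HB HT Hf); auto.
  - destruct (BN 1 1 ltac:(lra) ltac:(auto) Hb0) as (? & ? & ? & _ & _ & _ & _ & _ & _ & _ & _ & sg & k0 & H1 & H2 & H3).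
    exists sg, k0; split; [exact H1 | split; [exact H2 | intros y t Ht Hy; apply H3; auto]].
  - destruct (BN (-1) 1 ltac:(lra) ltac:(auto) Hb1) as (? & ? & ? & _ & _ & _ & _ & _ & _ & _ & _ & sg & k0 & H1 & H2 & H3).
    exists sg, k0; split; [exact H1 | split; [exact H2 | intros y t Ht Hy; apply H3; auto]]. }
assert (Hporb : forall i, (1 <= i <= N)%nat -> periodic_orbit B T (P i)).
{ intros i Hi; apply periodic_solution_orbit; auto. }
assert (Hzero : forall x, c x = 0 -> exists j, (1 <= j <= N)%nat /\ x = P j 0).
{ intros x Hx; destruct (Hf x) as (O & X0 & XT); rewrite Hx in O.
  assert (PO : periodic_orbit B T (g x)) by (split; [exact O | lra]).
  destruct (orbit_periodic_solution T mx (g x) HT Hmx Hperx PO) as [Q [HQ HQX]].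
  { intros t Ht; assert (A := Hinside (g x) PO t Ht); lra. }
  destruct (Hall Q HQ) as [j [Hj HQj]]; exists j; split; [exact Hj | ].
  rewrite <- HQj, HQX, X0 by lra; reflexivity. }
(* The orbits completed by the endpoints as constant curves, written as [(1 - s) / 2] with [s = 1]
   and [s = -1] to match [boundary_node]. *)
set (PP := fun i : nat => if Nat.eqb i 0 then (fun _ : R => (1 - 1) / 2)
    else if Nat.eqb i (S N) then (fun _ : R => (1 - -1) / 2) else P i).
assert (PP0 : PP 0%nat = fun _ => (1 - 1) / 2) by reflexivity.
assert (PPN : PP (S N) = fun _ => (1 - -1) / 2) by (unfold PP; simpl; now rewrite Nat.eqb_refl).
assert (PPi : forall i, (1 <= i <= N)%nat -> PP i = P i).
{ intros i Hi; unfold PP; destruct (Nat.eqb_spec i 0); [lia | ]; destruct (Nat.eqb_spec i (S N)); [lia | reflexivity]. }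
assert (Hcase : forall i, (i <= S N)%nat -> i = 0%nat \/ i = S N \/ (1 <= i <= N)%nat) by (intros; lia).
assert (CPP : forall i t, (i <= S N)%nat -> continuous (PP i) t).
{ intros i t Hi; destruct (Hcase i Hi) as [-> | [-> | Hi']].
  - apply continuous_const.
  - rewrite PPN; apply continuous_const.
  - rewrite PPi by exact Hi'; apply Hporb; exact Hi'. }
assert (Hlt : forall i t, (i <= N)%nat -> 0 <= t <= T -> PP i t < PP (S i) t).
{ intros i t Hi Ht.
  assert (A0 : (1 - 1) / 2 = 0) by field. assert (A1 : (1 - -1) / 2 = 1) by field.
  destruct (Nat.eq_dec i N) as [Ei | Ei]; destruct (Nat.eq_dec i 0) as [-> | Ni].
  - replace 1%nat with (S N) by lia; rewrite PPN, PP0; lra.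
  - replace (S i) with (S N) by lia; rewrite PPN, PPi by lia; assert (X := Hinside _ (Hporb i ltac:(lia)) t Ht); lra.
  - rewrite PP0, PPi by lia; assert (X := Hinside _ (Hporb 1%nat ltac:(lia)) t Ht); lra.
  - rewrite !PPi by lia; apply Hord; lia. }
destruct (choice_upto 0 (fun i q => 0 < q /\ forall t, 0 <= t <= T -> q <= PP (S i) t - PP i t) N) as [q Hq].
{ intros i Hi; apply (positive_lower_bound (fun t => PP (S i) t - PP i t) 0 T ltac:(lra)).
  - intros t _; apply (continuous_minus (V := R_NormedModule)); apply CPP; lia.
  - intros t Ht; specialize (Hlt i t Hi Ht); lra. }
destruct (finite_min q N) as [q0 [Hq0 Hq0']]; [intros i Hi; apply (Hq i Hi) | ].
(* Node tubes of half-width at most a quarter of the smallest separation leave room between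
   neighbours for the chains. *)
set (sep := q0 / 4). assert (Hsep : 0 < sep) by (unfold sep; lra).
assert (Hgapsep : forall i t, (i <= N)%nat -> 0 <= t <= T -> PP i t + 4 * sep <= PP (S i) t).
{ intros i t Hi Ht; destruct (Hq i Hi) as [_ A]; specialize (A t Ht); specialize (Hq0' i Hi); unfold sep; lra. }
clearbody sep.
set (gap := fun i x => ((1 <= i)%nat -> P i 0 < x) /\ ((S i <= N)%nat -> x < P (S i) 0)).
assert (Hmono : forall i j, (1 <= i)%nat -> (i <= j)%nat -> (j <= N)%nat -> P i 0 <= P j 0).
{ intros i j Hi Hij; induction Hij as [ | j Hij IH]; intros Hj; [lra | ].
  specialize (IH ltac:(lia)); specialize (Hord j 0 ltac:(lia)); lra. }
assert (Hsgn : forall i, (i <= N)%nat -> (forall x, gap i x -> c x < 0) \/ (forall x, gap i x -> 0 < c x)).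
{ intros i Hi; apply interval_constant_sign; [exact Hc | | ].
  - intros x y z [X1 X2] [Y1 Y2] Hz; split; intros H; [specialize (X1 H) | specialize (Y2 H)]; lra.
  - intros x [X1 X2] E; destruct (Hzero x E) as [j [Hj Ej]].
    destruct (le_lt_dec j i) as [Hji | Hji].
    + assert (A := Hmono j i ltac:(lia) Hji ltac:(lia)); specialize (X1 ltac:(lia)); lra.
    + assert (A := Hmono (S i) j ltac:(lia) ltac:(lia) ltac:(lia)); specialize (X2 ltac:(lia)); lra. }
set (e := value T mxx V mhx mhxx N P).
destruct (choice_upto (Outflow, (fun _ : R => 0, (fun _ : R => 0, (0, 0)))) (fun i z =>
   let kd := fst z in let P' := fst (snd z) in let k := fst (snd (snd z)) in
   let d := fst (snd (snd (snd z))) in let kap := snd (snd (snd (snd z))) in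
   0 < d <= sep /\ placed T (PP i) d (side N i) /\ node_core T mx kd (PP i) P' k d kap /\
   e i = node_value T V kd (PP i) k /\ ((1 <= i <= N)%nat -> kd <> Outflow) /\
   ((i = 0 \/ i = S N)%nat -> kd <> Sink) /\
   ((i <= N)%nat -> exists x, gap i x /\ (kd = Source -> c x < 0) /\ (kd <> Source -> 0 < c x)) /\
   ((1 <= i)%nat -> exists x, gap (i - 1)%nat x /\ (kd = Source -> 0 < c x) /\ (kd <> Source -> c x < 0))) (S N))
  as [z Hz].
{ intros i Hi; destruct (Hcase i Hi) as [-> | [-> | Hi']].
  - destruct (BN 1 sep Hsep ltac:(auto) Hb0) as (kd & d & kap & H1 & H2 & H3 & H4 & H5 & H6 & H7 & H8 & _).
    exists (kd, (fun _ => 0, (fun _ => 0, (d, kap)))); simpl; rewrite PP0.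
    split; [exact H1 | split; [exact H2 | split; [exact H4 | split; [ | split; [lia | split; [auto | split; [ | lia]]]]]]].
    + unfold e, value, value_at_0; simpl.
      replace ((1 - 1) / 2) with 0 in * by field.
      unfold dxx_at_0; destruct kd; [ | contradiction | ]; destruct (total_order_T (mhx 0) 0) as [[A | A] | A]; simpl;
        try (exfalso; first [specialize (H5 eq_refl) | specialize (H6 eq_refl)]; lra); auto.
      rewrite Rplus_0_r; rewrite hat_ext by lra; reflexivity.
    + intros _; exists ((1 - 1) / 2 - 1); split; [ | split; [intros E; specialize (H7 E); lra | intros E; specialize (H8 E); lra]].
      split; [lia | intros Hn; assert (X := Hinside _ (Hporb 1%nat ltac:(lia)) 0 ltac:(lra)); lra].
  - destruct (BN (-1) sep Hsep ltac:(auto) Hb1) as (kd & d & kap & H1 & H2 & H3 & H4 & H5 & H6 & H7 & H8 & _).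
    exists (kd, (fun _ => 0, (fun _ => 0, (d, kap)))); simpl fst; simpl snd; cbv zeta; rewrite PPN.
    split; [exact H1 | split; [ | split; [exact H4 | split; [ | split; [lia | split; [auto | split; [lia | ]]]]]]].
    + unfold side; simpl; rewrite Nat.eqb_refl; exact H2.
    + unfold e, value; simpl Nat.eqb; rewrite Nat.eqb_refl; cbv iota; unfold value_at_1.
      replace ((1 - -1) / 2) with 1 in * by field.
      unfold dxx_at_1; destruct kd; [ | contradiction | ]; destruct (total_order_T (mhx 1) 0) as [[A | A] | A]; simpl;
        try (exfalso; first [specialize (H5 eq_refl) | specialize (H6 eq_refl)]; lra); auto.
      rewrite Rplus_0_r; rewrite hat_ext by lra; reflexivity.
    + intros _; exists ((1 - -1) / 2 - -1); split; [ | split; [intros E; specialize (H7 E); lra | intros E; specialize (H8 E); lra]].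
      replace (S N - 1)%nat with N by lia.
      split; [intros Hn; assert (X := Hinside _ (Hporb N ltac:(lia)) 0 ltac:(lra)); lra | lia].
  - destruct (interior_node T mx mxx V M L c g (P i) sep HT Hsep Hmx Hmxx HV Hd2 HB Hf (Hporb i Hi')
      (Hinside _ (Hporb i Hi')) (fun t Ht => Hne i t Hi' Ht)) as (kd & k & d & kap & H1 & H2 & H3 & H4 & H5 & H6 & H7).
    exists (kd, (fun t => - ext T mx (P i t) t, (k, (d, kap)))); simpl fst; simpl snd; cbv zeta; rewrite PPi by exact Hi'.
    assert (G1 := Hgapsep i 0 ltac:(lia) ltac:(lra)).
    assert (G2 := Hgapsep (i - 1)%nat 0 ltac:(lia) ltac:(lra)).
    replace (S (i - 1)) with i in G2 by lia.
    rewrite (PPi i) in G1, G2 by exact Hi'.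
    assert (Nb0 : Nat.eqb i 0 = false) by (apply Nat.eqb_neq; lia).
    assert (NbN : Nat.eqb i (S N) = false) by (apply Nat.eqb_neq; lia).
    split; [exact H1 | split; [ | split; [exact H4 | split; [ | split; [auto | split; [lia | split]]]]]].
    + unfold side; rewrite Nb0, NbN; exact H2.
    + unfold e, value; rewrite Nb0, NbN; exact H5.
    + intros _; exists (P i 0 + d); split; [ | split; [intros E; apply (H6 E) | intros E; apply (H7 E)]].
      split; [lra | intros Hn; rewrite (PPi (S i)) in G1 by lia; lra].
    + intros _; exists (P i 0 - d); split; [ | split; [intros E; apply (H6 E) | intros E; apply (H7 E)]].
      split; [intros Hn; rewrite (PPi (i - 1)%nat) in G2 by lia; lra | ].
      replace (S (i - 1)) with i by lia; lra. }
set (kd := fun i => fst (z i)) in *. set (P' := fun i => fst (snd (z i))) in *.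
set (k := fun i => fst (snd (snd (z i)))) in *. set (d := fun i => fst (snd (snd (snd (z i))))) in *.
set (kap := fun i => snd (snd (snd (snd (z i))))) in *.
assert (Hz' : forall i, (i <= S N)%nat -> 0 < d i <= sep /\ placed T (PP i) (d i) (side N i) /\
   node_core T mx (kd i) (PP i) (P' i) (k i) (d i) (kap i) /\
   e i = node_value T V (kd i) (PP i) (k i) /\ ((1 <= i <= N)%nat -> kd i <> Outflow) /\
   ((i = 0 \/ i = S N)%nat -> kd i <> Sink) /\
   ((i <= N)%nat -> exists x, gap i x /\ (kd i = Source -> c x < 0) /\ (kd i <> Source -> 0 < c x)) /\
   ((1 <= i)%nat -> exists x, gap (i - 1)%nat x /\ (kd i = Source -> 0 < c x) /\ (kd i <> Source -> c x < 0))) by exact Hz.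
clear Hz; rename Hz' into Hz; clearbody kd P' k d kap; clear z.
(* Each end of a gap predicts the sign of [c] at some point of it. Two sources or two non-sources
   would predict opposite signs. *)
assert (Halt : forall i, (i <= N)%nat ->
   (kd i = Source /\ kd (S i) <> Source /\ forall x, gap i x -> c x < 0) \/
   (kd i <> Source /\ kd (S i) = Source /\ forall x, gap i x -> 0 < c x)).
{ intros i Hi.
  destruct (Hz i ltac:(lia)) as (_ & _ & _ & _ & _ & _ & HR & _).
  destruct (Hz (S i) ltac:(lia)) as (_ & _ & _ & _ & _ & _ & _ & HLft).
  destruct (HR Hi) as (x & Gx & X1 & X2).
  destruct (HLft ltac:(lia)) as (y & Gy & Y1 & Y2); replace (S i - 1)%nat with i in Gy by lia.
  destruct (classic (kd i = Source)) as [E1 | E1]; destruct (classic (kd (S i) = Source)) as [E2 | E2];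
    destruct (Hsgn i Hi) as [G | G]; assert (Gx' := G x Gx); assert (Gy' := G y Gy);
    try specialize (X1 E1); try specialize (X2 E1); try specialize (Y1 E2); try specialize (Y2 E2); try lra; auto. }
apply limit_of_bounds.
- intros i Hi; fold e; destruct (Hz i Hi) as (_ & _ & _ & -> & _); destruct (kd i); discriminate.
- intros i r eps Hi Er Heps; fold e in Er.
  destruct (Hz i Hi) as (Hdi & Hpl & Hcore & Hval & Hno & Hns & _).
  assert (W : exists D0, 0 < D0 /\ forall D l phi phix, 0 < D -> D < D0 -> eigenpair T D mx V l phi phix -> l <= r + eps).
  { rewrite Hval in Er; destruct (kd i) eqn:Ek; simpl in Hcore, Er.
    - injection Er as <-; now apply (eigenvalue_le_source T mx V (PP i) (P' i) (d i) (kap i) (side N i)).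
    - injection Er as <-; apply (eigenvalue_le_sink T mx V (PP i) (P' i) (k i) (d i)); auto; [lra | ].
      destruct (Hcase i Hi) as [Ei | [Ei | Ei]]; [exfalso; apply Hns; auto | exfalso; apply Hns; auto | ].
      unfold side in Hpl; destruct (Nat.eqb_spec i 0); [lia | ]; destruct (Nat.eqb_spec i (S N)); [lia | exact Hpl].
    - discriminate. }
  destruct W as [D0 [HD0 HD0']]; exists D0; split; [exact HD0 | intros D HD HDD].
  destruct (principal_eigenpair _ _ _ _ _ (Hlam D HD)) as (phi & phix & Hp); eapply HD0'; eauto.
- intros rho eps Hrho Heps.
  destruct (eigenvalue_ge_nodes T mx V M L c g N PP P' k kd d kap
    (fun i => match kd i with Source => 1 | _ => -1 end)
    (fun i => match kd i with Source => i | _ => S i end)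
    (fun i => match kd i with Source => S i | _ => i end) rho eps HT Heps Hmx HV HB Hf) as [D0 [HD0 HD0']].
  + intros i Hi; destruct (Hz i Hi) as (Hdi & Hpl & Hcore & Hval & _).
    split; [lra | split; [exact Hpl | ]].
    specialize (Hrho i Hi); fold e in Hrho; rewrite Hval in Hrho.
    destruct (kd i); simpl in *; auto.
  + intros i Hi; rewrite PPi by exact Hi; split; [now apply Hporb | now apply Hz; [lia | ]].
  + apply (Hz 0%nat ltac:(lia)); auto.
  + apply (Hz (S N) ltac:(lia)); auto.
  + intros i Hi; destruct (Halt i Hi) as [(E1 & E2 & _) | (E1 & E2 & _)].
    * rewrite E1; split; [exact E1 | split; [exact E2 | left; auto]].
    * assert (E3 : match kd i with Source => i | _ => S i end = S i) by (destruct (kd i); auto; contradiction).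
      assert (E4 : match kd i with Source => S i | _ => i end = i) by (destruct (kd i); auto; contradiction).
      assert (E5 : match kd i with Source => 1 | _ => -1 end = -1) by (destruct (kd i); auto; contradiction).
      rewrite E3, E4, E5; split; [exact E2 | split; [exact E1 | right; auto]].
  + intros i x Hi Hx1 Hx2.
    assert (G : gap i x).
    { split; intros H.
      - rewrite <- (PPi i) by lia; auto.
      - rewrite <- (PPi (S i)) by lia; auto. }
    destruct (Halt i Hi) as [(E1 & _ & E3) | (E1 & _ & E3)]; specialize (E3 x G).
    * rewrite E1; lra.
    * destruct (kd i); [contradiction | lra | lra].
  + intros i t Hi Ht; specialize (Hgapsep i t Hi Ht).
    destruct (Hz i ltac:(lia)) as (H1 & _); destruct (Hz (S i) ltac:(lia)) as (H2 & _); lra.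
  + exists D0; split; [exact HD0 | intros D HD HDD].
    destruct (principal_eigenpair _ _ _ _ _ (Hlam D HD)) as (phi & phix & Hp); eapply HD0'; eauto.
Qed.

Theorem theorem1p2
  (T : R) (HT : 0 < T)
  (m mt mx mxx V : R -> R -> R)
  (Hm_per : periodic_in_t T m) (Hm : is_C21 T m mt mx mxx)
  (HV_per : periodic_in_t T V) (HV : cont_cylinder T V)
  (mhx mhxx : R -> R)
  (Hmhx : deriv_unit (hat T m) mhx) (Hmhxx : deriv_unit mhx mhxx)
  (Hbdry : forall t, 0 <= t <= T -> mx 0 t <> 0 /\ mx 1 t <> 0)
  (lam : R -> R)
  (Hlam : forall D, 0 < D -> is_principal_eigenvalue T D mx V (lam D)) :
  (forall (N : nat) (P : nat -> R -> R),
     (1 <= N)%nat ->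
     (forall i, (1 <= i <= N)%nat -> periodic_solution T mx (P i)) ->
     (forall Q, periodic_solution T mx Q ->
        exists i, (1 <= i <= N)%nat /\ forall t, Q t = P i t) ->
     (forall t, 0 < P 1%nat t) ->
     (forall i t, (1 <= i < N)%nat -> P i t < P (S i) t) ->
     (forall t, P N t < 1) ->
     (forall i t, (1 <= i <= N)%nat -> 0 <= t <= T -> mxx (P i t) t <> 0) ->
     filterlim lam (at_right 0)
       (Rbar_locally (Rbar_min_upto (value T mxx V mhx mhxx N P) (S N))))
  /\
  ((forall Q, ~ periodic_solution T mx Q) ->
     filterlim lam (at_right 0)
       (Rbar_locally (Rbar_min (value_at_0 T V mhx mhxx)
                               (value_at_1 T V mhx mhxx)))).
Proof.
destruct Hm as (Hd1 & Hd2 & _ & Cm & _ & Cmx & Cmxx).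
split.
- intros N P _ Hsol Hall _ Hord _ Hne.
  now apply (eigenvalue_limit T m mx mxx V mhx mhxx lam N P).
- intros Hno.
  (* With [N = 0] the minimum up to [S N] reduces to that of the two endpoint values, and the
     conditions on the orbits are empty. *)
  apply (eigenvalue_limit T m mx mxx V mhx mhxx lam 0 (fun _ _ => 0)); auto; try lia.
  intros Q HQ; exfalso; exact (Hno Q HQ).
Qed.
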